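(* There exists a constant $\widetilde C>0$ depending only on $\Omega$ such that the following holds. Suppose that $$\sigma_{\min}\ge \frac{9\|\nabla\nu\|_{\infty}^2}{\nu_0},\qquad \widetilde C\,\|\nabla\cdot\boldsymbol{\beta}\|_0<\min\Big\{\sigma_{\min}-\frac{9\|\nabla\nu\|_\infty^2}{\nu_0},\ \frac{\nu_0}{12}\Big\},\qquad \rho_1=\tfrac23\nu_0,\qquad \rho_2>\tfrac{\nu_0}{3}.$$ Then for every $\mathbf f,\mathbf u\in[L^2(\Omega)]^d$ there exists a unique $(\mathbf y,\boldsymbol\kappa,p)\in\boldsymbol V\times\boldsymbol W\times Q$ such that $$\mathcal A((\mathbf y,\boldsymbol\kappa),(\mathbf v,\boldsymbol\theta))+\mathcal B((\mathbf v,\boldsymbol\theta),p)=(\mathbf f+\mathbf u,\mathbf v)\quad\forall(\mathbf v,\boldsymbol\theta)\in\boldsymbol V\times\boldsymbol W,\qquad \mathcal B((\mathbf y,\boldsymbol\kappa),\phi)=0\quad\forall\phi\in Q.$$ Furthermore, there is a constant $C>0$, independent of $\mathbf f$ and $\mathbf u$, such that $$\|(\mathbf y,\boldsymbol\kappa)\|+\|p\|_0\le C\big(\|\mathbf f\|_0+\|\mathbf u\|_0\big).$$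
   Context: Setting. $\Omega\subset\mathbb R^d$, $d\in\{2,3\}$, is an open bounded polygonal/polyhedral Lipschitz domain. $\nu\in W^{1,\infty}(\Omega)$ and $\sigma\in L^\infty(\Omega)$ are scalar functions with $\nu_0<\nu(x)<\nu_1$ and $\sigma_{\min}<\sigma(x)<\sigma_{\max}$ in $\Omega$ for constants $\nu_0,\nu_1,\sigma_{\min},\sigma_{\max}\in(0,\infty)$; $\boldsymbol\beta\in[W^{1,\infty}(\Omega)]^d$. $\boldsymbol V=[H^1_0(\Omega)]^d$, $\boldsymbol W=[L^2(\Omega)]^{d(d-1)/2}$, $Q=L^2_0(\Omega)$ (mean-zero $L^2$ functions). $(\cdot,\cdot)$ and $\|\cdot\|_0$ are the $L^2(\Omega)$ inner product and norm, $\|\cdot\|_\infty$ the $L^\infty(\Omega)$ norm. $\boldsymbol\varepsilon(\mathbf y)=\frac12(\nabla\mathbf y+(\nabla\mathbf y)^T)$. For $d=3$, $\mathbf{curl}$ and $\times$ are the usual ones; for $d=2$, $\mathbf{curl}(\mathbf w)=\partial_1w_2-\partial_2w_1$ for vector fields, $\nabla\nu\times\mathbf v=\partial_1\nu\,v_2-\partial_2\nu\,v_1$, elements of $\boldsymbol W$ are scalar and ''$\cdot$'' between scalars is multiplication. Norms: $|||\mathbf v|||_1^2=\|\mathbf v\|_0^2+\|\mathbf{curl}(\mathbf v)\|_0^2+\|\nabla\cdot\mathbf v\|_0^2$, $\|(\mathbf v,\boldsymbol\theta)\|^2=|||\mathbf v|||_1^2+\|\boldsymbol\theta\|_0^2$.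 Forms (with parameters $\rho_1,\rho_2>0$): $$\mathcal A((\mathbf y,\boldsymbol\kappa),(\mathbf v,\boldsymbol\theta))=-\int_\Omega2\boldsymbol\varepsilon(\mathbf y)\nabla\nu\cdot\mathbf v+\int_\Omega\nu\boldsymbol\kappa\cdot\mathbf{curl}(\mathbf v)+\int_\Omega\boldsymbol\kappa\cdot(\nabla\nu\times\mathbf v)+\int_\Omega\nu\boldsymbol\kappa\cdot\boldsymbol\theta-\int_\Omega\nu\boldsymbol\theta\cdot\mathbf{curl}(\mathbf y)+\int_\Omega(\sigma\mathbf y+(\boldsymbol\beta\cdot\nabla)\mathbf y)\cdot\mathbf v+\rho_1\int_\Omega(\mathbf{curl}(\mathbf y)-\boldsymbol\kappa)\cdot\mathbf{curl}(\mathbf v)+\rho_2\int_\Omega(\nabla\cdot\mathbf y)(\nabla\cdot\mathbf v),$$ $$\mathcal B((\mathbf v,\boldsymbol\theta),\phi)=-\int_\Omega\phi\,\nabla\cdot\mathbf v.$$ *)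

(* Defs.v *)
From HB Require Import structures.
From mathcomp Require Import all_boot all_order all_algebra.
From mathcomp Require Import all_classical all_reals all_analysis.

Set Implicit Arguments.
Unset Strict Implicit.
Unset Printing Implicit Defensive.
Import Order.TTheory GRing.Theory Num.Theory.
Import numFieldNormedType.Exports.

Local Open Scope classical_set_scope.
Local Open Scope ring_scope.

Fact rV_display : measure_display. Proof. exact: default_measure_display. Qed.

Section rV_measurable.
Variables (R : realType) (n : nat).

(* Product sigma-algebra on R^n, which is also the Borel one. *)
Definition rV_measurable : set (set 'rV[R]_n) :=
  g_sigma_preimage (fun (i : 'I_n) (x : 'rV[R]_n) => x ord0 i : measurableTypeR R).

Lemma rV_measurable0 : rV_measurable set0.
Proof. exact: sigma_algebra0. Qed.

Lemma rV_measurableC A : rV_measurable A -> rV_measurable (~` A).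
Proof. exact: sigma_algebraC. Qed.

Lemma rV_measurable_bigcup (F : (set 'rV[R]_n)^nat) :
  (forall i, rV_measurable (F i)) -> rV_measurable (\bigcup_i F i).
Proof. exact: sigma_algebra_bigcup. Qed.

HB.instance Definition _ := @isMeasurable.Build rV_display 'rV[R]_n
  rV_measurable rV_measurable0 rV_measurableC rV_measurable_bigcup.

End rV_measurable.

Definition rV_cons (R : realType) n (p : measurableTypeR R * 'rV[R]_n) :
  'rV[R]_n.+1 := row_mx (p.1 : R)%:M p.2.
Definition rV_uncons (R : realType) n (x : 'rV[R]_n.+1) :
  measurableTypeR R * 'rV[R]_n := (x ord0 ord0, rsubmx (x : 'rV[R]_(1 + n))).


Lemma measurable_rV_coord (R : realType) n (i : 'I_n) :
  measurable_fun [set: 'rV[R]_n]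
    (fun x : 'rV[R]_n => x ord0 i : measurableTypeR R).
Proof.
move=> _ Y mY; rewrite setTI; apply: sub_sigma_algebra => /=.
rewrite -bigcup_seq/=; exists i => /=; first by rewrite mem_index_enum.
by exists Y => //; rewrite setTI.
Qed.

Lemma measurable_to_rV d (T : measurableType d) (R : realType) n
    (f : T -> 'rV[R]_n) :
  (forall i, measurable_fun [set: T] (fun t => f t ord0 i : measurableTypeR R)) ->
  measurable_fun [set: T] f.
Proof.
move=> mf.
have H : @rV_measurable R n `<=` [set A | measurable (f @^-1` A)].
  apply: smallest_sub.
    split => /=.
    - by rewrite preimage_set0.
    - by move=> A mA; rewrite setTD preimage_setC; exact: measurableC.
    - by move=> F mF; rewrite preimage_bigcup; exact: bigcupT_measurable.
  rewrite -bigcup_seq; apply: bigcup_sub => i _ A [B mB <-].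
  by rewrite /= setTI -[X in measurable X]setTI; exact: (mf i).
by move=> _ Y mY; rewrite setTI; exact: H.
Qed.

Lemma rV_consE (R : realType) n (p : measurableTypeR R * 'rV[R]_n)
    (i : 'I_n.+1) :
  rV_cons p ord0 i = if unlift ord0 i is Some j then p.2 ord0 j else p.1.
Proof.
case: unliftP => [j|] ->.
  rewrite (_ : lift ord0 j = rshift 1 j); last exact/val_inj.
  exact: (row_mxEr (p.1 : R)%:M p.2).
rewrite (_ : ord0 = lshift n (ord0 : 'I_1)); last exact/val_inj.
by rewrite (row_mxEl (p.1 : R)%:M p.2) mxE.
Qed.

Lemma measurable_rV_cons (R : realType) n :
  measurable_fun setT (@rV_cons R n).
Proof.
apply: measurable_to_rV => i.
under [X in measurable_fun _ X]eq_fun do rewrite rV_consE.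
case: unliftP => [j|] _; last exact: measurable_fst.
apply: (@measurableT_comp _ _ _ _ _ _
  (fun x : 'rV[R]_n => x ord0 j : measurableTypeR R)) => //.
exact: measurable_rV_coord.
Qed.

Lemma measurable_rV_uncons (R : realType) n :
  measurable_fun setT (@rV_uncons R n).
Proof.
apply/measurable_fun_pairP; split => /=.
  exact: measurable_rV_coord.
apply: measurable_to_rV => i.
under [X in measurable_fun _ X]eq_fun do rewrite /= mxE.
exact: measurable_rV_coord.
Qed.

Lemma rV_consK (R : realType) n : cancel (@rV_cons R n) (@rV_uncons R n).
Proof.
move=> [a x]; rewrite /rV_uncons rV_consE unlift_none; congr pair.
exact: row_mxKr.
Qed.

Section leb_step.
Variables (R : realType) (n : nat).
Variable m : {sigma_finite_measure set 'rV[R]_n -> \bar R}.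

Let prodm : {measure set (measurableTypeR R * 'rV[R]_n)%type -> \bar R} :=
  (@lebesgue_measure R \x m)%E.

Let prodm_sigma_finite : sigma_finite setT prodm.
Proof.
have /sigma_finiteP[F [TF ndF Foo]] := sigma_finiteT (@lebesgue_measure R).
have /sigma_finiteP[G [TG ndG Goo]] := sigma_finiteT m.
exists (fun k => F k `*` G k).
  rewrite -setXTT TF TG predeqE => -[x y]; split.
    move=> [/= [k _ Fkx] [l _ Gly]]; exists (maxn k l) => //; split.
    - by move: x Fkx; exact/subsetPset/ndF/leq_maxl.
    - by move: y Gly; exact/subsetPset/ndG/leq_maxr.
  by move=> [k _ []/= ? ?]; split; exists k.
move=> k; have [? ?] := Foo k; have [? ?] := Goo k.
split; first exact: measurableX.
by rewrite /prodm /= product_measure1E// lte_mul_pinfty// ge0_fin_numE.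
Qed.

Definition leb_step : set 'rV[R]_n.+1 -> \bar R :=
  pushforward prodm (@rV_cons R n).

Let leb_step0 : leb_step set0 = 0%E.
Proof. by rewrite /leb_step /pushforward preimage_set0 measure0. Qed.

Let leb_step_ge0 A : (0 <= leb_step A)%E.
Proof. by rewrite /leb_step /pushforward; apply: measure_ge0. Qed.

Let leb_step_sigma_additive : semi_sigma_additive leb_step.
Proof.
have mc := @measurable_rV_cons R n.
move=> F mF tF mUF; rewrite /leb_step /pushforward preimage_bigcup.
apply: measure_semi_sigma_additive.
- by move=> k; rewrite -[X in measurable X]setTI; exact: mc.
- apply/trivIsetP => /= i j _ _ ij; rewrite -preimage_setI.
  by move/trivIsetP : tF => /(_ _ _ _ _ ij) ->//; rewrite preimage_set0.
- by rewrite -preimage_bigcup -[X in measurable X]setTI; exact: mc.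
Qed.

HB.instance Definition _ := isMeasure.Build _ _ _ leb_step
  leb_step0 leb_step_ge0 leb_step_sigma_additive.

Let leb_step_sigma_finite : sigma_finite setT leb_step.
Proof.
have [F UF mF] := prodm_sigma_finite.
have consK := @rV_consK R n.
exists (fun k => @rV_uncons R n @^-1` F k).
  by rewrite -preimage_bigcup -UF preimage_setT.
move=> k; have [mFk Fk] := mF k; split.
  by rewrite -[X in measurable X]setTI; exact: measurable_rV_uncons.
rewrite /leb_step /pushforward -comp_preimage (_ : _ \o _ = id)//.
by apply/funext => p /=; rewrite consK.
Qed.

HB.instance Definition _ := Measure_isSigmaFinite.Build _ _ _ leb_step
  leb_step_sigma_finite.

End leb_step.

(* Lebesgue measure on the Borel sets of R^n, as an iterated product; for
   n = 0 it is the unit mass at the only point. *)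
Fixpoint leb (R : realType) (n : nat) :
    {sigma_finite_measure set 'rV[R]_n -> \bar R} :=
  match n with
  | 0%N => @dirac _ _ (0 : 'rV[R]_0) R
  | n'.+1 => leb_step (leb R n')
  end.


Definition dot (R : realType) n (a b : 'rV[R]_n) : R :=
  \sum_(i < n) a ord0 i * b ord0 i.

Definition enorm (R : realType) n (a : 'rV[R]_n) : R := Num.sqrt (dot a a).

(* Number of components of a curl: 1 in the plane, 3 in space. *)
Definition cdim (d : nat) : nat := ((d * (d - 1)) %/ 2)%N.

Definition mx_entry (R : realType) d (M : 'M[R]_d) (p q : nat) : R :=
  if insub p is Some i then if insub q is Some j then M i j else 0 else 0.

(* Skew part of a square matrix as an axial vector (indices start at 0):
   M_01 - M_10 for d = 2, and (M_12 - M_21, M_20 - M_02, M_01 - M_10) for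
   d = 3. Applied to (a_i b_j) it gives a x b, applied to (d_i w_j) it gives
   curl w. Only d = 2 and d = 3 are meaningful. *)
Definition axial (R : realType) d (M : 'M[R]_d) : 'rV[R]_(cdim d) :=
  \row_(k < cdim d)
    (let p := if d == 2%N then 0%N else ((k + 1) %% 3)%N in
     let q := if d == 2%N then 1%N else ((k + 2) %% 3)%N in
     mx_entry M p q - mx_entry M q p).

Definition cross (R : realType) d (a b : 'rV[R]_d) : 'rV[R]_(cdim d) :=
  axial (a^T *m b).

Section Domain.
Variables (R : realType) (d : nat).
Local Notation E := 'rV[R]_d.
Variable Omega : set E.

(* Near each boundary point, Omega is the strict epigraph, in the direction of
   a unit vector e, of a Lipschitz function of the component orthogonal to e. *)
Definition lipschitz_boundary : Prop :=
  forall x, (closure Omega `\` Omega) x ->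
    exists r : R, exists e : E, exists g : E -> R,
      [/\ 0 < r, dot e e = 1, lipschitz g &
        forall z, ball x r z ->
          (Omega z <-> g (z - dot z e *: e) < dot z e)].

(* The closure is a finite union of finite intersections of closed
   half-spaces { x | a . x <= b }, a half-space being stored as (a, b). *)
Definition polyhedral : Prop :=
  exists Ps : seq (seq (E * R)),
    closure Omega =
    [set x | exists2 P, P \in Ps & forall h, h \in P -> dot h.1 x <= h.2].

Definition polyhedral_lipschitz_domain : Prop :=
  [/\ open Omega, Omega !=set0 & connected Omega] /\
  [/\ bounded_set Omega, lipschitz_boundary & polyhedral].

End Domain.

Section Sobolev.
Variables (R : realType) (d : nat).
Local Notation E := 'rV[R]_d.
Variable Omega : set E.
Local Notation mu := (leb R d).
Local Notation dir i := (delta_mx ord0 i : 'rV[R]_d).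
Implicit Types (u g phi : E -> R) (p : \bar R).

Definition integ u : R := \int[mu]_(x in Omega) u x.

(* L^p(Omega), functions being considered up to equality a.e. on Omega. *)
Definition inL p u : Prop :=
  measurable_fun Omega u /\ ('N[mu]_p [(EFin \o u) \_ Omega] < +oo)%E.

Definition normL p u : R := fine ('N[mu]_p [(EFin \o u) \_ Omega])%E.

Definition vinL p n (w : E -> 'rV[R]_n) : Prop :=
  forall i, inL p (fun x => w x ord0 i).

(* Norm of the pointwise Euclidean norm. *)
Definition vnormL p n (w : E -> 'rV[R]_n) : R :=
  normL p (fun x => enorm (w x)).

Definition vae_eq n (w w' : E -> 'rV[R]_n) : Prop := ae_eq mu Omega w w'.

Fixpoint Ck (k : nat) (phi : E -> R) : Prop :=
  continuous phi /\
  if k is k'.+1 then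
    forall i, (forall x, derivable phi x (dir i)) /\ Ck k' ('D_(dir i) phi)
  else True.

Definition test_fun phi : Prop :=
  [/\ forall k, Ck k phi, compact (closure [set x | phi x != 0]) &
      closure [set x | phi x != 0] `<=` Omega].

Definition loc_integrable u : Prop :=
  measurable_fun Omega u /\
  forall K, compact K -> K `<=` Omega -> mu.-integrable K (EFin \o u).

Definition weak_deriv (i : 'I_d) u g : Prop :=
  [/\ loc_integrable u, loc_integrable g &
      forall phi, test_fun phi ->
        integ (fun x => u x * 'D_(dir i) phi x) =
        - integ (fun x => g x * phi x)].

(* A chosen representative of the weak partial derivative, which is unique a.e.
   when it exists. *)
Definition wpartial (i : 'I_d) u : E -> R :=
  xget (fun=> 0) [set g | weak_deriv i u g].

Definition W1 p u : Prop :=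
  inL p u /\ forall i, exists2 g, weak_deriv i u g & inL p g.

Definition vW1 p n (w : E -> 'rV[R]_n) : Prop :=
  forall i, W1 p (fun x => w x ord0 i).

Definition grad u (x : E) : 'rV[R]_d := \row_i wpartial i u x.

Definition normH1 u : R :=
  Num.sqrt (normL 2%:E u ^+ 2 + vnormL 2%:E (grad u) ^+ 2).

(* Closure in H^1 of the test functions. *)
Definition H10 u : Prop :=
  W1 2%:E u /\
  forall e : R, 0 < e ->
    exists2 phi, test_fun phi & normH1 (fun x => u x - phi x) < e.

Definition inV (v : E -> 'rV[R]_d) : Prop :=
  forall i, H10 (fun x => v x ord0 i).

Definition inW (theta : E -> 'rV[R]_(cdim d)) : Prop := vinL 2%:E theta.

Definition inQ (q : E -> R) : Prop := inL 2%:E q /\ integ q = 0.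

(* (jac v)_ij = d_j v_i *)
Definition jac (v : E -> 'rV[R]_d) (x : E) : 'M[R]_d :=
  \matrix_(i, j) wpartial j (fun z => v z ord0 i) x.

Definition divg (v : E -> 'rV[R]_d) (x : E) : R := \tr (jac v x).

Definition curl (v : E -> 'rV[R]_d) (x : E) : 'rV[R]_(cdim d) :=
  axial (jac v x)^T.

Definition strain (v : E -> 'rV[R]_d) (x : E) : 'M[R]_d :=
  2^-1 *: (jac v x + (jac v x)^T).

(* Column-vector formulas such as eps(v) grad(nu) and (b . nabla) v = jac(v) b
   are transposed, vectors being rows. *)
Definition conv (b v : E -> 'rV[R]_d) (x : E) : 'rV[R]_d :=
  b x *m (jac v x)^T.

Definition norm1 (v : E -> 'rV[R]_d) : R :=
  Num.sqrt (vnormL 2%:E v ^+ 2 + vnormL 2%:E (curl v) ^+ 2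
            + normL 2%:E (divg v) ^+ 2).

Definition normVW (v : E -> 'rV[R]_d) (theta : E -> 'rV[R]_(cdim d)) : R :=
  Num.sqrt (norm1 v ^+ 2 + vnormL 2%:E theta ^+ 2).

Definition formA (rho1 rho2 : R) (nu sigma : E -> R) (beta : E -> 'rV[R]_d)
    (y : E -> 'rV[R]_d) (kappa : E -> 'rV[R]_(cdim d))
    (v : E -> 'rV[R]_d) (theta : E -> 'rV[R]_(cdim d)) : R :=
  - integ (fun x => dot (grad nu x *m (2 *: strain y x)^T) (v x))
  + integ (fun x => nu x * dot (kappa x) (curl v x))
  + integ (fun x => dot (kappa x) (cross (grad nu x) (v x)))
  + integ (fun x => nu x * dot (kappa x) (theta x))
  - integ (fun x => nu x * dot (theta x) (curl y x))
  + integ (fun x => dot (sigma x *: y x + conv beta y x) (v x))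
  + rho1 * integ (fun x => dot (curl y x - kappa x) (curl v x))
  + rho2 * integ (fun x => divg y x * divg v x).

Definition formB (v : E -> 'rV[R]_d) (theta : E -> 'rV[R]_(cdim d))
    (phi : E -> R) : R :=
  - integ (fun x => phi x * divg v x).

Definition oseen_solution (rho1 rho2 : R) (nu sigma : E -> R)
    (beta f u y : E -> 'rV[R]_d) (kappa : E -> 'rV[R]_(cdim d)) (q : E -> R) :
    Prop :=
  [/\ inV y, inW kappa, inQ q,
      forall v theta, inV v -> inW theta ->
        formA rho1 rho2 nu sigma beta y kappa v theta + formB v theta q =
        integ (fun x => dot (f x + u x) (v x)) &
      forall phi, inQ phi -> formB y kappa phi = 0].

End Sobolev.

(* Main.v *)
Require Import Defs.
From HB Require Import structures.
From mathcomp Require Import all_boot all_order all_algebra.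
From mathcomp Require Import all_classical all_reals all_analysis.
From mathcomp Require Import ess_sup_inf measurable_realfun ring lra zify.
Import Order.TTheory GRing.Theory Num.Theory.
Import numFieldNormedType.Exports.
Local Open Scope classical_set_scope.
Local Open Scope ring_scope.
Set Implicit Arguments.
Unset Strict Implicit.
Unset Printing Implicit Defensive.

(* Brezzi's theory: the flow form is coercive on the whole space and the
   pressure form satisfies the inf-sup condition.

   Coercivity.  For fields in [H^1_0] the Jacobian [J] satisfies
   [int J : J^T = int (div)^2], hence [2 |eps|^2 = |curl|^2 + 2 |div|^2], which
   absorbs the term in [grad nu].  The convection term is
   [- 1/2 int (div beta) |v|^2], and Ladyzhenskaya's inequality bounds the
   squared L^4 norm of [v] by [2 |||v|||_1^2]; this is why the smallness constant
   can be taken to be [1] for every domain.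

   The inf-sup condition is the Necas inequality [|q| <= C |grad q|_{-1}] for
   mean-zero [q].  In an open polytope, consider shells around the boundary
   whose widths decrease geometrically.  On a shell of width [e], the truncation
   [f] of [q] is [div w + r], where [w = - e^2 grad psi] up to a cutoff and
   [psi - e^2 Lap psi] is close to [f].  Dilating [r] towards the centre changes
   it by a divergence, and averaging many dilates with disjoint supports in the
   next inner shell divides its norm by [4].  So the norms of [q] on the shells
   satisfy a contracting recursion, which leaves a compact core, where [q] is
   compared with its mollification.  The polytopes that fill [Omega] are glued
   by connectedness: the means of [q] against bumps at nearby points differ by
   at most a multiple of [|grad q|_{-1}]. *)

(** * Semi-Hilbert spaces and saddle-point problems *)

(** The difficulty of the Necas inequality is uniformity up to the boundary. At distance [e] from it
    a function can only be smoothed at scale [e], so the remainder [r] of the smoothing satisfies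
    |grad r| <= C |f| / e, and it cannot be written as a divergence at a bounded cost. A dilation by
    [1 + O(e)], however, changes [r] by the divergence of a field whose H^1 size is
    [O(e) |r|_{H^1} = O(|f|)]: the cost is the same on all shells. Hence a fixed number of dilates
    suffices everywhere, and the ratio [lam] of consecutive widths is a constant chosen to make room
    for them.

    Analytic facts are proved for test functions, whose derivatives are classical, and pass to [H10]
    by density because every form is bounded. Weak derivatives are chosen representatives, so
    linearity holds only almost everywhere; semi-norms and the predicate [bl2] absorb this. *)

Lemma quad_discr (R : realFieldType) (a b c : R) :
  (forall t, 0 <= a + 2 * t * b + t ^+ 2 * c) -> b ^+ 2 <= a * c.
Proof.
move=> h; have a0 : 0 <= a by have := h 0; nra.
have [c0|c0|c0] := ltgtP c 0.
(* [c < 0] is contradictory: at [t = (a + 1) / - c + 1], which is at least 1, one has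
   [t^2 c <= - (a + 1)]; the sign of the argument is taken against [b] to make the linear term
   nonpositive. *)
- exfalso; have [b0|b0] := eqVneq b 0.
    have := h ((a + 1) / - c + 1); rewrite b0.
    set t := (a + 1) / - c + 1.
    have t1 : t * - c = a + 1 - c by rewrite /t; field; rewrite lt_eqF.
    have t2 : 1 <= t by rewrite /t lerDr divr_ge0//; nra.
    nra.
  have := h (- (b / `|b|) * ((a + 1) / - c + 1)).
  set s := b / `|b|; set t := (a + 1) / - c + 1.
  have s2 : s ^+ 2 = 1.
    by rewrite /s expr_div_n real_normK ?num_real// divff// sqrf_eq0.
  have sb : s * b = `|b|.
    have nb : `|b| != 0 by rewrite normr_eq0.
    apply: (@mulIf _ `|b|) => //; rewrite /s -expr2 real_normK ?num_real//.
    by rewrite mulrAC mulfVK.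
  have t1 : t * - c = a + 1 - c by rewrite /t; field; rewrite lt_eqF.
  have t2 : 1 <= t by rewrite /t lerDr divr_ge0//; nra.
  have -> : a + 2 * (- s * t) * b + (- s * t) ^+ 2 * c
     = a - 2 * t * (s * b) + t * (t * c) * s ^+ 2 by ring.
  rewrite s2 sb; have := normr_ge0 b; nra.
- have := h (- b / c).
  have -> : a + 2 * (- b / c) * b + (- b / c) ^+ 2 * c = a - b ^+ 2 / c.
    by field; rewrite gt_eqF.
  by rewrite subr_ge0 ler_pdivrMr.
- rewrite c0 mulr0; have [->|b0] := eqVneq b 0; first by rewrite expr2 mul0r.
  have := h (- (a + 1) / b); rewrite c0.
  have -> : a + 2 * (- (a + 1) / b) * b + (- (a + 1) / b) ^+ 2 * 0 = - a - 2.
    by field.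
  nra.
Qed.

(** Limits come with a geometric rate, since completeness is stated that way in [shilb]; this turns
    such a rate into an inequality for the limit itself. *)
Lemma quarter_small (R : realType) (x K : R) :
  (forall k, x <= K * 4^-1 ^+ k) -> x <= 0.
Proof.
move=> h; have : (fun k => K * 4^-1 ^+ k) @ \oo --> (0 : R).
  rewrite -[X in _ --> X](mulr0 K); apply: cvgMr; apply: cvg_expr.
  by rewrite ger0_norm// invf_lt1// ltr1n.
move=> c; rewrite -(cvg_lim (@Rhausdorff R) c); apply: limr_ge; first exact: cvgP c.
by near=> k; exact: h.
Unshelve. all: by end_near. Qed.

(* Functions are not identified almost everywhere, so the form is only positive
   semi-definite and the limits are not unique. *)
Record shilb (R : realType) (H : lmodType R) := Shilb {
  hdom : set H;
  hip : H -> H -> R;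
  hdom0 : hdom 0;
  hdomL : forall a u v, hdom u -> hdom v -> hdom (a *: u + v);
  hipC : forall u v, hdom u -> hdom v -> hip u v = hip v u;
  hipL : forall a u v w, hdom u -> hdom v -> hdom w ->
    hip (a *: u + v) w = a * hip u w + hip v w;
  hip_ge0 : forall u, hdom u -> 0 <= hip u u;
  hcomplete : forall (u : nat -> H) (c : R), (forall k, hdom (u k)) ->
    (forall k, hip (u k.+1 - u k) (u k.+1 - u k) <= c * 4^-1 ^+ k) ->
    exists2 l, hdom l &
      exists K, forall k, hip (u k - l) (u k - l) <= K * 4^-1 ^+ k }.

Definition hnorm (R : realType) (H : lmodType R) (X : shilb H) (u : H) : R :=
  Num.sqrt (hip X u u).

Section semi_inner_product.
Variables (R : realType) (H : lmodType R) (X : shilb H).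
Local Notation S := (hdom X).
Local Notation ip := (hip X).
Local Notation nrm := (hnorm X).

Lemma hdomD u v : S u -> S v -> S (u + v).
Proof. by move=> Su Sv; rewrite -[u]scale1r; exact: hdomL. Qed.
Lemma hdomZ a u : S u -> S (a *: u).
Proof. by move=> Su; rewrite -[_ *: _]addr0; apply: hdomL => //; exact: hdom0. Qed.
Lemma hdomN u : S u -> S (- u).
Proof. by move=> Su; rewrite -scaleN1r; exact: hdomZ. Qed.
Lemma hdomB u v : S u -> S v -> S (u - v).
Proof. by move=> Su Sv; apply: hdomD => //; exact: hdomN. Qed.

Lemma hip_linr a u v w : S u -> S v -> S w ->
  ip w (a *: u + v) = a * ip w u + ip w v.
Proof.
by move=> Su Sv Sw; rewrite hipC ?hipL 1?(hipC Su)// 1?(hipC Sv)//; exact: hdomL.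
Qed.

Lemma hnorm_ge0 u : 0 <= nrm u. Proof. exact: sqrtr_ge0. Qed.

Lemma hnorm_sqr u : S u -> nrm u ^+ 2 = ip u u.
Proof. by move=> Su; rewrite sqr_sqrtr// hip_ge0. Qed.

Lemma hip_quad u v t : S u -> S v ->
  ip (t *: v + u) (t *: v + u) = ip u u + 2 * t * ip u v + t ^+ 2 * ip v v.
Proof.
move=> Su Sv; rewrite hipL//; last exact: hdomL.
by rewrite !hip_linr// (hipC Sv Su); ring.
Qed.

Lemma hip_CS u v : S u -> S v -> `|ip u v| <= nrm u * nrm v.
Proof.
move=> Su Sv; rewrite -sqrtrM ?hip_ge0// -sqrtr_sqr ler_sqrt.
  apply: quad_discr => t; rewrite -hip_quad//; apply: hip_ge0; exact: hdomL.
by rewrite mulr_ge0 ?hip_ge0.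
Qed.

Lemma hnormD u v : S u -> S v -> nrm (u + v) <= nrm u + nrm v.
Proof.
move=> Su Sv; have h := hip_quad 1 Su Sv; rewrite scale1r addrC in h.
rewrite -(@ler_pXn2r _ 2)// ?nnegrE ?addr_ge0 ?hnorm_ge0//.
rewrite hnorm_sqr; last exact: hdomD.
rewrite h sqrrD !hnorm_sqr//; have := le_trans (ler_norm _) (hip_CS Su Sv).
by rewrite expr1n mulr2n; lra.
Qed.

Lemma hnormZ a u : S u -> nrm (a *: u) = `|a| * nrm u.
Proof.
move=> Su; rewrite /hnorm -(addr0 (a *: u)).
rewrite hip_quad//; last exact: hdom0.
have ip0 v : S v -> ip 0 v = 0.
  by move=> Sv; have := hipL 1 (hdom0 X) (hdom0 X) Sv; rewrite scale1r addr0 mul1r; lra.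
rewrite !ip0//; last exact: hdom0.
by rewrite mulr0 !add0r sqrtrM ?sqr_ge0// sqrtr_sqr.
Qed.

End semi_inner_product.

Section bilinear.
Variables (R : realType) (H1 H2 : lmodType R) (X : shilb H1) (Y : shilb H2).

Record bbilin (b : H1 -> H2 -> R) : Prop := Bbilin {
  bbL : forall a u v w, hdom X u -> hdom X v -> hdom Y w ->
     b (a *: u + v) w = a * b u w + b v w;
  bbR : forall a u v w, hdom Y u -> hdom Y v -> hdom X w ->
     b w (a *: u + v) = a * b w u + b w v;
  bbB : exists2 C, 0 <= C & forall u v, hdom X u -> hdom Y v ->
     `|b u v| <= C * hnorm X u * hnorm Y v }.

Record blin (l : H1 -> R) (C : R) : Prop := Blin {
  blC : 0 <= C;
  blL : forall a u v, hdom X u -> hdom X v -> l (a *: u + v) = a * l u + l v;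
  blB : forall u, hdom X u -> `|l u| <= C * hnorm X u }.

End bilinear.

Section lax_milgram.
Variables (R : realType) (H : lmodType R) (X : shilb H).
Local Notation S := (hdom X).
Local Notation ip := (hip X).
Local Notation nrm := (hnorm X).

(** Direct method: [u] minimises [J v = b v v - 2 l v], which coercivity bounds below. The
    minimising sequence is chosen within [4^-k] of the infimum so that [hcomplete] applies to it. *)
Lemma riesz (b : H -> H -> R) (alpha C : R) (l : H -> R) :
  bbilin X X b -> (forall u v, S u -> S v -> b u v = b v u) ->
  0 < alpha -> (forall u, S u -> alpha * ip u u <= b u u) -> blin X l C ->
  exists2 u, S u & forall v, S v -> b u v = l v.
Proof.
move=> [bL bR [Cb Cb0 bB]] bC a0 bcoer [C0 lL lB].
pose J v := b v v - 2 * l v.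
have bquad u v t : S u -> S v ->
    b (t *: v + u) (t *: v + u) = b u u + 2 * t * b u v + t ^+ 2 * b v v.
  move=> Su Sv; have Sw : S (t *: v + u) by exact: hdomL.
  by rewrite bL// !bR// (bC v u)//; ring.
have Jquad u v t : S u -> S v ->
    J (t *: v + u) = J u + 2 * t * (b u v - l v) + t ^+ 2 * b v v.
  by move=> Su Sv; rewrite /J bquad// lL//; ring.
have Jlow v : S v -> - (C ^+ 2 / alpha) <= J v.
  move=> Sv; have h1 := bcoer _ Sv; have h2 := ler_normlW (lB _ Sv).
  rewrite -hnorm_sqr// in h1; rewrite /J.
  have : 0 <= (alpha * nrm v - C) ^+ 2 / alpha by rewrite divr_ge0 ?sqr_ge0// ltW.
  have -> : (alpha * nrm v - C) ^+ 2 / alpha =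
     alpha * nrm v ^+ 2 - 2 * (C * nrm v) + C ^+ 2 / alpha by field; rewrite gt_eqF.
  lra.
pose JS := J @` S; pose m := inf JS.
have hJ : has_inf JS.
  split; first by exists (J 0), 0 => //; exact: hdom0.
  by exists (- (C ^+ 2 / alpha)) => _ [v Sv <-]; exact: Jlow.
have mJ v : S v -> m <= J v.
  by move=> Sv; apply: ge_inf; [case: hJ|exists v].
have q0 k : 0 < (4^-1 : R) ^+ k by rewrite exprn_gt0// invr_gt0.
have /choice[u hu] : forall k, exists u, S u /\ J u < m + 4^-1 ^+ k.
  move=> k; have [_ [v Sv <-] hv] := inf_adherent (q0 k) hJ.
  by exists v; split.
have Su k : S (u k) by case: (hu k).
have Ju k : J (u k) < m + 4^-1 ^+ k by case: (hu k).
(* Parallelogram identity: with [d = v - w], [b d d] is twice [J v + J w - 2 J] at the midpoint, and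
   [J] is at least [m] there. *)
have cau k : ip (u k.+1 - u k) (u k.+1 - u k) <= 4 / alpha * 4^-1 ^+ k.
  set v := u k.+1; set w := u k; have Sv : S v := Su _; have Sw : S w := Su _.
  have Sd : S (v - w) by exact: hdomB.
  rewrite mulrAC ler_pdivlMr// mulrC; apply: (le_trans (bcoer _ Sd)).
  have h1 := Jquad w (v - w) 1 Sw Sd; have h2 := Jquad w (v - w) 2^-1 Sw Sd.
  rewrite scale1r subrK in h1.
  have h3 : m <= J (2^-1 *: (v - w) + w) by apply: mJ; exact: hdomL.
  have := Ju k.+1; have := Ju k; rewrite exprS; have := q0 k.
  rewrite -/v -/w; rewrite h2 in h3.
  rewrite h1; lra.
have [x Sx [K hx]] := hcomplete Su cau; exists x => // w Sw.
have bw0 : 0 <= b w w.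
  by apply: le_trans (bcoer _ Sw); rewrite mulr_ge0 ?hip_ge0// ltW.
(* The quadratic [t -> J (u k + t w) - m] is nonnegative, so its discriminant bounds the residual of
   the Euler equation at [u k] by the distance of [J (u k)] to the infimum. *)
have D1 k : (b (u k) w - l w) ^+ 2 <= 4^-1 ^+ k * b w w.
  apply: quad_discr => t.
  have := mJ _ (hdomL t Sw (Su k)); rewrite Jquad//; have := Ju k; lra.
have D2 k : (b x w - b (u k) w) ^+ 2 <=
    Cb ^+ 2 * K * nrm w ^+ 2 * 4^-1 ^+ k.
  have -> : b x w - b (u k) w = - b (u k - x) w.
    by rewrite -[u k - x]addrC -scaleN1r bL//; ring.
  rewrite sqrrN -real_normK ?num_real//.
  apply: (@le_trans _ _ ((Cb * nrm (u k - x) * nrm w) ^+ 2)).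
    rewrite ler_pXn2r ?nnegrE ?mulr_ge0 ?hnorm_ge0//.
    by apply: bB => //; exact: hdomB.
  rewrite !exprMn [nrm (_ - _) ^+ 2]hnorm_sqr; last exact: hdomB.
  have := hx k; have := sqr_ge0 Cb; have := sqr_ge0 (nrm w).
  move=> h1 h2 h3.
  rewrite [leRHS](_ : _ = Cb ^+ 2 * (K * 4^-1 ^+ k) * nrm w ^+ 2);
    last by ring.
  by apply: ler_wpM2r => //; exact: ler_wpM2l.
have : (b x w - l w) ^+ 2 <= 0.
  apply: (@quarter_small _ _
     (2 * b w w + 2 * (Cb ^+ 2 * K * nrm w ^+ 2))) => k.
  have := D1 k; have := D2 k; set A := Cb ^+ 2 * _ * _; move=> h1 h2.
  have := sqr_ge0 ((b x w - b (u k) w) - (b (u k) w - l w)).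
  have : (b x w - l w) = (b x w - b (u k) w) + (b (u k) w - l w) by ring.
  move=> -> ; move: h1 h2; set y := b x w - _; set z := b (u k) w - _; nra.
rewrite le_eqVlt ltNge sqr_ge0 orbF sqrf_eq0 subr_eq0; exact/eqP.
Qed.

Lemma bbilin_hip : bbilin X X ip.
Proof.
split; [by move=> *; rewrite hipL|by move=> *; rewrite hip_linr|].
by exists 1 => // u v Su Sv; rewrite mul1r; exact: hip_CS.
Qed.

Lemma riesz_hip (l : H -> R) (C : R) : blin X l C ->
  exists2 u, S u & forall v, S v -> ip u v = l v.
Proof.
move=> lb; apply: (riesz bbilin_hip _ ltr01 _ lb).
  by move=> u v; exact: hipC.
by move=> u Su; rewrite mul1r.
Qed.

Lemma hip_null w v : S w -> S v -> ip w w <= 0 -> ip w v = 0.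
Proof.
move=> Sw Sv w0; apply/eqP; rewrite -normr_le0; apply: (le_trans (hip_CS Sw Sv)).
by rewrite /hnorm (_ : ip w w = 0) ?sqrtr0 ?mul0r//; apply/le_anti; rewrite w0 hip_ge0.
Qed.

(** Normal equations. [A] represents [a] and [f] represents [l]; the symmetric form [ip (A u) (A v)]
    is coercive with constant [alpha^2], so [riesz] solves [ip (A u) (A v) = ip f (A v)]. Then
    [w = A u - f] is orthogonal to [A w], that is [a w w = 0], and [w] is null by coercivity. *)
Theorem lax_milgram (a : H -> H -> R) (alpha C : R) (l : H -> R) :
  bbilin X X a -> 0 < alpha -> (forall u, S u -> alpha * ip u u <= a u u) ->
  blin X l C -> exists2 u, S u & forall v, S v -> a u v = l v.
Proof.
move=> [aL aR [Ca Ca0 aB]] al0 acoer lb.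
have /choice[A hA] : forall u, exists w, S u -> S w /\ forall v, S v -> ip w v = a u v.
  move=> u; have [Su|nSu] := pselect (S u); last by exists 0.
  have : blin X (a u) (Ca * nrm u).
    split; first by rewrite mulr_ge0// hnorm_ge0.
      by move=> c v w Sv Sw; exact: aR.
    by move=> v Sv; exact: aB.
  by move=> /riesz_hip[w Sw hw]; exists w.
have SA u : S u -> S (A u) by move=> Su; case: (hA u Su).
have eA u v : S u -> S v -> ip (A u) v = a u v by move=> Su Sv; case: (hA u Su) => _; exact.
have AB u : S u -> nrm (A u) <= Ca * nrm u.
  move=> Su; have := hnorm_ge0 X (A u); rewrite le_eqVlt => /predU1P[<-|n0].
    by rewrite mulr_ge0// hnorm_ge0.
  rewrite -(ler_pM2r n0) -expr2 hnorm_sqr ?eA//; try exact: SA.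
  by apply: le_trans (ler_norm _) _; apply: aB => //; exact: SA.
have Alow u : S u -> alpha * nrm u <= nrm (A u).
  move=> Su; have := hnorm_ge0 X u; rewrite le_eqVlt => /predU1P[<-|n0].
    by rewrite mulr0 hnorm_ge0.
  rewrite -(ler_pM2r n0) -mulrA -expr2 hnorm_sqr//.
  apply: (le_trans (acoer _ Su)); rewrite -eA//.
  by apply: le_trans (ler_norm _) _; apply: hip_CS => //; exact: SA.
have [f Sf hf] := riesz_hip lb.
have := @riesz (fun u v => ip (A u) (A v)) (alpha ^+ 2) (nrm f * Ca)
   (fun v => ip f (A v)); case.
- have L c u v w : S u -> S v -> S w ->
      ip (A (c *: u + v)) (A w) = c * ip (A u) (A w) + ip (A v) (A w).
    move=> Su Sv Sw; have Sz := SA _ Sw.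
    by rewrite !eA ?aL//; exact: hdomL.
  split => //.
    move=> c u v w Su Sv Sw; have Sz : S (c *: u + v) by exact: hdomL.
    rewrite hipC ?L ?(hipC (SA _ Sw))//; exact: SA.
  exists (Ca ^+ 2); first exact: sqr_ge0.
  move=> u v Su Sv; apply: (le_trans (hip_CS (SA _ Su) (SA _ Sv))).
  have -> : Ca ^+ 2 * nrm u * nrm v = (Ca * nrm u) * (Ca * nrm v) by ring.
  by apply: ler_pM; rewrite ?hnorm_ge0 ?AB.
- by move=> u v Su Sv; apply: hipC; exact: SA.
- by rewrite exprn_gt0.
- move=> u Su; rewrite -!hnorm_sqr//; last exact: SA.
  rewrite -exprMn ler_pXn2r ?nnegrE ?hnorm_ge0 ?Alow// mulr_ge0 ?hnorm_ge0//.
  exact: ltW.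
- split; first by rewrite mulr_ge0 ?hnorm_ge0.
    move=> c u v Su Sv; rewrite hipC//; last by apply: SA; exact: hdomL.
    rewrite eA//; last exact: hdomL.
    rewrite aL// -!eA//.
    by rewrite !(hipC Sf)//; exact: SA.
  move=> u Su; apply: (le_trans (hip_CS Sf (SA _ Su))).
  by rewrite -mulrA ler_wpM2l ?hnorm_ge0 ?AB.
move=> u Su hu; exists u => // v Sv; rewrite -hf// -eA//.
have Sw : S (- f + A u) by apply: hdomD; [exact: hdomN|exact: SA].
have w0 : ip (- f + A u) (A (- f + A u)) = 0.
  rewrite -scaleN1r hipL//; [|exact: SA|by apply: SA; rewrite scaleN1r].
  by rewrite scaleN1r hu//; ring.
have : ip (- f + A u) v = 0.
  apply: hip_null => //; rewrite hipC// in w0; last exact: SA.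
  rewrite eA// in w0; have := acoer _ Sw; rewrite w0 => h.
  by rewrite -(ler_pM2l al0) mulr0.
by rewrite -scaleN1r hipL//; [lra|exact: SA].
Qed.

End lax_milgram.

Section brezzi.
Variables (R : realType) (H1 H2 : lmodType R) (X : shilb H1) (Y : shilb H2).
Variables (a : H1 -> H1 -> R) (b : H1 -> H2 -> R) (alpha K : R).
Hypothesis ab : bbilin X X a.
Hypothesis bb : bbilin X Y b.
Hypothesis al0 : 0 < alpha.
Hypothesis acoer : forall u, hdom X u -> alpha * hip X u u <= a u u.
Hypothesis K0 : 0 <= K.
Hypothesis infsup : forall q N, 0 <= N -> hdom Y q ->
  (forall v, hdom X v -> `|b v q| <= N * hnorm X v) -> hnorm Y q <= K * N.

(** Coercivity only makes [u - u'] a null vector of the semi-norm, not zero, so the conclusion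
    concerns what [b] sees of it. *)
Lemma coercive_inj u u' : hdom X u -> hdom X u' ->
  (forall v, hdom X v -> a u v = a u' v) -> forall q, hdom Y q -> b u q = b u' q.
Proof.
move=> Su Su' h q Sq; have Sd : hdom X (-1 *: u' + u) by exact: hdomL.
have := h _ Sd; have := acoer Sd; case: (ab) => aL _ _.
rewrite [a (_ + _) _]aL//; move=> h1 h2.
have h3 : hip X (-1 *: u' + u) (-1 *: u' + u) = 0.
  by apply/le_anti; rewrite hip_ge0// andbT -(ler_pM2l al0) mulr0; lra.
case: (bb) => bL _ [C C0 bB].
have := bB _ _ Sd Sq; rewrite /hnorm h3 sqrtr0 mulr0 mul0r normr_le0 bL//.
by move=> /eqP; lra.
Qed.

(* Schur complement: if [a (T q) _ = b _ q], then the form [b (T q) p] is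
   coercive by the inf-sup condition. *)
Theorem brezzi_existence (l : H1 -> R) (C : R) : blin X l C ->
  exists x q, [/\ hdom X x, hdom Y q,
    (forall v, hdom X v -> a x v + b v q = l v) &
    forall r, hdom Y r -> b x r = 0].
Proof.
move=> lb; case: (ab) => aL aR [Ca Ca0 aB]; case: (bb) => bL bR [Cb Cb0 bB].
have [x0 Sx0 hx0] := lax_milgram ab al0 acoer lb.
have /choice[T hT] : forall q, exists w, hdom Y q ->
    hdom X w /\ forall v, hdom X v -> a w v = b v q.
  move=> q; have [Sq|nSq] := pselect (hdom Y q); last by exists 0.
  have : blin X (b^~ q) (Cb * hnorm Y q).
    split; first by rewrite mulr_ge0// hnorm_ge0.
      by move=> c v w Sv Sw; exact: bL.
    by move=> v Sv; rewrite mulrAC; exact: bB.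
  by move=> /(lax_milgram ab al0 acoer)[w Sw hw]; exists w.
have ST q : hdom Y q -> hdom X (T q) by move=> Sq; case: (hT _ Sq).
have eT q v : hdom Y q -> hdom X v -> a (T q) v = b v q.
  by move=> Sq; case: (hT _ Sq) => _; exact.
have Tlow q : hdom Y q -> hnorm Y q <= K * (Ca * hnorm X (T q)).
  move=> Sq; apply: infsup => //; first by rewrite mulr_ge0 ?hnorm_ge0.
  by move=> v Sv; rewrite -eT//; apply: aB => //; exact: ST.
have Tup q : hdom Y q -> alpha * hnorm X (T q) <= Cb * hnorm Y q.
  move=> Sq; have := hnorm_ge0 X (T q); rewrite le_eqVlt => /predU1P[<-|n0].
    by rewrite mulr0 mulr_ge0 ?hnorm_ge0.
  rewrite -(ler_pM2r n0) -mulrA -expr2 hnorm_sqr; last exact: ST.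
  apply: (le_trans (acoer (ST _ Sq))); rewrite eT//; last exact: ST.
  by apply: le_trans (ler_norm _) _; rewrite mulrAC; apply: bB => //; exact: ST.
(* [T] comes from a choice and need not be linear; its composition with [b] is. *)
have TL c q r s : hdom Y q -> hdom Y r -> hdom Y s ->
    b (T (c *: q + r)) s = c * b (T q) s + b (T r) s.
  move=> Sq Sr Ss; rewrite -bL//; try exact: ST.
  apply: coercive_inj => //.
  - by apply: ST; exact: hdomL.
  - by apply: hdomL; exact: ST.
  - move=> v Sv; rewrite aL//; try exact: ST.
    by rewrite !eT// ?bR//; exact: hdomL.
(* The inf-sup condition gives |q| <= K Ca |T q|, and [a (T q) (T q) >= alpha |T q|^2]; the added 1
   keeps the denominator positive. *)
pose beta := alpha / (K * Ca + 1) ^+ 2.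
have KC : 0 < K * Ca + 1 by rewrite ltr_wpDl// mulr_ge0.
have sb : bbilin Y Y (fun q r => b (T q) r).
  split; first exact: TL.
    by move=> c u v w Su Sv Sw; rewrite bR//; exact: ST.
  exists (Cb * (Cb / alpha)); first by rewrite !mulr_ge0// invr_ge0 ltW.
  move=> q r Sq Sr; apply: (le_trans (bB _ _ (ST _ Sq) Sr)).
  rewrite ler_wpM2r ?hnorm_ge0// -!mulrA ler_wpM2l// mulrCA mulrA.
  by rewrite -mulrA mulrC ler_pdivlMr// mulrC; exact: Tup.
have scoer q : hdom Y q -> beta * hip Y q q <= b (T q) q.
  move=> Sq; rewrite -eT//; last exact: ST.
  apply: le_trans (acoer (ST _ Sq)); rewrite -!hnorm_sqr//; last exact: ST.
  rewrite /beta mulrAC ler_pdivrMr ?exprn_gt0// -mulrA -exprMn.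
  rewrite ler_wpM2l ?(ltW al0)// ler_pXn2r ?nnegrE ?mulr_ge0 ?hnorm_ge0 ?(ltW KC)//.
  apply: (le_trans (Tlow _ Sq)); have := hnorm_ge0 X (T q); nra.
have [q Sq hq] : exists2 q, hdom Y q & forall r, hdom Y r -> b (T q) r = b x0 r.
  apply: (lax_milgram sb _ scoer (C := Cb * hnorm X x0)).
    by rewrite divr_gt0// exprn_gt0.
  split; first by rewrite mulr_ge0 ?hnorm_ge0.
    by move=> c u v Su Sv; rewrite bR.
  by move=> u Su; exact: bB.
exists (-1 *: T q + x0), q; split => //.
- by apply: hdomL => //; exact: ST.
- by move=> v Sv; rewrite aL// ?eT// ?hx0//; [ring|exact: ST].
- by move=> r Sr; rewrite bL// ?hq//; [ring|exact: ST].
Qed.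

(** [D] precedes the data, so that the estimate is uniform in them; for [l = 0] and [C = 0] it also
    yields uniqueness. *)
Lemma brezzi_estimate : exists2 D, 0 <= D & forall (l : H1 -> R) (C : R) x q,
  blin X l C -> hdom X x -> hdom Y q ->
  (forall v, hdom X v -> a x v + b v q = l v) ->
  (forall r, hdom Y r -> b x r = 0) -> hnorm X x + hnorm Y q <= D * C.
Proof.
case: (ab) => aL aR [Ca Ca0 aB].
exists (1 / alpha + K * (1 + Ca / alpha)).
  have ai : 0 <= alpha^-1 by rewrite invr_ge0 ltW.
  by rewrite mul1r addr_ge0// mulr_ge0// addr_ge0// mulr_ge0.
move=> l C x q [C0 lL lB] Sx Sq e1 e2.
have nx : hnorm X x <= C / alpha.
  rewrite ler_pdivlMr//; have := hnorm_ge0 X x; rewrite le_eqVlt => /predU1P[<-|n0].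
    by rewrite mul0r.
  rewrite -(ler_pM2r n0) mulrAC -expr2 hnorm_sqr// mulrC.
  apply: (le_trans (acoer Sx)); have := e1 _ Sx; rewrite e2// addr0 => ->.
  exact: le_trans (ler_norm _) (lB _ Sx).
have nq : hnorm Y q <= K * (C + Ca * hnorm X x).
  apply: infsup => //; first by rewrite addr_ge0 ?mulr_ge0 ?hnorm_ge0.
  move=> v Sv; have -> : b v q = l v - a x v by rewrite -e1//; ring.
  apply: (le_trans (ler_normB _ _)); rewrite mulrDl lerD//; first exact: lB.
  exact: aB.
apply: (le_trans (lerD nx nq)).
have -> : (1 / alpha + K * (1 + Ca / alpha)) * C =
   C / alpha + K * (C + Ca * (C / alpha)) by ring.
by rewrite lerD2l ler_wpM2l// lerD2l ler_wpM2l.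
Qed.

End brezzi.

Notation pushforward_measure :=
  (measure_function_pushforward__canonical__measure_function_Measure) (only parsing).

(** * Dilations of Lebesgue measure *)

Section leb_affine.
Variable R : realType.
Local Open Scope ereal_scope.

(** The right-hand side is a measure in [A], a scaled pushforward, which agrees with Lebesgue
    measure on half-open intervals. *)
Lemma lebesgue_measure_affine (s a : R) (A : set (measurableTypeR R)) :
  (0 < s)%R -> measurable A ->
  lebesgue_measure A =
  s%:E * lebesgue_measure ((fun x : measurableTypeR R => (s * x + a)%R) @^-1` A).
Proof.
move=> s0 mA; have mf : measurable_fun [set: measurableTypeR R]
    (fun x : measurableTypeR R => (s * x + a)%R : measurableTypeR R).
  by apply: measurable_funD => //; exact: measurable_funM.
pose m := mscale (NngNum (ltW s0)) (pushforward_measure lebesgue_measure mf).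
apply: (@lebesgue_measure_unique R m) => // _ [[x y]] _ <- /=.
rewrite /m /mscale/= /pushforward.
rewrite (_ : (_ @^-1` _)%classic = `]((x - a) / s)%R, ((y - a) / s)%R]%classic); last first.
  apply/seteqP; split=> z /=; rewrite !in_itv/= ltr_pdivrMr// ler_pdivlMr//.
    by rewrite ltrBlDr lerBrDr mulrC.
  by rewrite ltrBlDr lerBrDr mulrC.
rewrite !lebesgue_measure_itv/= !lte_fin ltr_pM2r ?invr_gt0// ltrD2r.
case: ifPn => // _; last by rewrite mule0.
by rewrite -!EFinB -EFinM; congr EFin; field; rewrite gt_eqF.
Qed.

Lemma measurable_affine n (s : R) (a : 'rV[R]_n) :
  measurable_fun setT (fun x : 'rV[R]_n => s *: x + a)%R.
Proof.
apply: measurable_to_rV => i; under [X in measurable_fun _ X]eq_fun do rewrite !mxE.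
apply: measurable_funD => //; apply: measurable_funM => //.
exact: measurable_rV_coord.
Qed.

Lemma leb_succ n (A : set 'rV[R]_n.+1) :
  leb R n.+1 A = (lebesgue_measure \x leb R n) (@rV_cons R n @^-1` A).
Proof. by []. Qed.

(** Induction on the dimension: the scaled pushforward agrees with the product measure on
    rectangles, by the one-dimensional case and the induction hypothesis, and product measures are
    determined by rectangles. *)
Lemma leb_affine n (s : R) (a : 'rV[R]_n) (A : set 'rV[R]_n) :
  (0 < s)%R -> measurable A ->
  leb R n A = (s ^+ n)%:E * leb R n ((fun x => s *: x + a)%R @^-1` A).
Proof.
move=> s0; elim: n => [|n IH] in a A *.
  move=> mA; rewrite expr0 mul1e; congr (leb R 0 _); apply/seteqP.
  by split => x /=; rewrite (thinmx0 x) (thinmx0 (_ + _)%R).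
move=> mA.
pose a0 : R := a ord0 ord0; pose a1 : 'rV[R]_n := rsubmx (a : 'rV[R]_(1 + n)).
pose phi (p : measurableTypeR R * 'rV[R]_n) : measurableTypeR R * 'rV[R]_n :=
  ((s * p.1 + a0)%R : measurableTypeR R, (s *: p.2 + a1)%R).
have mphi : measurable_fun setT phi.
  apply/measurable_fun_pairP; split => /=.
    by apply: measurable_funD => //; apply: measurable_funM.
  by have := measurableT_comp (@measurable_affine n s a1) (@measurable_snd _ _ (measurableTypeR R) 'rV[R]_n).
have s0n : (0 <= s ^+ n.+1)%R by rewrite exprn_ge0// ltW.
pose m := mscale (NngNum s0n) (pushforward_measure (lebesgue_measure \x leb R n)%E mphi).
have hm : forall X, measurable X -> (lebesgue_measure \x leb R n) X = m X.
  apply: product_measure_unique => B C mB mC.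
  transitivity ((s ^+ n.+1)%:E * (lebesgue_measure \x leb R n)
     (((fun x : measurableTypeR R => (s * x + a0)%R) @^-1` B) `*`
     ((fun x => s *: x + a1)%R @^-1` C))); first by [].
  rewrite product_measure1E; last 2 first.
  - rewrite -[X in measurable X]setTI.
    by apply: (measurable_funD (measurable_funM _ _)).
  - by rewrite -[X in measurable X]setTI; exact: measurable_affine.
  have LB := lebesgue_measure_affine a0 s0 mB; have LC := IH a1 _ mC.
  rewrite exprS EFinM muleACA; congr (_ * _); exact/esym.
rewrite !leb_succ.
have mcA : measurable (@rV_cons R n @^-1` A).
  by rewrite -[X in measurable X]setTI; exact: measurable_rV_cons.
rewrite (hm _ mcA); transitivity ((s ^+ n.+1)%:E *
  (lebesgue_measure \x leb R n) (phi @^-1` (@rV_cons R n @^-1` A))); first by [].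
have E p : rV_cons (phi p) = (s *: rV_cons p + a)%R.
  apply/rowP => i; rewrite [RHS]mxE [X in _ = (X + _)%R]mxE !rV_consE.
  case: unliftP => [j ->|->] //=.
  by rewrite !mxE/=; congr (_ + a _ _)%R; apply/val_inj.
have -> : phi @^-1` (@rV_cons R n @^-1` A) =
   @rV_cons R n @^-1` ((fun x => s *: x + a)%R @^-1` A); last by [].
by apply/seteqP; split => p; rewrite /preimage/= E.
Qed.

Lemma measurable_box n (A : 'I_n -> set R) : (forall i, measurable (A i)) ->
  measurable [set x : 'rV[R]_n | forall i, A i (x ord0 i)].
Proof.
move=> mA; rewrite (_ : mkset _ =
    \bigcap_(i in [set: 'I_n]) ((fun x : 'rV[R]_n => x ord0 i) @^-1` A i)).
  apply: fin_bigcap_measurable => // i _; rewrite -[X in measurable X]setTI.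
  by apply: (@measurable_rV_coord R n i) => //; exact: mA.
by apply/seteqP; split => x /= h i; [move=> _|]; exact: h.
Qed.

Lemma leb_box_lty n (k : R) : leb R n [set x | forall i, (`|x ord0 i| <= k)%R] < +oo.
Proof.
elim: n => [|n IH]; first by rewrite /= /dirac/= ltry.
have mB m : measurable [set x : 'rV[R]_m | forall i, (`|x ord0 i| <= k)%R].
  apply: (@measurable_box m (fun _ => [set z : R | `|z| <= k]%R)) => i.
  rewrite (_ : mkset _ = [set` `[(- k)%R, k]]); first exact: measurable_itv.
  by apply/seteqP; split => z /=; rewrite in_itv/= ler_norml.
have E : @rV_cons R n @^-1` [set x | forall i, (`|x ord0 i| <= k)%R] =
  (([set` `[(- k)%R, k]] : set (measurableTypeR R)) `*` [set x : 'rV[R]_n | forall i, (`|x ord0 i| <= k)%R]).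
  apply/seteqP; split => -[t x] /=.
    move=> h; split; first by have := h ord0; rewrite rV_consE unlift_none in_itv/= ler_norml.
    by move=> i; have := h (lift ord0 i); rewrite rV_consE liftK.
  move=> [ht hx] i; rewrite rV_consE; case: unliftP => [j _|_] //=.
  by move: ht; rewrite in_itv/= ler_norml.
rewrite leb_succ E.
have mI : measurable ([set` `[(- k)%R, k]] : set (measurableTypeR R)) by exact: measurable_itv.
rewrite (product_measure1E _ _ mI (mB n)).
apply: lte_mul_pinfty => //; rewrite ?measure_ge0//.
by rewrite /= lebesgue_measure_itv/=; case: ifP => // _; rewrite -EFinB fin_numE.
Qed.

Lemma measurable_ball_rV n (x : 'rV[R]_n) (e : R) : measurable (ball x e).
Proof.
have [e0|e0] := ltP 0%R e; last first.
  rewrite (_ : ball x e = set0)//; apply/seteqP; split => // y.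
  by rewrite -ball_normE/= => /(le_lt_trans (normr_ge0 _)); rewrite ltNge e0.
rewrite (_ : ball x e = [set y | forall i, ball (x ord0 i) e (y ord0 i)]).
  apply: (@measurable_box n (fun i => ball (x ord0 i) e)) => i.
  exact: measurable_ball.
apply/seteqP; split => y.
  by move=> [_ h] i; exact: h.
by move=> h; split => // i j; rewrite (ord1 i); exact: h.
Qed.

(** The sigma-algebra is generated by the coordinates, and balls of the sup norm are boxes. An open
    set is the countable union of the balls with rational centre and radius [1 / (k + 1)] that it
    contains. *)
Lemma open_measurable_rV n (U : set 'rV[R]_n) : open U -> measurable U.
Proof.
move=> oU.
pose I := [set p : 'rV[rat]_n * nat |
   ball (map_mx ratr p.1 : 'rV[R]_n) (p.2.+1%:R^-1)%R `<=` U].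
rewrite (_ : U = \bigcup_(p in I) ball (map_mx ratr p.1 : 'rV[R]_n) (p.2.+1%:R^-1)%R).
  rewrite bigcup_mkcond; apply: countable_bigcupT_measurable => // p.
  by case: ifP => // _; exact: measurable_ball_rV.
apply/seteqP; split => x; last by move=> [p Ip]; exact: Ip.
move=> /oU /nbhs_ballP[e /= e0 he].
have [k hk] : exists k : nat, (k.+1%:R^-1 < e / 2)%R.
  have /ltr_add_invr[k] : (0 < e / 2)%R by rewrite divr_gt0.
  by rewrite add0r => hk; exists k.
have ik0 : (0 < k.+1%:R^-1 :> R)%R by rewrite invr_gt0.
have /choice[q hq] : forall i : 'I_n, exists q : rat,
    (`|x ord0 i - ratr q| < k.+1%:R^-1)%R.
  move=> i; have [|q] := @rat_in_itvoo R (x ord0 i - k.+1%:R^-1)%R (x ord0 i + k.+1%:R^-1)%R.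
    by rewrite ltrD2l gt0_cp.
  by rewrite in_itv/= => /andP[h1 h2]; exists q; rewrite distrC ltr_distl h1 h2.
have hx : ball (map_mx ratr (\row_i q i) : 'rV[R]_n) (k.+1%:R^-1)%R x.
  split => // i j; rewrite (ord1 i) !mxE /ball/= distrC; exact: hq.
exists (\row_i q i, k) => //= y hy; apply: he.
by apply: (le_ball (e1 := (k.+1%:R^-1 + k.+1%:R^-1)%R));
  [rewrite (splitr e) lerD// ltW|apply: ball_triangle hy; exact: ball_sym].
Qed.

Lemma closed_measurable_rV n (U : set 'rV[R]_n) : closed U -> measurable U.
Proof.
move=> /closed_openC/open_measurable_rV/measurableC.
by rewrite setCK.
Qed.

Lemma continuous_measurable_rV n (f : 'rV[R]_n -> R) : continuous f ->
  measurable_fun setT f.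
Proof.
move=> cf; apply: (measurability _ (RGenOpens.measurableE R)) => //.
move=> _ [U [a [b ->]] <-]; rewrite setTI; apply: open_measurable_rV.
by apply: open_comp => // x _; exact: cf.
Qed.

Lemma leb_bounded_lty n (A : set 'rV[R]_n) : measurable A -> bounded_set A ->
  leb R n A < +oo.
Proof.
move=> mA [M [_ /(_ (M + 1)%R)]]; rewrite ltrDl ltr01 => /(_ isT) hA.
apply: le_lt_trans (leb_box_lty n (M + 1)); apply: le_measure; rewrite ?inE//.
  apply: (@measurable_box n (fun _ => [set z : R | `|z| <= M + 1]%R)) => i.
  rewrite (_ : mkset _ = [set` `[(- (M + 1))%R, (M + 1)%R]]); first exact: measurable_itv.
  by apply/seteqP; split => z /=; rewrite in_itv/= ler_norml.
move=> x /hA hx i; apply: le_trans hx.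
rewrite /Num.norm/= mx_normrE; apply: (le_bigmax _ _ (ord0, i)).
Qed.

Lemma dot_continuous n (a : 'rV[R]_n) : continuous (dot a).
Proof.
apply: continuous_big => [|i _ x]; first exact: add_continuous.
by have h := @coord_continuous R 1 n ord0 i x; exact: cvgM (cvg_cst _) h.
Qed.

(** For every [N], the translates of a bounded piece by [j / N] along a transversal axis, [j < N],
    are disjoint, have equal measures and lie in one fixed box. So [N] times the measure of the
    piece stays bounded. *)
Lemma leb_hyperplane n (a : 'rV[R]_n) (b : R) : a != 0%R ->
  leb R n [set x | dot a x = b] = 0.
Proof.
move=> a0; have /existsP[i ai0] : [exists i, a ord0 i != 0%R].
  apply/contraT => /existsPn h; move/eqP : a0; case.
  by apply/rowP => i; rewrite mxE; exact/eqP/negPn/h.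
pose e : 'rV[R]_n := delta_mx ord0 i.
have dote x t : dot a (x + t *: e)%R = (dot a x + t * a ord0 i)%R.
  rewrite /dot (bigD1 i)//= [in RHS](bigD1 i)//= !mxE !eqxx mulr1 mulrDr.
  rewrite addrAC mulrC -!addrA; congr (_ + _)%R; rewrite addrC [RHS]addrC mulrC; congr (_ + _)%R.
  by apply: eq_bigr => j ji; rewrite !mxE (negbTE ji) mulr0 addr0.
pose H := [set x | dot a x = b].
pose Q (k : R) := [set x : 'rV[R]_n | forall i, (`|x ord0 i| <= k)%R].
have mQ k : measurable (Q k).
  apply: (@measurable_box n (fun _ => [set z : R | `|z| <= k]%R)) => j.
  rewrite (_ : mkset _ = [set` `[(- k)%R, k]]); first exact: measurable_itv.
  by apply/seteqP; split => z /=; rewrite in_itv/= ler_norml.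
have mH : measurable H.
  rewrite (_ : H = dot a @^-1` [set b]); last by [].
  rewrite -[X in measurable X]setTI; apply: continuous_measurable_rV => //.
  exact: dot_continuous.
have HQ (k : nat) : leb R n (H `&` Q k%:R) = 0.
  have mHQ : measurable (H `&` Q k%:R) by exact: measurableI.
  pose F (N j : nat) := (fun x => 1%R *: x + (- (j%:R / N%:R) *: e))%R @^-1` (H `&` Q k%:R).
  have mF N j : measurable (F N j).
    by rewrite -[X in measurable X]setTI; exact: measurable_affine.
  have lF N j : leb R n (F N j) = leb R n (H `&` Q k%:R).
    by rewrite [RHS](@leb_affine n 1 (- (j%:R / N%:R) *: e)%R _ ltr01 mHQ) expr1n mul1e.
  have QM := leb_box_lty n (k%:R + 1).
  have hN (N : nat) : \sum_(j < N) leb R n (H `&` Q k%:R) <= leb R n (Q (k%:R + 1)%R).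
    under eq_bigr => j _ do rewrite -(lF N j).
    have <- : leb R n (\big[setU/set0]_(j < N) F N j) = \sum_(j < N) leb R n (F N j).
      apply: measure_bigsetU_ord => //.
      apply/trivIsetP => j1 j2 _ _ j12; apply/seteqP; split => // x [[/= h1 _] [/= h2 _]].
      move: h1 h2; rewrite /H /= !scale1r !dote => <- /eqP; apply/negP.
      rewrite -subr_eq0 (_ : (_ - _ = (j1%:R - j2%:R) / N%:R * a ord0 i)%R); last by ring.
      rewrite !mulf_neq0 ?invr_eq0 ?pnatr_eq0//.
        by rewrite subr_eq0 eqr_nat.
      by rewrite -lt0n (leq_ltn_trans _ (ltn_ord j1)).
    apply: le_measure; rewrite ?inE//; first exact: bigsetU_measurable.
    rewrite -bigcup_seq; apply: bigcup_sub => j _ x [_ /= hx] l.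
    have := hx l; rewrite !mxE mul1r => {}hx.
    have jN : (0 <= (j%:R / N%:R : R) <= 1)%R.
      rewrite divr_ge0//= ler_pdivrMr ?mul1r ?ler_nat ?(ltnW (ltn_ord j))//.
      by rewrite ltr0n (leq_ltn_trans _ (ltn_ord j)).
    move: hx; rewrite !ler_norml; move: jN => /andP[]; set t := (_ / _)%R => t0 t1.
    case: (eqVneq l i) => _ /=; rewrite ?mulr1 ?mulr0 ?addr0 => /andP[h1 h2]; apply/andP; split; lra.
  have fM : leb R n (Q (k%:R + 1)%R) \is a fin_num by rewrite ge0_fin_numE// measure_ge0.
  have fm : leb R n (H `&` Q k%:R) \is a fin_num.
    rewrite ge0_fin_numE// ?measure_ge0//; apply: le_lt_trans QM.
    by have := hN 1%N; rewrite big_ord1.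
  move: hN; rewrite -(fineK fm) -(fineK fM); set r := fine _; set M := fine (leb R n (Q _)).
  move=> hN; have : (0 <= r)%R by rewrite fine_ge0// measure_ge0.
  rewrite le_eqVlt => /predU1P[<-//|r0]; exfalso.
  have := hN (Num.truncn (M / r)).+1; rewrite sumEFin lee_fin sumr_const card_ord.
  apply/negP; rewrite -ltNge -mulr_natr mulrC -ltr_pdivrMr//.
  exact: truncnS_gt.
have : (leb R n).-negligible (\bigcup_k (H `&` Q k%:R)).
  apply: negligible_bigcup => k; apply/negligibleP; last exact: HQ.
  exact: measurableI.
rewrite -setI_bigcupr (_ : \bigcup_k Q k%:R = setT) ?setIT.
  by move=> h; apply/negligibleP.
apply/seteqP; split => // x _; exists (Num.truncn `|x|).+1 => //= j.
apply: le_trans (ltW (truncnS_gt _)).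
by rewrite /Num.norm/= mx_normrE; apply: (le_bigmax _ _ (ord0, j)).
Qed.

End leb_affine.

(** * Square-integrable functions *)

Section square_integrable.
Context d (T : measurableType d) (R : realType) (mu : {measure set T -> \bar R}).
Implicit Types (D : set T) (f g h : T -> R).

Definition sqint D f := measurable_fun D f /\
  mu.-integrable D (EFin \o (fun x => f x ^+ 2)).

Definition l2ip D f g : R := \int[mu]_(x in D) (f x * g x).

Definition l2n D f : R := Num.sqrt (l2ip D f f).

Lemma integrable_le D f g : measurable D -> measurable_fun D f ->
  mu.-integrable D (EFin \o g) -> (forall x, D x -> `|f x| <= g x) ->
  mu.-integrable D (EFin \o f).
Proof.
move=> mD mf ig fg; apply: (le_integrable mD _ _ ig); first exact/measurable_EFinP.
by move=> x Dx /=; rewrite lee_fin (le_trans (fg _ Dx))// ler_norm.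
Qed.

Lemma integrable_mfun D f : mu.-integrable D (EFin \o f) -> measurable_fun D f.
Proof. by move=> /integrableP[/measurable_EFinP]. Qed.

Lemma integrableRD D f g : measurable D -> mu.-integrable D (EFin \o f) ->
  mu.-integrable D (EFin \o g) -> mu.-integrable D (EFin \o (fun x => f x + g x)).
Proof. by move=> mD; exact: integrableD. Qed.

Lemma integrableRB D f g : measurable D -> mu.-integrable D (EFin \o f) ->
  mu.-integrable D (EFin \o g) -> mu.-integrable D (EFin \o (fun x => f x - g x)).
Proof. by move=> mD; exact: integrableB. Qed.

Lemma integrableRZ D f (k : R) : measurable D -> mu.-integrable D (EFin \o f) ->
  mu.-integrable D (EFin \o (fun x => k * f x)).
Proof. by move=> mD; exact: integrableZl. Qed.

Lemma integrableR_sum D (I : Type) (s : seq I) (F : I -> T -> R) : measurable D ->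
  (forall i, mu.-integrable D (EFin \o F i)) ->
  mu.-integrable D (EFin \o (fun x => \sum_(i <- s) F i x)).
Proof.
move=> mD iF; rewrite (_ : EFin \o _ = fun x => (\sum_(i <- s) (EFin \o F i) x)%E).
  exact: integrable_sum.
by apply/funext => x /=; rewrite sumEFin.
Qed.

Lemma Rintegral_sum D (I : Type) (s : seq I) (F : I -> T -> R) : measurable D ->
  (forall i, mu.-integrable D (EFin \o F i)) ->
  \int[mu]_(x in D) (\sum_(i <- s) F i x) = \sum_(i <- s) \int[mu]_(x in D) F i x.
Proof.
move=> mD iF; elim: s => [|i s IH].
  under eq_Rintegral do rewrite big_nil.
  by rewrite big_nil Rintegral_cst// mul0r.
rewrite big_cons -IH -RintegralD//; last exact: integrableR_sum.
by apply: eq_Rintegral => x _; rewrite big_cons.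
Qed.

Lemma sqintM D f g : measurable D -> sqint D f -> sqint D g ->
  mu.-integrable D (EFin \o (fun x => f x * g x)).
Proof.
move=> mD [mf sf] [mg sg]; apply: (integrable_le mD _ (integrableRD mD sf sg)).
  exact: measurable_funM.
move=> x _; rewrite normrM -(normr_id (f x)) -(normr_id (g x)).
rewrite -[f x ^+ 2]real_normK ?num_real// -[g x ^+ 2]real_normK ?num_real//.
rewrite !normr_id; have := sqr_ge0 (`|f x| - `|g x|); nra.
Qed.

Lemma sqint0 D : measurable D -> sqint D (fun=> 0).
Proof.
move=> mD; split => //; rewrite (_ : EFin \o _ = cst 0%E); first exact: integrable0.
by apply/funext => x; rewrite /= expr0n.
Qed.

Lemma sqintZ D (k : R) f : measurable D -> sqint D f -> sqint D (fun x => k * f x).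
Proof.
move=> mD [mf sf]; split; first exact: measurable_funM.
rewrite (_ : EFin \o _ = EFin \o (fun x => k ^+ 2 * f x ^+ 2)); first exact: integrableRZ.
by apply/funext => x; rewrite /= exprMn.
Qed.

Lemma sqintD D f g : measurable D -> sqint D f -> sqint D g ->
  sqint D (fun x => f x + g x).
Proof.
move=> mD sf sg; have ifg := sqintM mD sf sg.
case: sf sg => [mf sf] [mg sg]; split; first exact: measurable_funD.
rewrite (_ : EFin \o _ =
  EFin \o (fun x => f x ^+ 2 + (2 * (f x * g x) + g x ^+ 2))).
  by do 2 (apply: integrableRD => //); exact: integrableRZ.
by apply/funext => x /=; congr EFin; ring.
Qed.

Lemma sqintN D f : measurable D -> sqint D f -> sqint D (fun x => - f x).
Proof.
move=> mD sf; rewrite (_ : (fun x => - f x) = fun x => -1 * f x); first exact: sqintZ.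
by apply/funext => x; rewrite mulN1r.
Qed.

Lemma sqintB D f g : measurable D -> sqint D f -> sqint D g ->
  sqint D (fun x => f x - g x).
Proof. by move=> mD sf sg; apply: sqintD => //; exact: sqintN. Qed.

Lemma sqint_sum D (I : Type) (s : seq I) (F : I -> T -> R) : measurable D ->
  (forall i, sqint D (F i)) -> sqint D (fun x => \sum_(i <- s) F i x).
Proof.
move=> mD sF; elim: s => [|i s IH].
  by under eq_fun do rewrite big_nil; exact: sqint0.
by under eq_fun do rewrite big_cons; exact: sqintD.
Qed.

Lemma sqint_bounded D f g (M : R) : measurable D -> measurable_fun D f ->
  (forall x, D x -> `|f x| <= M) -> sqint D g -> sqint D (fun x => f x * g x).
Proof.
move=> mD mf fM [mg sg]; split; first exact: measurable_funM.
apply: (integrable_le (g := fun x => M ^+ 2 * g x ^+ 2) mD).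
- by apply: measurable_funX; exact: measurable_funM.
- exact: integrableRZ.
- move=> x Dx; rewrite ger0_norm ?sqr_ge0// exprMn ler_wpM2r ?sqr_ge0//.
  by rewrite -real_normK ?num_real// ler_pXn2r ?nnegrE// ?fM// (le_trans _ (fM _ Dx)).
Qed.

Lemma l2ipC D f g : l2ip D f g = l2ip D g f.
Proof. by apply: eq_Rintegral => x _; rewrite mulrC. Qed.

Lemma l2ipDl D f g h : measurable D -> sqint D f -> sqint D g -> sqint D h ->
  l2ip D (fun x => f x + g x) h = l2ip D f h + l2ip D g h.
Proof.
move=> mD sf sg sh; rewrite /l2ip -RintegralD//; try exact: sqintM.
by apply: eq_Rintegral => x _; rewrite mulrDl.
Qed.

Lemma l2ipZl D (k : R) f h : measurable D -> sqint D f -> sqint D h ->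
  l2ip D (fun x => k * f x) h = k * l2ip D f h.
Proof.
move=> mD sf sh; rewrite /l2ip -RintegralZl//; try exact: sqintM.
by apply: eq_Rintegral => x _; rewrite mulrA.
Qed.

Lemma l2ip_ge0 D f : 0 <= l2ip D f f.
Proof. by apply: Rintegral_ge0 => x _; rewrite -expr2 sqr_ge0. Qed.

Lemma l2ip_int D f : sqint D f ->
  (\int[mu]_(x in D) (f x ^+ 2)%:E)%E = (l2ip D f f)%:E.
Proof.
move=> [_ /integrableP[mf2 lt]]; rewrite /l2ip/= /Rintegral fineK.
  by apply: eq_integral => x _; rewrite expr2.
rewrite fin_num_abs; apply: le_lt_trans lt; rewrite gee0_abs.
  rewrite le_eqVlt; apply/orP; left; apply/eqP; apply: eq_integral => x _ /=.
  by rewrite ger0_norm ?sqr_ge0// expr2.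
by apply: integral_ge0 => x _; rewrite lee_fin -expr2 sqr_ge0.
Qed.

(** Riesz-Fischer with a rate. The squared increments, of integral at most [c 4^-j], are weighted by
    [2^j]: the weighted series still has a finite integral, and where it converges it makes the
    sequence Cauchy. *)
Lemma l2_complete D (u : nat -> T -> R) (c : R) : measurable D ->
  (forall k, sqint D (u k)) ->
  (forall k, l2ip D (fun x => u k.+1 x - u k x) (fun x => u k.+1 x - u k x)
             <= c * 4^-1 ^+ k) ->
  exists2 l, sqint D l &
    forall k, l2ip D (fun x => u k x - l x) (fun x => u k x - l x)
              <= 4 * c * 4^-1 ^+ k.
Proof.
move=> mD su hu.
pose w k j x : R := 2 ^+ (k + j) * (u (k + j).+1 x - u (k + j)%N x) ^+ 2.
have w0 k j x : 0 <= w k j x by rewrite mulr_ge0 ?sqr_ge0 ?exprn_ge0.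
pose S k x : \bar R := (\sum_(j <oo) (w k j x)%:E)%E.
have sd k : sqint D (fun x => u k.+1 x - u k x) by exact: sqintB.
have mw k j : measurable_fun D (EFin \o w k j).
  apply/measurable_EFinP; apply: measurable_funM => //.
  by apply: measurable_funX; case: (sd (k + j)%N).
have c0 : 0 <= c by have := le_trans (l2ip_ge0 D _) (hu 0%N); rewrite expr0 mulr1.
have iS k : (\int[mu]_(x in D) S k x <= (c * 2 * 2^-1 ^+ k)%:E)%E.
  rewrite integral_nneseries//; last by move=> *; rewrite lee_fin.
  apply: (@lime_le _ _ _ _ _ _ _); first by apply: is_cvg_nneseries => j _ _; apply: integral_ge0 => x _; rewrite lee_fin.
  apply: nearW => m.
  apply: (@le_trans _ _ (\sum_(0 <= j < m) (c * 2^-1 ^+ k * 2^-1 ^+ j)%:E)%E).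
    apply: lee_sum => j _.
    under eq_integral do rewrite EFinM.
    rewrite ge0_integralZl//; last 2 first.
    - by apply/measurable_EFinP; apply: measurable_funX; case: (sd (k + j)%N).
    - by move=> x _; rewrite lee_fin sqr_ge0.
    rewrite l2ip_int// -EFinM lee_fin.
    apply: (le_trans (ler_wpM2l _ (hu (k + j)%N))); first by rewrite exprn_ge0.
    rewrite mulrCA -mulrA ler_wpM2l// -exprD -exprMn (_ : 2 * 4^-1 = 2^-1 :> R)//.
    by field.
  rewrite sumEFin lee_fin -mulr_sumr -mulrA [2 * _]mulrC mulrA.
  apply: ler_wpM2l; first by rewrite mulr_ge0// exprn_ge0.
  rewrite (_ : \sum_(0 <= i < m) _ = 2 - 2 * 2^-1 ^+ m); first by rewrite gerBl mulr_ge0// exprn_ge0.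
  elim: m => [|m IH]; first by rewrite big_geq// expr0; ring.
  by rewrite big_nat_recr//= IH exprS; field.
  by move=> j; exact: mw.
have mS k : measurable_fun D (S k).
  apply: ge0_emeasurable_sum => [j x _ _|j _]; last exact: mw.
  by rewrite lee_fin.
have S0 k x : (0 <= S k x)%E by apply: nneseries_ge0 => j _ _; rewrite lee_fin.
(* Induction with [(x + y)^2 <= 2 x^2 + 2 y^2]; the factor 2 lost at each step is what the weights
   [2^j] compensate. *)
have psum k x m : (u (k + m)%N x - u k x) ^+ 2 <=
    2 * 2^-1 ^+ k * \sum_(0 <= j < m) w k j x.
  elim: m k => [|m IH] k; first by rewrite addn0 subrr expr0n big_geq// mulr0.
  rewrite big_nat_recl// [w k 0%N x]/w addn0.
  have -> : \sum_(0 <= i < m) w k i.+1 x = \sum_(0 <= i < m) w k.+1 i x.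
    by apply: eq_bigr => i _; rewrite /w addnS addSn.
  have := IH k.+1; rewrite addSn -addnS [2^-1 ^+ k.+1]exprS; set Y := \sum_(0 <= i < m) _.
  set e := 2^-1 ^+ k; have e2 : e * 2 ^+ k = 1.
    by rewrite /e -exprMn mulVf// expr1n.
  move=> h; have := sqr_ge0 ((u k.+1 x - u k x) - (u (k + m.+1)%N x - u k.+1 x)).
  have -> : 2 * e * (2 ^+ k * (u k.+1 x - u k x) ^+ 2 + Y) =
     2 * (e * 2 ^+ k) * (u k.+1 x - u k x) ^+ 2 + 2 * e * Y by ring.
  rewrite e2 mulr1; have : 2 * (2^-1 * e) * Y = e * Y by field.
  move=> E; rewrite E in h; lra.
pose A := [set x | D x /\ (S 0%N x < +oo)%E].
have mA : measurable A.
  rewrite (_ : A = D `&` [set x | (S 0%N x < +oo)%E])//.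
  exact: emeasurable_fun_infty_o.
(* Set to zero off [A], the sequence converges everywhere on [D], so that its limit is
   measurable. *)
pose v k x := u k x * \1_A x.
have Av x : A x -> v ^~ x = u ^~ x.
  by move=> Ax; apply/funext => k; rewrite /v indicE mem_set// mulr1.
have nAv x : ~ A x -> v ^~ x = fun=> 0.
  by move=> Ax; apply/funext => k; rewrite /v indicE memNset// mulr0.
have cvgv x : cvgn (v ^~ x).
  have [Ax|nAx] := pselect (A x); last by rewrite nAv//; exact: is_cvg_cst.
  rewrite Av//; case: Ax => Dx Sx.
  pose M := fine (S 0%N x).
  have hM k m : (u (k + m)%N x - u k x) ^+ 2 <= 2 * 2^-1 ^+ k * M.
    apply: (le_trans (psum k x m)); apply: ler_wpM2l.
      by rewrite mulr_ge0// exprn_ge0.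
    rewrite -lee_fin /M fineK ?ge0_fin_numE// -sumEFin.
    apply: (@le_trans _ _ (\sum_(0 <= j < k + m) (w 0%N j x)%:E)%E).
      have E : (\sum_(k <= j < k + m) (w 0%N j x)%:E = \sum_(0 <= i < m) (w k i x)%:E)%E.
        rewrite -{1}[k]add0n big_addn addKn; apply: eq_bigr => i _.
        by rewrite /w add0n addnC.
      rewrite [in leRHS](big_cat_nat (n := k))//= ?leq_addr// E leeDr//.
      by apply: sume_ge0 => i _; rewrite lee_fin.
    apply: nneseries_lim_ge => j _ _; by rewrite lee_fin.
  have M0 : 0 <= M by rewrite fine_ge0.
  apply/cauchy_cvgP/cauchy_exP => _/posnumP[e].
  have : (fun k => 2 * 2^-1 ^+ k * M) @ \oo --> (0 : R).
    rewrite -[X in _ --> X](mul0r M); apply: cvgMl.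
    rewrite -[X in _ --> X](mulr0 2); apply: cvgMr; apply: cvg_expr.
    by rewrite ger0_norm// invf_lt1// ltr1n.
  move=> /cvgr0_norm_lt /(_ (e%:num ^+ 2)); rewrite exprn_gt0// => /(_ isT)[k _ hk].
  exists (u k x); exists k => // m /= km.
  have := hM k (m - k)%N; rewrite subnKC// => h1.
  have := hk k (leqnn k); rewrite /= => /(le_lt_trans (ler_norm _)) => h2.
  rewrite -ball_normE/= distrC -(@ltr_pXn2r _ 2)// ?nnegrE//.
  by rewrite real_normK ?num_real//; exact: le_lt_trans h2.
pose l : T -> R := fun x => limn (v ^~ x).
have ml : measurable_fun D l.
  apply: (measurable_fun_cvg (h := v)) => [k|x _].
    by apply: measurable_funM; [case: (su k)|exact: measurable_indic].
  exact: cvgv.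
have bl k x : A x -> (((u k x - l x) ^+ 2)%:E <= (2 * 2^-1 ^+ k)%:E * S k x)%E.
  move=> Ax; have Dx : D x by case: Ax.
  have hm m : (((u (k + m)%N x - u k x) ^+ 2)%:E <= (2 * 2^-1 ^+ k)%:E * S k x)%E.
    apply: (@le_trans _ _ (2 * 2^-1 ^+ k * \sum_(0 <= j < m) w k j x)%:E).
      by rewrite lee_fin.
    rewrite EFinM; apply: lee_wpmul2l; first by rewrite lee_fin mulr_ge0// exprn_ge0.
    by rewrite -sumEFin; apply: nneseries_lim_ge => j _ _; rewrite lee_fin.
  have c1 : (fun m => ((u (m + k)%N x - u k x) ^+ 2)%:E) @ \oo --> ((l x - u k x) ^+ 2)%:E.
    apply: cvg_EFin; first exact: nearW.
    have lx : u m x @[m --> \oo] --> l x by rewrite /l Av// -Av//; exact: cvgv.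
    have lk : (u (m + k)%N x - u k x) @[m --> \oo] --> l x - u k x.
      apply: cvgB; last exact: cvg_cst.
      by have := lx; rewrite -(cvg_shiftn k).
    rewrite expr2 /comp/=; under eq_fun do rewrite expr2.
    exact: cvgM.
  rewrite -(sqrrN) opprB -(cvg_lim _ c1)//; apply: lime_le; first by apply/cvg_ex; eexists; exact: c1.
  by apply: nearW => m; rewrite addnC.
have nA : {ae mu, forall x, D x -> A x}.
  have : mu.-integrable D (S 0%N).
    apply/integrableP; split => //; apply: (le_lt_trans _ (ltry (c * 2 * 2^-1 ^+ 0))).
    apply: le_trans (iS 0%N); under eq_integral => x _ do rewrite gee0_abs//.
    exact: lexx.
  move=> /(integrable_ae mD); apply: filterS => x h Dx; split => //.
  by have := h Dx; rewrite ge0_fin_numE.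
have bint k : (\int[mu]_(x in D) ((u k x - l x) ^+ 2)%:E <= (4 * c * 4^-1 ^+ k)%:E)%E.
  have h1 : (\int[mu]_(x in D) ((u k x - l x) ^+ 2)%:E <=
      \int[mu]_(x in D) ((2 * 2^-1 ^+ k)%:E * S k x))%E.
    apply: ae_ge0_le_integral => //.
    - by move=> x _; rewrite lee_fin sqr_ge0.
    - by apply/measurable_EFinP; apply: measurable_funX; apply: measurable_funB => //; case: (su k).
    - by move=> x _; rewrite mule_ge0// lee_fin mulr_ge0// exprn_ge0.
    - exact: measurable_funeM.
    - by move: nA; apply: filterS => x h Dx; exact/bl/h.
  apply: (le_trans h1).
  have e0 : (0 <= (2 * 2^-1 ^+ k : R)%:E)%E by rewrite lee_fin mulr_ge0// exprn_ge0.
  rewrite ge0_integralZl//.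
  apply: (le_trans (lee_wpmul2l _ (iS k))); first by rewrite lee_fin mulr_ge0// exprn_ge0.
  rewrite -EFinM lee_fin (_ : 4^-1 = 2^-1 * 2^-1 :> R); last by field.
  by rewrite exprMn le_eqVlt; apply/orP; left; apply/eqP; ring.
have sl k : sqint D (fun x => u k x - l x).
  split; first by apply: measurable_funB => //; case: (su k).
  apply/integrableP; split.
    by apply/measurable_EFinP; apply: measurable_funX; apply: measurable_funB => //; case: (su k).
  apply: (le_lt_trans _ (ltry (4 * c * 4^-1 ^+ k))); apply: le_trans (bint k).
  by under eq_integral => x _ do rewrite /= ger0_norm ?sqr_ge0//; exact: lexx.
exists l.
  rewrite (_ : l = fun x => u 0%N x - (u 0%N x - l x)); first exact: sqintB.
  by apply/funext => x; rewrite opprB addrC subrK.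
by move=> k; rewrite -lee_fin -l2ip_int.
Qed.

End square_integrable.

(** * Smooth functions and test functions *)

Section Ck_algebra.
Variables (R : realType) (n : nat).
Local Notation E := 'rV[R]_n.
Local Notation dir i := (delta_mx ord0 i : 'rV[R]_n).
Implicit Types (f g : E -> R).

Definition pd (i : 'I_n) f : E -> R := 'D_(dir i) f.

Definition smooth f := forall k, Ck k f.

Lemma CkW k f : Ck k.+1 f -> Ck k f.
Proof.
elim: k f => [|k IH] f [cf h]; first by split.
by split => // i; have [h1 h2] := h i; split => //; exact: IH.
Qed.

Lemma smooth_cont f : smooth f -> continuous f.
Proof. by move=> /(_ 0%N)[]. Qed.

Lemma smooth_derivable f i x : smooth f -> derivable f x (dir i).
Proof. by move=> /(_ 1%N)[_ /(_ i)[]]. Qed.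

Lemma smooth_is_derive f i x : smooth f -> is_derive x (dir i) f (pd i f x).
Proof. by move=> sf; apply: derivableP; exact: smooth_derivable. Qed.

Lemma smooth_pd f i : smooth f -> smooth (pd i f).
Proof. by move=> sf k; have [_ /(_ i)[]] := sf k.+1. Qed.

Lemma Ck_ext k f g : f =1 g -> Ck k f -> Ck k g.
Proof. by move=> /funext ->. Qed.

Lemma Ck_cst k (c : R) : Ck k (fun _ : E => c).
Proof.
have cc (a : R) : continuous (fun _ : E => a) by exact: cst_continuous.
elim: k c => [|k IH] c; first by split => //; exact: cc.
split => [|i]; first exact: cc.
split; first by move=> x; exact: derivable_cst.
apply: (@Ck_ext _ (fun=> 0)); last exact: IH.
by move=> x; rewrite derive_cst.
Qed.

Lemma pdD f g i x : derivable f x (dir i) -> derivable g x (dir i) ->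
  pd i (fun x => f x + g x) x = pd i f x + pd i g x.
Proof. by move=> df dg; rewrite /pd -deriveD. Qed.

Lemma pdM f g i x : derivable f x (dir i) -> derivable g x (dir i) ->
  pd i (fun x => f x * g x) x = pd i f x * g x + f x * pd i g x.
Proof.
move=> df dg.
have h := deriveM df dg; rewrite -[LHS]/('D_(dir i) (f * g) x).
by rewrite h addrC [pd i f x * _]mulrC.
Qed.

Lemma pdZ f i (c : R) x : derivable f x (dir i) ->
  pd i (fun x => c * f x) x = c * pd i f x.
Proof. by move=> df; rewrite /pd -[LHS]/('D_(dir i) (c *: f) x) deriveZ. Qed.

Lemma pdN f i x : derivable f x (dir i) -> pd i (fun x => - f x) x = - pd i f x.
Proof. by move=> df; rewrite /pd -[LHS]/('D_(dir i) (- f) x) deriveN. Qed.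

Lemma pd_cst i (c : R) x : pd i (fun=> c) x = 0.
Proof. by rewrite /pd derive_cst. Qed.

Lemma CkD k f g : Ck k f -> Ck k g -> Ck k (fun x => f x + g x).
Proof.
elim: k f g => [|k IH] f g [cf df] [cg dg].
  by split => // x; exact: (cvgD (cf x) (cg x)).
split => [x|i]; first exact: (cvgD (cf x) (cg x)).
have [df1 df2] := df i; have [dg1 dg2] := dg i.
split; first by move=> x; exact: derivableD.
apply: (@Ck_ext _ (fun x => pd i f x + pd i g x)); last exact: IH.
by move=> x; rewrite -pdD.
Qed.

Lemma CkM k f g : Ck k f -> Ck k g -> Ck k (fun x => f x * g x).
Proof.
elim: k f g => [|k IH] f g Cf Cg.
  by case: Cf Cg => cf _ [cg _]; split => // x; exact: (cvgM (cf x) (cg x)).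
have := CkW Cf; have := CkW Cg; case: Cf Cg => cf df [cg dg] Cg Cf.
split => [x|i]; first exact: (cvgM (cf x) (cg x)).
have [df1 df2] := df i; have [dg1 dg2] := dg i.
split; first by move=> x; exact: derivableM.
apply: (@Ck_ext _ (fun x => pd i f x * g x + f x * pd i g x)).
  by move=> x; rewrite -pdM.
by apply: CkD; exact: IH.
Qed.

Lemma smooth_cst (c : R) : smooth (fun=> c). Proof. by move=> k; exact: Ck_cst. Qed.
Lemma smoothD f g : smooth f -> smooth g -> smooth (fun x => f x + g x).
Proof. by move=> sf sg k; exact: CkD. Qed.
Lemma smoothM f g : smooth f -> smooth g -> smooth (fun x => f x * g x).
Proof. by move=> sf sg k; exact: CkM. Qed.
Lemma smoothZ (c : R) f : smooth f -> smooth (fun x => c * f x).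
Proof. by move=> sf; apply: smoothM => //; exact: smooth_cst. Qed.
Lemma smoothN f : smooth f -> smooth (fun x => - f x).
Proof.
by move=> sf k; apply: (@Ck_ext _ (fun x => -1 * f x));
  [move=> x; rewrite mulN1r|exact: smoothZ].
Qed.
Lemma smoothB f g : smooth f -> smooth g -> smooth (fun x => f x - g x).
Proof. by move=> sf sg; apply: smoothD => //; exact: smoothN. Qed.
Lemma smooth_sum (I : Type) (s : seq I) (F : I -> E -> R) :
  (forall i, smooth (F i)) -> smooth (fun x => \sum_(i <- s) F i x).
Proof.
move=> sF; elim: s => [|i s IH].
  by under eq_fun do rewrite big_nil; exact: smooth_cst.
by under eq_fun do rewrite big_cons; exact: smoothD.
Qed.
Lemma smooth_prod (I : Type) (s : seq I) (F : I -> E -> R) :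
  (forall i, smooth (F i)) -> smooth (fun x => \prod_(i <- s) F i x).
Proof.
move=> sF; elim: s => [|i s IH].
  by under eq_fun do rewrite big_nil; exact: smooth_cst.
by under eq_fun do rewrite big_cons; exact: smoothM.
Qed.

Lemma pd_sum (I : Type) (s : seq I) (F : I -> E -> R) i x :
  (forall j, smooth (F j)) ->
  pd i (fun x => \sum_(j <- s) F j x) x = \sum_(j <- s) pd i (F j) x.
Proof.
move=> sF; elim: s => [|j s IH].
  by rewrite big_nil (_ : (fun _ => _) = fun=> 0) ?pd_cst//; apply/funext => y; rewrite big_nil.
rewrite big_cons -IH -pdD.
- by congr (pd i _ x); apply/funext => y; rewrite big_cons.
- exact: smooth_derivable.
- by apply: smooth_derivable; exact: smooth_sum.
Qed.

End Ck_algebra.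

Section lines.
Variables (R : realType) (n : nat).
Local Notation E := 'rV[R]_n.
Local Notation dir i := (delta_mx ord0 i : 'rV[R]_n).
Implicit Types (f g : E -> R).

(** The two difference quotients are the same function of the increment. One-variable results, such
    as the chain rule and the mean value theorem, transfer to directional derivatives in this
    way. *)
Lemma is_derive_line f (x v : E) (t df : R) :
  is_derive t 1 (fun s : R => f (x + s *: v)) df <-> is_derive (x + t *: v) v f df.
Proof.
pose q1 := fun h : R => h^-1 *: (((fun s : R => f (x + s *: v)) \o shift t) (h *: 1) - f (x + t *: v)).
pose q2 := fun h : R => h^-1 *: ((f \o shift (x + t *: v)) (h *: v) - f (x + t *: v)).
have E12 : q1 = q2.
  apply/funext => h; rewrite /q1 /q2 /=; congr (_ *: (f _ - _)).
  by rewrite scaler1 scalerDl addrCA.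
have E3 : 'D_1 (fun s : R => f (x + s *: v)) t = 'D_v f (x + t *: v).
  by rewrite /derive -/q1 -/q2 E12.
split => -[d1 d2]; split.
- by rewrite /derivable -/q2 -E12.
- by rewrite -d2 E3.
- by rewrite /derivable -/q1 E12.
- by rewrite -d2 E3.
Qed.

Lemma is_derive_line0 f (x v : E) (df : R) :
  is_derive (0 : R) 1 (fun s : R => f (x + s *: v)) df <-> is_derive x v f df.
Proof. by rewrite is_derive_line scale0r addr0. Qed.

Lemma is_derive1_cont (h dh : R -> R) : (forall s, is_derive s (1 : R) h (dh s)) ->
  continuous h.
Proof.
move=> hd s; apply: differentiable_continuous; apply/derivable1_diffP.
by have [] := hd s.
Qed.

Lemma MVT0 (h dh : R -> R) (t : R) : (forall s, is_derive s (1 : R) h (dh s)) ->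
  exists2 s, `|s| <= `|t| & h t - h 0 = t * dh s.
Proof.
move=> hd; have ch := is_derive1_cont hd.
have [t0|t0|->] := ltgtP t 0; last by exists 0; rewrite // subrr mul0r.
- have [|c] := @MVT R h dh t 0 t0 (fun x _ => hd x); first exact: continuous_subspaceT.
  rewrite in_itv/= => /andP[c1 c2] e; exists c.
    by rewrite (ltr0_norm c2) (ltr0_norm t0) lerN2 ltW.
  by rewrite -opprB e; ring.
- have [|c] := @MVT R h dh 0 t t0 (fun x _ => hd x); first exact: continuous_subspaceT.
  rewrite in_itv/= => /andP[c1 c2] e; exists c.
    by rewrite !ger0_norm ?ltW.
  by rewrite e; ring.
Qed.

(** By the mean value theorem, the increment from [x + t v] to [x + t (v + c e_i)] is [t c] times a
    value of [pd i f] at a point that tends to [x] with [t]. *)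
Lemma is_derive_dirD f (x v : E) (i : 'I_n) (c d : R) :
  (forall y, derivable f y (dir i)) -> continuous (pd i f) ->
  is_derive x v f d -> is_derive x (v + c *: dir i) f (d + c * pd i f x).
Proof.
move=> df cf /is_derive_line0 dv; apply/is_derive_line0.
have hs t : exists s, `|s| <= `|t * c| /\
   f (x + t *: (v + c *: dir i)) - f (x + t *: v) = t * c * pd i f (x + t *: v + s *: dir i).
  have [|s h1 h2] := @MVT0 (fun s => f (x + t *: v + s *: dir i))
     (fun s => pd i f (x + t *: v + s *: dir i)) (t * c).
    by move=> s; apply/is_derive_line; exact: derivableP.
  exists s; split => //; rewrite -h2 scale0r addr0; congr (f _ - _).
  by rewrite scalerDr scalerA addrA.
have {hs}/choice[s hs] := hs.
have c1 : (fun h : R => h^-1 * (f (x + h *: v) - f x)) @ 0^' --> d.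
  case: dv => dv1 dv2; have := dv1; rewrite /derivable => /cvgP/= .
  move: dv2; rewrite /derive => ->.
  by rewrite /shift/=; under eq_fun do rewrite /= addr0 scale0r addr0 /GRing.scale/= mulr1.
have c2 : (fun h : R => c * pd i f (x + h *: v + s h *: dir i)) @ 0^' --> c * pd i f x.
  apply: cvgMr.
  have lx : (fun h : R => x + h *: v + s h *: dir i) @ 0^' --> x.
    rewrite -[X in _ --> X]addr0; apply: cvgD.
      rewrite -[X in _ --> X]addr0; apply: cvgD; first exact: cvg_cst.
      rewrite -(scale0r v); apply: cvgZl; exact: cvg_within_filter.
    rewrite -[X in _ --> X](scale0r (dir i)); apply: cvgZl.
    apply/cvgr0Pnorm_le => e e0.
    have h0 : (fun t : R => t * c) @ 0^' --> (0 : R).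
      by rewrite -[X in _ --> X](mul0r c); apply: cvgMl; exact: cvg_within_filter.
    move/cvgr0_norm_le : h0 => /(_ _ e0); apply: filterS => t ht.
    by have [h _] := hs t; exact: le_trans h ht.
  exact: continuous_cvg (cf x) lx.
have c12 : (fun h : R => h^-1 * (f (x + h *: v) - f x) +
     c * pd i f (x + h *: v + s h *: dir i)) @ 0^' --> d + c * pd i f x by exact: cvgD.
have E : (fun h : R => h^-1 *: (((fun s0 : R => f (x + s0 *: (v + c *: dir i))) \o shift 0) (h *: 1)
    - f (x + 0 *: (v + c *: dir i)))) @ 0^' --> d + c * pd i f x.
  apply: cvg_trans c12; apply: near_eq_cvg.
  near=> h; have h0 : h != 0 by near: h; exact: nbhs_dnbhs_neq.
  have [_ e] := hs h.
  rewrite /= scaler1 addr0 scale0r addr0.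
  have -> : f (x + h *: (v + c *: dir i)) - f x = (f (x + h *: v) - f x) +
     h * c * pd i f (x + h *: v + s h *: dir i) by rewrite -e; ring.
  have sc (a : R) : h^-1 *: a = h^-1 * a by [].
  by rewrite scalerDr !sc -!mulrA mulKf.
split; first exact: cvgP E.
exact/cvg_lim.
Unshelve. all: by end_near. Qed.

(** [smooth] only speaks of derivatives along the axes; the axes are added to the direction one at a
    time. *)
Lemma smooth_dir f (x v : E) : smooth f ->
  is_derive x v f (\sum_(i < n) v ord0 i * pd i f x).
Proof.
move=> sf; have : is_derive x (\sum_(i < n) v ord0 i *: dir i) f (\sum_(i < n) v ord0 i * pd i f x).
  elim: (index_enum _) => [|i r IH].
    rewrite !big_nil; apply/is_derive_line0.
    by under [X in is_derive _ _ X]eq_fun do rewrite scaler0; exact: is_derive_cst.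
  rewrite !big_cons addrC [X in is_derive _ _ _ X]addrC.
  apply: is_derive_dirD => // [y|]; first exact: smooth_derivable.
  by apply: smooth_cont; exact: smooth_pd.
by rewrite -row_sum_delta.
Qed.

Lemma smooth_line f (x v : E) (t : R) : smooth f ->
  is_derive t 1 (fun s : R => f (x + s *: v)) (\sum_(i < n) v ord0 i * pd i f (x + t *: v)).
Proof. by move=> sf; apply/is_derive_line; exact: smooth_dir. Qed.

End lines.

(** * A smooth step function of one variable *)

Section C1_functions.
Variable R : realType.
Implicit Types (t u : R -> R).

Fixpoint C1 (k : nat) t : Prop :=
  if k is k'.+1 then exists2 t', (forall x, is_derive x (1 : R) t (t' x)) & C1 k' t'
  else continuous t.

Lemma C1_cont k t : C1 k t -> continuous t.
Proof. by case: k => [//|k] [t' /is_derive1_cont]. Qed.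

Lemma C1W k t : C1 k.+1 t -> C1 k t.
Proof.
elim: k t => [|k IH] t; first by move=> [t' /is_derive1_cont].
by move=> [t' h1 h2]; exists t' => //; exact: IH.
Qed.

Lemma C1D k t u : C1 k t -> C1 k u -> C1 k (fun x => t x + u x).
Proof.
elim: k t u => [|k IH] t u; first by move=> ct cu x; exact: (cvgD (ct x) (cu x)).
move=> [t' dt Ct] [u' du Cu]; exists (fun x => t' x + u' x); last exact: IH.
by move=> x; exact: is_deriveD.
Qed.

Lemma C1_cst k (c : R) : C1 k (fun=> c).
Proof.
elim: k c => [|k IH] c; first exact: cst_continuous.
by exists (fun=> 0) => // x; exact: is_derive_cst.
Qed.

Lemma C1M k t u : C1 k t -> C1 k u -> C1 k (fun x => t x * u x).
Proof.
elim: k t u => [|k IH] t u; first by move=> ct cu x; exact: (cvgM (ct x) (cu x)).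
move=> Ct Cu; have Ct1 := C1W Ct; have Cu1 := C1W Cu; case: Ct Cu => t' dt Ct [u' du Cu].
exists (fun x => t x * u' x + u x * t' x); last by apply: C1D; exact: IH.
by move=> x; exact: is_deriveM.
Qed.

Lemma C1V k t : (forall x, t x != 0) -> C1 k t -> C1 k (fun x => (t x)^-1).
Proof.
move=> t0; elim: k => [|k IH] Ct; first by move=> x; exact: (cvgV (t0 x) (Ct x)).
have Ct1 := IH (C1W Ct); case: Ct => t' dt Ct.
exists (fun x => -1 * ((t x)^-1 * (t x)^-1) * t' x); last first.
  by apply: C1M => //; apply: C1M; [exact: C1_cst|exact: C1M].
move=> x; apply: DeriveDef; first by apply: derivableV => //; case: (dt x).
rewrite deriveV//.
by case: (dt x) => _ ->; rewrite expr2 invfM mulN1r.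
Qed.

Lemma is_derive_affine (a b x : R) : is_derive x (1 : R) (fun s : R => a * s + b) a.
Proof.
have h := is_deriveD (is_deriveZ a (is_derive_id x (1 : R))) (is_derive_cst b x (1 : R)).
by rewrite addr0 [a *: 1]mulr1 in h.
Qed.

Lemma C1_affine k t (a b : R) : C1 k t -> C1 k (fun x => t (a * x + b)).
Proof.
elim: k t => [|k IH] t.
  move=> ct x; apply: (@continuous_comp _ _ _ (fun x => a * x + b) t); last exact: ct.
  apply: cvgD; last exact: cvg_cst.
  by apply: cvgMr; exact: cvg_id.
move=> [t' dt Ct]; exists (fun x => t' (a * x + b) * a); last first.
  by apply: C1M; [exact: IH|exact: C1_cst].
move=> x; apply: (@is_derive1_comp R t (fun x => a * x + b) x _ a (dt _)).
exact: is_derive_affine.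
Qed.

(** The derivative of [expf j] is [expf j.+2 - j expf j.+1], so the family is closed under
    differentiation and all orders of smoothness follow by one induction over every [j]. *)
Definition expf (j : nat) (x : R) : R := if 0 < x then x ^- j * expR (- x^-1) else 0.

Lemma expf_ge0 j x : 0 <= expf j x.
Proof. by rewrite /expf; case: ifP => // x0; rewrite mulr_ge0 ?expR_ge0// invr_ge0 exprn_ge0// ltW. Qed.

(** From [expR y >= (y / m)^m] at [y = 1 / x] and [m = j + 2]. The quadratic bound gives the zero
    derivative at the origin. *)
Lemma expf_le j (x : R) : expf j x <= (j.+2%:R) ^+ j.+2 * x ^+ 2.
Proof.
rewrite /expf; case: ifPn => x0; last by rewrite mulr_ge0 ?sqr_ge0// exprn_ge0.
rewrite expRN ler_pdivrMr ?expR_gt0//.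
have m0 : 0 < j.+2%:R :> R by rewrite ltr0n.
have h : (x^-1 / j.+2%:R) ^+ j.+2 <= expR x^-1.
  have -> : expR x^-1 = expR (x^-1 / j.+2%:R) ^+ j.+2.
    by rewrite -expRM_natl -mulr_natl mulrC divfK// gt_eqF.
  have y0 : 0 <= x^-1 / j.+2%:R by rewrite divr_ge0// invr_ge0 ltW.
  rewrite ler_pXn2r ?nnegrE ?expR_ge0//.
  by apply: le_trans (expR_ge1Dx _); rewrite lerDr.
rewrite -mulrA; apply: le_trans (ler_wpM2l _ (ler_wpM2l (sqr_ge0 x) h)); last by rewrite exprn_ge0// ltW.
rewrite -(addn2 j); set M := (j + 2)%:R; have M0 : M ^+ (j + 2) != 0.
  by rewrite expf_neq0// gt_eqF// /M addn2.
have x2 : x ^+ 2 != 0 by rewrite expf_neq0// gt_eqF.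
have xj : x ^+ j != 0 by rewrite expf_neq0// gt_eqF.
rewrite exprMn !exprVn (exprD x); set A := M ^+ _; set B := x ^+ j.
rewrite le_eqVlt; apply/orP; left; apply/eqP; field.
by rewrite M0 gt_eqF//= xj.
Qed.

Lemma is_derive_expf j x : is_derive x (1 : R) (expf j)
   (expf j.+2 x - j%:R * expf j.+1 x).
Proof.
have pw k : (fun y : R => y^-1) ^+ k = (fun y : R => y^-1 ^+ k).
  by elim: k => [//|k IH]; rewrite exprS IH; apply/funext => y; rewrite exprS.
have [x0|x0|->] := ltgtP x 0.
- have -> : expf j.+2 x - j%:R * expf j.+1 x = 0.
    by rewrite /expf !ltNge (ltW x0)/= mulr0 subr0.
  have nE : \near x, cst 0 x = expf j x.
    near=> y; rewrite /expf ltNge ltW//=; near: y; exact: lt_nbhsl.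
  by apply: (near_eq_is_derive nE); exact: is_derive_cst.
- pose g := fun y : R => y ^- j * expR (- y^-1).
  have nE : \near x, g x = expf j x.
    near=> y; rewrite /expf /g ifT//; near: y; exact: lt_nbhsr.
  apply: (near_eq_is_derive nE).
  have xn0 : x != 0 by rewrite gt_eqF.
  have d1 : is_derive x (1 : R) (fun y : R => y^-1) (- x ^- 2).
    apply: DeriveDef; first by apply: (@derivableV _ _ id) => //; exact: derivable_id.
    by rewrite (@deriveV _ _ id)// derive_id [_ *: _]mulr1.
  have d2 : is_derive x (1 : R) (fun y : R => expR (- y^-1)) (expR (- x^-1) * - (- x ^- 2)).
    by apply: (@is_derive1_comp R expR (fun y => - y^-1)).
  have d3 := @is_deriveX _ _ (fun y : R => y^-1) j x (1 : R) _ d1.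
  have d4 := @is_deriveM _ _ _ _ _ _ _ _ d3 d2.
  have -> : g = ((fun y : R => y^-1) ^+ j) * (fun y : R => expR (- y^-1)).
    by rewrite pw; apply/funext => y; rewrite /g -exprVn.
  apply: (@is_derive_eq _ _ _ _ _ _ _ _ d4).
  rewrite /expf x0 -!exprVn; set y := x^-1; set e := expR _.
  have sc (a c : R) : a *: c = a * c by [].
  rewrite !sc pw -/y -/e; clear.
  by case: j => [|j] /=; rewrite ?exprS ?expr0; ring.
- rewrite {2 3}/expf ltxx mulr0 subr0.
  have e0 : expf j 0 = 0 by rewrite /expf ltxx.
  have L : (fun h : R => h^-1 *: ((expf j \o shift 0) (h *: 1) - expf j 0)) @ 0^' --> (0 : R).
    apply/cvgr0Pnorm_le => e epos.
    near=> h; have h0 : h != 0 by near: h; exact: nbhs_dnbhs_neq.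
    rewrite /= scaler1 addr0 e0 subr0 normrM normfV ler_pdivrMl ?normr_gt0//.
    rewrite ger0_norm ?expf_ge0//; apply: (le_trans (expf_le j h)).
    rewrite -real_normK ?num_real// expr2 mulrCA ler_wpM2l//.
    rewrite -ler_pdivlMl ?exprn_gt0 ?ltr0n//.
    near: h; apply: cvg_within; apply: (@nbhs0_le _ R).
    by rewrite mulr_gt0// invr_gt0 exprn_gt0// ltr0n.
  by split; [exact: cvgP L|exact/cvg_lim].
Unshelve. all: by end_near. Qed.

Lemma C1_expf k j : C1 k (expf j).
Proof.
elim: k j => [|k IH] j.
  exact: (is_derive1_cont (is_derive_expf j)).
exists (fun x => expf j.+2 x + (- j%:R) * expf j.+1 x).
  by move=> x; rewrite mulNr; exact: is_derive_expf.
by apply: C1D => //; apply: C1M => //; exact: C1_cst.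
Qed.

Definition step01 (x : R) : R := expf 0 x / (expf 0 x + expf 0 (1 - x)).

Lemma expf0_gt0 x : 0 < x -> 0 < expf 0 x.
Proof. by move=> x0; rewrite /expf x0 expr0 invr1 mul1r expR_gt0. Qed.

Lemma step01_den x : 0 < expf 0 x + expf 0 (1 - x).
Proof.
have [x0|x0] := ltP 0 x; first by rewrite ltr_pwDl ?expf0_gt0 ?expf_ge0.
by rewrite ltr_wpDl ?expf_ge0// expf0_gt0// subr_gt0 (le_lt_trans x0).
Qed.

Lemma step01_C1 k : C1 k step01.
Proof.
apply: C1M; first exact: C1_expf.
apply: C1V; first by move=> x; rewrite gt_eqF// step01_den.
apply: C1D; first exact: C1_expf.
rewrite (_ : (fun x => _) = fun x => expf 0 (-1 * x + 1)).
  by apply: C1_affine; exact: C1_expf.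
by apply/funext => x; rewrite mulN1r addrC.
Qed.

Lemma step01_ge0 x : 0 <= step01 x.
Proof. by rewrite divr_ge0 ?expf_ge0// ltW// step01_den. Qed.

Lemma step01_le1 x : step01 x <= 1.
Proof. by rewrite ler_pdivrMr ?step01_den// mul1r lerDl expf_ge0. Qed.

Lemma step01_eq0 x : x <= 0 -> step01 x = 0.
Proof. by move=> x0; rewrite /step01 {1}/expf ltNge x0 mul0r. Qed.

Lemma step01_eq1 x : 1 <= x -> step01 x = 1.
Proof.
move=> x1; rewrite /step01 [X in _ + X]/expf subr_gt0 ltNge x1/= addr0 divff//.
by rewrite gt_eqF// expf0_gt0// (lt_le_trans _ x1).
Qed.

Lemma step01_gt0 x : 0 < x -> 0 < step01 x.
Proof. by move=> x0; rewrite divr_gt0 ?step01_den ?expf0_gt0. Qed.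

End C1_functions.

Lemma Ck_ridge (R : realType) n k (t : R -> R) (a : 'rV[R]_n) (b : R) :
  C1 k t -> Ck k (fun x => t (dot a x + b)).
Proof.
have ct (u : R -> R) : continuous u -> continuous (fun x => u (dot a x + b)).
  move=> cu x; apply: (@continuous_comp _ _ _ (fun x => dot a x + b) u); last exact: cu.
  exact: (cvgD (@dot_continuous _ _ a x) (cvg_cst b)).
elim: k t => [|k IH] t; first by move=> h; split => //; exact: ct.
move=> Ct; split; first by apply: ct; exact: C1_cont Ct.
case: Ct => t' dt Ct i.
have dotl x (s : R) : dot a (x + s *: delta_mx ord0 i) = a ord0 i * s + dot a x.
  rewrite /dot (bigD1 i)//= [in RHS](bigD1 i)//= !mxE !eqxx mulr1 mulrDr addrA.
  rewrite [a ord0 i * s + _]addrC; congr (_ + _); apply: eq_bigr => j ji.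
  by rewrite !mxE (negbTE ji) mulr0 addr0.
have d x : is_derive x (delta_mx ord0 i) (fun x => t (dot a x + b)) (t' (dot a x + b) * a ord0 i).
  apply/is_derive_line0; under [X in is_derive _ _ X]eq_fun do rewrite dotl -addrA.
  apply: (@is_derive1_comp R t (fun s => a ord0 i * s + (dot a x + b))).
    by rewrite mulr0 add0r.
  exact: is_derive_affine.
split; first by move=> x; case: (d x).
apply: (@Ck_ext _ _ _ (fun x => t' (dot a x + b) * a ord0 i)).
  by move=> x; case: (d x).
by apply: CkM; [exact: IH|exact: Ck_cst].
Qed.

Section test_functions.
Variables (R : realType) (n : nat).
Local Notation E := 'rV[R]_n.
Local Notation mu := (leb R n).
Local Notation dir i := (delta_mx ord0 i : 'rV[R]_n).
Implicit Types (f g phi psi : E -> R) (U V : set E).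

(** Equivalent to [test_fun] by [tf_test_fun]. Any compact set outside which [phi] vanishes is
    accepted, which makes the algebra of test functions easier than with the closed support. *)
Definition tf U phi := smooth phi /\
  exists A, [/\ compact A, A `<=` U & forall x, ~ A x -> phi x = 0].

Lemma compact_closed_rV (A : set E) : compact A -> closed A.
Proof. by apply: compact_closed; exact: norm_hausdorff. Qed.

Lemma pd_off (A : set E) f i : closed A -> (forall x, ~ A x -> f x = 0) ->
  forall x, ~ A x -> pd i f x = 0.
Proof.
move=> cA fA x nAx; have oA : nbhs x (~` A) by apply: open_nbhs_nbhs; split => //; exact: closed_openC.
have -> : pd i f x = 'D_(dir i) (cst 0) x.
  by apply: near_eq_derive; near=> y; apply: fA; near: y.
by rewrite derive_cst.
Unshelve. all: by end_near. Qed.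

Lemma tf_test_fun U phi : tf U phi <-> test_fun U phi.
Proof.
split.
  move=> [sp [A [cA AU pA]]].
  have h : closure [set x | phi x != 0] `<=` A.
    have /closure_id -> := compact_closed_rV cA.
    by apply: closure_subset => x /= /eqP px; apply: contrapT => /pA.
  split => //; last by move=> x /h/AU.
  by apply: subclosed_compact cA h; exact: closed_closure.
move=> [sp cp pU]; split => //; exists (closure [set x | phi x != 0]); split => //.
move=> x nx; apply/eqP; apply: contrapT => /negP px; apply: nx.
exact: subset_closure.
Qed.

Lemma tf_smooth U phi : tf U phi -> smooth phi. Proof. by case. Qed.

Lemma tf_cont U phi : tf U phi -> continuous phi.
Proof. by move=> /tf_smooth/smooth_cont. Qed.

Lemma tf_sub U V phi : U `<=` V -> tf U phi -> tf V phi.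
Proof. by move=> UV [sp [A [cA AU pA]]]; split => //; exists A; split => // x /AU/UV. Qed.

Lemma tf_off U phi x : tf U phi -> ~ U x -> phi x = 0.
Proof. by move=> [_ [A [_ AU pA]]] nU; apply: pA => /AU. Qed.

Lemma tf0 U : tf U (fun=> 0).
Proof.
split; first exact: smooth_cst.
by exists set0; split => //; exact: compact0.
Qed.

Lemma tfMl U f phi : smooth f -> tf U phi -> tf U (fun x => f x * phi x).
Proof.
move=> sf [sp [A [cA AU pA]]]; split; first exact: smoothM.
by exists A; split => // x /pA ->; rewrite mulr0.
Qed.

Lemma tfMr U f phi : smooth f -> tf U phi -> tf U (fun x => phi x * f x).
Proof.
by move=> sf tp; rewrite (_ : (fun x => _) = fun x => f x * phi x);
  [exact: tfMl|apply/funext => x; rewrite mulrC].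
Qed.

Lemma tfZ U (c : R) phi : tf U phi -> tf U (fun x => c * phi x).
Proof. by apply: tfMl; exact: smooth_cst. Qed.

Lemma tfD U phi psi : tf U phi -> tf U psi -> tf U (fun x => phi x + psi x).
Proof.
move=> [sp [A [cA AU pA]]] [sq [B [cB BU pB]]]; split; first exact: smoothD.
exists (A `|` B); split; first exact: compactU.
  by rewrite subUset.
by move=> x /not_orP[/pA -> /pB ->]; rewrite addr0.
Qed.

Lemma tfN U phi : tf U phi -> tf U (fun x => - phi x).
Proof.
by move=> tp; rewrite (_ : (fun x => _) = fun x => -1 * phi x);
  [exact: tfZ|apply/funext => x; rewrite mulN1r].
Qed.

Lemma tfB U phi psi : tf U phi -> tf U psi -> tf U (fun x => phi x - psi x).
Proof. by move=> tp tq; apply: tfD => //; exact: tfN. Qed.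

Lemma tf_pd U phi i : tf U phi -> tf U (pd i phi).
Proof.
move=> [sp [A [cA AU pA]]]; split; first exact: smooth_pd.
by exists A; split => //; apply: pd_off => //; exact: compact_closed_rV.
Qed.

Lemma tf_sum U (I : Type) (s : seq I) (F : I -> E -> R) :
  (forall i, tf U (F i)) -> tf U (fun x => \sum_(i <- s) F i x).
Proof.
move=> tF; elim: s => [|i s IH].
  by under eq_fun do rewrite big_nil; exact: tf0.
by under eq_fun do rewrite big_cons; exact: tfD.
Qed.

Lemma continuous_affine (s : R) (a : E) : continuous (fun x : E => s *: x + a).
Proof.
move=> x; have h := @scaler_continuous R E s x.
exact: (cvgD h (cvg_cst a)).
Qed.

Lemma continuous_shift (a : E) : continuous (fun x : E => x + a).
Proof.
rewrite (_ : (fun x : E => x + a) = (fun x => 1 *: x + a)); first exact: continuous_affine.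
by apply/funext => x; rewrite scale1r.
Qed.

Lemma pd_affine f (s : R) (a : E) i x : smooth f ->
  is_derive x (dir i) (fun y => f (s *: y + a)) (s * pd i f (s *: x + a)).
Proof.
move=> sf; apply/is_derive_line0.
have -> : (fun t : R => f (s *: (x + t *: dir i) + a)) =
    (fun t => f ((s *: x + a) + t *: dir i)) \o (fun t => s * t + 0).
  apply/funext => t /=; rewrite addr0; congr f.
  by rewrite scalerDr scalerA addrAC.
rewrite mulrC; apply: is_derive1_comp; last exact: is_derive_affine.
by apply/is_derive_line; rewrite mulr0 addr0 scale0r addr0; exact: smooth_is_derive.
Qed.

Lemma smooth_affine f (s : R) (a : E) : smooth f -> smooth (fun x => f (s *: x + a)).
Proof.
have ca (g : E -> R) : continuous g -> continuous (fun x : E => g (s *: x + a)).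
  move=> cg x; apply: (@continuous_comp _ _ _ (fun x : E => s *: x + a) g).
    exact: continuous_affine.
  exact: cg.
move=> sf k; elim: k f sf => [|k IH] f sf.
  by split => //; apply: ca; exact: smooth_cont.
split; first by apply: ca; exact: smooth_cont.
move=> i; split; first by move=> x; case: (pd_affine s a i x sf).
apply: (@Ck_ext _ _ _ (fun x => s * pd i f (s *: x + a))).
  by move=> x; case: (pd_affine s a i x sf) => _ ->.
by apply: CkM; [exact: Ck_cst|apply: IH; exact: smooth_pd].
Qed.

Lemma pdE_affine f (s : R) (a : E) i x : smooth f ->
  pd i (fun y => f (s *: y + a)) x = s * pd i f (s *: x + a).
Proof. by move=> sf; case: (pd_affine s a i x sf). Qed.

Lemma tf_affine U f (s : R) (a : E) : s != 0 -> tf U f ->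
  tf [set x | U (s *: x + a)] (fun x => f (s *: x + a)).
Proof.
move=> s0 [sf [A [cA AU pA]]]; split; first exact: smooth_affine.
exists ((fun y : E => s^-1 *: y + (- (s^-1 *: a))) @` A); split.
- by apply: continuous_compact => //; apply: continuous_subspaceT; exact: continuous_affine.
- move=> _ [y Ay <-] /=; rewrite scalerDr scalerN !scalerA mulfV// !scale1r subrK.
  exact: AU.
- move=> x nx; apply: pA => Ax; apply: nx; exists (s *: x + a) => //.
  by rewrite scalerDr scalerA mulVf// scale1r addrK.
Qed.

Lemma tf_bounded U phi : tf U phi -> exists2 M : R, 0 <= M & forall x, `|phi x| <= M.
Proof.
move=> [sp [A [cA AU pA]]].
have [A0|/set0P A0] := eqVneq A set0.
  by exists 0 => // x; rewrite pA ?normr0// A0.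
have cn : {within A, continuous (fun x => `|phi x|)}.
  apply: continuous_subspaceT => x.
  by apply: (@continuous_comp _ _ _ phi Num.norm); [exact: smooth_cont|exact: norm_continuous].
have [c _ hc] := EVT_max_rV A0 cA cn; exists `|phi c| => // x.
have [Ax|nAx] := pselect (A x); first by apply: hc; rewrite inE.
by rewrite pA// normr0.
Qed.

Lemma compact_mu_lty (A : set E) : compact A -> (mu A < +oo)%E.
Proof.
move=> cA; apply: leb_bounded_lty; last exact: compact_bounded.
by apply: closed_measurable_rV; exact: compact_closed_rV.
Qed.

Lemma compact_measurable_rV (A : set E) : compact A -> measurable A.
Proof. by move=> cA; apply: closed_measurable_rV; exact: compact_closed_rV. Qed.

Lemma cont_measurable f (D : set E) : continuous f -> measurable_fun D f.
Proof. by move=> cf; apply: measurable_funTS; exact: continuous_measurable_rV. Qed.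

Lemma integrable_indicR (A : set E) (c : R) : measurable A -> (mu A < +oo)%E ->
  mu.-integrable setT (EFin \o (fun x => c * \1_A x)).
Proof.
move=> mA lA; apply: integrableRZ => //.
apply/integrableP; split; first by apply/measurable_EFinP; exact: measurable_indic.
by under eq_integral do rewrite /= ger0_norm//; rewrite integral_indic// setIT.
Qed.

Lemma integrable_cstR (A : set E) (c : R) : measurable A -> (mu A < +oo)%E ->
  mu.-integrable A (EFin \o (fun=> c)).
Proof.
move=> mA lA; apply/integrableP; split; first exact: measurable_cst.
by rewrite /= integral_cst//; apply: lte_mul_pinfty.
Qed.

Lemma integrable_cpt f (A : set E) (M : R) : measurable_fun setT f -> measurable A ->
  (mu A < +oo)%E ->
  (forall x, `|f x| <= M) -> (forall x, ~ A x -> f x = 0) ->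
  mu.-integrable setT (EFin \o f).
Proof.
move=> mf mA lA fM fA; apply: (integrable_le (g := fun x => M * \1_A x)) => //.
  exact: integrable_indicR.
move=> x _; have [Ax|nAx] := pselect (A x).
  by rewrite indicE mem_set// mulr1.
by rewrite fA// normr0 indicE memNset// mulr0.
Qed.

Lemma tf_integrable U phi : tf U phi -> mu.-integrable setT (EFin \o phi).
Proof.
move=> tp; have [M _ hM] := tf_bounded tp; have cp := tf_cont tp.
case: tp => sp [A [cA AU pA]].
apply: (integrable_cpt (A := A) (M := M)) => //.
- exact: cont_measurable.
- exact: compact_measurable_rV.
- exact: compact_mu_lty.
Qed.

Lemma tf_sqint U phi (D : set E) : measurable D -> tf U phi -> sqint mu D phi.
Proof.
move=> mD tp; split; first by apply: cont_measurable; exact: tf_cont tp.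
apply: (integrableS measurableT mD) => //.
have -> : EFin \o (fun x => phi x ^+ 2) = EFin \o (fun x => phi x * phi x).
  by apply/funext => x; rewrite /= expr2.
by apply: (tf_integrable (U := U)); apply: tfMl => //; exact: tf_smooth tp.
Qed.

End test_functions.

(** * Integration by parts for test functions *)

Section integral_calculus.
Variables (R : realType) (n : nat).
Local Notation E := 'rV[R]_n.
Local Notation mu := (leb R n).
Local Notation dir i := (delta_mx ord0 i : 'rV[R]_n).
Implicit Types (f g phi psi : E -> R) (U V : set E).

(** The change of variables is an integral against a pushforward for nonnegative functions ([key]);
    the general case splits [f] into its positive and negative parts. *)
Lemma integrable_affine f (s : R) (a : E) : 0 < s -> mu.-integrable setT (EFin \o f) ->
  mu.-integrable setT (EFin \o (fun x => f (s *: x + a))) /\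
  \int[mu]_x f (s *: x + a) = (s ^+ n)^-1 * \int[mu]_x f x.
Proof.
move=> s0 /integrableP[mf lf].
have sn0 : 0 < s ^+ n by rewrite exprn_gt0.
have maf := @measurable_affine R n s a.
have key (g : E -> \bar R) : measurable_fun setT g -> (forall x, (0 <= g x)%E) ->
   (\int[mu]_x g x = (s ^+ n)%:E * \int[mu]_x g (s *: x + a)%R)%E.
  move=> mg g0.
  pose m' := mscale (NngNum (ltW sn0)) (pushforward_measure mu maf).
  have mm' A : measurable A -> A `<=` setT -> m' A = mu A.
    by move=> mA _; rewrite [RHS](leb_affine a s0 mA).
  rewrite -(@eq_measure_integral _ _ _ setT mu m')//.
  rewrite ge0_integral_mscale//=.
  by rewrite ge0_integral_pushforward.
have iaf : (\int[mu]_x `|(f (s *: x + a)%R)%:E| < +oo)%E.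
  have := key (fun x => `|(f x)%:E|)%E; rewrite /= => k1.
  move: lf; rewrite k1//.
  set X := (\int[mu]_x _)%E.
  have : (0 <= X)%E by apply: integral_ge0.
  case: X => [r _ _| |]; rewrite ?ltry//.
    by move=> _; rewrite gt0_muley ?lte_fin.
  by apply/measurable_EFinP; apply: measurableT_comp => //; exact/measurable_EFinP.
have if' : mu.-integrable setT (EFin \o (fun x => f (s *: x + a))).
  by apply/integrableP; split => //; exact: (measurableT_comp mf maf).
split => //.
pose h (x : E) := f (s *: x + a).
pose P := (\int[mu]_x (EFin \o h)^\+ x)%E; pose N := (\int[mu]_x (EFin \o h)^\- x)%E.
have kp : (\int[mu]_x (EFin \o f)^\+ x = (s ^+ n)%:E * P)%E.
  rewrite (key _ (measurable_funepos mf)); last by move=> x; exact: funepos_ge0.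
  by congr (_ * _)%E; apply: eq_integral => x _; rewrite !funeposE.
have kn : (\int[mu]_x (EFin \o f)^\- x = (s ^+ n)%:E * N)%E.
  rewrite (key _ (measurable_funeneg mf)); last by move=> x; exact: funeneg_ge0.
  by congr (_ * _)%E; apply: eq_integral => x _; rewrite !funenegE.
have p1 : P \is a fin_num := integrable_fin_num measurableT (integrable_funepos measurableT if').
have p2 : N \is a fin_num := integrable_fin_num measurableT (integrable_funeneg measurableT if').
have -> : \int[mu]_x f x = fine (\int[mu]_x (EFin \o f)^\+ x - \int[mu]_x (EFin \o f)^\- x)%E.
  by rewrite /Rintegral integralE.
have -> : \int[mu]_x f (s *: x + a) = fine (P - N)%E by rewrite /Rintegral integralE.
rewrite kp kn -muleBr//; last by rewrite fin_num_adde_defl// fin_numN.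
rewrite fineM//; last by rewrite fin_numB p1 p2.
by rewrite mulKf// gt_eqF.
Qed.

Lemma Rintegral_shift f (a : E) : mu.-integrable setT (EFin \o f) ->
  \int[mu]_x f (x + a) = \int[mu]_x f x.
Proof.
move=> fi; have [_] := integrable_affine a ltr01 fi.
by rewrite expr1n invr1 mul1r => <-; under [RHS]eq_Rintegral do rewrite scale1r.
Qed.

Lemma integrable_shift f (a : E) : mu.-integrable setT (EFin \o f) ->
  mu.-integrable setT (EFin \o (fun x => f (x + a))).
Proof.
move=> fi; have [h _] := integrable_affine a ltr01 fi.
by move: h; under [X in _ -> integrable _ _ X]eq_fun do rewrite /= -[x in f (x + _)]scale1r.
Qed.

Lemma is_derive_int (f f' : R -> E -> R) (G : E -> R) (u v a : R) :
  a \in `]u, v[ ->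
  (forall t, t \in `]u, v[ -> mu.-integrable setT (EFin \o f t)) ->
  (forall t y, t \in `]u, v[ -> is_derive t (1 : R) (f ^~ y) (f' t y)) ->
  mu.-integrable setT (EFin \o G) ->
  (forall t y, t \in `]u, v[ -> `|f' t y| <= G y) ->
  is_derive a (1 : R) (fun t => \int[mu]_y f t y) (\int[mu]_y f' a y).
Proof.
move=> auv fi fd Gi fG.
have d1E t y : t \in `]u, v[ -> partial1of2 f t y = f' t y.
  by move=> tuv; rewrite partial1of2E; case: (fd t y tuv).
have a1 : `]u, v[%classic a by rewrite /= in auv *.
have a2 x : `]u, v[%classic x -> mu.-integrable setT (EFin \o f x) by move=> h; apply: fi.
have a3 x y : `]u, v[%classic x -> setT y -> derivable (f ^~ y) x 1.
  by move=> h _; case: (fd x y h).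
have G0 y : 0 <= G y by exact: le_trans (fG a y auv).
have a4 x y : `]u, v[%classic x -> setT y -> `|partial1of2 f x y| <= G y.
  by move=> h _; rewrite d1E//; exact: fG.
have := derivable_under_integral measurableT a1 a2 a3 G0 Gi a4.
have := differentiation_under_integral measurableT a1 a2 a3 G0 Gi a4.
rewrite derive1E => h1 h2; apply: DeriveDef => //; rewrite h1.
by apply: eq_Rintegral => y _; rewrite d1E.
Qed.

(* The weight [q] and the moving test function share a compact [A] that
   contains the supports for all times. *)
Lemma is_derive_int_weight (q : E -> R) (f f' : R -> E -> R) (A : set E) (M u v a : R) :
  a \in `]u, v[ -> measurable A ->
  mu.-integrable A (EFin \o q) ->
  (forall t, t \in `]u, v[ -> continuous (f t)) ->
  (forall t y, t \in `]u, v[ -> is_derive t (1 : R) (f ^~ y) (f' t y)) ->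
  (forall t y, t \in `]u, v[ -> ~ A y -> f t y = 0 /\ f' t y = 0) ->
  (forall t y, t \in `]u, v[ -> `|f t y| <= M /\ `|f' t y| <= M) ->
  is_derive a (1 : R) (fun t => \int[mu]_y (q y * f t y)) (\int[mu]_y (q y * f' a y)).
Proof.
move=> auv mA qi fc fd fA fM.
have qAi : mu.-integrable setT (EFin \o (q \_ A)).
  by move: qi; rewrite (integrable_mkcond _ mA) restrict_EFin.
have Gi : mu.-integrable setT (EFin \o (fun y => M * `|(q \_ A) y|)).
  by apply: integrableRZ => //; exact: integrable_norm.
have E1 t y : t \in `]u, v[ -> q y * f t y = (q \_ A) y * f t y.
  move=> tuv; rewrite /patch; case: ifPn => // /negP nA.
  by have [->] := fA _ y tuv (fun h => nA (mem_set h)); rewrite !mulr0.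
apply: (@is_derive_int (fun t y => q y * f t y) (fun t y => q y * f' t y) _ u v a auv _ _ Gi).
- move=> t tuv; have -> : EFin \o (fun y => q y * f t y) = EFin \o (fun y => (q \_ A) y * f t y).
    by apply/funext => y /=; rewrite E1.
  apply: (integrable_le _ _ Gi) => //.
    apply: measurable_funM; first exact: integrable_mfun qAi.
    by apply: cont_measurable; exact: fc.
  by move=> y _; rewrite normrM mulrC ler_wpM2r//; have [] := fM t y tuv.
- by move=> t y tuv; have := is_deriveZ (q y) (fd t y tuv).
- move=> t y tuv; rewrite normrM /patch; case: ifPn => [_|/negP nA].
    by rewrite mulrC ler_wpM2r//; have [] := fM t y tuv.
  have [_ ->] := fA _ y tuv (fun h => nA (mem_set h)).
  by rewrite !normr0 !mulr0.
Qed.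

Lemma compact_bound_rV (A : set E) : compact A -> exists2 k : R, 0 < k & forall x, A x -> `|x| <= k.
Proof.
move=> /compact_bounded[M [_ h]]; exists (`|M| + 1); first by rewrite ltr_wpDl.
by apply: h; rewrite (le_lt_trans (ler_norm _))// ltrDl.
Qed.

(** The integral of [phi (x + t e_i)] does not depend on [t], and its derivative at 0 is the
    left-hand side. *)
Lemma int_pd U phi i : tf U phi -> \int[mu]_x pd i phi x = 0.
Proof.
move=> tp; have sp := tf_smooth tp; have [M M0 hM] := tf_bounded tp.
have [M' _ hM'] := tf_bounded (tf_pd i tp).
have [A [cA AU pA]] := tp.2; have [k k0 hk] := compact_bound_rV cA.
(* The extra 1 makes room for the translates by [|t| < 1], so that one set carries all supports. *)
pose B : set E := [set x | forall j, `|x ord0 j| <= k + 1].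
have mB : measurable B.
  apply: (@measurable_box R n (fun _ => [set z : R | `|z| <= k + 1])) => j.
  rewrite (_ : mkset _ = [set` `[(- (k + 1)), (k + 1)]]); first exact: measurable_itv.
  by apply/seteqP; split => z /=; rewrite in_itv/= ler_norml.
have lB : (mu B < +oo)%E by exact: leb_box_lty.
have nB x t : t \in `](-1), 1[ -> ~ B x -> ~ A (x + t *: dir i).
  rewrite in_itv/= => /andP[t1 t2] nB /hk hx; apply: nB => j.
  have h1 : `|(x + t *: dir i) ord0 j| <= k.
    by apply: le_trans hx; rewrite /Num.norm/= mx_normrE; apply: (le_bigmax _ _ (ord0, j)).
  have h2 : `|(t *: dir i) ord0 j| <= 1.
    rewrite !mxE/= normrM; apply: (@le_trans _ _ (1 * 1)); last by rewrite mulr1.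
    apply: ler_pM => //; first by rewrite ler_norml !ltW.
    by case: (j == i); rewrite ?normr1 ?normr0.
  have -> : x ord0 j = (x + t *: dir i) ord0 j - (t *: dir i) ord0 j by rewrite mxE addrK.
  by apply: (le_trans (ler_normB _ _)); exact: lerD.
have h := @is_derive_int_weight (fun=> 1) (fun t x => phi (x + t *: dir i))
  (fun t x => pd i phi (x + t *: dir i)) B (Num.max M M') (-1) 1 0.
have {}h : is_derive (0 : R) (1 : R) (fun t => \int[mu]_y (1 * phi (y + t *: dir i)))
    (\int[mu]_y (1 * pd i phi (y + 0 *: dir i))).
  apply: h => //.
  - by rewrite in_itv/= ltrN10 ltr01.
  - exact: integrable_cstR.
  - move=> t _ x; apply: (@continuous_comp _ _ _ (fun x : E => x + t *: dir i) phi).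
      exact: continuous_shift.
    exact: smooth_cont.
  - by move=> t y _; apply/is_derive_line; exact: smooth_is_derive.
  - move=> t y ht nBy; split; first by apply: pA; exact: nB.
    exact: (@pd_off R n A phi i (compact_closed_rV cA) pA _ (nB _ _ ht nBy)).
  - by move=> t y _; rewrite !le_max hM hM' orbT.
have c : (fun t => \int[mu]_y (1 * phi (y + t *: dir i))) = cst (\int[mu]_y phi y).
  apply/funext => t /=; rewrite -(Rintegral_shift (t *: dir i) (tf_integrable tp)).
  by apply: eq_Rintegral => y _; rewrite mul1r.
have := derive_val (is_derive := h); rewrite c derive_cst => ->.
by apply: eq_Rintegral => y _; rewrite scale0r addr0 mul1r.
Qed.

Lemma int_parts U phi psi i : tf U phi -> smooth psi ->
  \int[mu]_x (phi x * pd i psi x) = - \int[mu]_x (pd i phi x * psi x).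
Proof.
move=> tp sp; have h := int_pd i (tfMr sp tp).
have t1 := tf_integrable (tfMr (smooth_pd i sp) tp).
have t2 := tf_integrable (tfMr sp (tf_pd i tp)).
apply/eqP; rewrite -subr_eq0 opprK addrC -RintegralD// -h; apply/eqP.
by apply: eq_Rintegral => x _; rewrite pdM//; apply: smooth_derivable => //; exact: tf_smooth tp.
Qed.

End integral_calculus.

(** * The space L^2 and its norm *)

Section l2_hilbert.
Context d (T : measurableType d) (R : realType) (mu : {measure set T -> \bar R}).
Variable (D : set T).
Hypothesis mD : measurable D.
Implicit Types f g h : T -> R.

Definition l2_hilb : shilb (T -> R).
Proof.
refine (@Shilb R (T -> R) (sqint mu D) (l2ip mu D) _ _ _ _ _ _).
- exact: sqint0.
- by move=> a u v su sv; apply: sqintD => //; exact: sqintZ.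
- by move=> u v _ _; exact: l2ipC.
- move=> a u v w su sv sw; rewrite -l2ipZl// -l2ipDl//; exact: sqintZ.
- by move=> u _; exact: l2ip_ge0.
- move=> u c su hu; have [l sl hl] := l2_complete mD su hu.
  by exists l => //; exists (4 * c).
Defined.

Lemma l2n_ge0 f : 0 <= l2n mu D f. Proof. exact: sqrtr_ge0. Qed.

Lemma l2n_sqr f : l2n mu D f ^+ 2 = l2ip mu D f f.
Proof. by rewrite sqr_sqrtr// l2ip_ge0. Qed.

Lemma l2_CS f g : sqint mu D f -> sqint mu D g ->
  `|l2ip mu D f g| <= l2n mu D f * l2n mu D g.
Proof. by move=> sf sg; exact: (@hip_CS _ _ l2_hilb f g sf sg). Qed.

Lemma l2nD f g : sqint mu D f -> sqint mu D g ->
  l2n mu D (fun x => f x + g x) <= l2n mu D f + l2n mu D g.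
Proof. by move=> sf sg; exact: (@hnormD _ _ l2_hilb f g sf sg). Qed.

Lemma l2nZ (c : R) f : sqint mu D f -> l2n mu D (fun x => c * f x) = `|c| * l2n mu D f.
Proof. by move=> sf; exact: (@hnormZ _ _ l2_hilb c f sf). Qed.

Lemma l2nN f : l2n mu D (fun x => - f x) = l2n mu D f.
Proof. by congr Num.sqrt; apply: eq_Rintegral => x _; rewrite mulrNN. Qed.

Lemma l2nB f g : sqint mu D f -> sqint mu D g ->
  l2n mu D (fun x => f x - g x) <= l2n mu D f + l2n mu D g.
Proof.
move=> sf sg; rewrite -(l2nN g); apply: l2nD => //; exact: sqintN.
Qed.

Lemma l2n_sum (I : Type) (s : seq I) (F : I -> T -> R) : (forall i, sqint mu D (F i)) ->
  l2n mu D (fun x => \sum_(i <- s) F i x) <= \sum_(i <- s) l2n mu D (F i).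
Proof.
move=> sF; elim: s => [|i s IH].
  rewrite big_nil /l2n /l2ip; under eq_Rintegral do rewrite big_nil mulr0.
  by rewrite Rintegral_cst// mul0r sqrtr0.
rewrite big_cons; under [fun x => _]eq_fun do rewrite big_cons.
apply: (le_trans (l2nD _ _)) => //; first exact: sqint_sum.
by rewrite lerD2l.
Qed.

Lemma l2ip_le f g : sqint mu D f -> sqint mu D g -> (forall x, D x -> `|f x| <= `|g x|) ->
  l2ip mu D f f <= l2ip mu D g g.
Proof.
move=> sf sg fg; apply: le_Rintegral => //; [exact: sqintM|exact: sqintM|].
move=> x Dx; rewrite -!expr2 -[f x ^+ 2]real_normK ?num_real//.
by rewrite -[g x ^+ 2]real_normK ?num_real// ler_pXn2r ?nnegrE// fg.
Qed.

Lemma l2n_le f g : sqint mu D f -> sqint mu D g -> (forall x, D x -> `|f x| <= `|g x|) ->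
  l2n mu D f <= l2n mu D g.
Proof. by move=> sf sg fg; rewrite ler_sqrt ?l2ip_ge0// l2ip_le. Qed.

Lemma l2n_bounded f g (M : R) : measurable_fun D f -> (forall x, D x -> `|f x| <= M) ->
  sqint mu D g -> l2n mu D (fun x => f x * g x) <= M * l2n mu D g.
Proof.
move=> mf fM sg; have [->|/set0P[y Dy]] := eqVneq D set0.
  by rewrite /l2n /l2ip !Rintegral_set0 sqrtr0 mulr0.
have M0 : 0 <= M by apply: le_trans (fM _ Dy).
have -> : M * l2n mu D g = l2n mu D (fun x => M * g x) by rewrite l2nZ// ger0_norm.
apply: l2n_le => //.
- exact: sqint_bounded fM sg.
- exact: sqintZ.
- by move=> x Dx; rewrite !normrM (ger0_norm M0) ler_wpM2r// fM.
Qed.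

Lemma l2ip_eq0_ae f : sqint mu D f -> l2ip mu D f f = 0 -> ae_eq mu D f (cst 0).
Proof.
move=> [mf sf] f0.
have : (\int[mu]_(x in D) `|(f x ^+ 2)%:E| = 0)%E.
  under eq_integral do rewrite gee0_abs ?lee_fin ?sqr_ge0//.
  by rewrite l2ip_int// f0.
have mf2 : measurable_fun D (fun x => (f x ^+ 2)%:E) by case/integrableP : sf.
move=> /(ae_eq_integral_abs mu mD mf2); apply: filterS => x h Dx.
by have := h Dx => -[] /eqP; rewrite sqrf_eq0 => /eqP.
Qed.

Lemma l2ip_ae_eq f f' g g' : ae_eq mu D f f' -> ae_eq mu D g g' ->
  sqint mu D f -> sqint mu D f' -> sqint mu D g -> sqint mu D g' ->
  l2ip mu D f g = l2ip mu D f' g'.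
Proof.
move=> ff' gg' [mf _] [mf' _] [mg _] [mg' _]; rewrite /l2ip /Rintegral; congr fine.
apply: ae_eq_integral => //; try by apply/measurable_EFinP; exact: measurable_funM.
by apply: filterS2 ff' gg' => x h1 h2 Dx; rewrite h1// h2.
Qed.

End l2_hilbert.

(** * Fundamental lemma of the calculus of variations *)

Section fundamental_lemma.
Variables (R : realType) (n : nat).
Local Notation E := 'rV[R]_n.
Local Notation mu := (leb R n).
Implicit Types (a b x : E) (U : set E).

Definition obox a b : set E := [set x | forall i, a ord0 i < x ord0 i < b ord0 i].
Definition cbox a b : set E := [set x | forall i, a ord0 i <= x ord0 i <= b ord0 i].

Lemma cbox_compact a b : compact (cbox a b).
Proof.
have := @rV_compact R n (fun i => [set` `[a ord0 i, b ord0 i]]) (fun i => @segment_compact _ _ _).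
by congr compact; apply/seteqP; split => x /= h i; have := h i; rewrite in_itv.
Qed.

Lemma obox_measurable a b : measurable (obox a b).
Proof.
have := @measurable_box R n (fun i => [set` `]a ord0 i, b ord0 i[]) (fun i => measurable_itv _).
by congr measurable; apply/seteqP; split => x /= h i; have := h i; rewrite in_itv.
Qed.

Lemma obox_cbox a b : obox a b `<=` cbox a b.
Proof. by move=> x h i; have /andP[h1 h2] := h i; rewrite !ltW. Qed.

Lemma oboxI a b a' b' : obox a b `&` obox a' b' =
  obox (\row_i Num.max (a ord0 i) (a' ord0 i)) (\row_i Num.min (b ord0 i) (b' ord0 i)).
Proof.
apply/seteqP; split => x.
  move=> [h1 h2] i; rewrite !mxE gt_max lt_min.
  by have /andP[-> ->] := h1 i; have /andP[-> ->] := h2 i.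
move=> h; split => i; have := h i; rewrite !mxE gt_max lt_min.
  by move=> /andP[/andP[-> _] /andP[-> _]].
by move=> /andP[/andP[_ ->] /andP[_ ->]].
Qed.

Definition boxes : set (set E) := [set B | exists a b, B = obox a b].

Lemma boxes_generate : measurable `<=` <<s boxes >>.
Proof.
have SA := @smallest_sigma_algebra _ [set: E] boxes.
apply: smallest_sub => //; rewrite -bigcup_seq; apply: bigcup_sub => i _ _ [Y mY <-].
rewrite setTI.
have : (fun Y : set R => <<s boxes >> ((fun x : E => x ord0 i) @^-1` Y)) Y; last by [].
move: Y mY; rewrite (RGenOpens.measurableE R); apply: smallest_sub.
  split => /=.
  - by rewrite preimage_set0; case: SA.
  - by move=> A hA; rewrite setTD preimage_setC -setTD; case: SA => _ h _; exact: h.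
  - by move=> F hF; rewrite preimage_bigcup; case: SA => _ _; exact.
move=> _ [p [q ->]].
have -> : (fun x : E => x ord0 i) @^-1` `]p, q[%classic = \bigcup_(k : nat)
   obox (\row_j if j == i then p else - k%:R) (\row_j if j == i then q else k%:R).
  apply/seteqP; split => x /=.
    rewrite in_itv/= => hx; exists (Num.truncn `|x|).+1 => // j; rewrite !mxE.
    case: eqVneq => [->//|_]; rewrite -ltr_norml; apply: le_lt_trans (truncnS_gt _).
    by rewrite /Num.norm/= mx_normrE; apply: (le_bigmax _ _ (ord0, j)).
  by move=> [k _] /(_ i); rewrite !mxE eqxx in_itv.
case: SA => _ _; apply => k; apply: sub_sigma_algebra.
by exists (\row_j if j == i then p else - k%:R), (\row_j if j == i then q else k%:R).
Qed.

(** Smooth functions between 0 and the indicator of the open box; at each point of the box the value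
    is 1 from some [k] on. *)
Definition box_bump a b (k : nat) : E -> R := fun x =>
  \prod_(i < n) (step01 (k%:R * (x ord0 i - a ord0 i)) * step01 (k%:R * (b ord0 i - x ord0 i))).

Lemma smooth_coord (t : R -> R) (i : 'I_n) (c e : R) : (forall k, C1 k t) ->
  smooth (fun x : E => t (c * x ord0 i + e)).
Proof.
move=> Ct k; apply: (@Ck_ext _ _ _ (fun x => t (dot (c *: delta_mx ord0 i) x + e))).
  move=> x; congr (t (_ + _)); rewrite /dot (bigD1 i)//= !mxE !eqxx mulr1 big1 ?addr0//.
  by move=> j ji; rewrite !mxE (negbTE ji) !mulr0 mul0r.
exact: Ck_ridge.
Qed.

Lemma smooth_box_bump a b k : smooth (box_bump a b k).
Proof.
apply: smooth_prod => i; apply: smoothM.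
  have -> : (fun x : E => step01 (k%:R * (x ord0 i - a ord0 i))) =
     fun x => step01 (k%:R * x ord0 i + - (k%:R * a ord0 i)).
    by apply/funext => x; rewrite mulrBr.
  by apply: smooth_coord; exact: step01_C1.
have -> : (fun x : E => step01 (k%:R * (b ord0 i - x ord0 i))) =
   fun x => step01 (- k%:R * x ord0 i + (k%:R * b ord0 i)).
  by apply/funext => x; rewrite mulrBr mulNr addrC.
by apply: smooth_coord; exact: step01_C1.
Qed.

Lemma box_bump_ge0 a b k x : 0 <= box_bump a b k x.
Proof. by apply: prodr_ge0 => i _; rewrite mulr_ge0 ?step01_ge0. Qed.

Lemma box_bump_le1 a b k x : box_bump a b k x <= 1.
Proof.
suff /andP[_ ->] : 0 <= box_bump a b k x <= 1 by [].
apply: (big_ind (fun y => 0 <= y <= 1)) => [|y z /andP[y0 y1] /andP[z0 z1]|i _].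
- by rewrite ler01 lexx.
- by rewrite mulr_ge0// mulr_ile1.
- by rewrite mulr_ge0 ?step01_ge0// mulr_ile1 ?step01_ge0 ?step01_le1.
Qed.

Lemma box_bump_off a b k x : ~ obox a b x -> box_bump a b k x = 0.
Proof.
move=> /existsNP[i /negP]; rewrite negb_and -!leNgt => h.
rewrite /box_bump (bigD1 i)//=; case/orP: h => h.
  by rewrite step01_eq0 ?mul0r// mulr_ge0_le0// subr_le0.
by rewrite [X in _ * X * _]step01_eq0 ?mulr0 ?mul0r// mulr_ge0_le0// subr_le0.
Qed.

Lemma box_bump_cvg a b x : obox a b x -> \forall k \near \oo, box_bump a b k x = 1.
Proof.
move=> h.
have e0 (y : R) : 0 < y -> \forall k \near \oo, step01 (k%:R * y) = 1.
  move=> y0; near=> k; apply: step01_eq1; rewrite -ler_pdivrMr//.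
  by near: k; exact: nbhs_infty_ger.
have e1 : \forall k \near \oo, forall i : 'I_n,
    step01 (k%:R * (x ord0 i - a ord0 i)) * step01 (k%:R * (b ord0 i - x ord0 i)) = 1.
  apply: filter_forall => i; have /andP[h1 h2] := h i.
  have := e0 (x ord0 i - a ord0 i); rewrite subr_gt0 => /(_ h1).
  have := e0 (b ord0 i - x ord0 i); rewrite subr_gt0 => /(_ h2).
  by apply: filterS2 => k -> ->; rewrite mulr1.
by apply: filterS e1 => k e; rewrite /box_bump big1.
Unshelve. all: by end_near. Qed.

Lemma tf_box_bump U a b k : cbox a b `<=` U -> tf U (box_bump a b k).
Proof.
move=> cU; split; first exact: smooth_box_bump.
exists (cbox a b); split => //; first exact: cbox_compact.
by move=> x nx; apply: box_bump_off => /obox_cbox.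
Qed.

Lemma box_bump_gt0 a b x : obox a b x -> 0 < box_bump a b 1 x.
Proof.
move=> h; apply: prodr_gt0 => i _; have /andP[h1 h2] := h i.
by rewrite !mul1r mulr_gt0// step01_gt0// subr_gt0.
Qed.

Section vanishing.
Variables (U : set E) (g : E -> R).
Hypothesis oU : open U.
Hypothesis gl : forall K, compact K -> K `<=` U -> mu.-integrable K (EFin \o g).
Hypothesis g0 : forall phi, tf U phi -> \int[mu]_(x in U) (g x * phi x) = 0.

Let mU : measurable U. Proof. exact: open_measurable_rV. Qed.

Let h a b := (g \_ (cbox a b)).

Let hi a b : cbox a b `<=` U -> mu.-integrable setT (EFin \o h a b).
Proof.
move=> cU; have := gl (@cbox_compact a b) cU.
by rewrite (integrable_mkcond _ (compact_measurable_rV (@cbox_compact a b))) restrict_EFin.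
Qed.

Let integral_obox a b : cbox a b `<=` U -> (\int[mu]_(x in obox a b) (g x)%:E = 0)%E.
Proof.
move=> cU.
have hb k x : h a b x * box_bump a b k x = (fun x => g x * box_bump a b k x) x.
  rewrite /h /patch; case: ifPn => // /negP nx; rewrite box_bump_off ?mulr0//.
  by move=> /obox_cbox/mem_set.
have z k : \int[mu]_x (h a b x * box_bump a b k x) = 0.
  rewrite -[RHS](g0 (tf_box_bump k cU)) [RHS]Rintegral_mkcond; apply: eq_Rintegral => x _.
  rewrite hb /patch; case: ifPn => // /negP nx; rewrite box_bump_off ?mulr0//.
  by move=> /obox_cbox/cU/mem_set.
have mb k : measurable_fun setT (fun x => h a b x * box_bump a b k x).
  apply: measurable_funM; first exact: integrable_mfun (hi cU).
  by apply: cont_measurable; apply: smooth_cont; exact: smooth_box_bump.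
have le k x : `|h a b x * box_bump a b k x| <= `|h a b x|.
  by rewrite normrM ler_piMr// ger0_norm ?box_bump_ge0 ?box_bump_le1.
have cv x : (fun k => (h a b x * box_bump a b k x)%:E) @ \oo --> ((g \_ (obox a b)) x)%:E.
  apply: cvg_near_cst; have [ox|nox] := pselect (obox a b x).
    have := box_bump_cvg ox; apply: filterS => k ->.
    by rewrite mulr1 /h /patch !mem_set//; exact: obox_cbox.
  by apply: nearW => k; rewrite box_bump_off// mulr0 /patch memNset.
have mlim : measurable_fun setT (EFin \o (g \_ (obox a b))).
  apply: (emeasurable_fun_cvg (fun k x => (h a b x * box_bump a b k x)%:E)) => [k|x _].
    exact/measurable_EFinP.
  exact: cv.
have [_ _] := @dominated_convergence _ _ _ mu setT measurableT
   (fun k x => (h a b x * box_bump a b k x)%:E) (EFin \o (g \_ (obox a b)))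
   (fun x => `|h a b x|%:E) (fun k => proj2 (measurable_EFinP _ _) (mb k)) mlim
   (aeW _ (fun x _ => cv x)) (integrable_norm (hi cU))
   (aeW _ (fun x k _ => le k x)).
have -> : [sequence (\int[mu]_(x in setT) (h a b x * box_bump a b k x)%:E)%E]_k = cst 0%E.
  apply/funext => k /=; have := z k; rewrite /Rintegral => zk.
  rewrite -[LHS]fineK ?zk//; apply: integrable_fin_num => //.
  apply: (le_integrable measurableT _ _ (hi cU)) => [|x _]; first exact/measurable_EFinP.
  by rewrite /= lee_fin; exact: le.
move=> c; rewrite integral_mkcond restrict_EFin.
by rewrite -(cvg_lim _ c)// lim_cst.
Qed.

(** The integral of [g] vanishes on all boxes inside, by dominated convergence along [box_bump].
    Boxes are stable under intersection and generate the sigma-algebra, so it vanishes on every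
    measurable subset by the monotone class argument. *)
Lemma ae_zero_cbox a b : cbox a b `<=` U -> ae_eq mu (obox a b) g (cst 0).
Proof.
move=> cU; have mo := obox_measurable a b.
have gi : mu.-integrable (obox a b) (EFin \o g).
  apply: (integrableS _ mo (@obox_cbox a b)); first exact: compact_measurable_rV (@cbox_compact a b).
  exact: gl (@cbox_compact a b) cU.
have Z S : measurable S -> (\int[mu]_(x in obox a b `&` S) (g x)%:E = 0)%E.
  pose H : set (set E) := [set S | measurable S /\ (\int[mu]_(x in obox a b `&` S) (g x)%:E = 0)%E].
  have dH : dynkin H.
    split.
    - by split => //; rewrite setIT integral_obox.
    - move=> A [mA zA]; split; first exact: measurableC.
      have := integral_obox cU; rewrite -{1}(setUIDK (obox a b) A) integral_setU_EFin//.
      + by rewrite zA add0e setDE.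
      + exact: measurableI.
      + exact: measurableD.
      + by rewrite setUIDK; exact: integrable_mfun gi.
      + by apply/disj_setPS => x [[_ ?] [_ ?]].
    - move=> F tF HF; split; first by apply: bigcupT_measurable => k; case: (HF k).
      rewrite setI_bigcupr integral_bigcup.
      + by rewrite eseries0// => k _ _; case: (HF k).
      + exact: trivIset_setIl.
      + by move=> k; apply: measurableI => //; case: (HF k).
      + rewrite -setI_bigcupr; apply: integrableS gi => //.
        by apply: measurableI => //; apply: bigcupT_measurable => k; case: (HF k).
  have /dynkin_lambda_system lH := dH.
  have bI : setI_closed boxes.
    by move=> _ _ [p [q ->]] [p' [q' ->]]; rewrite oboxI; do 2 eexists; reflexivity.
  have bH : boxes `<=` H.
    move=> _ [p [q ->]]; split; first exact: obox_measurable.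
    rewrite oboxI; apply: integral_obox; apply: subset_trans cU => x hx i.
    have := hx i; rewrite !mxE ge_max le_min => /andP[/andP[-> _] /andP[-> _]] //.
  move=> mS; have [] // := lambda_system_subset bI lH bH _ (boxes_generate mS).
have Z' : forall S, S `<=` obox a b -> measurable S ->
   (\int[mu]_(x in S) (EFin \o g) x = \int[mu]_(x in S) cst 0 x)%E.
  by move=> S SB mS; rewrite [RHS]integral0_eq// -(Z S mS) setIidr.
have := integral_ae_eq mo gi (measurable_cst 0%E) Z'.
by apply: filterS => x hx Bx; have := hx Bx => -[].
Qed.

Lemma fundamental_ae : {ae mu, forall x, U x -> g x = 0}.
Proof.
(* Boxes with rational corners cover [U] and are countably many, so their exceptional sets add up to
   a null set. *)
pose J := [set p : 'rV[rat]_n * 'rV[rat]_n |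
  cbox (map_mx ratr p.1) (map_mx ratr p.2) `<=` U].
have aeJ : \forall x \ae mu, forall p : 'rV[rat]_n * 'rV[rat]_n, J p ->
    obox (map_mx ratr p.1) (map_mx ratr p.2) x -> g x = 0.
  have [f fs] : exists f : nat -> 'rV[rat]_n * 'rV[rat]_n, forall p, exists k, f k = p.
    exists (fun k => odflt (0, 0) (unpickle k)) => p; exists (pickle p).
    by rewrite pickleK.
  have : \forall x \ae mu, forall k, J (f k) ->
      obox (map_mx ratr (f k).1) (map_mx ratr (f k).2) x -> g x = 0.
    apply: ae_foralln => k; have [Jk|nJ] := pselect (J (f k)); last by apply: aeW.
    by apply: filterS (ae_zero_cbox Jk) => x hx _.
  by apply: filterS => x hx p; have [k <-] := fs p; exact: hx.
apply: filterS aeJ => x hx Ux.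
have /nbhs_ballP[e /= e0 he] := oU Ux.
have rd (l u : R) : l < u -> exists q : rat, l < ratr q < u.
  by move=> /rat_in_itvoo[q]; rewrite in_itv/= => hq; exists q.
have /choice[p hp] : forall i : 'I_n, exists q : rat, x ord0 i - e < ratr q < x ord0 i.
  by move=> i; apply: rd; rewrite gtrBl.
have /choice[q hq] : forall i : 'I_n, exists q : rat, x ord0 i < ratr q < x ord0 i + e.
  by move=> i; apply: rd; rewrite ltrDl.
apply: (hx (\row_i p i, \row_i q i)).
  move=> y /= hy; apply: he; split => // i j; rewrite (ord1 i) /ball/=.
  have := hy j; rewrite !mxE => /andP[y1 y2].
  have /andP[p1 p2] := hp j; have /andP[q1 q2] := hq j.
  by rewrite ltr_distl; apply/andP; split; lra.
move=> i /=; rewrite !mxE; have /andP[_ ->] := hp i; by have /andP[-> _] := hq i.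
Qed.

End vanishing.
End fundamental_lemma.

Section Rintegral_linear.
Context d (T : measurableType d) (R : realType) (mu : {measure set T -> \bar R}).

Lemma RintZ (D : set T) (f : T -> R) (k : R) : measurable D -> mu.-integrable D (EFin \o f) ->
  \int[mu]_(x in D) (k * f x) = k * \int[mu]_(x in D) f x.
Proof. by move=> mD fi; rewrite RintegralZl. Qed.

Lemma RintN (D : set T) (f : T -> R) : measurable D -> mu.-integrable D (EFin \o f) ->
  \int[mu]_(x in D) (- f x) = - \int[mu]_(x in D) f x.
Proof.
move=> mD fi; rewrite -mulN1r -RintZ//.
by apply: eq_Rintegral => x _; rewrite mulN1r.
Qed.

End Rintegral_linear.

(** Second-order test at 0 for [h s - (e s + b) s]: its derivative vanishes at 0, and if [c > 2 e]
    it would be positive just to the right. The linear term occurs because the parabola comes from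
    [c |x|^2] along a line that misses the origin. *)
Lemma second_derivative_max (R : realType) (h h' : R -> R) (b c e : R) :
  (forall s, is_derive s (1 : R) h (h' s)) -> is_derive (0 : R) 1 h' c ->
  (forall s, h s <= h 0 + (e * s + b) * s) -> c <= 2 * e.
Proof.
move=> hd dc hmax; rewrite leNgt; apply/negP => ce.
pose k s := h s - (e * s + b) * s.
have kd s : is_derive s (1 : R) k (h' s - (2 * e * s + b)).
  have h1 := is_deriveM (is_derive_affine e b s) (is_derive_id s (1 : R)).
  have h2 := is_deriveB (hd s) h1.
  by apply: (is_derive_eq h2); rewrite /GRing.scale/=; ring.
have k0 : is_derive (0 : R) 1 k 0.
  apply: (@derive1_at_max R k (-1) 1 0); rewrite ?in_itv/=.
  - lra.
  - by move=> t _; have [] := kd t.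
  - by apply/andP; split; lra.
  - by move=> t _; rewrite /k; have := hmax t; lra.
have hb : h' 0 = b.
  have [_ e1] := k0; have [_ e2] := kd 0; move: e2; rewrite e1; lra.
have [hdv hde] := dc; move: hdv; rewrite /derivable => /cvgP; rewrite -/(derive h' 0 1) hde.
move=> /(@cvgr_gt _ _ _ _ _ _) /(_ _ ce); rewrite near_withinE => /nbhs_ballP[r /= r0 hr].
have pos s : 0 < s < r -> 2 * e * s + b < h' s.
  move=> /andP[s0 sr]; have := hr s.
  rewrite /ball/= sub0r normrN gtr0_norm// => /(_ sr (lt0r_neq0 s0)).
  rewrite addr0 /GRing.scale/= mulr1 hb => h1.
  by move: h1; rewrite [X in _ < X]mulrC ltr_pdivlMr// => h1; lra.
have r20 : 0 < r / 2 by lra.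
have [|s] := @MVT R k (fun s => h' s - (2 * e * s + b)) 0 (r / 2) r20 (fun s _ => kd s).
  exact: continuous_subspaceT (is_derive1_cont kd).
rewrite in_itv/= => /andP[s0 sr] ek.
have ps : 0 < h' s - (2 * e * s + b) by rewrite subr_gt0 pos// s0/=; lra.
have : 0 < k (r / 2) - k 0 by rewrite ek mulr_gt0//; lra.
by rewrite /k; have := hmax (r / 2); lra.
Qed.

Opaque pd.
(** * Density of the range of an elliptic operator *)

Section elliptic.
Variables (R : realType) (n : nat).
Local Notation E := 'rV[R]_n.
Local Notation mu := (leb R n).
Local Notation dir i := (delta_mx ord0 i : 'rV[R]_n).
Implicit Types (f g phi psi q : E -> R).

Definition locint q := forall K, compact K -> mu.-integrable K (EFin \o q).

Lemma coord_le (x : E) i : `|x ord0 i| <= `|x|.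
Proof. by rewrite [leRHS]/Num.norm/= mx_normrE; apply: (le_bigmax _ _ (ord0, i)). Qed.

Lemma norm_le_coord (x : E) (r : R) : 0 <= r -> (forall i, `|x ord0 i| <= r) -> `|x| <= r.
Proof.
move=> r0 h; rewrite [leLHS]/Num.norm/= mx_normrE; apply/bigmax_leP; split => // -[i j] _ /=.
by rewrite (ord1 i).
Qed.

Definition cball (r : R) : set E := [set x | `|x| <= r].

Lemma cball_compact r : compact (cball r).
Proof.
have [r0|r0] := leP 0 r; last first.
  rewrite (_ : cball r = set0); first exact: compact0.
  by apply/seteqP; split => x //=; rewrite /cball/= => h; have := normr_ge0 x; rewrite leNgt (le_lt_trans h).
have -> : cball r = cbox (const_mx (- r)) (const_mx r).
  apply/seteqP; split => x h.
    by move=> i; rewrite !mxE -ler_norml (le_trans (coord_le _ _)).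
  by apply: norm_le_coord => // i; have := h i; rewrite !mxE -ler_norml.
exact: cbox_compact.
Qed.

Lemma sqint_locint D q : measurable D -> sqint mu D q ->
  forall K, compact K -> K `<=` D -> mu.-integrable K (EFin \o q).
Proof.
move=> mD [mq q2] K cK KD; have mK := compact_measurable_rV cK.
apply: (@integrable_le _ _ _ mu K q (fun x => 1 + q x ^+ 2)) => //.
- exact: measurable_funS mq.
- apply: integrableRD => //; first by apply: integrable_cstR => //; exact: compact_mu_lty.
  exact: integrableS q2.
- move=> x _; have h := sqr_ge0 (`|q x| - 1).
  by rewrite -[q x ^+ 2]real_normK ?num_real//; nra.
Qed.

Lemma tf_setT U phi : tf U phi -> tf setT phi. Proof. exact: tf_sub. Qed.

Lemma tf_shift phi (a : E) : tf setT phi -> tf setT (fun x => phi (x + a)).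
Proof.
move=> /(tf_affine a (oner_neq0 R)).
by under [X in tf _ X -> _]eq_fun do rewrite scale1r; exact: tf_sub.
Qed.

Lemma pd_shift phi (a : E) i x : smooth phi -> pd i (fun x => phi (x + a)) x = pd i phi (x + a).
Proof.
move=> sp; have := pdE_affine 1 a i x sp; rewrite scale1r mul1r => <-.
by under [in RHS]eq_fun do rewrite scale1r.
Qed.

Lemma is_derive_int_dir q psi (x v : E) (a : R) : locint q -> tf setT psi ->
  is_derive a (1 : R) (fun t => \int[mu]_y (q y * psi (y + (x + t *: v))))
    (\int[mu]_y (q y * \sum_(i < n) v ord0 i * pd i psi (y + (x + a *: v)))).
Proof.
move=> lq tp; have sp := tf_smooth tp.
pose dp z := \sum_(i < n) v ord0 i * pd i psi z.
have tdp : tf setT dp by apply: tf_sum => i; apply: tfZ; exact: tf_pd.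
have [M M0 hM] := tf_bounded tp; have [M' M'0 hM'] := tf_bounded tdp.
have [A [cA AU pA]] := tp.2; have [k k0 hk] := compact_bound_rV cA.
have dpA z : ~ A z -> dp z = 0.
  move=> nA; apply: big1 => i _; rewrite (pd_off i (compact_closed_rV cA) pA) ?mulr0//.
pose r := k + `|x| + (`|a| + 1) * `|v|.
have far (t : R) y : t \in `]a - 1, a + 1[ -> ~ cball r y -> ~ A (y + (x + t *: v)).
  rewrite in_itv/= => /andP[t1 t2] nb /hk h; apply: nb; rewrite /cball/=.
  have -> : y = (y + (x + t *: v)) - (x + t *: v) by rewrite addrK.
  apply: (le_trans (ler_normB _ _)); rewrite /r -addrA; apply: lerD => //.
  apply: (le_trans (ler_normD _ _)); rewrite lerD2l normrZ ler_wpM2r//.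
  have : `|t - a| <= 1 by rewrite ler_norml; apply/andP; split; lra.
  by have := ler_normD (t - a) a; rewrite subrK; lra.
apply: (@is_derive_int_weight _ _ q (fun t y => psi (y + (x + t *: v)))
  (fun t y => dp (y + (x + t *: v))) (cball r) (Num.max M M') (a - 1) (a + 1)).
- by rewrite in_itv/= ltrDl ltr01 andbT gtrBl.
- exact: compact_measurable_rV (@cball_compact r).
- exact: lq (@cball_compact r).
- by move=> t _; apply: smooth_cont; apply: tf_smooth; exact: tf_shift.
- move=> t y _; have := smooth_line (y + x) v t sp.
  by under [X in is_derive _ _ X _ -> _]eq_fun do rewrite -addrA; rewrite -addrA.
- by move=> t y ta nb; split; [apply: pA|apply: dpA]; exact: far nb.
- by move=> t y _; rewrite !le_max hM hM' orbT.
Qed.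

(** The symmetry of second derivatives, obtained under the integral: parts and a translation give
    [int (pd i phi)(y) psi(y + t e_j) = - int (pd i psi)(y) phi(y - t e_j)], which is differentiated
    at [t = 0]. *)
Lemma int_pd_swap phi psi i j : tf setT phi -> tf setT psi ->
  \int[mu]_x (pd i phi x * pd j psi x) = \int[mu]_x (pd j phi x * pd i psi x).
Proof.
move=> tp tq; have sp := tf_smooth tp; have sq := tf_smooth tq.
have lc g : tf setT g -> locint g.
  by move=> tg K cK; apply: integrableS (tf_integrable tg) => //; exact: compact_measurable_rV.
have sumE g (k : 'I_n) y (c : R) :
    \sum_(l < n) (c *: dir k) ord0 l * pd l g y = c * pd k g y.
  rewrite (bigD1 k)//= !mxE !eqxx mulr1 big1 ?addr0// => l lk.
  by rewrite !mxE (negbTE lk) andbF mulr0 mul0r.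
have d1 := is_derive_int_dir 0 (1 *: dir j) 0 (lc _ (tf_pd i tp)) tq.
have d2 := is_derive_int_dir 0 (-1 *: dir j) 0 (lc _ (tf_pd i tq)) tp.
have [_ e1] := d1; have [_ e2] := d2.
have e12 : (fun t : R => \int[mu]_y (pd i phi y * psi (y + (0 + t *: (1 *: dir j))))) =
    - (fun t : R => \int[mu]_y (pd i psi y * phi (y + (0 + t *: (-1 *: dir j))))).
  apply/funext => t /=; rewrite [RHS]/GRing.opp/=.
  pose a := 0 + t *: (1 *: dir j); have ta := tf_shift a tq.
  have := int_parts i tp (tf_smooth ta) => /(congr1 -%R); rewrite opprK => <-.
  congr (- _); under eq_Rintegral do rewrite pd_shift//.
  have tF := tfMl sp (tf_shift a (tf_pd i tq)).
  rewrite -(Rintegral_shift (- a) (tf_integrable tF)); apply: eq_Rintegral => y _.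
  by rewrite subrK mulrC /a scale1r scaleN1r scalerN !add0r.
have := derive_val (is_derive := d1); rewrite e12 deriveN; last by case: d2.
rewrite e2.
under eq_Rintegral do rewrite sumE scale0r !addr0 mulN1r mulrN.
under [X in _ = X -> _]eq_Rintegral do rewrite sumE scale0r !addr0 mul1r.
have Ni := tf_integrable (tfMl (smooth_pd i sq) (tf_pd j tp)).
rewrite (_ : \int[mu]_y _ = - \int[mu]_y (pd i psi y * pd j phi y)); last first.
  exact: (RintN measurableT Ni).
rewrite opprK => <-; apply: eq_Rintegral => x _; exact: mulrC.
Qed.

Definition lap psi : E -> R := fun x => \sum_(i < n) pd i (pd i psi) x.

Definition ell (e : R) psi : E -> R := fun x => psi x - e ^+ 2 * lap psi x.

Lemma tf_ell e psi : tf setT psi -> tf setT (ell e psi).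
Proof.
move=> tp; apply: tfB => //; apply: tfZ; apply: tf_sum => i.
by do 2 apply: tf_pd.
Qed.

Lemma tf_lap psi : tf setT psi -> tf setT (lap psi).
Proof. by move=> tp; apply: tf_sum => i; do 2 apply: tf_pd. Qed.

Let sq g : tf setT g -> sqint mu setT g. Proof. exact: tf_sqint. Qed.

Lemma int_pd_comm phi psi i j : tf setT phi -> tf setT psi ->
  \int[mu]_x (phi x * pd i (pd j psi) x) = \int[mu]_x (phi x * pd j (pd i psi) x).
Proof.
move=> tp tq; have sq' := tf_smooth tq.
apply: (etrans (int_parts i tp (smooth_pd j sq'))).
apply: (etrans _ (esym (int_parts j tp (smooth_pd i sq')))).
exact: (congr1 -%R (int_pd_swap i j tp tq)).
Qed.

(** One derivative of each index moves across by parts. Summed over [i] and [j] this says that the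
    Laplacian has the L^2 norm of the whole Hessian. *)
Lemma l2ip_pd2 psi i j : tf setT psi -> l2ip mu setT (pd i (pd j psi)) (pd i (pd j psi)) =
  l2ip mu setT (pd i (pd i psi)) (pd j (pd j psi)).
Proof.
move=> tp; have t2 k l : tf setT (pd k (pd l psi)) by do 2 apply: tf_pd.
apply: (etrans (int_pd_comm i j (t2 i j) tp)).
apply: (etrans _ (int_pd_swap j i (tf_pd i tp) (tf_pd j tp))).
by apply: eq_Rintegral => x _; exact: mulrC.
Qed.

Lemma l2ip_lap psi : tf setT psi -> l2ip mu setT (lap psi) (lap psi) =
  \sum_(i < n) \sum_(j < n) l2ip mu setT (pd i (pd j psi)) (pd i (pd j psi)).
Proof.
move=> tp; have t2 k l : tf setT (pd k (pd l psi)) by do 2 apply: tf_pd.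
rewrite {1}/l2ip /lap; under eq_Rintegral do rewrite big_distrlr.
have ii i j : mu.-integrable setT (EFin \o (fun x => pd i (pd i psi) x * pd j (pd j psi) x)).
  by apply: sqintM => //; exact: sq.
rewrite Rintegral_sum//; last by move=> i; apply: integrableR_sum => // j; exact: ii.
apply: eq_bigr => i _; apply: (etrans (Rintegral_sum _ measurableT (ii i))).
by apply: eq_bigr => j _; apply/esym; exact: l2ip_pd2.
Qed.

Lemma ler_sum2_term (F : 'I_n -> 'I_n -> R) i j : (forall i j, 0 <= F i j) ->
  F i j <= \sum_(i < n) \sum_(j < n) F i j.
Proof.
move=> F0; rewrite (bigD1 i)//= (bigD1 j)//= -addrA lerDl addr_ge0// ?sumr_ge0// => k _.
exact: sumr_ge0.
Qed.

Lemma l2n_pd2 psi i j : tf setT psi -> l2n mu setT (pd i (pd j psi)) <= l2n mu setT (lap psi).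
Proof.
move=> tp; apply: ler_wsqrtr; rewrite [leRHS](l2ip_lap tp).
apply: (ler_sum2_term (F := fun i j => l2ip mu setT (pd i (pd j psi)) (pd i (pd j psi)))).
by move=> k l; exact: l2ip_ge0.
Qed.

Lemma l2ip_energy e psi : tf setT psi -> l2ip mu setT psi (ell e psi) =
  l2ip mu setT psi psi + e ^+ 2 * \sum_(i < n) l2ip mu setT (pd i psi) (pd i psi).
Proof.
move=> tp; have tl := tf_lap tp.
rewrite {1}/l2ip /ell; under eq_Rintegral do rewrite mulrDr mulrN mulrCA -mulNr.
rewrite RintegralD//; [|exact: sqintM (sq tp) (sq tp)|]; last first.
  by apply: integrableRZ => //; exact: sqintM (sq tp) (sq tl).
congr (_ + _); rewrite RintZ//; last exact: sqintM (sq tp) (sq tl).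
rewrite mulNr -mulrN; congr (_ * _); under eq_Rintegral do rewrite mulr_sumr.
rewrite Rintegral_sum//; last first.
  by move=> i; apply: sqintM (sq tp) (sq _) => //; do 2 apply: tf_pd.
rewrite -sumrN; apply: eq_bigr => i _.
by rewrite (int_parts i tp (smooth_pd i (tf_smooth tp))) opprK.
Qed.

(** Testing with [psi] itself gives |psi|^2 + e^2 |grad psi|^2 <= |psi| |ell e psi|. *)
Lemma ell_energy e psi : tf setT psi ->
  l2n mu setT psi <= l2n mu setT (ell e psi) /\
  forall i, 0 <= e -> e * l2n mu setT (pd i psi) <= l2n mu setT (ell e psi).
Proof.
move=> tp; have te := tf_ell e tp; set N := l2n mu setT (ell e psi).
have N0 : 0 <= N by exact: l2n_ge0.
have P0 : 0 <= l2n mu setT psi by exact: l2n_ge0.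
have h : l2ip mu setT psi psi + e ^+ 2 * \sum_(i < n) l2ip mu setT (pd i psi) (pd i psi) <=
   l2n mu setT psi * N.
  by rewrite -l2ip_energy//; apply: (le_trans (ler_norm _)); exact: l2_CS (sq tp) (sq te).
have S0 (P : pred 'I_n) : 0 <= \sum_(i < n | P i) l2ip mu setT (pd i psi) (pd i psi).
  by apply: sumr_ge0 => i _; exact: l2ip_ge0.
rewrite -l2n_sqr// in h.
have h1 : l2n mu setT psi <= N.
  have [->//|P1] := eqVneq (l2n mu setT psi) 0.
  have {}P1 : 0 < l2n mu setT psi by rewrite lt_neqAle eq_sym P1.
  rewrite -(ler_pM2l P1) -expr2; apply: le_trans h; rewrite lerDl mulr_ge0 ?sqr_ge0//.
split => // i e0; rewrite -(@ler_pXn2r _ 2)// ?nnegrE ?mulr_ge0 ?l2n_ge0//.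
rewrite exprMn l2n_sqr//.
have : e ^+ 2 * l2ip mu setT (pd i psi) (pd i psi) <=
   e ^+ 2 * \sum_(i < n) l2ip mu setT (pd i psi) (pd i psi).
  by rewrite ler_wpM2l ?sqr_ge0// (bigD1 i)//= lerDl.
have := ler_wpM2r N0 h1; have := sqr_ge0 (l2n mu setT psi); rewrite -/N expr2; nra.
Qed.

(** [e^2 lap psi = psi - ell e psi], and both terms on the right are bounded by |ell e psi|. *)
Lemma ell_energy2 e psi i j : tf setT psi ->
  e ^+ 2 * l2n mu setT (pd i (pd j psi)) <= 2 * l2n mu setT (ell e psi).
Proof.
move=> tp; have [h1 _] := ell_energy e tp; have te := tf_ell e tp; have tl := tf_lap tp.
apply: (@le_trans _ _ (l2n mu setT (fun x => psi x - ell e psi x))).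
  have -> : (fun x => psi x - ell e psi x) = fun x => e ^+ 2 * lap psi x.
    by apply/funext => x; rewrite /ell opprB addrC subrK.
  rewrite l2nZ//; last exact: sq.
  by rewrite ger0_norm ?sqr_ge0// ler_wpM2l ?sqr_ge0// l2n_pd2.
apply: (le_trans (l2nB _ (sq tp) (sq te))) => //.
by rewrite mulr_natl mulr2n lerD2r.
Qed.

Lemma l2n_shift phi (a : E) : tf setT phi ->
  l2n mu setT (fun x => phi (x + a)) = l2n mu setT phi.
Proof.
move=> tp; congr Num.sqrt; rewrite /l2ip.
by rewrite (Rintegral_shift a (tf_integrable (tfMl (tf_smooth tp) tp))).
Qed.

Lemma dot_line (x : E) i (s : R) :
  dot (x + s *: dir i) (x + s *: dir i) = dot x x + (s + 2 * x ord0 i) * s.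
Proof.
rewrite /dot (bigD1 i)//= [X in _ = X + _](bigD1 i)//= !mxE !eqxx mulr1.
under eq_bigr => j ji do rewrite !mxE (negbTE ji) andbF mulr0 addr0.
by rewrite [RHS]addrAC; congr (_ + _); ring.
Qed.

Lemma norm_sqr_le_dot (x : E) : `|x| ^+ 2 <= dot x x.
Proof.
have d0 : 0 <= dot x x by apply: sumr_ge0 => i _; rewrite -expr2 sqr_ge0.
rewrite -[leRHS]sqr_sqrtr// ler_pXn2r ?nnegrE ?sqrtr_ge0//.
apply: norm_le_coord; first exact: sqrtr_ge0.
move=> i; rewrite -sqrtr_sqr ler_sqrt// /dot (bigD1 i)//= expr2 lerDl.
by apply: sumr_ge0 => j _; rewrite -expr2 sqr_ge0.
Qed.

Lemma dot_sqr_continuous : continuous (fun x : E => dot x x).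
Proof.
apply: continuous_big => [|i _ x]; first exact: add_continuous.
by have h := @coord_continuous R 1 n ord0 i x; exact: (cvgM h h).
Qed.

Lemma lipschitz_continuous (Q : E -> R) (L : R) : 0 <= L ->
  (forall x v, `|Q (x + v) - Q x| <= L * `|v|) -> continuous Q.
Proof.
move=> L0 h x; apply/(@cvgrPdist_lt R R E (nbhs x) (nbhs_filter x) Q (Q x)) => e e0; apply/nbhs_ballP.
exists (e / (L + 1)) => /=; first by rewrite divr_gt0// ltr_wpDl.
move=> y; rewrite -ball_normE /= distrC => xy.
rewrite distrC; have := h x (y - x); rewrite [x + _]addrC subrK => /le_lt_trans; apply.
apply: (@le_lt_trans _ _ ((L + 1) * `|y - x|)); first by rewrite ler_wpM2r// lerDl.
by rewrite mulrC -ltr_pdivlMr// ltr_wpDl.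
Qed.

Section moving_average.
Variable q : E -> R.
Hypothesis sqq : sqint mu setT q.

(** The correlation of [q] with [phi]. It is bounded and its derivatives fall on [phi], so a merely
    square-integrable [q] produces regular functions to which a maximum principle applies. *)
Definition mavg phi (x : E) : R := \int[mu]_y (q y * phi (y + x)).

Let lq : locint q.
Proof. by move=> K cK; exact: (sqint_locint measurableT sqq cK). Qed.

Lemma mavg_bound phi x : tf setT phi -> `|mavg phi x| <= l2n mu setT q * l2n mu setT phi.
Proof. by move=> tp; rewrite -(l2n_shift x tp); apply: l2_CS => //; exact: sq (tf_shift x tp). Qed.

Lemma is_derive_mavg phi (x v : E) (a : R) : tf setT phi ->
  is_derive a (1 : R) (fun t => mavg phi (x + t *: v))
    (mavg (fun z => \sum_(i < n) v ord0 i * pd i phi z) (x + a *: v)).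
Proof. exact: is_derive_int_dir. Qed.

Lemma is_derive_mavg_dir phi (x : E) (i : 'I_n) (a : R) : tf setT phi ->
  is_derive a (1 : R) (fun t => mavg phi (x + t *: dir i)) (mavg (pd i phi) (x + a *: dir i)).
Proof.
move=> tp; have := is_derive_mavg x (dir i) a tp; congr is_derive.
rewrite /mavg; apply: eq_Rintegral => y _; congr (_ * _).
rewrite (bigD1 i)//= mxE !eqxx mul1r big1 ?addr0// => l lk.
by rewrite mxE (negbTE lk) andbF mul0r.
Qed.

Lemma mavg_lipschitz phi : tf setT phi -> exists2 L : R, 0 <= L &
  forall x v, `|mavg phi (x + v) - mavg phi x| <= L * `|v|.
Proof.
move=> tp; exists (l2n mu setT q * \sum_(i < n) l2n mu setT (pd i phi)).
  by rewrite mulr_ge0 ?l2n_ge0// sumr_ge0// => i _; exact: l2n_ge0.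
move=> x v; pose dp z := \sum_(i < n) v ord0 i * pd i phi z.
have tdp : tf setT dp by apply: tf_sum => i; apply: tfZ; exact: tf_pd.
have [s _] := MVT0 1 (fun s => is_derive_mavg x v s tp).
rewrite scale1r scale0r addr0 mul1r => ->; apply: (le_trans (mavg_bound _ tdp)).
rewrite -mulrA ler_wpM2l ?l2n_ge0//.
apply: (@le_trans _ _ (\sum_(i < n) l2n mu setT (fun z => v ord0 i * pd i phi z))).
  by apply: l2n_sum => // i; apply: sq; apply: tfZ; exact: tf_pd.
rewrite mulr_suml; apply: ler_sum => i _; rewrite l2nZ//; last by apply: sq; exact: tf_pd.
by rewrite mulrC ler_wpM2l ?l2n_ge0// coord_le.
Qed.

(* Maximum principle: [Q := mavg eta] is bounded and solves [Q = e^2 Lap Q],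
   so [Q - c |x|^2] has a maximum, where [Q <= 2 n c e^2]. *)
Lemma ell_orth_le0 (e : R) eta : 0 < e ->
  (forall psi, tf setT psi -> \int[mu]_x (q x * ell e psi x) = 0) ->
  tf setT eta -> \int[mu]_x (q x * eta x) <= 0.
Proof.
move=> e0 orth te; pose Q := mavg eta.
have Qeq x : Q x = e ^+ 2 * \sum_(i < n) mavg (pd i (pd i eta)) x.
  have ts := tf_shift x te; have := orth _ ts.
  have ell_shift y : ell e (fun z => eta (z + x)) y = ell e eta (y + x).
    have E1 i : pd i (pd i (fun z => eta (z + x))) y = pd i (pd i eta) (y + x).
      rewrite -(pd_shift x i y (tf_smooth (tf_pd i te))).
      have -> // : pd i (fun z => eta (z + x)) = fun z => pd i eta (z + x).
      by apply/funext => z; rewrite pd_shift//; exact: tf_smooth te.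
    exact: (congr1 (fun t => eta (y + x) - e ^+ 2 * t) (eq_bigr _ (fun i _ => E1 i))).
  under eq_Rintegral do rewrite ell_shift /ell mulrDr mulrN mulrCA -mulNr.
  have qi phi : tf setT phi -> mu.-integrable setT (EFin \o (fun y => q y * phi (y + x))).
    by move=> tp; apply: sqintM => //; exact: sq (tf_shift x tp).
  rewrite RintegralD//; [|exact: qi|by apply: integrableRZ => //; exact: (qi _ (tf_lap te))].
  rewrite RintZ//; last exact: (qi _ (tf_lap te)).
  rewrite mulNr => /eqP; rewrite subr_eq0 => /eqP; rewrite -/(mavg eta x) -/(Q x) => ->.
  congr (_ * _); under eq_Rintegral do rewrite mulr_sumr.
  by rewrite Rintegral_sum// => i; apply: (qi (pd i (pd i eta))); do 2 apply: tf_pd.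
pose M := l2n mu setT q * l2n mu setT eta.
have M0 : 0 <= M by rewrite mulr_ge0 ?l2n_ge0.
have QM x : `|Q x| <= M by exact: mavg_bound.
have [L L0 hL] := mavg_lipschitz te.
have cQ : continuous Q := lipschitz_continuous L0 hL.
have key (c : R) : 0 < c -> Q 0 <= 2 * n%:R * e ^+ 2 * c.
  (* Beyond this radius the penalty [c |x|^2] exceeds [2 M], while [Q] varies by at most [2 M]; the
     maximum over the ball is therefore global. *)
  move=> c0; pose r := 2 * M / c + 1.
  have r1 : 1 <= r by rewrite lerDr divr_ge0 ?(ltW c0)// mulr_ge0.
  have cG : continuous (fun x => Q x - c * dot x x).
    by move=> x; exact: (cvgB (cQ x) (cvgM (cvg_cst c) (@dot_sqr_continuous x))).
  have ne : cball r !=set0 by exists 0; rewrite /cball/= normr0; lra.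
  have [x0 _ hx0] := EVT_max_rV ne (@cball_compact r) (continuous_subspaceT cG).
  have max x : Q x - c * dot x x <= Q x0 - c * dot x0 x0.
    have [xr|xr] := leP `|x| r; first by apply: hx0; rewrite inE.
    have h0 : Q 0 - c * dot (0 : E) 0 <= Q x0 - c * dot x0 x0.
      by apply: hx0; rewrite inE /cball/= normr0; lra.
    apply: le_trans h0; have -> : dot (0 : E) 0 = 0 :> R.
      by apply: big1 => i _; rewrite mxE mul0r.
    have := QM x; have := QM 0; rewrite !ler_norml => /andP[a1 _] /andP[_ a2].
    have : c * r < c * dot x x.
      rewrite ltr_pM2l//; apply: lt_le_trans (norm_sqr_le_dot x); nra.
    by rewrite /r mulrDr mulrCA mulfV ?gt_eqF//; lra.
  have d2 i : mavg (pd i (pd i eta)) x0 <= 2 * c.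
    have hd s := is_derive_mavg_dir x0 i s te.
    have hdd := is_derive_mavg_dir x0 i 0 (tf_pd i te).
    rewrite scale0r addr0 in hdd.
    apply: (second_derivative_max (b := 2 * c * x0 ord0 i) hd hdd) => s.
    have := max (x0 + s *: dir i); rewrite dot_line scale0r addr0 /Q; lra.
  have Q0 : Q 0 <= Q x0.
    have := max 0; have -> : dot (0 : E) 0 = 0 :> R by apply: big1 => i _; rewrite mxE mul0r.
    have : 0 <= c * dot x0 x0 by rewrite (mulr_ge0 (ltW c0))// (le_trans (sqr_ge0 _) (norm_sqr_le_dot _)).
    lra.
  apply: (le_trans Q0); rewrite Qeq.
  have : \sum_(i < n) mavg (pd i (pd i eta)) x0 <= \sum_(i < n) (2 * c) by exact: ler_sum.
  rewrite sumr_const card_ord -mulr_natl => hs.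
  by have := ler_wpM2l (sqr_ge0 e) hs; lra.
have -> : \int[mu]_x (q x * eta x) = Q 0.
  by apply: eq_Rintegral => x _; rewrite addr0.
rewrite leNgt; apply/negP => Q0; set K := 2 * n%:R * e ^+ 2 in key.
have K0 : 0 <= K by rewrite mulr_ge0 ?sqr_ge0// mulr_ge0 ?ler0n.
have := key (Q 0 / (K + 1)); rewrite divr_gt0 ?ltr_wpDl// => /(_ isT).
rewrite mulrA ler_pdivlMr ?ltr_wpDl// mulrDr mulr1 [K * _]mulrC => h1; lra.
Qed.

End moving_average.

Lemma ell_orth q (e : R) : 0 < e -> sqint mu setT q ->
  (forall psi, tf setT psi -> \int[mu]_x (q x * ell e psi x) = 0) -> ae_eq mu setT q (cst 0).
Proof.
move=> e0 sqq orth; have lq : locint q by move=> K cK; exact: (sqint_locint measurableT sqq cK).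
have := @fundamental_ae R n setT q openT (fun K cK _ => lq K cK); apply => phi tp.
apply/le_anti; rewrite (ell_orth_le0 sqq e0 orth tp)/=.
have := ell_orth_le0 sqq e0 orth (tfN tp).
under eq_Rintegral do rewrite mulrN.
by rewrite RintN// ?oppr_le0//; apply: sqintM => //; exact: sq.
Qed.

Lemma ell_lin e (a : R) phi psi x : smooth phi -> smooth psi ->
  ell e (fun y => a * phi y + psi y) x = a * ell e phi x + ell e psi x.
Proof.
move=> sp sq'.
have h1 i : pd i (fun y => a * phi y + psi y) = fun y => a * pd i phi y + pd i psi y.
  apply/funext => y; rewrite pdD ?pdZ//; try exact: smooth_derivable.
  by apply: smooth_derivable; exact: smoothZ.
have h2 i : pd i (pd i (fun y => a * phi y + psi y)) x = a * pd i (pd i phi) x + pd i (pd i psi) x.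
  have s1 := smooth_pd i sp; have s2 := smooth_pd i sq'.
  rewrite h1 pdD ?pdZ//; try exact: smooth_derivable.
  by apply: smooth_derivable; exact: smoothZ.
rewrite /ell; have -> : lap (fun y => a * phi y + psi y) x = a * lap phi x + lap psi x.
  by rewrite {1}/lap (eq_bigr _ (fun i _ => h2 i)) big_split/= -mulr_sumr.
by move: (lap phi x) (lap psi x) => S S'; ring.
Qed.

Section density.
Variable e : R.
Hypothesis e0 : 0 < e.

Let cl : set (E -> R) := [set g | sqint mu setT g /\ forall eta, 0 < eta ->
  exists2 psi, tf setT psi & l2n mu setT (fun x => g x - ell e psi x) <= eta].

Let cl_ell psi : tf setT psi -> cl (ell e psi).
Proof.
move=> tp; split; first exact: sq (tf_ell e tp).
move=> eta eta0; exists psi => //; rewrite /l2n /l2ip.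
under eq_Rintegral do rewrite subrr mulr0.
by rewrite Rintegral_cst// mul0r sqrtr0 ltW.
Qed.

Let cl0 : cl 0.
Proof.
have -> : 0 = ell e (fun=> 0); last by apply: cl_ell; exact: tf0.
apply/funext => x; rewrite /ell /lap big1 ?mulr0 ?subr0// => i _.
have -> : pd i (fun=> 0 : R) = (fun=> 0 : R) by apply/funext => y; rewrite pd_cst.
by rewrite pd_cst.
Qed.

Let clL a u v : cl u -> cl v -> cl (a *: u + v).
Proof.
move=> [su hu] [sv hv]; split; first by apply: sqintD => //; exact: sqintZ.
move=> eta eta0; have a0 : 0 < `|a| + 1 by rewrite ltr_wpDl.
have [|phi tp hp] := hu (eta / 2 / (`|a| + 1)); first by rewrite !divr_gt0.
have [|psi tq hq] := hv (eta / 2); first by rewrite divr_gt0.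
exists (fun y => a * phi y + psi y); first by apply: tfD => //; exact: tfZ.
have -> : (fun x => (a *: u + v) x - ell e (fun y => a * phi y + psi y) x) =
   fun x => a * (u x - ell e phi x) + (v x - ell e psi x).
  apply/funext => x; rewrite (ell_lin _ _ _ (tf_smooth tp) (tf_smooth tq)).
  have -> : (a *: u + v) x = a * u x + v x by [].
  by move: (ell e phi x) (ell e psi x) (u x) (v x) => *; ring.
have s1 := sqintB measurableT su (sq (tf_ell e tp)).
have s2 := sqintB measurableT sv (sq (tf_ell e tq)).
have s3 := sqintZ a measurableT s1.
apply: (le_trans (l2nD _ s3 s2)) => //; rewrite l2nZ// [leRHS](splitr eta).
apply: lerD => //; apply: (@le_trans _ _ ((`|a| + 1) * (eta / 2 / (`|a| + 1)))).
  by apply: ler_pM => //; [exact: l2n_ge0|rewrite lerDl].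
by rewrite mulrC divfK// gt_eqF.
Qed.

Let cl_hilb : shilb (E -> R).
Proof.
refine (@Shilb R (E -> R) cl (l2ip mu setT) cl0 clL _ _ _ _).
- by move=> u v _ _; exact: l2ipC.
- by move=> a u v w [su _] [sv _] [sw _]; exact: (@hipL _ _ (l2_hilb mu (@measurableT _ E))).
- by move=> u _; exact: l2ip_ge0.
- move=> u c clu hu.
  have [l sl [K hl]] := @hcomplete _ _ (l2_hilb mu (@measurableT _ E)) u c (fun k => proj1 (clu k)) hu.
  exists l; last by exists K.
  split => // eta eta0.
  have [k hk] : exists k, l2n mu setT (fun x => l x - u k x) <= eta / 2.
    apply/not_existsP => H; suff : (eta / 2) ^+ 2 <= 0.
      by rewrite leNgt exprn_gt0// divr_gt0.
    apply: (@quarter_small _ _ K) => k; apply: le_trans (hl k).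
    have /negP := H k; rewrite -ltNge => /ltW.
    have e20 : 0 <= eta / 2 by rewrite divr_ge0// ltW.
    move=> hk; have : (eta / 2) ^+ 2 <= l2n mu setT (fun x => l x - u k x) ^+ 2.
      by rewrite ler_pXn2r// ?nnegrE// l2n_ge0.
    move=> /le_trans; apply; rewrite l2n_sqr; rewrite /l2ip le_eqVlt; apply/orP; left; apply/eqP.
    apply: eq_Rintegral => x _; have -> : (u k - l) x = u k x - l x by [].
    by move: (u k x) (l x) => *; ring.
  have [sk clk] := clu k; have [|psi tp hp] := clk (eta / 2); first by rewrite divr_gt0.
  exists psi => //.
  have -> : (fun x => l x - ell e psi x) = fun x => (l x - u k x) + (u k x - ell e psi x).
    by apply/funext => x; rewrite addrA subrK.
  have s1 := sqintB measurableT sl sk; have s2 := sqintB measurableT sk (sq (tf_ell e tp)).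
  apply: (le_trans (l2nD _ s1 s2)) => //; rewrite [leRHS](splitr eta); exact: lerD.
Defined.

(** The closure [cl] of the range of [ell e] is itself a semi-Hilbert space, and the Riesz
    representative [g] of [f] in it is the orthogonal projection. [f - g] is orthogonal to the
    range, hence zero almost everywhere by [ell_orth]. *)
Lemma ell_dense f eta : sqint mu setT f -> 0 < eta ->
  exists2 psi, tf setT psi & l2n mu setT (fun x => f x - ell e psi x) <= eta.
Proof.
move=> sf eta0; have mT := @measurableT _ E.
have bl : blin cl_hilb (l2ip mu setT f) (l2n mu setT f).
  split; first exact: l2n_ge0.
    move=> a u v hu hv; have [su _] : cl u := hu; have [sv _] : cl v := hv.
    rewrite l2ipC (l2ipC mu setT f u) (l2ipC mu setT f v).
    exact: (@hipL _ _ (l2_hilb mu mT) a u v f su sv sf).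
  by move=> u hu; have [su _] : cl u := hu; exact: l2_CS.
have [g cg gv] := riesz_hip bl; have [sg hg] : cl g := cg.
have sfg := sqintB mT sf sg.
have fg0 : l2n mu setT (fun x => f x - g x) = 0.
  have ae0 : ae_eq mu setT (fun x => f x - g x) (cst 0).
    apply: (ell_orth e0 sfg) => psi tp; have se := sq (tf_ell e tp).
    have := gv _ (cl_ell tp) => /eqP; rewrite eq_sym -subr_eq0 => /eqP <-.
    rewrite /l2ip /= -RintegralB//; [|exact: sqintM|exact: sqintM].
    by apply: eq_Rintegral => x _; rewrite mulrBl.
  have s0 : sqint mu setT (cst 0) by exact: sqint0.
  rewrite /l2n (l2ip_ae_eq mT ae0 ae0 sfg s0 sfg s0) /l2ip.
  by under eq_Rintegral do rewrite mulr0; rewrite Rintegral_cst// mul0r sqrtr0.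
have [psi tp hp] := hg eta eta0; exists psi => //.
have -> : (fun x => f x - ell e psi x) = fun x => (f x - g x) + (g x - ell e psi x).
  by apply/funext => x; rewrite addrA subrK.
have s2 := sqintB mT sg (sq (tf_ell e tp)).
by apply: (le_trans (l2nD _ sfg s2)) => //; rewrite fg0 add0r.
Qed.

End density.

End elliptic.

Section step_bounds.
Variable R : realType.
Implicit Types t : R -> R.

Lemma derive_locally_cst t t' (c : R) (I : set R) x : open I -> I x ->
  (forall y, I y -> t y = c) -> is_derive x (1 : R) t (t' x) -> t' x = 0.
Proof.
move=> oI Ix tc dt; have : is_derive x (1 : R) t 0.
  apply: (near_eq_is_derive (f := fun=> c)); rewrite ?oner_neq0//.
  have : nbhs x I by apply: open_nbhs_nbhs.
  by apply: filterS => y /tc ->.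
by case: dt => _ <- [].
Qed.

Lemma derive_const_tails t t' (a b : R) : (forall x, x < 0 -> t x = a) -> (forall x, 1 < x -> t x = b) ->
  (forall x, is_derive x (1 : R) t (t' x)) ->
  (forall x, x < 0 -> t' x = 0) /\ (forall x, 1 < x -> t' x = 0).
Proof.
move=> ta tb dt; split => x hx.
  by apply: (@derive_locally_cst t t' a [set y | y < 0]) => //; exact: open_lt.
by apply: (@derive_locally_cst t t' b [set y | 1 < y]) => //; exact: open_gt.
Qed.

Lemma bounded_tails t : continuous t -> (forall x, x < 0 -> t x = 0) -> (forall x, 1 < x -> t x = 0) ->
  exists2 M, 0 <= M & forall x, `|t x| <= M.
Proof.
move=> ct t0 t1.
have cn : {within `[0, 1], continuous (fun x : R => `|t x|)}.
  apply: continuous_subspaceT => x; apply: (@continuous_comp _ _ _ t Num.norm); first exact: ct.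
  exact: norm_continuous.
have [c _ hc] := EVT_max ler01 cn.
exists `|t c| => // x; have [x0|x0] := ltP x 0; first by rewrite t0// normr0.
have [x1|x1] := ltP 1 x; first by rewrite t1// normr0.
by apply: hc; rewrite in_itv/= x0.
Qed.

Lemma step01_derive_bounded : exists t' t'' (B : R), [/\ 1 <= B,
  (forall x, is_derive x (1 : R) (@step01 R) (t' x)), (forall x, is_derive x (1 : R) t' (t'' x)),
  (forall x, `|t' x| <= B) & (forall x, `|t'' x| <= B)].
Proof.
have [t' dt [t'' dt' ct'']] := step01_C1 R 2.
have [z0 z1] : (forall x, x < 0 -> t' x = 0) /\ (forall x, 1 < x -> t' x = 0).
  apply: (derive_const_tails _ _ dt) => x hx; first by rewrite step01_eq0// ltW.
  by rewrite step01_eq1// ltW.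
have [w0 w1] := derive_const_tails z0 z1 dt'.
have [M M0 hM] := bounded_tails (is_derive1_cont dt') z0 z1.
have [M' M'0 hM'] := bounded_tails ct'' w0 w1.
exists t', t'', (1 + M + M'); split => //; first lra.
- by move=> x; apply: (le_trans (hM x)); lra.
- by move=> x; apply: (le_trans (hM' x)); lra.
Qed.

End step_bounds.

(** * Cutoffs adapted to a polytope *)

Section cutoffs.
Variables (R : realType) (n : nat).
Local Notation E := 'rV[R]_n.
Implicit Types (f g : E -> R).

(* [f] varies on the length scale [1 / L]. *)
Definition sbd (M L : R) f := [/\ smooth f, forall x, `|f x| <= M,
  forall i x, `|pd i f x| <= M * L & forall i j x, `|pd i (pd j f) x| <= M * L ^+ 2].

Lemma sbd_ge0 M L f : sbd M L f -> 0 <= M.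
Proof. by move=> [_ /(_ 0) h _ _]; exact: le_trans h. Qed.

Lemma sbd_mono M M' L L' f : 0 <= L -> M <= M' -> L <= L' -> sbd M L f -> sbd M' L' f.
Proof.
move=> L0 MM LL sf; have M0 := sbd_ge0 sf; have [s h0 h1 h2] := sf; split => //.
- by move=> x; exact: le_trans MM.
- by move=> i x; apply: le_trans (h1 i x) _; apply: ler_pM.
- move=> i j x; apply: le_trans (h2 i j x) _; apply: ler_pM => //; first exact: sqr_ge0.
  by rewrite ler_pXn2r ?nnegrE// (le_trans L0).
Qed.

Lemma pdM_smooth f g i : smooth f -> smooth g ->
  pd i (fun x => f x * g x) = fun x => pd i f x * g x + f x * pd i g x.
Proof. by move=> sf sg; apply/funext => x; rewrite pdM//; exact: smooth_derivable. Qed.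

Lemma pdD_smooth f g i : smooth f -> smooth g ->
  pd i (fun x => f x + g x) = fun x => pd i f x + pd i g x.
Proof. by move=> sf sg; apply/funext => x; rewrite pdD//; exact: smooth_derivable. Qed.

Lemma pdZ_smooth f i (c : R) : smooth f -> pd i (fun x => c * f x) = fun x => c * pd i f x.
Proof. by move=> sf; apply/funext => x; rewrite pdZ//; exact: smooth_derivable. Qed.

Lemma pdB_smooth f g i : smooth f -> smooth g ->
  pd i (fun x => f x - g x) = fun x => pd i f x - pd i g x.
Proof.
move=> sf sg; rewrite (pdD_smooth i sf (smoothN sg)); apply/funext => x.
by rewrite pdN//; exact: smooth_derivable.
Qed.

Lemma pdM2_smooth f g i j : smooth f -> smooth g ->
  pd i (pd j (fun x => f x * g x)) = fun x => pd i (pd j f) x * g x + pd j f x * pd i g x +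
    (pd i f x * pd j g x + f x * pd i (pd j g) x).
Proof.
move=> sf sg; rewrite (pdM_smooth j sf sg).
rewrite (pdD_smooth i (smoothM (smooth_pd j sf) sg) (smoothM sf (smooth_pd j sg))).
by rewrite (pdM_smooth i (smooth_pd j sf) sg) (pdM_smooth i sf (smooth_pd j sg)).
Qed.

(** The factor 4 counts the terms of a second derivative of a product. *)
Lemma sbdM M M' L f g : 0 <= L -> sbd M L f -> sbd M' L g ->
  sbd (4 * (M * M')) L (fun x => f x * g x).
Proof.
move=> L0 sf sg; have M0 := sbd_ge0 sf; have M'0 := sbd_ge0 sg.
have [s1 a0 a1 a2] := sf; have [s2 b0 b1 b2] := sg.
have MM : 0 <= M * M' by exact: mulr_ge0.
have mm (a b A B : R) : `|a| <= A -> `|b| <= B -> `|a * b| <= A * B.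
  by move=> h1 h2; rewrite normrM ler_pM.
split; first exact: smoothM.
- by move=> x; apply: le_trans (mm _ _ _ _ (a0 x) (b0 x)) _; lra.
- move=> i x; rewrite (pdM_smooth i s1 s2); apply: (le_trans (ler_normD _ _)).
  have := mm _ _ _ _ (a1 i x) (b0 x); have := mm _ _ _ _ (a0 x) (b1 i x).
  have : 0 <= M * M' * L by exact: mulr_ge0.
  lra.
- move=> i j x; rewrite (pdM2_smooth i j s1 s2).
  have h1 := mm _ _ _ _ (a2 i j x) (b0 x); have h2 := mm _ _ _ _ (a1 j x) (b1 i x).
  have h3 := mm _ _ _ _ (a1 i x) (b1 j x); have h4 := mm _ _ _ _ (a0 x) (b2 i j x).
  apply: (le_trans (ler_normD _ _)).
  have h5 := ler_normD (pd i (pd j f) x * g x) (pd j f x * pd i g x).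
  have h6 := ler_normD (pd i f x * pd j g x) (f x * pd i (pd j g) x).
  apply: le_trans (lerD h5 h6) _.
  apply: le_trans (lerD (lerD h1 h2) (lerD h3 h4)) _.
  by rewrite le_eqVlt; apply/orP; left; apply/eqP; ring.
Qed.

Lemma sbd_cst (c L : R) : 0 <= L -> sbd `|c| L (fun=> c).
Proof.
move=> L0; have h i : pd i (fun=> c) = (fun=> 0 : R) :> (E -> R).
  by apply/funext => x; rewrite pd_cst.
split; [exact: smooth_cst|by []|move=> i x|move=> i j x].
  by rewrite h normr0 mulr_ge0.
by rewrite h pd_cst normr0 mulr_ge0 ?sqr_ge0.
Qed.

Lemma sbd_oneB M L f : 0 <= L -> sbd M L f -> sbd (1 + M) L (fun x => 1 - f x).
Proof.
move=> L0 sf; have [s h0 h1 h2] := sf; have [c _ _ _] := sbd_cst 1 L0.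
have e i : pd i (fun x => 1 - f x) = fun x => - pd i f x.
  rewrite (pdB_smooth i c s); apply/funext => x; rewrite pd_cst sub0r//.
split; first exact: smoothB.
- by move=> x; apply: (le_trans (ler_normB _ _)); rewrite normr1 lerD2l.
- by move=> i x; rewrite e normrN; apply: le_trans (h1 i x) _; rewrite ler_wpM2r// ler_wpDl.
- move=> i j x; rewrite e pdN ?normrN; last by apply: smooth_derivable; exact: smooth_pd.
  by apply: le_trans (h2 i j x) _; rewrite ler_wpM2r ?sqr_ge0// ler_wpDl.
Qed.

Lemma sbd_prod (I : Type) (s : seq I) (F : I -> E -> R) (M L : R) : 0 <= L ->
  (forall i, sbd M L (F i)) -> sbd ((4 * M) ^+ size s) L (fun x => \prod_(i <- s) F i x).
Proof.
move=> L0 sF; elim: s => [|i s IH].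
  under [X in sbd _ _ X]eq_fun do rewrite big_nil.
  by have := sbd_cst 1 L0; rewrite normr1 expr0.
under [X in sbd _ _ X]eq_fun do rewrite big_cons.
by rewrite [size _]/= exprS -mulrA; exact: sbdM.
Qed.

Lemma pd_ridge (t t' : R -> R) (a : E) (b : R) i :
  (forall x, is_derive x (1 : R) t (t' x)) ->
  pd i (fun x => t (dot a x + b)) = fun x => a ord0 i * t' (dot a x + b).
Proof.
move=> dt; apply/funext => x.
have dotl (s : R) : dot a (x + s *: delta_mx ord0 i) = a ord0 i * s + dot a x.
  rewrite /dot (bigD1 i)//= [in RHS](bigD1 i)//= !mxE !eqxx mulr1 mulrDr addrA.
  rewrite [a ord0 i * s + _]addrC; congr (_ + _); apply: eq_bigr => j ji.
  by rewrite !mxE (negbTE ji) mulr0 addr0.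
have d : is_derive x (delta_mx ord0 i) (fun x => t (dot a x + b)) (t' (dot a x + b) * a ord0 i).
  apply/is_derive_line0; under [X in is_derive _ _ X]eq_fun do rewrite dotl -addrA.
  apply: (@is_derive1_comp R t (fun s => a ord0 i * s + (dot a x + b))).
    by rewrite mulr0 add0r.
  exact: is_derive_affine.
by case: d => _; rewrite mulrC => <-.
Qed.

Lemma sbd_step : exists2 B : R, 1 <= B & forall (a : E) (b c : R), 0 <= c ->
  (forall i, `|a ord0 i| <= c) -> sbd B c (fun x => step01 (dot a x + b)).
Proof.
have [t' [t'' [B [B1 d1 d2 b1 b2]]]] := step01_derive_bounded R.
exists B => // a b c c0 ac; split; first by move=> k; apply: Ck_ridge; exact: step01_C1.
- by move=> x; rewrite ger0_norm ?step01_ge0// (le_trans (step01_le1 _)).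
- by move=> i x; rewrite (pd_ridge _ _ _ d1) normrM mulrC ler_pM.
- move=> i j x; rewrite (pd_ridge _ _ _ d1).
  (* Smoothness of [t' (dot a x + b)] is read off from the derivative [a_j t' (dot a x + b)] of a
     smooth ridge function, which requires dividing by [a_j]. *)
  have [aj|aj] := eqVneq (a ord0 j) 0.
    have -> : (fun x => a ord0 j * t' (dot a x + b)) = fun=> 0 by apply/funext => y; rewrite aj mul0r.
    by rewrite pd_cst normr0 mulr_ge0 ?sqr_ge0// (le_trans _ B1).
  have sm : smooth (fun x : E => t' (dot a x + b)).
    have : smooth (fun x => a ord0 j * t' (dot a x + b)).
      by rewrite -(pd_ridge _ _ _ d1); apply: smooth_pd => k; apply: Ck_ridge; exact: step01_C1.
    move=> /(smoothZ (a ord0 j)^-1); congr smooth; apply/funext => y.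
    by rewrite mulrA mulVf// mul1r.
  rewrite (pdZ_smooth i (a ord0 j) sm) (pd_ridge _ _ _ d2).
  rewrite !normrM mulrA mulrC; apply: ler_pM => //; rewrite expr2; exact: ler_pM.
Qed.

Lemma sbd_scale (M A L : R) f : 1 <= A -> 0 <= L -> sbd M (A * L) f -> sbd (M * A ^+ 2) L f.
Proof.
move=> A1 L0 sf; have M0 := sbd_ge0 sf; have [s h0 h1 h2] := sf; split => //.
- by move=> x; apply: le_trans (h0 x) _; rewrite ler_peMr// expr_ge1// (le_trans ler01).
- move=> i x; apply: le_trans (h1 i x) _; rewrite mulrA; apply: ler_wpM2r => //.
  by apply: ler_wpM2l => //; rewrite expr2 ler_peMr// (le_trans ler01).
- by move=> i j x; apply: le_trans (h2 i j x) _; rewrite exprMn mulrA.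
Qed.

Section polytope_cutoff.
Variables (p : nat) (a : 'I_p -> E).

Definition opoly (t : R) : set E := [set x | forall i, dot (a i) x < t].
Definition cpoly (t : R) : set E := [set x | forall i, dot (a i) x <= t].

Definition pcut (s t : R) : E -> R := fun x =>
  \prod_(i < p) step01 ((t - dot (a i) x) / (t - s)).

(** [M] depends on the polytope but not on [s] and [t]: each factor has slope at most [A / (t - s)],
    and [sbd_scale] moves [A] into the constant. *)
Lemma pcut_sbd : exists2 M : R, 1 <= M & forall s t, s < t -> sbd M (t - s)^-1 (pcut s t).
Proof.
have [B B1 hB] := sbd_step.
pose A : R := 1 + \sum_(i < p) `|a i|.
have A1 : 1 <= A by rewrite lerDl sumr_ge0.
have B0 : 0 <= B by exact: le_trans B1.
have BA : 1 <= B * A ^+ 2.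
  by rewrite -[1]mulr1; apply: ler_pM => //; rewrite expr_ge1// (le_trans ler01).
exists ((4 * (B * A ^+ 2)) ^+ size (index_enum 'I_p)); first by rewrite exprn_ege1//; lra.
move=> s t st; have c0 : 0 < (t - s)^-1 by rewrite invr_gt0 subr_gt0.
have := @sbd_prod 'I_p (index_enum _) (fun i x => step01 ((t - dot (a i) x) / (t - s)))
  (B * A ^+ 2) (t - s)^-1 (ltW c0).
apply => i.
have -> : (fun x => step01 ((t - dot (a i) x) / (t - s))) =
    fun x => step01 (dot (- (t - s)^-1 *: a i) x + t / (t - s)).
  apply/funext => x; congr step01; rewrite mulrBl addrC; congr (_ + _).
  rewrite /dot mulr_suml -sumrN; apply: eq_bigr => k _; rewrite !mxE; ring.
apply: sbd_scale => //; first exact: ltW.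
apply: hB; first by rewrite mulr_ge0 ?(ltW c0)// (le_trans ler01).
move=> k; rewrite mxE normrM normrN (gtr0_norm c0) mulrC ler_wpM2r ?(ltW c0)//.
apply: (le_trans (coord_le _ _)); rewrite /A (bigD1 i)//=.
by rewrite addrCA lerDl addr_ge0// sumr_ge0.
Qed.

Lemma pcut_eq1 s t x : s < t -> cpoly s x -> pcut s t x = 1.
Proof.
move=> st h; apply: big1 => i _; apply: step01_eq1.
by rewrite ler_pdivlMr ?subr_gt0// mul1r lerD2l lerN2.
Qed.

Lemma pcut_eq0 s t x : s < t -> ~ opoly t x -> pcut s t x = 0.
Proof.
move=> st /existsNP[i /negP]; rewrite -leNgt => h; rewrite /pcut (bigD1 i)//= step01_eq0 ?mul0r//.
by rewrite mulr_le0_ge0 ?subr_le0// invr_ge0 subr_ge0 ltW.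
Qed.

End polytope_cutoff.

End cutoffs.

(** * Gradients in H^-1 and the local decomposition *)

Section fields.
Variables (R : realType) (n : nat).
Local Notation E := 'rV[R]_n.
Local Notation mu := (leb R n).
Local Notation L2 := (l2n mu setT).
Local Notation sq := (sqint mu setT).
Implicit Types (f g phi psi q : E -> R) (U V : set E) (v w : 'I_n -> E -> R).

Definition dv v : E -> R := fun x => \sum_(i < n) pd i (v i) x.
Definition tfv U v := forall i, tf U (v i).
(** A sum of L^2 norms in place of the Hilbert H^1 norm: it dominates the latter ([tf_flow]) and can
    be estimated term by term. *)
Definition h1s v : R := \sum_(i < n) (L2 (v i) + \sum_(j < n) L2 (pd j (v i))).

(* [N] bounds the H^-1 norm of the gradient of [q] on [U]. *)
Definition gradle U q (N : R) := forall v, tfv U v ->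
  `|\int[mu]_x (q x * dv v x)| <= N * h1s v.

(* The number of terms of [h1s]. *)
Definition nn : R := (n + n * n)%:R.

Lemma nn_ge0 : 0 <= nn. Proof. exact: ler0n. Qed.

Lemma h1s_ge0 v : 0 <= h1s v.
Proof. by apply: sumr_ge0 => i _; rewrite addr_ge0 ?l2n_ge0// sumr_ge0// => j _; exact: l2n_ge0. Qed.

Lemma h1s_le v (B : R) : (forall i, L2 (v i) <= B) -> (forall i j, L2 (pd j (v i)) <= B) ->
  h1s v <= nn * B.
Proof.
move=> h0 h1; rewrite /h1s; apply: (@le_trans _ _ (\sum_(i < n) (B + \sum_(j < n) B))).
  by apply: ler_sum => i _; apply: lerD => //; exact: ler_sum.
by rewrite big_split/= !sumr_const card_ord -mulrnA -mulrnDr mulr_natl.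
Qed.

Lemma gradle_sub U V q N : V `<=` U -> gradle U q N -> gradle V q N.
Proof. by move=> VU h v tv; apply: h => i; exact: tf_sub (tv i). Qed.

Lemma tf_sq U phi : tf U phi -> sq phi. Proof. exact: tf_sqint. Qed.

Lemma tf_dv U v : tfv U v -> tf U (dv v).
Proof. by move=> tv; apply: tf_sum => i; exact: tf_pd. Qed.

Lemma l2n_sbd (M L : R) X g : sbd M L X -> sq g -> L2 (fun x => X x * g x) <= M * L2 g.
Proof.
move=> [s h0 _ _] sg; apply: l2n_bounded => //; apply: cont_measurable; exact: smooth_cont.
Qed.

Lemma l2n0 : L2 (fun=> 0) = 0.
Proof. by rewrite /l2n /l2ip mulr0 Rintegral_cst// mul0r sqrtr0. Qed.

Lemma pd0 i : pd i (fun=> 0) = (fun=> 0) :> (E -> R).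
Proof. by apply/funext => x; rewrite pd_cst. Qed.

Lemma h1s0 : h1s (fun=> fun=> 0) = 0.
Proof.
by apply: big1 => i _; rewrite l2n0 add0r; apply: big1 => j _; rewrite pd0 l2n0.
Qed.

Lemma dv0 x : dv (fun=> fun=> 0) x = 0.
Proof. by apply: big1 => i _; rewrite pd_cst. Qed.

Lemma l2nD_le f g (A B : R) : sq f -> sq g -> L2 f <= A -> L2 g <= B ->
  L2 (fun x => f x + g x) <= A + B.
Proof. by move=> sf sg fA gB; apply: le_trans (l2nD measurableT sf sg) _; exact: lerD. Qed.

Lemma l2nZ_le f (c A : R) : sq f -> L2 f <= A -> L2 (fun x => c * f x) <= `|c| * A.
Proof. by move=> sf fA; rewrite (l2nZ measurableT c sf) ler_wpM2l. Qed.

Lemma l2n_sum_le (I : finType) (F : I -> E -> R) (A : R) : (forall i, sq (F i)) ->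
  (forall i, L2 (F i) <= A) -> L2 (fun x => \sum_i F i x) <= #|I|%:R * A.
Proof.
move=> sF FA; apply: (le_trans (l2n_sum measurableT (index_enum I) sF)).
by apply: (@le_trans _ _ (\sum_(i : I) A)); [exact: ler_sum|rewrite sumr_const mulr_natl].
Qed.

Lemma l2nM_le f g (M A : R) : continuous f -> (forall x, `|f x| <= M) -> sq g -> L2 g <= A ->
  L2 (fun x => f x * g x) <= M * A.
Proof.
move=> cf fM sg gA; apply: (@le_trans _ _ (M * L2 g)).
  by apply: l2n_bounded => //; exact: cont_measurable.
by apply: ler_wpM2l => //; exact: le_trans (fM 0).
Qed.

(* [w] is a cutoff times [- e^2 grad psi], where [psi - e^2 lap psi] is close to
   [f]. *)
Lemma local_decomposition (M : R) : 0 <= M -> exists2 C : R, 0 <= C &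
  forall (e : R) X f (eta : R) A V, 0 < e -> e <= 1 -> sbd M e^-1 X ->
  compact A -> A `<=` V -> (forall x, ~ A x -> X x = 0) ->
  sq f -> (forall x, X x * f x = f x) -> 0 < eta ->
  exists w r, [/\ tfv V w, tf V r, (forall x, ~ A x -> r x = 0 /\ forall i, w i x = 0),
    L2 (fun x => f x - (dv w x + r x)) <= eta &
    [/\ h1s w <= C * L2 f, L2 r <= C * L2 f & forall l, L2 (pd l r) <= C * L2 f / e]].
Proof.
move=> M0; exists (nn * (6 * M) + M * (6 * n%:R + 6)).
  by rewrite addr_ge0// ?mulr_ge0 ?nn_ge0// ?addr_ge0 ?mulr_ge0 ?ler0n.
move=> e X f eta A V e0 e1 sX cA AV XA sf Xf eta0.
have [f0|f0] := eqVneq (L2 f) 0.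
  exists (fun=> fun=> 0), (fun=> 0); split => //; try by move=> *; exact: tf0.
    under [fun x => _]eq_fun do rewrite dv0 addr0 subr0.
    by rewrite f0 ltW.
  by split => [||l]; rewrite f0 ?h1s0 ?pd0 ?l2n0 mulr0 ?mul0r.
have {}f0 : 0 < L2 f by rewrite lt_neqAle eq_sym f0 l2n_ge0.
(* The first bound keeps |ell e psi| below 2 |f|; the second leaves an error [eta] after
   multiplication by the cutoff, which is at most [M]. *)
pose eta' := Num.min (L2 f) (eta / (M + 1)).
have eta'0 : 0 < eta' by rewrite lt_min f0 divr_gt0// ltr_wpDl.
have [psi tp hp] := ell_dense e0 sf eta'0.
have [E0 E1] := ell_energy e tp; have E2 i j := ell_energy2 e i j tp.
have te := tf_ell e tp.
have sp := tf_smooth tp; have [smX X0 X1 X2] := sX.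
pose L := L2 (ell e psi).
have LL : L <= 2 * L2 f.
  have -> : L = L2 (fun x => f x - (f x - ell e psi x)).
    by congr (L2 _); apply/funext => x; rewrite subKr.
  apply: (le_trans (l2nB _ sf (sqintB _ sf (tf_sq te)))) => //.
  have : eta' <= L2 f by rewrite ge_min lexx.
  by move: hp; set t := L2 (fun x => _); lra.
have L0 : 0 <= L by exact: l2n_ge0.
have tX g : smooth g -> tf V (fun x => X x * g x).
  move=> sg; split; first exact: smoothM.
  by exists A; split => // x /XA ->; rewrite mul0r.
have clA := compact_closed_rV cA.
have dXA i x : ~ A x -> pd i X x = 0 by exact: pd_off.
have tdX i g : smooth g -> tf V (fun x => pd i X x * g x).
  move=> sg; split; first by apply: smoothM => //; exact: smooth_pd.
  by exists A; split => // x /dXA ->; rewrite mul0r.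
(* [X (psi - e^2 Lap psi) = - e^2 div (X grad psi) + (X psi + e^2 grad X . grad psi)]: the first
   part is [dv w], the second is [r], which contains no second derivative of [psi]. *)
pose w (i : 'I_n) x := - e ^+ 2 * (X x * pd i psi x).
pose r x := X x * psi x + e ^+ 2 * \sum_(i < n) pd i X x * pd i psi x.
have tr1 : tf V (fun x => X x * psi x) by exact: tX.
have tr2 i : tf V (fun x => pd i X x * pd i psi x) by apply: tdX; exact: smooth_pd.
have tw i : tf V (fun x => X x * pd i psi x) by apply: tX; exact: smooth_pd.
exists w, r; split.
- by move=> i; apply: tfZ.
- by apply: tfD => //; apply: tfZ; exact: tf_sum.
- move=> x nA; split; last by move=> i; rewrite /w XA// mul0r mulr0.
  by rewrite /r XA// mul0r add0r big1 ?mulr0// => i _; rewrite dXA// mul0r.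
- have -> : (fun x => f x - (dv w x + r x)) = fun x => X x * (f x - ell e psi x).
    apply/funext => x.
    have -> : dv w x = - e ^+ 2 * (\sum_(i < n) pd i X x * pd i psi x + X x * lap psi x).
      rewrite /dv /lap mulr_sumr -big_split/= mulr_sumr; apply: eq_bigr => i _.
      by rewrite (pdZ_smooth i _ (tf_smooth (tw i))) (pdM_smooth i smX (smooth_pd i sp)).
    rewrite mulrBr Xf /ell /r; move: (\sum_(i < n) _) (lap psi x) (X x) (psi x) (f x) => *; ring.
  apply: (le_trans (l2n_sbd sX (sqintB measurableT sf (tf_sq te)))).
  apply: (@le_trans _ _ (M * (eta / (M + 1)))).
    by apply: ler_wpM2l => //; apply: le_trans hp _; rewrite ge_min lexx orbT.
  rewrite mulrA ler_pdivrMr ?ltr_wpDl// mulrC; apply: ler_wpM2l; [exact: ltW|lra].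
- have e'0 : e != 0 by rewrite gt_eqF.
  have D1 i : L2 (pd i psi) <= L / e.
    by rewrite ler_pdivlMr// mulrC; apply: E1; exact: ltW.
  have D2 i j : L2 (pd i (pd j psi)) <= 2 * L / e ^+ 2.
    by rewrite ler_pdivlMr ?exprn_gt0// mulrC; exact: E2.
  have c0 : continuous X by exact: smooth_cont.
  have c1 i : continuous (pd i X) by apply: smooth_cont; exact: smooth_pd.
  have c2 i j : continuous (pd i (pd j X)) by apply: smooth_cont; do 2 apply: smooth_pd.
  have s0 := tf_sq tp; have s1 i := tf_sq (tf_pd i tp).
  have s2 i j := tf_sq (tf_pd i (tf_pd j tp)).
  have sp1 i := smooth_pd i sp; have sX1 i := smooth_pd i smX.
  have e20 : 0 <= e ^+ 2 by exact: sqr_ge0.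
  have ML0 : 0 <= M * L by exact: mulr_ge0.
  have MLf : M * L <= 2 * (M * L2 f) by rewrite mulrCA ler_wpM2l.
  have Mf0 : 0 <= M * L2 f by rewrite mulr_ge0// ltW.
  have nM0 : 0 <= n%:R * (M * L2 f) by rewrite mulr_ge0 ?ler0n.
  have nML : n%:R * (M * L) <= 2 * (n%:R * (M * L2 f)) by rewrite [leRHS]mulrCA ler_wpM2l ?ler0n.
  have nnf : 0 <= nn * (6 * M) * L2 f.
    by rewrite -mulrA mulr_ge0 ?nn_ge0// -mulrA mulr_ge0.
  have small : M * L + n%:R * (3 * (M * L)) + M * L <= (nn * (6 * M) + M * (6 * n%:R + 6)) * L2 f.
    have -> : (nn * (6 * M) + M * (6 * n%:R + 6)) * L2 f =
      nn * (6 * M) * L2 f + 6 * (n%:R * (M * L2 f)) + 6 * (M * L2 f) by ring.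
    rewrite mulrCA; lra.
  have w1 i : L2 (w i) <= 3 * (M * L).
    have h := l2nZ_le (- e ^+ 2) (tf_sq (tw i)) (l2nM_le c0 X0 (s1 i) (D1 i)).
    apply: (le_trans h); rewrite normrN ger0_norm//.
    have -> : e ^+ 2 * (M * (L / e)) = e * (M * L) by field.
    have := ler_wpM2r ML0 e1; lra.
  have w2 i l : L2 (pd l (w i)) <= 3 * (M * L).
    rewrite (pdZ_smooth l _ (tf_smooth (tw i))) (pdM_smooth l smX (sp1 i)).
    have t1 := tf_sq (tdX l _ (sp1 i)); have t2 := tf_sq (tX _ (smooth_pd l (sp1 i))).
    have h := l2nD_le t1 t2 (l2nM_le (c1 l) (X1 l) (s1 i) (D1 i)) (l2nM_le c0 X0 (s2 l i) (D2 l i)).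
    have := l2nZ_le (- e ^+ 2) (sqintD measurableT t1 t2) h.
    move=> /le_trans; apply; rewrite normrN ger0_norm// le_eqVlt; apply/orP; left; apply/eqP.
    by field.
  split.
  + apply: (le_trans (h1s_le w1 w2)).
    have -> : (nn * (6 * M) + M * (6 * n%:R + 6)) * L2 f =
      nn * (6 * (M * L2 f)) + (6 * (n%:R * (M * L2 f)) + 6 * (M * L2 f)) by ring.
    by apply: ler_wpDr; [lra|apply: ler_wpM2l; [exact: nn_ge0|lra]].
  + have hS : L2 (fun x => \sum_(i < n) pd i X x * pd i psi x) <= n%:R * (M / e * (L / e)).
      have := l2n_sum_le (fun i => tf_sq (tr2 i)) (fun i => l2nM_le (c1 i) (X1 i) (s1 i) (D1 i)).
      by rewrite card_ord.
    have tS := tf_sq (tf_sum (index_enum 'I_n) tr2).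
    have := l2nD_le (tf_sq tr1) (sqintZ (e ^+ 2) measurableT tS) (l2nM_le c0 X0 s0 E0)
      (l2nZ_le (e ^+ 2) tS hS).
    move=> /le_trans; apply; rewrite (ger0_norm e20); apply: le_trans small; rewrite -/L.
    have -> : e ^+ 2 * (n%:R * (M / e * (L / e))) = n%:R * (M * L) by field.
    have : 0 <= n%:R * (M * L) by rewrite mulr_ge0 ?ler0n.
    by rewrite [n%:R * (3 * _)]mulrCA; lra.
  + move=> l; pose S i x := pd l (pd i X) x * pd i psi x + pd i X x * pd l (pd i psi) x.
    have tA i : tf V (fun x => pd l (pd i X) x * pd i psi x).
      split; first by apply: smoothM => //; exact: smooth_pd.
      by exists A; split => // x nA; rewrite (pd_off l clA (dXA i))// mul0r.
    have tB i : tf V (fun x => pd i X x * pd l (pd i psi) x) by apply: tdX; exact: smooth_pd.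
    have -> : pd l r = fun x => (pd l X x * psi x + X x * pd l psi x) + e ^+ 2 * \sum_(i < n) S i x.
      rewrite /r (pdD_smooth l (tf_smooth tr1)); last first.
        by apply: smoothZ; apply: smooth_sum => i; exact: tf_smooth (tr2 i).
      rewrite (pdM_smooth l smX sp) (pdZ_smooth l (e ^+ 2) (tf_smooth (tf_sum (index_enum 'I_n) tr2))).
      apply/funext => x; rewrite pd_sum; last by move=> i; exact: tf_smooth (tr2 i).
      congr (_ + _ * _); apply: eq_bigr => i _.
      by rewrite (pdM_smooth l (sX1 i) (sp1 i)).
    have hS : L2 (fun x => \sum_(i < n) S i x) <=
        n%:R * (M * e^-1 ^+ 2 * (L / e) + M / e * (2 * L / e ^+ 2)).
      have hA i := l2nM_le (c2 l i) (X2 l i) (s1 i) (D1 i).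
      have hB i := l2nM_le (c1 i) (X1 i) (s2 l i) (D2 l i).
      have := l2n_sum_le (fun i => tf_sq (tfD (tA i) (tB i)))
        (fun i => l2nD_le (tf_sq (tA i)) (tf_sq (tB i)) (hA i) (hB i)).
      by rewrite card_ord.
    have tS := tf_sq (tf_sum (index_enum 'I_n) (fun i => tfD (tA i) (tB i))).
    have t1 := tf_sq (tdX l _ sp); have t2 := tf_sq (tX _ (sp1 l)).
    have h0 := l2nD_le t1 t2 (l2nM_le (c1 l) (X1 l) s0 E0) (l2nM_le c0 X0 (s1 l) (D1 l)).
    have := l2nD_le (sqintD measurableT t1 t2) (sqintZ (e ^+ 2) measurableT tS) h0
      (l2nZ_le (e ^+ 2) tS hS).
    move=> /le_trans; apply; rewrite (ger0_norm e20) -/L.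
    have -> : M / e * L + M * (L / e) + e ^+ 2 *
       (n%:R * (M * e^-1 ^+ 2 * (L / e) + M / e * (2 * L / e ^+ 2))) =
      (M * L + n%:R * (3 * (M * L)) + M * L) / e by field.
    by apply: ler_wpM2r small; rewrite invr_ge0 ltW.
Qed.

End fields.

(** * Exchanging integrals against a bounded kernel *)

Section kernel_fubini.
Context d1 d2 (T1 : measurableType d1) (T2 : measurableType d2) (R : realType).
Variables (m1 : {sigma_finite_measure set T1 -> \bar R}).
Variables (m2 : {sigma_finite_measure set T2 -> \bar R}).
Variables (A : T1 -> R) (B : T2 -> R) (k : T1 * T2 -> R) (M : R).
Hypothesis iA : m1.-integrable setT (EFin \o A).
Hypothesis iB : m2.-integrable setT (EFin \o B).
Hypothesis mk : measurable_fun setT k.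
Hypothesis kM : forall z, `|k z| <= M.

Let f (z : T1 * T2) : \bar R := (A z.1 * B z.2 * k z)%:E.

Let mA : measurable_fun setT A. Proof. exact: integrable_mfun iA. Qed.
Let mB : measurable_fun setT B. Proof. exact: integrable_mfun iB. Qed.

Let mf : measurable_fun setT f.
Proof.
apply/measurable_EFinP; apply: measurable_funM => //.
by apply: measurable_funM; apply: measurableT_comp.
Qed.

Let iBk x : m2.-integrable setT (EFin \o (fun y => B y * k (x, y))).
Proof.
apply: (@integrable_le _ _ _ m2 setT _ (fun y => M * `|B y|)) => //.
- by apply: measurable_funM => //; apply: measurableT_comp => //; exact: measurable_pair1.
- by apply: integrableRZ => //; exact: integrable_norm.
- by move=> y _; rewrite normrM mulrC ler_wpM2r.
Qed.

Let iAk y : m1.-integrable setT (EFin \o (fun x => A x * k (x, y))).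
Proof.
apply: (@integrable_le _ _ _ m1 setT _ (fun x => M * `|A x|)) => //.
- by apply: measurable_funM => //; apply: measurableT_comp => //; exact: measurable_pair2.
- by apply: integrableRZ => //; exact: integrable_norm.
- by move=> x _; rewrite normrM mulrC ler_wpM2r.
Qed.

Let fi : (m1 \x m2)%E.-integrable setT f.
Proof.
apply/integrable12ltyP => //.
pose b := \int[m2]_y `|B y|.
have bE : (\int[m2]_y (`|B y|)%:E = b%:E)%E.
  by rewrite /b /Rintegral fineK//; apply: integrable_fin_num => //; exact: integrable_norm.
have nA : m1.-integrable setT (EFin \o (fun x => M * b * `|A x|)).
  by apply: integrableRZ => //; exact: integrable_norm.
apply: (@le_lt_trans _ _ (\int[m1]_x (M * b * `|A x|)%:E)%E); last first.
  have := integrable_fin_num measurableT nA; rewrite ge0_fin_numE//.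
  apply: integral_ge0 => x _; rewrite lee_fin mulr_ge0// mulr_ge0//.
    by exact: le_trans (kM (x, point)).
  by apply: Rintegral_ge0.
apply: ge0_le_integral => //.
- by move=> x _; exact: integral_ge0.
- have mfa : measurable_fun setT (abse \o f) by exact: measurableT_comp.
  by apply: (@measurable_fun_fubini_tonelli_F _ _ T1 T2 R m2 (abse \o f) mfa) => z; exact: abse_ge0.
- by apply/measurable_EFinP; exact: integrable_mfun nA.
- move=> x _.
  apply: (@le_trans _ _ (\int[m2]_y (M * `|A x| * `|B y|)%:E)%E).
    apply: ge0_le_integral => //.
    + apply: measurableT_comp => //; apply: measurableT_comp => //; exact: measurable_pair1.
    + by apply/measurable_EFinP; apply: measurable_funM => //; exact: measurableT_comp.
    + move=> y _; rewrite /f /= lee_fin !normrM mulrC.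
      by rewrite mulrA ler_wpM2r// ler_wpM2r.
  under eq_integral do rewrite EFinM.
  rewrite ge0_integralZl//; last 2 first.
    by apply/measurable_EFinP; exact: measurableT_comp.
    by rewrite lee_fin mulr_ge0// (le_trans _ (kM (x, point))).
  by rewrite bE -EFinM lee_fin mulrAC.
Qed.

Lemma kernel_fubini :
  \int[m1]_x (A x * \int[m2]_y (B y * k (x, y))) =
  \int[m2]_y (B y * \int[m1]_x (A x * k (x, y))).
Proof.
rewrite [LHS]/Rintegral [RHS]/Rintegral; congr fine.
transitivity (\int[m1]_x \int[m2]_y f (x, y))%E.
  apply: eq_integral => x _; rewrite -RintZ// /Rintegral fineK; last first.
    by apply: integrable_fin_num => //; exact: integrableRZ.
  by apply: eq_integral => y _; rewrite /f /= mulrA.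
rewrite (Fubini fi); apply: eq_integral => y _; rewrite -RintZ// /Rintegral fineK; last first.
  by apply: integrable_fin_num => //; exact: integrableRZ.
by apply: eq_integral => x _; rewrite /f /= mulrCA mulrA.
Qed.

End kernel_fubini.

Lemma MVT01 (R : realType) (h dh : R -> R) (b : R) : 0 <= b ->
  (forall s, 0 <= s <= b -> is_derive s (1 : R) h (dh s)) ->
  exists2 s, 0 <= s <= b & h b - h 0 = b * dh s.
Proof.
rewrite le_eqVlt => /orP[/eqP <- _|b0 hd].
  by exists 0; rewrite ?lexx// subrr mul0r.
have cn : {within `[0, b], continuous h}.
  apply: derivable_within_continuous => x; rewrite in_itv/= => /hd; by case.
have [|s] := @MVT R h dh 0 b b0 _ cn.
  by move=> x; rewrite in_itv/= => /andP[x0 xb]; apply: hd; rewrite !ltW.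
rewrite in_itv/= subr0 => /andP[s0 sb] e; exists s; first by rewrite !ltW.
by rewrite e mulrC.
Qed.

Lemma Rint_norm_le d (T : measurableType d) (R : realType) (mu : {measure set T -> \bar R})
    (D : set T) (f g : T -> R) : measurable D ->
  mu.-integrable D (EFin \o f) -> mu.-integrable D (EFin \o g) ->
  (forall x, D x -> `|f x| <= g x) -> `|\int[mu]_(x in D) f x| <= \int[mu]_(x in D) g x.
Proof.
move=> mD fi gi fg; apply: le_trans (le_normr_Rintegral mD fi) _.
apply: le_Rintegral => //; exact: integrable_norm.
Qed.

Lemma weighted_mean_le d (T : measurableType d) (R : realType) (mu : {measure set T -> \bar R})
    (w f : T -> R) (c K : R) :
  mu.-integrable setT (EFin \o w) -> mu.-integrable setT (EFin \o (fun x => w x * f x)) ->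
  (forall x, w x != 0 -> `|f x - c| <= K) ->
  `|\int[mu]_x (w x * f x) - (\int[mu]_x w x) * c| <= K * \int[mu]_x `|w x|.
Proof.
move=> iw iwf h; have inw := integrable_norm iw.
rewrite mulrC -(RintZ c measurableT iw) -RintegralB//; last exact: integrableRZ.
rewrite -(RintZ K measurableT inw); apply: Rint_norm_le => //.
- by apply: integrableRB => //; exact: integrableRZ.
- exact: integrableRZ.
- move=> x _; rewrite [c * _]mulrC -mulrBr normrM mulrC.
  rewrite -[(_ \o w) x]/(`|w x|).
  have [->|wx] := eqVneq (w x) 0; first by rewrite normr0 !mulr0.
  by apply: ler_wpM2r => //; exact: h.
Qed.

(** * Moving mass by divergences *)

Section hops.
Variables (R : realType) (n : nat).
Local Notation E := 'rV[R]_n.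
Local Notation mu := (leb R n).
Local Notation L2 := (l2n mu setT).
Local Notation sq := (sqint mu setT).
Implicit Types (f g phi psi q : E -> R) (U V : set E) (v w : 'I_n -> E -> R).

Definition h1f phi : R := L2 phi + \sum_(j < n) L2 (pd j phi).

Lemma h1f_ge0 phi : 0 <= h1f phi.
Proof. by rewrite addr_ge0 ?l2n_ge0// sumr_ge0// => j _; exact: l2n_ge0. Qed.

Lemma tf_shiftU U phi (a : E) : tf U phi -> tf [set x | U (x + a)] (fun x => phi (x + a)).
Proof.
move=> /(tf_affine a (oner_neq0 R)).
under [X in tf _ X -> _]eq_fun do rewrite scale1r.
by apply: tf_sub => x /=; rewrite scale1r.
Qed.

(** The derivative in [t] of [phi (y + x + t z)] is the divergence in [y] of the field
    [z phi (y + x + t z)], so [gradle] bounds it. The mean value theorem leaves a single [t]. *)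
Lemma hop_shift U q N phi (x z : E) : 0 <= N -> sq q -> gradle U q N -> tf setT phi ->
  (forall t, 0 <= t <= 1 -> tf U (fun y => phi (y + (x + t *: z)))) ->
  `|mavg q phi (x + z) - mavg q phi x| <= N * (n%:R * `|z| * h1f phi).
Proof.
move=> N0 sqq gq tp tU; have sp := tf_smooth tp.
have [s s01] := MVT01 ler01 (fun s _ => is_derive_mavg sqq x z s tp).
rewrite scale1r scale0r addr0 mul1r => ->.
pose v (i : 'I_n) y := z ord0 i * phi (y + (x + s *: z)).
have tv : tfv U v by move=> i; apply: tfZ; exact: tU.
have ts := tf_shift (x + s *: z) tp.
have -> : mavg q (fun y => \sum_(i < n) z ord0 i * pd i phi y) (x + s *: z) =
    \int[mu]_y (q y * dv v y).
  apply: eq_Rintegral => y _; congr (_ * _); apply: eq_bigr => i _.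
  by rewrite (pdZ_smooth i (z ord0 i) (tf_smooth ts)) pd_shift.
apply: (le_trans (gq _ tv)); apply: ler_wpM2l => //.
apply: (@le_trans _ _ (\sum_(i < n) (`|z| * h1f phi))); last first.
  by rewrite sumr_const card_ord -mulrA mulr_natl.
apply: ler_sum => i _.
have -> : L2 (v i) = `|z ord0 i| * L2 phi.
  by rewrite (l2nZ measurableT (z ord0 i) (tf_sq ts)) (l2n_shift _ tp).
have -> : \sum_(j < n) L2 (pd j (v i)) = `|z ord0 i| * \sum_(j < n) L2 (pd j phi).
  rewrite mulr_sumr; apply: eq_bigr => j _.
  rewrite (pdZ_smooth j (z ord0 i) (tf_smooth ts)) (l2nZ measurableT (z ord0 i) (tf_sq (tf_pd j ts))).
  have -> : pd j (fun y => phi (y + (x + s *: z))) = fun y => pd j phi (y + (x + s *: z)).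
    by apply/funext => y; rewrite pd_shift.
  by rewrite (l2n_shift _ (tf_pd j tp)).
by rewrite -mulrDr; apply: ler_wpM2r; [exact: h1f_ge0|exact: coord_le].
Qed.

Lemma measurable_rV_sub (f g : E * E -> E) : measurable_fun setT f -> measurable_fun setT g ->
  measurable_fun setT (fun z => f z - g z).
Proof.
move=> mf mg; apply: measurable_to_rV => i.
under [X in measurable_fun _ X]eq_fun do rewrite !mxE.
by apply: measurable_funB; apply: (@measurableT_comp _ _ _ _ _ _
  (fun x : E => x ord0 i : measurableTypeR R)) => //; exact: measurable_rV_coord.
Qed.

Lemma measurable_rV_add (f g : E * E -> E) : measurable_fun setT f -> measurable_fun setT g ->
  measurable_fun setT (fun z => f z + g z).
Proof.
move=> mf mg; apply: measurable_to_rV => i.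
under [X in measurable_fun _ X]eq_fun do rewrite !mxE.
by apply: measurable_funD; apply: (@measurableT_comp _ _ _ _ _ _
  (fun x : E => x ord0 i : measurableTypeR R)) => //; exact: measurable_rV_coord.
Qed.

Section core.
Variables (U V : set E) (q r om : E -> R) (N s D : R) (y0 : E).
Hypothesis N0 : 0 <= N.
Hypothesis sqq : sq q.
Hypothesis iq : mu.-integrable setT (EFin \o q).
Hypothesis gq : gradle U q N.
Hypothesis tr : tf V r.
Hypothesis Vy0 : V y0.
Hypothesis starV : forall y t, V y -> 0 <= t <= 1 -> V (y0 + t *: (y - y0)).
Hypothesis VU : forall x z, V x -> `|z| <= s -> U (x + z).
Hypothesis VD : forall x, V x -> `|x - y0| <= D.
Hypothesis tom : tf (cball s) om.
Hypothesis om_even : forall x, om (- x) = om x.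
Hypothesis om_ge0 : forall x, 0 <= om x.
Hypothesis om1 : \int[mu]_x om x = 1.

Let T z := mavg q r z.
Let G y := mavg q om (- y).

Let mavg_fubini : \int[mu]_z (om z * T z) = \int[mu]_y (r y * G y).
Proof.
have [Mr Mr0 hr] := tf_bounded tr; have [Mo Mo0 ho] := tf_bounded tom.
have io := tf_integrable tom; have ir := tf_integrable tr.
have cr : measurable_fun setT r by apply: cont_measurable; exact: tf_cont tr.
have co : measurable_fun setT om by apply: cont_measurable; exact: tf_cont tom.
have k1 : measurable_fun setT (fun z : E * E => r (z.2 + z.1)).
  apply: (measurableT_comp cr); apply: measurable_rV_add; [exact: measurable_snd|exact: measurable_fst].
have k2 : measurable_fun setT (fun z : E * E => om (z.2 - z.1)).
  apply: (measurableT_comp co); apply: measurable_rV_sub; [exact: measurable_snd|exact: measurable_fst].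
rewrite /T /mavg (kernel_fubini io iq k1 (fun z => hr _)).
have inner x : \int[mu]_z (om z * r (x + z)) = \int[mu]_y (r y * om (y - x)).
  have tF : tf (cball s) (fun z => om z * r (x + z)).
    apply: tfMr => //; rewrite (_ : (fun z => r (x + z)) = fun z => r (z + x)).
      by apply: tf_smooth; apply: tf_shift; exact: tf_setT tr.
    by apply/funext => z; rewrite addrC.
  rewrite -(Rintegral_shift (- x) (tf_integrable tF)); apply: eq_Rintegral => y _.
  by rewrite [x + _]addrC subrK mulrC.
under eq_Rintegral do rewrite /= inner.
rewrite (kernel_fubini iq ir k2 (fun z => ho _)); apply: eq_Rintegral => y _; congr (_ * _).
by rewrite /G /mavg; apply: eq_Rintegral => x _ /=; rewrite -om_even opprB.
Qed.

Let mavg_measurable phi : tf setT phi -> measurable_fun setT (mavg q phi).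
Proof.
move=> tp; have [L L0 hL] := mavg_lipschitz sqq tp.
exact: cont_measurable (lipschitz_continuous L0 hL).
Qed.

(** Two moves. First [r] is replaced by the mean of its translates by [|z| <= s], weighted by [om];
    by Fubini and the evenness of [om], [q] against this mean is [int r G], where [G y] is the mean
    of [q] against the bump centred at [y]. Then [G y] is compared with [G y0] along the segment
    from [y0] to [y], which stays in [V]. *)
Lemma core_estimate : `|\int[mu]_x (q x * r x) - (\int[mu]_x r x) * mavg q om (- y0)| <=
  N * (n%:R * s * h1f r + (\int[mu]_x `|r x|) * (n%:R * D * h1f om)).
Proof.
have io := tf_integrable tom; have ir := tf_integrable tr.
have tr' := tf_setT tr; have tom' := tf_setT tom.
have V0 : 0 <= D by apply: le_trans (VD Vy0).
pose MT := l2n mu setT q * l2n mu setT r; pose MG := l2n mu setT q * l2n mu setT om.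
have hT z : `|T z| <= MT by exact: mavg_bound.
have hG y : `|G y| <= MG by exact: mavg_bound.
have ioT : mu.-integrable setT (EFin \o (fun z => om z * T z)).
  apply: (@integrable_le _ _ _ mu setT _ (fun z => MT * om z)) => //.
  - by apply: measurable_funM; [exact: integrable_mfun io|exact: mavg_measurable].
  - exact: integrableRZ.
  - by move=> z _; rewrite normrM mulrC (ger0_norm (om_ge0 z)) ler_wpM2r.
have irG : mu.-integrable setT (EFin \o (fun y => r y * G y)).
  apply: (@integrable_le _ _ _ mu setT _ (fun z => MG * `|r z|)) => //.
  - apply: measurable_funM; first exact: integrable_mfun ir.
    have [L L0 hL] := mavg_lipschitz sqq tom'.
    apply: cont_measurable; apply: (lipschitz_continuous L0) => x v.
    by rewrite /G opprD -[`|v|]normrN; exact: hL.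
  - by apply: integrableRZ => //; exact: integrable_norm.
  - by move=> z _; rewrite normrM mulrC ler_wpM2r.
have hTz z : om z != 0 -> `|T z - T 0| <= N * (n%:R * s * h1f r).
  move=> oz; have zs : cball s z by apply: contrapT => /(tf_off tom) h; rewrite h eqxx in oz.
  have := @hop_shift U q N r 0 z N0 sqq gq tr'; rewrite add0r => hs.
  apply: (le_trans (hs _)).
    move=> t /andP[t0 t1]; apply: tf_sub (tf_shiftU (0 + t *: z) tr) => y /= Vy.
    rewrite -[y](addrK (0 + t *: z)); apply: VU => //.
    rewrite add0r normrN normrZ ger0_norm//; apply: le_trans zs; exact: ler_piMl.
  apply: ler_wpM2l => //; apply: ler_wpM2r; first exact: h1f_ge0.
  by apply: ler_wpM2l zs; exact: ler0n.
have hGy y : r y != 0 -> `|G y - G y0| <= N * (n%:R * D * h1f om).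
  move=> ry; have Vy : V y by apply: contrapT => /(tf_off tr) h; rewrite h eqxx in ry.
  have := @hop_shift U q N om (- y0) (y0 - y) N0 sqq gq tom'; rewrite addKr => hs.
  apply: (le_trans (hs _)).
    move=> t t01; apply: tf_sub (tf_shiftU (- y0 + t *: (y0 - y)) tom) => x /= hx.
    have := VU (starV Vy t01) hx.
    have -> // : y0 + t *: (y - y0) + (x + (- y0 + t *: (y0 - y))) = x.
    by rewrite -[y0 - y]opprB scalerN -opprD addrC subrK.
  apply: ler_wpM2l => //; apply: ler_wpM2r; first exact: h1f_ge0.
  by apply: ler_wpM2l; [exact: ler0n|rewrite distrC; exact: VD].
have e1 := weighted_mean_le io ioT hTz; have e2 := weighted_mean_le ir irG hGy.
have no : \int[mu]_x `|om x| = 1.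
  by rewrite -[RHS]om1; apply: eq_Rintegral => x _; rewrite ger0_norm.
have T0 : T 0 = \int[mu]_x (q x * r x) by apply: eq_Rintegral => x _; rewrite addr0.
rewrite om1 mul1r no mulr1 mavg_fubini T0 distrC in e1.
move: e1 e2; rewrite -/(G y0).
move: (\int[mu]_x (q x * r x)) (\int[mu]_y (r y * G y)) (G y0) (\int[mu]_x r x) (\int[mu]_x `|r x|).
move=> a1 a2 a3 a4 a5 e1 e2.
have -> : a1 - a4 * a3 = (a1 - a2) + (a2 - a4 * a3) by rewrite addrA subrK.
apply: le_trans (ler_normD _ _) _; rewrite mulrDr; apply: lerD => //.
by apply: le_trans e2 _; rewrite -[leLHS]mulrA [_ * a5]mulrC.
Qed.

End core.
End hops.

Section dilation.
Variables (R : realType) (n : nat).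
Local Notation E := 'rV[R]_n.
Local Notation mu := (leb R n).
Local Notation L2 := (l2n mu setT).
Local Notation dir i := (delta_mx ord0 i : 'rV[R]_n).
Implicit Types (f g phi psi q r : E -> R) (U V : set E) (v w : 'I_n -> E -> R).

Lemma dot_dir (x : E) i : dot (dir i) x = x ord0 i.
Proof.
rewrite /dot (bigD1 i)//= mxE !eqxx mul1r big1 ?addr0// => j ji.
by rewrite mxE (negbTE ji) andbF mul0r.
Qed.

Lemma C1_id k : C1 k (fun x : R => x).
Proof.
case: k => [|k]; first by move=> x; exact: cvg_id.
by exists (fun=> 1); [move=> x; exact: is_derive_id|exact: C1_cst].
Qed.

Lemma smooth_coordinate i : smooth (fun x : E => x ord0 i).
Proof.
move=> k; apply: (@Ck_ext _ _ _ (fun x => (fun y : R => y) (dot (dir i) x + 0))).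
  by move=> x; rewrite dot_dir addr0.
exact: (@Ck_ridge R n k (fun y : R => y) (dir i) 0 (C1_id k)).
Qed.

Lemma pd_coordinate i j : pd j (fun x : E => x ord0 i) = fun=> (i == j)%:R.
Proof.
have -> : (fun x : E => x ord0 i) = fun x => (fun y : R => y) (dot (dir i) x + 0).
  by apply/funext => x; rewrite dot_dir addr0.
rewrite (pd_ridge _ _ _ (fun x => is_derive_id x (1 : R))); apply/funext => x.
by rewrite mxE eqxx eq_sym mulr1.
Qed.

(* [d/dt (dil t r) = div (Fdil t r)]. *)
Definition dil (t : R) r : E -> R := fun y => t ^+ n * r (t *: y).
Definition Fdil (t : R) r (j : 'I_n) : E -> R := fun y => t ^+ n.-1 * (y ord0 j * r (t *: y)).

Lemma smooth_scale r (t : R) : smooth r -> smooth (fun y => r (t *: y)).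
Proof.
move=> /(smooth_affine t 0); congr smooth; apply/funext => y; by rewrite addr0.
Qed.

Lemma pd_scale r (t : R) i : smooth r -> pd i (fun y => r (t *: y)) = fun y => t * pd i r (t *: y).
Proof.
move=> sr; apply/funext => y; have := pdE_affine t 0 i y sr; rewrite addr0 => <-.
by congr pd; apply/funext => z; rewrite addr0.
Qed.

Lemma tf_scale U r (t : R) : t != 0 -> tf U r -> tf [set y | U (t *: y)] (fun y => r (t *: y)).
Proof.
move=> t0 /(tf_affine 0 t0); under [X in tf _ X -> _]eq_fun do rewrite addr0.
by apply: tf_sub => y /=; rewrite addr0.
Qed.

Lemma tf_dil U r (t : R) : t != 0 -> tf U r -> tf [set y | U (t *: y)] (dil t r).
Proof. by move=> t0 tr; apply: tfZ; exact: tf_scale. Qed.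

Lemma tf_Fdil U r (t : R) j : t != 0 -> tf U r -> tf [set y | U (t *: y)] (Fdil t r j).
Proof.
move=> t0 tr; apply: tfZ; apply: tfMl; first exact: smooth_coordinate.
exact: tf_scale.
Qed.

Lemma pd_Fdil r (t : R) j l : smooth r -> pd l (Fdil t r j) =
  fun y => t ^+ n.-1 * ((j == l)%:R * r (t *: y) + y ord0 j * (t * pd l r (t *: y))).
Proof.
move=> sr; rewrite (pdZ_smooth l _ (smoothM (smooth_coordinate j) (smooth_scale t sr))).
by rewrite (pdM_smooth l (smooth_coordinate j) (smooth_scale t sr)) pd_coordinate pd_scale.
Qed.

Lemma is_derive_exp (m : nat) (t : R) : is_derive t (1 : R) (fun s : R => s ^+ m) (m%:R * t ^+ m.-1).
Proof.
have h := @is_deriveX R R id m t 1 1 (is_derive_id t 1).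
have e : (fun s : R => s ^+ m) = id ^+ m.
  apply/funext => s; elim: m {h} => [|m IH]; first by rewrite !expr0.
  by rewrite !exprS [RHS]/GRing.mul /= -IH.
by rewrite e; apply: (is_derive_eq h); rewrite /GRing.scale/= mulr1.
Qed.

Lemma is_derive_dil r (y : E) (t : R) : smooth r ->
  is_derive t (1 : R) (fun s => dil s r y) (dv (Fdil t r) y).
Proof.
move=> sr; have h1 := smooth_line 0 y t sr.
have h2 := is_deriveM (is_derive_exp n t) h1.
have e : (fun s => dil s r y) = (fun s : R => s ^+ n) * (fun s => r (0 + s *: y)).
  by apply/funext => s; rewrite /dil [RHS]/GRing.mul/= add0r.
rewrite e; apply: (is_derive_eq h2); rewrite /GRing.scale/= add0r /dv.
under [RHS]eq_bigr do rewrite pd_Fdil// eqxx mul1r mulrDr.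
rewrite big_split/= sumr_const card_ord addrC; congr (_ + _); last first.
  by rewrite -mulr_natl; ring.
rewrite mulr_sumr; apply: eq_bigr => i _.
have -> : t ^+ n = t ^+ n.-1 * t by rewrite -exprSr prednK//; exact: leq_ltn_trans (ltn_ord i).
ring.
Qed.

Lemma hop_dil q r V (tau : R) : 1 <= tau -> locint q -> tf V r ->
  exists2 xi, 1 <= xi <= tau & \int[mu]_y (q y * dil tau r y) - \int[mu]_y (q y * r y) =
    (tau - 1) * \int[mu]_y (q y * dv (Fdil xi r) y).
Proof.
move=> t1 lq tr; have sr := tf_smooth tr.
have [M M0 hM] := tf_bounded tr.
have [A [cA AU pA]] := tr.2; have [k k0 hk] := compact_bound_rV cA.
pose hd (t : R) y := dv (Fdil t r) y.
have tau1 : 0 <= tau - 1 by rewrite subr_ge0.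
(* An open interval around [[1, tau]] is needed to differentiate; its lower end 1/2 keeps the
   supports of the dilates in a ball of twice the radius. *)
have far (t : R) y : t \in `]2^-1, tau + 1[ -> ~ cball (2 * k) y -> ~ A (t *: y).
  rewrite in_itv/= => /andP[ta tb] nb /hk; rewrite normrZ gtr0_norm; last by apply: lt_trans ta; lra.
  move=> h; apply: nb; rewrite /cball/=; have := normr_ge0 y; nra.
have [B B0 hB] : exists2 B : R, 0 <= B & forall t y, t \in `]2^-1, tau + 1[ -> `|hd t y| <= B.
  have /choice[P hP] : forall i, exists B : R, forall x, `|pd i r x| <= B.
    by move=> i; have [B _ hB] := tf_bounded (tf_pd i tr); exists B.
  have P0 i : 0 <= P i by apply: le_trans (hP i 0).
  pose T : R := (tau + 1) ^+ n.-1.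
  have T0 : 0 <= T by rewrite exprn_ge0//; lra.
  exists (\sum_(i < n) T * (M + k * P i)).
    by apply: sumr_ge0 => i _; rewrite mulr_ge0 ?addr_ge0 ?mulr_ge0 ?(ltW k0).
  move=> t y; rewrite in_itv/= => /andP[ta tb].
  apply: (le_trans (ler_norm_sum _ _ _)); apply: ler_sum => i _.
  have t0 : 0 <= t by lra.
  rewrite pd_Fdil// eqxx mul1r normrM normrX (ger0_norm t0); apply: ler_pM => //.
    by rewrite exprn_ge0.
    by rewrite lerXn2r ?nnegrE//; lra.
  apply: (le_trans (ler_normD _ _)); apply: lerD; first exact: hM.
  have [At|nAt] := pselect (A (t *: y)); last first.
    by rewrite (pd_off i (compact_closed_rV cA) pA)// !mulr0 normr0 mulr_ge0 ?(ltW k0).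
  rewrite mulrA normrM; apply: ler_pM => //.
  apply: le_trans (hk _ At); have -> : y ord0 i * t = (t *: y) ord0 i by rewrite mxE mulrC.
  exact: coord_le.
have der t : t \in `]2^-1, tau + 1[ ->
   is_derive t (1 : R) (fun t => \int[mu]_y (q y * dil t r y)) (\int[mu]_y (q y * hd t y)).
  move=> ht; apply: (@is_derive_int_weight _ _ q (fun t => dil t r) hd (cball (2 * k))
     (Num.max ((tau + 1) ^+ n * M) B) 2^-1 (tau + 1) t ht).
  - exact: compact_measurable_rV (@cball_compact _ _ _).
  - exact: lq (@cball_compact _ _ _).
  - by move=> s hs; apply: smooth_cont; apply: smoothZ; exact: smooth_scale.
  - by move=> s y hs; exact: is_derive_dil.
  - move=> s y hs nb; have nA := far _ _ hs nb; split; first by rewrite /dil pA// mulr0.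
    apply: big1 => i _; rewrite pd_Fdil// pA//.
    by rewrite (pd_off i (compact_closed_rV cA) pA)// !mulr0 addr0 mulr0.
  - move=> s y hs; rewrite !le_max hB// orbT; split=> //; apply/orP; left.
    rewrite normrM; move: hs; rewrite in_itv/= => /andP[s1 s2].
    have s0 : 0 <= s by lra.
    rewrite normrX ger0_norm// ler_pM// ?exprn_ge0//.
    by rewrite lerXn2r ?nnegrE//; lra.
have der1 s : 0 <= s <= tau - 1 -> is_derive s (1 : R)
    (fun s => \int[mu]_y (q y * dil (1 * s + 1) r y)) (\int[mu]_y (q y * hd (1 * s + 1) y)).
  move=> /andP[s0 s1]; have ht : 1 * s + 1 \in `]2^-1, tau + 1[.
    by rewrite in_itv/=; apply/andP; split; lra.
  have h := @is_derive1_comp R (fun t => \int[mu]_y (q y * dil t r y)) (fun s => 1 * s + 1)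
    s _ _ (der _ ht) (is_derive_affine 1 1 s).
  by apply: (is_derive_eq h); rewrite mulr1.
have [s s01] := MVT01 tau1 der1.
rewrite !mul1r add0r subrK => e; exists (s + 1); first lra.
by rewrite -e; congr (_ - _); apply: eq_Rintegral => y _; rewrite /dil expr1n mul1r scale1r.
Qed.

Lemma l2n_scale r U (t : R) : 1 <= t -> tf U r -> L2 (fun y => r (t *: y)) <= L2 r.
Proof.
move=> t1 tr; have t0 : 0 < t by lra.
apply: ler_wsqrtr; rewrite /l2ip.
have [_] := integrable_affine 0 t0 (tf_integrable (tfMl (tf_smooth tr) tr)).
under eq_Rintegral do rewrite addr0; move=> ->.
apply: ler_piMl; first exact: l2ip_ge0.
by rewrite invf_le1 ?exprn_gt0// exprn_ege1.
Qed.

Lemma l2n_dil r U (t : R) : 1 <= t -> t <= 2 -> tf U r -> L2 (dil t r) <= 2 ^+ n * L2 r.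
Proof.
move=> t1 t2 tr; have t0 : t != 0 by rewrite gt_eqF//; lra.
rewrite /dil (l2nZ measurableT (t ^+ n) (tf_sq (tf_scale t0 tr))).
apply: ler_pM => //; first exact: l2n_ge0.
  rewrite normrX ger0_norm; last lra.
  by rewrite lerXn2r ?nnegrE//; lra.
exact: l2n_scale tr.
Qed.

(** The unbounded factor [y_j] costs only [rho]: on the support [t y] lies in [V], hence in
    [cball rho]. Dilating by [t >= 1] does not increase L^2 norms. *)
Lemma l2n_Fdil r V (t rho B0 B1 : R) : 1 <= t -> t <= 2 -> 1 <= rho -> tf V r -> V `<=` cball rho ->
  L2 r <= B0 -> (forall l, L2 (pd l r) <= B1) ->
  (forall j, L2 (Fdil t r j) <= 2 ^+ n * rho * (B0 + B1)) /\
  (forall j l, L2 (pd l (Fdil t r j)) <= 2 ^+ n * rho * (B0 + B1)).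
Proof.
move=> t1 t2 rho1 tr Vrho h0 h1; have t0 : 0 < t by lra.
have tne : t != 0 by rewrite gt_eqF.
have rho0 : 0 <= rho by lra.
have B00 : 0 <= B0 by apply: le_trans h0; exact: l2n_ge0.
have T0 : 0 <= t ^+ n.-1 by rewrite exprn_ge0//; lra.
have Tle (i : 'I_n) : t ^+ n.-1 * t <= 2 ^+ n.
  rewrite -exprSr prednK; last exact: leq_ltn_trans (ltn_ord i).
  by rewrite lerXn2r ?nnegrE//; lra.
have st := tf_scale tne tr.
have cy f (j : 'I_n) (y : E) : tf V f -> `|y ord0 j * (t * f (t *: y))| <= `|rho * f (t *: y)|.
  move=> tf_f; have [Vy|nV] := pselect (V (t *: y)); last by rewrite (tf_off tf_f nV) !mulr0.
  rewrite mulrA !normrM; apply: ler_wpM2r => //; rewrite -normrM (ger0_norm rho0).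
  apply: le_trans (Vrho _ Vy); have -> : y ord0 j * t = (t *: y) ord0 j by rewrite mxE mulrC.
  exact: coord_le.
have main f j : tf V f -> L2 (fun y => y ord0 j * (t * f (t *: y))) <= rho * L2 f.
  move=> tf_f; have stf := tf_scale tne tf_f.
  apply: (@le_trans _ _ (L2 (fun y => rho * f (t *: y)))).
    apply: l2n_le => //; last by move=> y _; exact: cy.
    - by apply: tf_sq (tfMl (smooth_coordinate j) (tfZ t stf)).
    - by apply: tf_sq (tfZ rho stf).
  rewrite (l2nZ measurableT rho (tf_sq stf)) (ger0_norm rho0).
  by apply: ler_wpM2l => //; exact: l2n_scale tf_f.
have rhoB : rho * L2 r <= rho * B0 by apply: ler_wpM2l.
have tn (i : 'I_n) : t ^+ n.-1 <= 2 ^+ n.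
  by apply: le_trans (Tle i); rewrite ler_peMr.
split=> [j|j l].
  have -> : Fdil t r j = fun y => t ^+ n.-1 / t * (y ord0 j * (t * r (t *: y))).
    by apply/funext => y; rewrite /Fdil; field.
  have sqm := tf_sq (tfMl (smooth_coordinate j) (tfZ t st)).
  rewrite (l2nZ measurableT _ sqm).
  have h := main r j tr; have B10 : 0 <= B1 by apply: le_trans (h1 j); exact: l2n_ge0.
  rewrite -mulrA; apply: ler_pM => //; first exact: l2n_ge0.
    rewrite ger0_norm ?divr_ge0 ?(ltW t0)//; apply: le_trans (tn j).
    by rewrite ler_pdivrMr// ler_peMr.
  by apply: (le_trans h); apply: (le_trans rhoB); apply: ler_wpM2l => //; rewrite lerDl.
have B10 : 0 <= B1 by apply: le_trans (h1 j); exact: l2n_ge0.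
have sr := tf_smooth tr; rewrite pd_Fdil//.
have tl := tf_pd l tr; have stl := tf_scale tne tl.
have s1 := tf_sq (tfZ (j == l)%:R st).
have s2 := tf_sq (tfMl (smooth_coordinate j) (tfZ t stl)).
rewrite (l2nZ measurableT _ (sqintD measurableT s1 s2)) (ger0_norm T0) -mulrA.
apply: ler_pM => //; first exact: l2n_ge0.
  exact: tn j.
have hA : L2 (fun y => (j == l)%:R * r (t *: y)) <= B0.
  rewrite (l2nZ measurableT _ (tf_sq st)); apply: le_trans h0; apply: le_trans (l2n_scale t1 tr).
  by apply: ler_piMl; [exact: l2n_ge0|case: (j == l); rewrite ?normr1 ?normr0].
have hB := main _ j tl.
apply: (le_trans (l2nD_le s1 s2 hA (lexx _))).
rewrite mulrDr; apply: lerD; first by rewrite ler_peMl.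
by apply: (le_trans hB); apply: ler_wpM2l.
Qed.

End dilation.

(** * Sums of functions with few overlaps *)

Section band_sums.
Context d (T : measurableType d) (R : realType) (mu : {measure set T -> \bar R}).
Variable D : set T.
Hypothesis mD : measurable D.

Let band (w k l : nat) := ((k < l + w) && (l < k + w))%N.

Let count_band (w m k : nat) : (\sum_(l < m) band w k l <= 2 * w)%N.
Proof.
rewrite -(big_mkord xpredT (fun l => nat_of_bool (band w k l))).
rewrite (_ : \sum_(0 <= l < m) _ = \sum_(0 <= l < m | band w k l) 1)%N; last first.
  by rewrite [RHS]big_mkcond; apply: eq_bigr => l _; case: (band w k l).
rewrite sum1_count -size_filter -[(2 * w)%N](size_iota (k.+1 - w)); apply: uniq_leq_size.
  by rewrite filter_uniq// iota_uniq.
move=> l; rewrite mem_filter => /andP[/andP[h1 h2] _]; rewrite mem_iota; lia.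
Qed.

Lemma l2ip_amgm f g : sqint mu D f -> sqint mu D g ->
  l2ip mu D f g <= (l2ip mu D f f + l2ip mu D g g) / 2.
Proof.
move=> sf sg; have := l2_CS mD sf sg.
rewrite -(l2n_sqr mu D f) -(l2n_sqr mu D g).
have := ler_norm (l2ip mu D f g); have := sqr_ge0 (l2n mu D f - l2n mu D g).
rewrite sqrrB; nra.
Qed.

(** Only pairs with [|k - l| < w] contribute. After the arithmetic-geometric inequality each square
    is counted once per partner, at most [2 w] times. *)
Lemma l2ip_band (w m : nat) (F : nat -> T -> R) : (forall k, sqint mu D (F k)) ->
  (forall k l x, D x -> (k + w <= l)%N -> F k x * F l x = 0) ->
  l2ip mu D (fun x => \sum_(k < m) F k x) (fun x => \sum_(k < m) F k x) <=
  (2 * w)%:R * \sum_(k < m) l2ip mu D (F k) (F k).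
Proof.
move=> sF F0.
have iF k l : mu.-integrable D (EFin \o (fun x => F k x * F l x)) by exact: sqintM.
have -> : l2ip mu D (fun x => \sum_(k < m) F k x) (fun x => \sum_(k < m) F k x) =
    \sum_(k < m) \sum_(l < m) l2ip mu D (F k) (F l).
  rewrite {1}/l2ip; under eq_Rintegral do rewrite big_distrlr.
  rewrite Rintegral_sum//; last by move=> i; apply: integrableR_sum => // j; exact: iF.
  apply: eq_bigr => k _.
  exact: (etrans (Rintegral_sum (index_enum 'I_m) mD (fun l : 'I_m => iF k l))).
pose x k := l2ip mu D (F k) (F k).
pose b k l : R := (band w k l)%:R.
have bC k l : b k l = b l k by rewrite /b /band andbC.
apply: (@le_trans _ _ (\sum_(k < m) \sum_(l < m) b k l * ((x k + x l) / 2))).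
  apply: ler_sum => k _; apply: ler_sum => l _.
  rewrite /b; case: (boolP (band w k l)) => [_|]; first by rewrite mul1r; exact: l2ip_amgm.
  rewrite negb_and -!leqNgt => h; rewrite mul0r le_eqVlt; apply/orP; left; apply/eqP.
  rewrite /l2ip (@eq_Rintegral _ _ _ mu D (fun=> 0)); first by rewrite Rintegral_cst// mul0r.
  move=> y; rewrite inE => Dy; case/orP: h => h; last exact: F0 h.
  by rewrite mulrC; exact: F0 h.
have sym : \sum_(k < m) \sum_(l < m) b k l * ((x k + x l) / 2) = \sum_(k < m) \sum_(l < m) b k l * x k.
  have e1 : \sum_(k < m) \sum_(l < m) b k l * ((x k + x l) / 2) =
     2^-1 * (\sum_(k < m) \sum_(l < m) b k l * x k) + 2^-1 * (\sum_(k < m) \sum_(l < m) b k l * x l).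
    rewrite !mulr_sumr -big_split/=; apply: eq_bigr => k _.
    by rewrite !mulr_sumr -big_split/=; apply: eq_bigr => l _; field.
  rewrite e1 [X in _ + _ * X]exchange_big/=.
  have -> : \sum_(l < m) \sum_(k < m) b k l * x l = \sum_(k < m) \sum_(l < m) b k l * x k.
    by apply: eq_bigr => k _; apply: eq_bigr => l _; rewrite bC.
  by field.
rewrite sym mulr_sumr; apply: ler_sum => k _; rewrite -mulr_suml; apply: ler_wpM2r; first exact: l2ip_ge0.
by rewrite -natr_sum ler_nat count_band.
Qed.
End band_sums.

Section l2ip_right.
Context d (T : measurableType d) (R : realType) (mu : {measure set T -> \bar R}).
Variable D : set T.
Hypothesis mD : measurable D.
Implicit Types f g h : T -> R.

Lemma l2ipDr f g h : sqint mu D f -> sqint mu D g -> sqint mu D h ->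
  l2ip mu D f (fun x => g x + h x) = l2ip mu D f g + l2ip mu D f h.
Proof.
move=> sf sg sh; rewrite /l2ip -RintegralD//; [|exact: sqintM|exact: sqintM].
by apply: eq_Rintegral => x _; rewrite mulrDr.
Qed.

Lemma l2ipZr f g (c : R) : sqint mu D f -> sqint mu D g ->
  l2ip mu D f (fun x => c * g x) = c * l2ip mu D f g.
Proof.
move=> sf sg; rewrite /l2ip -(RintZ c mD (sqintM mD sf sg)).
by apply: eq_Rintegral => x _; rewrite mulrCA.
Qed.

Lemma l2ipBr f g h : sqint mu D f -> sqint mu D g -> sqint mu D h ->
  l2ip mu D f (fun x => g x - h x) = l2ip mu D f g - l2ip mu D f h.
Proof.
move=> sf sg sh; rewrite /l2ip -RintegralB//; [|exact: sqintM|exact: sqintM].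
by apply: eq_Rintegral => x _; rewrite mulrBr.
Qed.

Lemma l2ip_sumr (I : Type) (s : seq I) f (F : I -> T -> R) : sqint mu D f ->
  (forall i, sqint mu D (F i)) ->
  l2ip mu D f (fun x => \sum_(i <- s) F i x) = \sum_(i <- s) l2ip mu D f (F i).
Proof.
move=> sf sF; rewrite /l2ip -(Rintegral_sum s mD (fun i => sqintM mD sf (sF i))).
by apply: eq_Rintegral => x _; rewrite mulr_sumr.
Qed.

Lemma l2ip_lincomb (m : nat) f g (F : nat -> T -> R) (c : nat -> R) (k : R) : sqint mu D f ->
  sqint mu D g -> (forall s, sqint mu D (F s)) ->
  l2ip mu D f (fun x => g x - k * \sum_(s < m) c s * F s x) =
  l2ip mu D f g - k * \sum_(s < m) c s * l2ip mu D f (F s).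
Proof.
move=> sf sg sF.
have sc s : sqint mu D (fun x => c s * F s x) by exact: sqintZ.
have sS := sqint_sum (index_enum 'I_m) mD (fun s : 'I_m => sc s).
rewrite (l2ipBr sf sg (sqintZ k mD sS)) (l2ipZr k sf sS).
have e := @l2ip_sumr 'I_m (index_enum _) f (fun s : 'I_m => fun x => c s * F s x) sf (fun s => sc s).
rewrite e; congr (_ - _ * _); apply: eq_bigr => s _; exact: l2ipZr.
Qed.

Lemma l2ip_sumr_nat (m : nat) f (F : nat -> T -> R) (k : R) : sqint mu D f ->
  (forall s, sqint mu D (F s)) ->
  l2ip mu D f (fun x => k * \sum_(s < m) F s x) = k * \sum_(s < m) l2ip mu D f (F s).
Proof.
move=> sf sF; have sS := sqint_sum (index_enum 'I_m) mD (fun s : 'I_m => sF s).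
rewrite (l2ipZr k sf sS); congr (_ * _).
exact: (@l2ip_sumr 'I_m (index_enum _) f (fun s : 'I_m => F s) sf (fun s => sF s)).
Qed.

End l2ip_right.

(** * Necas inequality on a polytope *)

Section polytope_shells.
Variables (R : realType) (n p : nat).
Local Notation E := 'rV[R]_n.
Local Notation mu := (leb R n).
Local Notation L2 := (l2n mu setT).
Local Notation sq := (sqint mu setT).
Local Notation ip := (l2ip mu setT).
Implicit Types (f g phi psi q r : E -> R) (U V : set E) (v w : 'I_n -> E -> R).
Variables (a : 'I_p -> E).

Lemma dotZr (b x : E) (c : R) : dot b (c *: x) = c * dot b x.
Proof. by rewrite /dot mulr_sumr; apply: eq_bigr => i _; rewrite mxE mulrCA. Qed.

Lemma opoly_open t : open (opoly a t).
Proof.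
rewrite openE => x h; apply: (filter_forall (F := nbhs x)) => i.
have : open (dot (a i) @^-1` [set y | y < t]).
  by apply: open_comp; [move=> y _; exact: dot_continuous|exact: open_lt].
by rewrite openE => /(_ x); apply; exact: h.
Qed.

Lemma cpoly_closed t : closed (cpoly a t).
Proof.
have -> : cpoly a t = \bigcap_(i in [set: 'I_p]) (dot (a i) @^-1` [set y | y <= t]).
  by apply/seteqP; split => x; [move=> h i _; exact: h|move=> h i; exact: h].
apply: closed_bigI => i _.
by apply: closed_comp; [move=> x _; exact: dot_continuous|exact: closed_le].
Qed.

Lemma opoly_cpoly s t : s <= t -> opoly a s `<=` cpoly a t.
Proof. by move=> st x h i; rewrite ltW// (lt_le_trans (h i)). Qed.

Lemma cpoly_opoly s t : s < t -> cpoly a s `<=` opoly a t.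
Proof. by move=> st x h i; rewrite (le_lt_trans (h i)). Qed.

Lemma opoly_mono s t : s <= t -> opoly a s `<=` opoly a t.
Proof. by move=> st x h i; rewrite (lt_le_trans (h i)). Qed.

Definition ann (s t : R) : set E := cpoly a t `\` opoly a s.

Lemma ann_dil (s t c : R) x : 0 < c -> ann s t (c *: x) <-> ann (s / c) (t / c) x.
Proof.
move=> c0; split=> -[h1 h2]; split.
- by move=> i; have := h1 i; rewrite dotZr ler_pdivlMr// mulrC.
- by move=> h; apply: h2 => i; have := h i; rewrite dotZr ltr_pdivlMr// mulrC.
- by move=> i; have := h1 i; rewrite dotZr ler_pdivlMr// mulrC.
- by move=> h; apply: h2 => i; have := h i; rewrite dotZr ltr_pdivlMr// mulrC.
Qed.

Lemma ann_mono s t s' t' : s' <= s -> t <= t' -> ann s t `<=` ann s' t'.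
Proof.
move=> ss tt x [h1 h2]; split; first by move=> i; exact: le_trans (h1 i) tt.
by move=> h; apply: h2; exact: opoly_mono h.
Qed.

Lemma ann_disjoint s t s' t' x : t < s' -> ann s t x -> ann s' t' x -> False.
Proof. by move=> ts [h1 _] [_ h2]; apply: h2; exact: cpoly_opoly h1. Qed.

Lemma ann_closed s t : closed (ann s t).
Proof.
by apply: closedI; [exact: cpoly_closed|apply: open_closedC; exact: opoly_open].
Qed.

Lemma bernoulli_le (x : R) (m : nat) : 0 <= x <= 1 -> 1 - m%:R * x <= (1 - x) ^+ m.
Proof.
move=> /andP[x0 x1]; elim: m => [|m IH]; first by rewrite mul0r subr0 expr0.
have h : (1 - m%:R * x) * (1 - x) <= (1 - x) ^+ m.+1.
  by rewrite exprSr; apply: ler_wpM2r => //; lra.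
apply: le_trans h; rewrite -natr1; have : 0 <= m%:R * x * x by rewrite !mulr_ge0.
lra.
Qed.

Section widths.
Variable lam : R.
Hypothesis lam4 : (4 : R) <= lam.

Definition ek (k : nat) : R := 2^-1 * lam^-1 ^+ k.

Lemma ek_gt0 k : 0 < ek k.
Proof.
have l4 := lam4; have l0 : 0 < lam by lra.
by apply: mulr_gt0; [rewrite invr_gt0|apply: exprn_gt0; rewrite invr_gt0].
Qed.

Lemma ekS k : lam * ek k.+1 = ek k.
Proof.
have l4 := lam4; have l0 : lam != 0 by rewrite gt_eqF//; lra.
by rewrite /ek exprS; field.
Qed.

Lemma ek_le k : 4 * ek k.+1 <= ek k.
Proof. by rewrite -(ekS k) ler_wpM2r// ltW// ek_gt0. Qed.

Lemma ek_half k : ek k <= 2^-1.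
Proof.
elim: k => [|k IH]; first by rewrite /ek expr0 mulr1.
by have := ek_le k; have := ek_gt0 k.+1; lra.
Qed.

Lemma ek_mono k l : (k <= l)%N -> ek l <= ek k.
Proof.
move=> /subnKC <-; elim: (l - k)%N => [|j IH]; first by rewrite addn0.
by rewrite addnS; have := ek_le (k + j); have := ek_gt0 (k + j).+1; lra.
Qed.

(** Bernoulli's inequality. This fixes the ratio of the widths: after [m + 1] contractions by
    [1 - 2 ek k.+1] the level has not dropped below that of the next inner shell, [1 - ek k]. *)
Lemma sigma_pow (m k i : nat) : (2 * m.+2)%:R <= lam -> (i <= m.+1)%N ->
  1 - ek k <= (1 - 2 * ek k.+1) ^+ i.
Proof.
move=> ml im; have e0 := ek_gt0 k.+1; have e1 := ek_le k; have eh := ek_half k.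
have x01 : 0 <= 2 * ek k.+1 <= 1 by apply/andP; split; lra.
apply: le_trans (bernoulli_le i x01); rewrite lerD2l lerN2 -(ekS k) mulrA.
rewrite ler_wpM2r ?(ltW e0)//; apply: le_trans ml.
by rewrite mulrC -natrM ler_nat leq_mul2l/= ltnW.
Qed.

End widths.

Variable rho : R.
Hypothesis rho1 : (1 : R) <= rho.
Hypothesis arho : opoly a 1 `<=` cball rho.

Lemma ann_compact s t : t < 1 -> compact (ann s t).
Proof.
move=> t1; have h : ann s t `<=` cball rho.
  by apply: subset_trans arho => x [h _]; exact: cpoly_opoly h.
exact: (subclosed_compact (@ann_closed s t) (@cball_compact R n rho) h).
Qed.

Lemma l2n_average_le (m : nat) (u : E -> R) (F : nat -> E -> R) (c : nat -> R) (A B K : R) :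
  (0 < m)%N -> sq u -> (forall s, sq (F s)) -> L2 u <= A ->
  (forall s, (s < m)%N -> `|c s| <= K) -> (forall s, (s < m)%N -> L2 (F s) <= B) ->
  L2 (fun x => u x - m%:R^-1 * \sum_(s < m) c s * F s x) <= A + K * B.
Proof.
move=> m0 su sF uA cK FB; have mR : (m%:R : R) != 0 by rewrite pnatr_eq0 -lt0n.
have sc s : sq (fun x => c s * F s x) by apply: sqintZ.
have sS := sqint_sum (index_enum 'I_m) measurableT (fun s : 'I_m => sc s).
apply: le_trans (l2nB measurableT su (sqintZ m%:R^-1 measurableT sS)) _.
apply: lerD => //; rewrite (l2nZ measurableT _ sS) ger0_norm ?invr_ge0//.
rewrite -[leRHS](mulKf mR) ler_wpM2l ?invr_ge0//.
apply: le_trans (l2n_sum measurableT (index_enum 'I_m) (fun s : 'I_m => sc s)) _.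
apply: (@le_trans _ _ (\sum_(s < m) K * B)); last by rewrite sumr_const card_ord mulr_natl.
apply: ler_sum => s _; rewrite (l2nZ measurableT _ (sF s)).
apply: ler_pM => //; [exact: l2n_ge0|exact: cK|exact: FB].
Qed.

Lemma ler_sum_term (F : 'I_n -> R) i : (forall i, 0 <= F i) -> F i <= \sum_(j < n) F j.
Proof. by move=> F0; rewrite (bigD1 i)//= lerDl sumr_ge0. Qed.

Lemma l2n_le_h1s v i : L2 (v i) <= h1s v.
Proof.
have S0 k : 0 <= \sum_(j < n) L2 (pd j (v k)) by apply: sumr_ge0 => j _; exact: l2n_ge0.
apply: (@le_trans _ _ (L2 (v i) + \sum_(j < n) L2 (pd j (v i)))); first by rewrite lerDl.
apply: (ler_sum_term (F := fun i => L2 (v i) + \sum_(j < n) L2 (pd j (v i)))) => k.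
by rewrite addr_ge0 ?l2n_ge0.
Qed.

Lemma l2n_pd_le_h1s v i j : L2 (pd j (v i)) <= h1s v.
Proof.
have S0 k : 0 <= \sum_(j < n) L2 (pd j (v k)) by apply: sumr_ge0 => l _; exact: l2n_ge0.
apply: (@le_trans _ _ (L2 (v i) + \sum_(j < n) L2 (pd j (v i)))).
  apply: ler_wpDl; first exact: l2n_ge0.
  by apply: (ler_sum_term (F := fun j => L2 (pd j (v i)))) => k; exact: l2n_ge0.
apply: (ler_sum_term (F := fun i => L2 (v i) + \sum_(j < n) L2 (pd j (v i)))) => k.
by rewrite addr_ge0 ?l2n_ge0.
Qed.

(* [rb] is the mean of dilates of the remainder whose supports are disjoint, so
   that its norm decreases like the inverse square root of their number. *)
Lemma shell_step : exists lam C : R, [/\ (4 : R) <= lam, (0 : R) <= C & forall k q (delta : R),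
  sq q -> locint q -> 0 < delta ->
  let f x := q x * \1_(opoly a (1 - ek lam k.+2) `\` opoly a (1 - ek lam k.+1)) x in
  exists G rb, [/\ [/\ tfv (opoly a 1) G, tf (opoly a 1) rb,
     (forall x, ~ ann (1 - ek lam k) (1 - ek lam k.+2 / 2) x -> forall i, G i x = 0) &
     (forall x, ~ (opoly a (1 - ek lam k.+1) `\` opoly a (1 - ek lam k)) x -> rb x = 0)],
     (forall i, L2 (G i) <= C * L2 f), (forall i j, L2 (pd j (G i)) <= C * L2 f),
     4 * L2 rb <= L2 f &
     `|ip q f - (ip q (dv G) + ip q rb)| <= L2 q * delta]].
Proof.
have [M0 M01 hcut] := pcut_sbd a.
have M00 : 0 <= M0 by exact: le_trans M01.
have M1 : 0 <= 4 * (M0 * (1 + M0)) by rewrite !mulr_ge0// addr_ge0.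
have [C1 C10 hloc] := @local_decomposition R n _ M1.
pose Q : R := 2 ^+ n * C1.
have Q0 : 0 <= Q by rewrite mulr_ge0// exprn_ge0.
(* 32 is [4^2 * 2]: the square of the factor gained, times the [2 w] of [l2ip_band] for [w = 1]. [Q]
   bounds the norm of one dilate relative to that of [f]. *)
pose m := (Num.truncn (32 * Q ^+ 2)).+1.
have mQ : 32 * Q ^+ 2 <= m%:R by apply: ltW; exact: truncnS_gt.
pose lam : R := (2 * m.+2)%:R.
have lam4 : (4 : R) <= lam by rewrite /lam ler_nat; lia.
pose C := C1 + 8 * (2 ^+ n * rho * C1 * lam ^+ 2).
have lam0 : 0 < lam by lra.
have rho0 : 0 <= rho by exact: le_trans rho1.
have P0 : 0 <= 2 ^+ n * rho * C1 * lam ^+ 2.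
  by rewrite !mulr_ge0 ?exprn_ge0// ltW.
have C0 : 0 <= C by rewrite addr_ge0// mulr_ge0.
exists lam, C; split => // k q delta sqq lq d0 f.
set ej := ek lam k.+1; set ei := ek lam k; pose eps := ek lam k.+2 / 2.
have ej0 : 0 < ej by exact: ek_gt0.
have eps0 : 0 < eps by rewrite divr_gt0 ?ek_gt0.
have ejS : 4 * (2 * eps) <= ej by rewrite /eps; have := ek_le lam4 k.+1; rewrite -/ej; lra.
have eiS : 4 * ej <= ei by exact: ek_le.
have eih : ei <= 2^-1 by exact: ek_half.
have eps2 : ek lam k.+2 = 2 * eps by rewrite /eps; field.
pose sg := 1 - 2 * ej.
(* Equal to 1 on the shell that carries [f]. It falls to 0 over the width [eps] outwards and over
   the larger width [ej] inwards, so [eps] is its length scale. *)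
pose X x := pcut a (1 - ek lam k.+2) (1 - eps) x * (1 - pcut a sg (1 - ej) x).
have w1 : 1 - ek lam k.+2 < 1 - eps by rewrite eps2; lra.
have w2 : sg < 1 - ej by rewrite /sg; lra.
have sX : sbd (4 * (M0 * (1 + M0))) eps^-1 X.
  have ie : 0 <= eps^-1 by rewrite invr_ge0 ltW.
  apply: sbdM => //.
    by have := hcut _ _ w1; congr (sbd _ _^-1 _); rewrite eps2; lra.
  apply: sbd_oneB => //; apply: sbd_mono (hcut _ _ w2) => //.
    by rewrite invr_ge0 subr_ge0 ltW.
  by rewrite lef_pV2 ?posrE ?subr_gt0// /sg; lra.
pose As := ann sg (1 - eps).
have cAs : compact As by apply: ann_compact; lra.
have AsK : As `<=` opoly a 1 by move=> x [h _]; apply: cpoly_opoly h; lra.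
have XAs x : ~ As x -> X x = 0.
  move=> nA; have [h1|h1] := pselect (cpoly a (1 - eps) x); last first.
    by rewrite /X pcut_eq0 ?mul0r// => h; apply: h1; exact: opoly_cpoly h.
  have [h2|h2] := pselect (opoly a sg x); last by exfalso; apply: nA.
  by rewrite /X (pcut_eq1 w2 (opoly_cpoly (lexx _) h2)) subrr mulr0.
have mA : measurable (opoly a (1 - ek lam k.+2) `\` opoly a (1 - ej)).
  by apply: measurableD; apply: open_measurable_rV; exact: opoly_open.
have sf : sq f.
  rewrite /f; under [X in sqint _ _ X]eq_fun do rewrite mulrC.
  apply: (@sqint_bounded _ _ _ mu setT _ q 1) => // x _.
  by rewrite /indic; case: (_ \in _); rewrite ?normr1 ?normr0.
have Xf x : X x * f x = f x.
  rewrite /f /indic; case: (boolP (x \in _)) => [|_]; last by rewrite !mulr0.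
  rewrite inE => -[h1 h2]; rewrite /X pcut_eq1//; last exact: opoly_cpoly h1.
  by rewrite (pcut_eq0 w2 h2) subr0 !mul1r.
have eps1 : eps <= 1 by lra.
have [w [r [tw tr offA err [hw hr hpr]]]] := hloc eps X f delta As (opoly a 1) eps0 eps1 sX cAs AsK XAs sf Xf d0.
have sg0 : 0 < sg by rewrite /sg; lra.
have sg1 : sg < 1 by rewrite /sg; lra.
(* The dilate by [tau s] lives between the levels [sg^(s+2)] and [(1 - eps) sg^(s+1)]. The supports
   are thus disjoint, and already the first one lies below the level [1 - ej], in the next inner
   shell. *)
pose tau (s : nat) := sg^-1 ^+ s.+1.
have tau1 s : 1 <= tau s by rewrite exprn_ege1// invf_ge1// ltW.
have tau0 s : 0 < tau s by apply: lt_le_trans (tau1 s).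
have itau s : (tau s)^-1 = sg ^+ s.+1 by rewrite /tau exprVn invrK.
have sgp s : (s <= m.+1)%N -> 1 - ei <= sg ^+ s by move=> sm; have ml : (2 * m.+2)%:R <= lam by []; have := sigma_pow lam4 k ml sm.
have tau2 s : (s < m)%N -> tau s <= 2.
  move=> sm; rewrite -[tau s]invrK itau -[leRHS]invrK lef_pV2 ?posrE ?exprn_gt0 ?invr_gt0//.
  by apply: le_trans (sgp _ _); [lra|rewrite ltnS ltnW].
have AsK2 s : 1 <= s -> [set y | opoly a 1 (s *: y)] `<=` opoly a 1.
  move=> s1 y h i; have := h i; rewrite dotZr => hi.
  have [d0'|d0'] := leP (dot (a i) y) 0; first by lra.
  by apply: le_lt_trans hi; rewrite ler_peMl// ltW.
have /choice[xi hxi] : forall s : nat, exists xi, 1 <= xi <= tau s /\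
    ip q (dil (tau s) r) - ip q r = (tau s - 1) * ip q (dv (Fdil xi r)).
  by move=> s; have [xi h1 h2] := hop_dil (tau1 s) lq tr; exists xi.
have offr x : ~ As x -> r x = 0 by move=> /offA[].
have xi1 s : 1 <= xi s by have [/andP[]] := hxi s.
have xit s : xi s <= tau s by have [/andP[]] := hxi s.
have xi0 s : 0 < xi s by apply: lt_le_trans (xi1 s).
have tdil s : tf (opoly a 1) (dil (tau s) r).
  by apply: tf_sub (AsK2 _ (tau1 s)) _; apply: tf_dil => //; rewrite gt_eqF.
have tF s i : tf (opoly a 1) (Fdil (xi s) r i).
  by apply: tf_sub (AsK2 _ (xi1 s)) _; apply: tf_Fdil => //; rewrite gt_eqF.
have m0 : (0 < m)%N by [].
have mR : (m%:R : R) != 0 by rewrite pnatr_eq0.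
pose mi : R := m%:R^-1; have mi0 : 0 <= mi by rewrite invr_ge0.
pose rb y := mi * \sum_(s < m) dil (tau s) r y.
pose G i y := w i y - mi * \sum_(s < m) (tau s - 1) * Fdil (xi s) r i y.
have tSF i : tf (opoly a 1) (fun y => \sum_(s < m) (tau s - 1) * Fdil (xi s) r i y).
  by apply: tf_sum => s; apply: tfZ.
have tSd : tf (opoly a 1) (fun y => \sum_(s < m) dil (tau s) r y) by exact: tf_sum.
have low s : (s < m)%N -> 1 - ei <= sg / tau s.
  by move=> sm; rewrite itau -exprS; apply: sgp.
have hi s : (1 - eps) / tau s < 1 - ej.
  rewrite itau exprS; apply: (@le_lt_trans _ _ sg); last by rewrite /sg; lra.
  rewrite mulrCA; apply: ler_piMr; first exact: ltW.
  have h1 : sg ^+ s <= 1 by rewrite exprn_ile1 ?ltW.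
  have h2 : 0 <= sg ^+ s by rewrite exprn_ge0// ltW.
  by apply: mulr_ile1 => //; lra.
pose L := L2 f; have L0 : 0 <= L by exact: l2n_ge0.
pose Bd := 2 ^+ n * rho * (C1 * L + C1 * L / eps).
have AsKr : opoly a 1 `<=` cball rho by exact: arho.
have hFd s := fun sm : (s < m)%N => l2n_Fdil (xi1 s) (le_trans (xit s) (tau2 s sm)) rho1 tr AsKr hr hpr.
have taum s : (s < m)%N -> `|tau s - 1| <= 2 * ei.
  move=> sm; rewrite ger0_norm ?subr_ge0//.
  have u1 : 1 - ei <= (tau s)^-1 by rewrite itau; apply: sgp; rewrite ltnS ltnW.
  have h1 := ler_wpM2l (ltW (tau0 s)) u1; rewrite mulfV ?(lt0r_neq0 (tau0 s))// in h1.
  have := tau2 s sm; have := ler_wpM2r (ltW (ek_gt0 lam4 k)) (tau2 s sm); rewrite -/ei; lra.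
have eiE : ei = lam ^+ 2 * (2 * eps).
  by rewrite -eps2 /ei -(ekS lam4 k) -(ekS lam4 k.+1) mulrA expr2.
(* [tau s - 1] is at most [2 ei], which offsets the [1 / eps] from the gradient of [r]: the quotient
   [ei / eps] equals [2 lam^2] for every [k]. *)
have CE : C1 * L + 2 * ei * Bd <= C * L.
  have CL0 : 0 <= C1 * L by rewrite mulr_ge0.
  have n0 : 0 <= 2 ^+ n * rho * lam ^+ 2 by rewrite !mulr_ge0 ?exprn_ge0// ltW.
  rewrite /C [leRHS]mulrDl lerD2l /Bd eiE.
  have -> : 2 * (lam ^+ 2 * (2 * eps)) * (2 ^+ n * rho * (C1 * L + C1 * L / eps)) =
    4 * (2 ^+ n * rho * lam ^+ 2) * (C1 * L) * (eps + 1) by field; rewrite gt_eqF.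
  have -> : 8 * (2 ^+ n * rho * C1 * lam ^+ 2) * L = 4 * (2 ^+ n * rho * lam ^+ 2) * (C1 * L) * 2 by ring.
  by apply: ler_wpM2l; [rewrite !mulr_ge0|lra].
have hpdG i j : pd j (G i) = fun x => pd j (w i) x - mi * \sum_(s < m) (tau s - 1) * pd j (Fdil (xi s) r i) x.
  rewrite /G (pdB_smooth j (tf_smooth (tw i)) (smoothZ mi (tf_smooth (tSF i)))).
  rewrite (pdZ_smooth j mi (tf_smooth (tSF i))); apply/funext => x; congr (_ - _ * _).
  rewrite pd_sum; last by move=> s; apply: smoothZ; exact: tf_smooth (tF s i).
  by apply: eq_bigr => s _; rewrite (pdZ_smooth j _ (tf_smooth (tF s i))).
exists G, rb; split.
- split.
  + by move=> i; apply: tfB => //; exact: tfZ.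
  + exact: tfZ.
  + move=> x nD i; have nA : ~ As x by move=> /(ann_mono _ _) h; apply: nD; apply: h; rewrite /sg; lra.
    rewrite /G; have [_ ->] := offA x nA; rewrite sub0r big1 ?mulr0 ?oppr0// => s _.
    rewrite /Fdil offr ?mulr0// => /(ann_dil _ _ _ (xi0 s)) h; apply: nD; apply: ann_mono h.
      apply: (le_trans (low s (ltn_ord s))); rewrite ler_wpM2l ?(ltW sg0)//.
      by rewrite lef_pV2 ?posrE.
    rewrite ler_pdivrMr//; apply: ler_peMr => //; lra.
  + move=> x nA; rewrite /rb big1 ?mulr0// => s _; rewrite /dil offr ?mulr0//.
    move=> /(ann_dil _ _ _ (tau0 s)) h; apply: nA; split; last by case: (ann_mono (low s (ltn_ord s)) (lexx _) h).
    by have [h1 _] := h; exact: cpoly_opoly (hi s) _ h1.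
- move=> i; apply: le_trans CE.
  apply: (@l2n_average_le m (w i) (fun s => Fdil (xi s) r i) (fun s => tau s - 1) (C1 * L) Bd (2 * ei)
    m0 (tf_sq (tw i)) (fun s => tf_sq (tF s i)) _ taum) => //.
    by apply: le_trans hw; exact: l2n_le_h1s.
  by move=> s sm; have [h _] := hFd s sm; exact: h.
- move=> i j; apply: le_trans CE.
  rewrite hpdG.
  apply: (@l2n_average_le m (pd j (w i)) (fun s => pd j (Fdil (xi s) r i)) (fun s => tau s - 1) (C1 * L) Bd
    (2 * ei) m0 (tf_sq (tf_pd j (tw i))) (fun s => tf_sq (tf_pd j (tF s i))) _ taum) => //.
    by apply: le_trans hw; exact: l2n_pd_le_h1s.
  by move=> s sm; have [_ h] := hFd s sm; exact: h.
- have dis k1 l1 x : setT x -> (k1 + 1 <= l1)%N -> dil (tau k1) r x * dil (tau l1) r x = 0.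
    move=> _; rewrite addn1 => kl; rewrite /dil.
    have [h1|h1] := pselect (As (tau k1 *: x)); last by rewrite offr ?mulr0 ?mul0r.
    have [h2|h2] := pselect (As (tau l1 *: x)); last by rewrite [r (tau l1 *: x)]offr ?mulr0.
    exfalso; move: h1 h2 => /(ann_dil _ _ _ (tau0 k1)) h1 /(ann_dil _ _ _ (tau0 l1)) h2.
    apply: (ann_disjoint _ h2 h1); rewrite !itau -exprS.
    apply: (@lt_le_trans _ _ (sg ^+ l1.+1)).
      by rewrite gtr_pMl ?exprn_gt0//; lra.
    by apply: ler_wiXn2l; rewrite ?ltW.
  have sSd := tf_sq tSd.
  have hS : L2 (fun y => \sum_(s < m) dil (tau s) r y) ^+ 2 <= 2 * (m%:R * (Q * L) ^+ 2).
    rewrite l2n_sqr.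
    apply: le_trans (l2ip_band measurableT m (fun s => tf_sq (tdil s)) dis) _.
    rewrite muln1; apply: ler_wpM2l => //.
    apply: (@le_trans _ _ (\sum_(s < m) (Q * L) ^+ 2)).
      apply: ler_sum => s _; rewrite -l2n_sqr ler_pXn2r ?nnegrE ?l2n_ge0 ?mulr_ge0//.
      apply: le_trans (l2n_dil (tau1 s) (tau2 s (ltn_ord s)) tr) _.
      by rewrite /Q -mulrA ler_wpM2l ?exprn_ge0.
    by rewrite sumr_const card_ord mulr_natl.
  rewrite -(@ler_pXn2r _ 2)// ?nnegrE ?mulr_ge0 ?l2n_ge0//.
  rewrite /rb (l2nZ measurableT mi sSd) (ger0_norm mi0) !exprMn -/L.
  have mm : m%:R * mi = 1 by rewrite mulfV.
  have h32 : 32 * Q ^+ 2 * mi <= 1 by rewrite -[leRHS]mm; apply: ler_wpM2r.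
  move: hS; set S2 := L2 _ ^+ 2 => hS.
  have -> : 4 ^+ 2 * (mi ^+ 2 * S2) = 16 * mi ^+ 2 * S2 by ring.
  have c0 : 0 <= 16 * mi ^+ 2 by rewrite mulr_ge0 ?sqr_ge0.
  apply: le_trans (ler_wpM2l c0 hS) _.
  have -> : 16 * mi ^+ 2 * (2 * (m%:R * (Q * L) ^+ 2)) = 32 * Q ^+ 2 * mi * (m%:R * mi) * L ^+ 2 by ring.
  by rewrite mm mulr1; apply: ler_piMl => //; exact: sqr_ge0.
- have sw := tf_sq (tf_dv tw); have sr := tf_sq tr.
  have sdF s := tf_sq (tf_dv (tF s)); have sdd s := tf_sq (tdil s).
  have sE := sqintB measurableT sf (sqintD measurableT sw sr).
  (* [mi * Z], the exact change of [ip q r] caused by the averaging, is subtracted in [dv G] and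
     added in [rb]; it cancels in the sum. *)
  pose Z := \sum_(s < m) (tau s - 1) * ip q (dv (Fdil (xi s) r)).
  have e1 : ip q (dv G) = ip q (dv w) - mi * Z.
    have -> : dv G = fun y => dv w y - mi * \sum_(s < m) (tau s - 1) * dv (Fdil (xi s) r) y.
      apply/funext => y; rewrite /dv; under eq_bigr do rewrite hpdG.
      rewrite sumrB; congr (_ - _); rewrite -mulr_sumr exchange_big/=; congr (_ * _).
      by apply: eq_bigr => s _; rewrite mulr_sumr.
    exact: (l2ip_lincomb measurableT m (fun s => tau s - 1) mi sqq sw sdF).
  have e2 : ip q rb = ip q r + mi * Z.
    apply: (etrans (l2ip_sumr_nat measurableT m mi sqq sdd)).
    have -> : \sum_(s < m) ip q (dil (tau s) r) = \sum_(s < m) (ip q r + (tau s - 1) * ip q (dv (Fdil (xi s) r))).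
      by apply: eq_bigr => s _; have [_ <-] := hxi s; rewrite addrC subrK.
    by rewrite big_split/= sumr_const card_ord mulrDr -mulr_natl mulKf.
  have e3 : ip q f - (ip q (dv G) + ip q rb) = ip q (fun x => f x - (dv w x + r x)).
    rewrite (l2ipBr measurableT sqq sf (sqintD measurableT sw sr)) (l2ipDr measurableT sqq sw sr) e1 e2.
    by move: (ip q (dv w)) (ip q r) (ip q f) (mi * Z) => *; ring.
  rewrite e3; apply: le_trans (l2_CS measurableT sqq sE) _.
  by apply: ler_wpM2l err; exact: l2n_ge0.
Qed.

End polytope_shells.

(** * Even bumps of integral one *)

Section bump.
Variables (R : realType).

Lemma leb_box_gt0 n (k : R) : 0 < k -> (0 < leb R n [set x | forall i, (`|x ord0 i| <= k)%R])%E.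
Proof.
move=> k0; elim: n => [|n IH].
  by rewrite /= /dirac/= indicE mem_set ?lte01// => -[].
have mB m : measurable [set x : 'rV[R]_m | forall i, (`|x ord0 i| <= k)%R].
  apply: (@measurable_box R m (fun _ => [set z : R | `|z| <= k]%R)) => i.
  rewrite (_ : mkset _ = [set` `[(- k)%R, k]]); first exact: measurable_itv.
  by apply/seteqP; split => z /=; rewrite in_itv/= ler_norml.
have E : @rV_cons R n @^-1` [set x | forall i, (`|x ord0 i| <= k)%R] =
  (([set` `[(- k)%R, k]] : set (measurableTypeR R)) `*` [set x : 'rV[R]_n | forall i, (`|x ord0 i| <= k)%R]).
  apply/seteqP; split => -[t x] /=.
    move=> h; split; first by have := h ord0; rewrite rV_consE unlift_none in_itv/= ler_norml.
    by move=> i; have := h (lift ord0 i); rewrite rV_consE liftK.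
  move=> [ht hx] i; rewrite rV_consE; case: unliftP => [j _|_] //=.
  by move: ht; rewrite in_itv/= ler_norml.
rewrite leb_succ E.
have mI : measurable ([set` `[(- k)%R, k]] : set (measurableTypeR R)) by exact: measurable_itv.
rewrite (product_measure1E _ _ mI (mB n)).
apply: mule_gt0 => //.
rewrite /= lebesgue_measure_itv/= lte_fin gtrN// -EFinB lte_fin; lra.
Qed.

Variable n : nat.
Local Notation E := 'rV[R]_n.
Local Notation mu := (leb R n).

Lemma even_bump (s : R) : 0 < s -> exists om : E -> R, [/\ tf (cball s) om,
  (forall x, om (- x) = om x), (forall x, 0 <= om x) & \int[mu]_x om x = 1].
Proof.
move=> s0; pose lo : E := const_mx (- s); pose hi : E := const_mx s.
pose w := box_bump lo hi 1.
have tw : tf (cball s) w.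
  apply: tf_box_bump => x h; apply: norm_le_coord; first exact: ltW.
  by move=> i; have := h i; rewrite !mxE -ler_norml.
have w0 x : 0 <= w x by exact: box_bump_ge0.
have we x : w (- x) = w x.
  rewrite /w /box_bump; apply: eq_bigr => i _; rewrite !mxE !mul1r mulrC.
  by congr (step01 _ * step01 _); ring.
have iw := tf_integrable tw; pose I := \int[mu]_x w x.
have I0 : 0 < I.
  rewrite lt_neqAle Rintegral_ge0// andbT eq_sym; apply/negP => /eqP Iz.
  have z : (\int[mu]_x `|(w x)%:E| = 0)%E.
    rewrite (_ : (\int[mu]_x `|(w x)%:E|)%E = (\int[mu]_x (w x)%:E)%E); last first.
      by apply: eq_integral => x _; rewrite gee0_abs// lee_fin.
    rewrite -[LHS]fineK; last exact: integrable_fin_num.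
    by rewrite -/(Rintegral mu setT w) -/I Iz.
  have mw : measurable_fun setT (fun x => (w x)%:E) by case/integrableP : iw.
  have := (ae_eq_integral_abs mu measurableT mw).1 z.
  move=> [N [mN N0 subN]].
  have : (mu [set x : E | forall i, (`|x ord0 i| <= s / 2)%R] <= mu N)%E.
    apply: le_measure; rewrite ?inE//.
      apply: (@measurable_box R n (fun _ => [set z : R | `|z| <= s / 2]%R)) => i.
      rewrite (_ : mkset _ = [set` `[(- (s / 2))%R, s / 2]]); first exact: measurable_itv.
      by apply/seteqP; split => y /=; rewrite in_itv/= ler_norml.
    move=> x /= hx; apply: subN => /= h; have [] := h Logic.I => /eqP.
    apply/negP; rewrite gt_eqF//; apply: box_bump_gt0 => i; rewrite !mxE -ltr_norml.
    by apply: le_lt_trans (hx i) _; lra.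
  rewrite N0 leNgt => /negP; apply; apply: leb_box_gt0; lra.
exists (fun x => I^-1 * w x); split.
- exact: tfZ.
- by move=> x; rewrite we.
- by move=> x; rewrite mulr_ge0// invr_ge0 ltW.
- by rewrite RintZ// mulVf// gt_eqF.
Qed.

End bump.

Lemma l2_exhaust d (T : measurableType d) (R : realType) (mu : {measure set T -> \bar R})
    (q : T -> R) (K : set T) (Km : nat -> set T) (B : R) : measurable K ->
  (forall m, measurable (Km m)) -> (forall m, Km m `<=` K) ->
  (forall x, K x -> \forall m \near \oo, Km m x) -> sqint mu setT q ->
  (forall m, l2ip mu setT (fun x => q x * \1_(Km m) x) (fun x => q x * \1_(Km m) x) <= B) ->
  l2ip mu setT (fun x => q x * \1_K x) (fun x => q x * \1_K x) <= B.
Proof.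
move=> mK mKm KmK exh [mq q2] hB.
have sqE (A : set T) x : q x * \1_A x * (q x * \1_A x) = q x ^+ 2 * \1_A x.
  rewrite expr2 indicE; case: (_ \in _); first by rewrite !mulr1.
  by rewrite !mulr0.
have mf (A : set T) : measurable A -> measurable_fun setT (fun x => q x ^+ 2 * \1_A x).
  by move=> mA; apply: measurable_funM; [exact: measurable_funX|exact: measurable_indic].
have le1 (A : set T) x : `|q x ^+ 2 * \1_A x| <= q x ^+ 2.
  rewrite indicE; case: (_ \in _); first by rewrite mulr1 ger0_norm// sqr_ge0.
  by rewrite mulr0 normr0 sqr_ge0.
have ii (A : set T) : measurable A -> mu.-integrable setT (EFin \o (fun x => q x ^+ 2 * \1_A x)).
  by move=> mA; apply: (integrable_le measurableT (mf _ mA) q2) => x _; exact: le1.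
have cv x : (fun m => (q x ^+ 2 * \1_(Km m) x)%:E) @ \oo --> (q x ^+ 2 * \1_K x)%:E.
  apply: cvg_near_cst; have [Kx|nKx] := pselect (K x).
    by have := exh _ Kx; apply: filterS => m Kmx; rewrite !indicE !mem_set.
  apply: nearW => m; rewrite !indicE !memNset// => h; exact: nKx (KmK _ _ h).
have [_ _] := @dominated_convergence _ _ _ mu setT measurableT
   (fun m x => (q x ^+ 2 * \1_(Km m) x)%:E) (fun x => (q x ^+ 2 * \1_K x)%:E)
   (fun x => (q x ^+ 2)%:E) (fun m => proj2 (measurable_EFinP _ _) (mf _ (mKm m)))
   (proj2 (measurable_EFinP _ _) (mf _ mK))
   (aeW _ (fun x _ => cv x)) q2 (aeW _ (fun x m _ => le1 (Km m) x)).
move=> c; rewrite /l2ip; under eq_Rintegral do rewrite sqE.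
have fl : (\int[mu]_x (q x ^+ 2 * \1_K x)%:E <= B%:E)%E.
  rewrite -(cvg_lim _ c)//; apply: lime_le; first by apply/cvg_ex; eexists; exact: c.
  apply: nearW => m /=; have := hB m; rewrite /l2ip; under eq_Rintegral do rewrite sqE.
  move=> h; rewrite -[leLHS]fineK ?lee_fin//; exact: integrable_fin_num (ii _ (mKm m)).
by move: fl; rewrite -[X in (X <= _)%E]fineK ?lee_fin//; exact: integrable_fin_num (ii _ mK).
Qed.

Lemma pow4_small (R : realType) (g : R) : 0 < g -> \forall k \near \oo, (4^-1 : R) ^+ k < g.
Proof.
move=> g0.
have c4 : (fun k => (4^-1 : R) ^+ k) @ \oo --> (0 : R).
  by apply: cvg_expr; rewrite ger0_norm ?invr_ge0// invf_lt1// ltr1n.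
exact: (@cvgr_lt _ _ _ _ _ _ c4 _ g0).
Qed.

Lemma ek_pow4 (R : realType) (lam : R) (k : nat) : 4 <= lam -> ek lam k.+1 <= 4^-1 ^+ k.
Proof.
move=> lam4; have l0 : 0 < lam by lra.
have h0 : 0 <= lam^-1 by rewrite invr_ge0 ltW.
have l4 : lam^-1 <= 4^-1 by rewrite lef_pV2 ?posrE.
have h4 : 0 <= 4^-1 :> R by rewrite invr_ge0.
have h3 : lam^-1 ^+ k <= 4^-1 ^+ k by rewrite lerXn2r ?nnegrE.
have h1 : lam^-1 ^+ k.+1 <= lam^-1 ^+ k.
  by rewrite exprSr; apply: ler_piMr; [exact: exprn_ge0|lra].
by have h2 : 0 <= lam^-1 ^+ k.+1; [exact: exprn_ge0|rewrite /ek; lra].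
Qed.

(** * From the shells to the whole polytope *)

Section polytope.
Variables (R : realType) (n p : nat).
Local Notation E := 'rV[R]_n.
Local Notation mu := (leb R n).
Local Notation L2 := (l2n mu setT).
Local Notation sq := (sqint mu setT).
Local Notation ip := (l2ip mu setT).
Implicit Types (f g phi psi q r : E -> R) (U V : set E) (v w : 'I_n -> E -> R).
Variables (a : 'I_p -> E) (rho : R).
Hypothesis rho1 : (1 : R) <= rho.
Hypothesis arho : opoly a 1 `<=` cball rho.
Local Notation K := (opoly a 1).

Lemma sq_indic q (A : set E) : measurable A -> sq q -> sq (fun x => q x * \1_A x).
Proof.
move=> mA sqq; under [X in sqint _ _ X]eq_fun do rewrite mulrC.
apply: (@sqint_bounded _ _ _ mu setT _ q 1) => // x _.
by rewrite /indic; case: (_ \in _); rewrite ?normr1 ?normr0.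
Qed.

Lemma opoly_measurable t : measurable (opoly a t).
Proof. by apply: open_measurable_rV; exact: opoly_open. Qed.

Lemma small_addr_gt0 (x y c : R) : 0 <= c -> (forall e : R, 0 < e -> x <= y + c * e) -> x <= y.
Proof.
move=> c0 h; apply/ler_addgt0Pr => e e0.
have c1 : 0 < c + 1 by lra.
apply: le_trans (h (e / (c + 1)) _) _; first by rewrite divr_gt0.
by rewrite lerD2l mulrA ler_pdivrMr// mulrDr mulr1 mulrC lerDl ltW.
Qed.

Lemma opoly_thicken (e : R) : 0 < e -> exists2 s : R, 0 < s &
  forall x z, opoly a (1 - e) x -> `|z| <= s -> K (x + z).
Proof.
move=> e0; pose A : R := 1 + \sum_(i < p) \sum_(j < n) `|a i ord0 j|.
have A1 : 1 <= A by rewrite lerDl; apply: sumr_ge0 => i _; exact: sumr_ge0.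
have A0 : 0 < A by lra.
exists (e / 2 / A); first by rewrite !divr_gt0.
move=> x z hx hz i.
have dD : dot (a i) (x + z) = dot (a i) x + dot (a i) z.
  by rewrite /dot -big_split/=; apply: eq_bigr => j _; rewrite mxE mulrDr.
have dz : `|dot (a i) z| <= e / 2.
  apply: (le_trans (ler_norm_sum _ _ _)).
  apply: (@le_trans _ _ (\sum_(j < n) `|a i ord0 j| * (e / 2 / A))).
    apply: ler_sum => j _; rewrite normrM ler_wpM2l//; apply: le_trans hz; exact: coord_le.
  rewrite -mulr_suml mulrA ler_pdivrMr// mulrC; apply: ler_wpM2l; first by rewrite divr_ge0 ?ltW.
  rewrite /A (bigD1 i)//= addrCA lerDl addr_ge0//; apply: sumr_ge0 => k _; exact: sumr_ge0.
rewrite dD; have := hx i; have := ler_norm (dot (a i) z); lra.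
Qed.

Lemma l2n_sqrt f (B : R) : 0 <= B -> ip f f <= B ^+ 2 -> L2 f <= B.
Proof. by move=> B0 h; rewrite -[leRHS](ger0_norm B0) -sqrtr_sqr; exact: ler_wsqrtr. Qed.

Definition shell lam k : set E := opoly a (1 - ek lam k.+1) `\` opoly a (1 - ek lam k).
Definition on_shell lam q k : E -> R := fun x => q x * \1_(shell lam k) x.

Lemma shell_measurable lam k : measurable (shell lam k).
Proof. by apply: measurableD; exact: opoly_measurable. Qed.

Lemma indic_ip q r (A : set E) : (forall x, ~ A x -> r x = 0) ->
  ip q r = ip (fun x => q x * \1_A x) r.
Proof.
move=> h; apply: eq_Rintegral => x _; rewrite indicE.
case: (boolP (x \in A)) => [_|/negP nA]; first by rewrite mulr1.
by rewrite h ?mulr0 ?mul0r// => Ax; apply: nA; rewrite inE.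
Qed.

Lemma ip_indic q (A : set E) : ip q (fun x => q x * \1_A x) = ip (fun x => q x * \1_A x) (fun x => q x * \1_A x).
Proof.
apply: indic_ip => x nA; rewrite indicE memNset ?mulr0//.
Qed.

Lemma dv_sum (m : nat) (G : nat -> 'I_n -> E -> R) : (forall k i, smooth (G k i)) ->
  dv (fun i x => \sum_(k < m) G k i x) = fun x => \sum_(k < m) dv (G k) x.
Proof.
move=> sG; apply/funext => x; rewrite /dv exchange_big/=; apply: eq_bigr => i _.
by rewrite pd_sum.
Qed.

(** With [A k] the squared norm of [q] on shell [k], [shell_step] bounds [A k.+1] by
    [ip q (dv (G k))] plus [(A k + A k.+1) / 8]. The fields are summed before [gradle] is applied:
    they overlap boundedly, so the H^1 size of their sum is [O(sqrt S2)], and [S2] is absorbed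
    without any loss in [m]. *)
Lemma shell_sum : exists lam C : R, [/\ (4 : R) <= lam, (0 : R) <= C & forall q (N : R),
  sq q -> 0 <= N -> gradle K q N -> forall m : nat,
  \sum_(k < m) ip (on_shell lam q k.+1) (on_shell lam q k.+1) <=
    C * N ^+ 2 + ip (on_shell lam q 0) (on_shell lam q 0)].
Proof.
have [lam [C [lam4 C0 step]]] := shell_step rho1 arho.
exists lam, (18 * (nn R n * C) ^+ 2); split => //; first by rewrite mulr_ge0// sqr_ge0.
move=> q N sqq N0 gq m.
have lq : locint q by move=> A cA; exact: (sqint_locint measurableT sqq cA).
pose A k := ip (on_shell lam q k) (on_shell lam q k).
have A0 k : 0 <= A k by exact: l2ip_ge0.
pose S2 := \sum_(k < m) A k.+1; have S20 : 0 <= S2 by apply: sumr_ge0.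
rewrite -/(A 0%N) (_ : \sum_(k < m) _ = S2)//.
have sf k : sq (on_shell lam q k) by apply: sq_indic => //; exact: shell_measurable.
suff key : S2 / 2 <= (9 * (nn R n * C) ^+ 2 * N ^+ 2 + A 0%N / 8) by have := A0 0%N; lra.
apply: (@small_addr_gt0 _ _ (m%:R * L2 q)); first by rewrite mulr_ge0 ?l2n_ge0.
move=> e e0.
have /choice[Gr hGr] : forall k, exists Gr : ('I_n -> E -> R) * (E -> R), 
   [/\ [/\ tfv K Gr.1, tf K Gr.2,
     (forall x, ~ ann a (1 - ek lam k) (1 - ek lam k.+2 / 2) x -> forall i, Gr.1 i x = 0) &
     (forall x, ~ shell lam k x -> Gr.2 x = 0)],
     (forall i, L2 (Gr.1 i) <= C * L2 (on_shell lam q k.+1)),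
     (forall i j, L2 (pd j (Gr.1 i)) <= C * L2 (on_shell lam q k.+1)),
     4 * L2 Gr.2 <= L2 (on_shell lam q k.+1) &
     `|ip q (on_shell lam q k.+1) - (ip q (dv Gr.1) + ip q Gr.2)| <= L2 q * e].
  by move=> k; have [G [rb h]] := step k q e sqq lq e0; exists (G, rb).
pose G k := (Gr k).1; pose rb k := (Gr k).2.
have tG k : tfv K (G k) by have [[]] := hGr k.
have sG k i : smooth (G k i) := tf_smooth (tG k i).
have trb k : tf K (rb k) by have [[]] := hGr k.
pose Gs i x := \sum_(k < m) G k i x.
have tGs : tfv K Gs by move=> i; apply: tf_sum => k; exact: tG.
pose D k := ann a (1 - ek lam k) (1 - ek lam k.+2 / 2).
have GD k i x : ~ D k x -> G k i x = 0 by move=> nD; have [[_ _ h _] _ _ _ _] := hGr k; exact: (h x nD i).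
have disD k l x : (k + 3 <= l)%N -> D k x -> D l x -> False.
  move=> kl; apply: ann_disjoint.
  have h1 := ek_mono lam4 kl; rewrite addn3 in h1.
  have h2 := ek_le lam4 k.+2; have h3 := ek_gt0 lam4 k.+2; have h4 := ek_gt0 lam4 k.+3; lra.
(* The sets [D k] and [D l] are disjoint as soon as [l >= k + 3], so [l2ip_band] costs a factor 6,
   rounded up to 9, the square of 3. *)
have band (F : nat -> E -> R) : (forall k, sq (F k)) -> (forall k x, ~ D k x -> F k x = 0) ->
   (forall k, L2 (F k) <= C * L2 (on_shell lam q k.+1)) ->
   L2 (fun x => \sum_(k < m) F k x) <= 3 * (C * Num.sqrt S2).
  move=> sF F0 FB; apply: l2n_sqrt; first by rewrite !mulr_ge0 ?sqrtr_ge0.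
  apply: le_trans (l2ip_band measurableT (w := 3) m sF _) _.
    move=> k l x _ kl; have [Dk|Dk] := pselect (D k x); last by rewrite F0// mul0r.
    by rewrite [F l x]F0 ?mulr0// => Dl; exact: disD kl Dk Dl.
  rewrite !exprMn sqr_sqrtr// /S2 !mulr_sumr; apply: ler_sum => k _.
  have CA : L2 (F k) ^+ 2 <= (C * L2 (on_shell lam q k.+1)) ^+ 2.
    by rewrite ler_pXn2r ?nnegrE ?mulr_ge0 ?l2n_ge0.
  rewrite exprMn !l2n_sqr -/(A k.+1) in CA.
  have : 0 <= C ^+ 2 * A k.+1 by rewrite mulr_ge0 ?sqr_ge0.
  lra.
have hGs : h1s Gs <= nn R n * (3 * (C * Num.sqrt S2)).
  apply: h1s_le => [i|i j].
    apply: (band (fun k => G k i)) => [k|k x|k]; [exact: tf_sq (tG k i)|exact: GD|].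
    by have [_ h _ _ _] := hGr k; exact: h.
  have -> : pd j (Gs i) = fun x => \sum_(k < m) pd j (G k i) x.
    by apply/funext => x; rewrite /Gs pd_sum.
  apply: (band (fun k => pd j (G k i))) => [k|k x|k].
  - exact: tf_sq (tf_pd j (tG k i)).
  - by apply: pd_off => [|y]; [exact: ann_closed|exact: GD].
  - by have [_ _ h _ _] := hGr k; exact: h.
have hdv : \sum_(k < m) ip q (dv (G k)) <= N * (nn R n * (3 * (C * Num.sqrt S2))).
  have sdG k : sq (dv (G k)) := tf_sq (tf_dv (tG k)).
  have <- := @l2ip_sumr _ _ _ mu setT measurableT 'I_m (index_enum _) q (fun k : 'I_m => dv (G k)) sqq (fun k => sdG k).
  rewrite -(dv_sum m sG) -/Gs; apply: le_trans (ler_norm _) _; apply: le_trans (gq _ tGs) _.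
  by apply: ler_wpM2l.
(* [rb k] sees [q] only on shell [k], so the product is at most [sqrt (A k) * sqrt (A k.+1) / 4]. *)
have hrb k : ip q (rb k) <= (A k + A k.+1) / 8.
  have [[_ _ _ off] _ _ h4 _] := hGr k.
  rewrite (indic_ip q off) -/(on_shell lam q k).
  apply: le_trans (ler_norm _) _; apply: le_trans (l2_CS measurableT (sf k) (tf_sq (trb k))) _.
  rewrite /A -!l2n_sqr; move: h4; rewrite -/(rb k).
  have := l2n_ge0 mu setT (on_shell lam q k); have := l2n_ge0 mu setT (rb k).
  move: (L2 (rb k)) (L2 (on_shell lam q k)) (L2 (on_shell lam q k.+1)) => x y z x0 y0 xz.
  have := sqr_ge0 (y - z); nra.
have hA k : A k.+1 <= ip q (dv (G k)) + ip q (rb k) + L2 q * e.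
  have [_ _ _ _ h] := hGr k; rewrite /A /on_shell -ip_indic -/(on_shell lam q k.+1).
  by have := le_trans (ler_norm _) h; rewrite -/(G k) -/(rb k); lra.
have hS : S2 <= \sum_(k < m) ip q (dv (G k)) + \sum_(k < m) (A k + A k.+1) / 8 + m%:R * (L2 q * e).
  have -> : m%:R * (L2 q * e) = \sum_(k < m) L2 q * e by rewrite sumr_const card_ord mulr_natl.
  rewrite -!big_split/=; apply: ler_sum => k _; apply: le_trans (hA k) _.
  by rewrite lerD2r lerD2l.
have hAk : \sum_(k < m) (A k + A k.+1) / 8 <= (A 0%N + 2 * S2) / 8.
  rewrite -mulr_suml ler_wpM2r// big_split/= -/S2.
  have : \sum_(k < m) A k <= A 0%N + S2.
    have -> : A 0%N + S2 = \sum_(k < m.+1) A k by rewrite big_ord_recl.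
    by rewrite big_ord_recr/= lerDl.
  lra.
have := sqr_sqrtr S20; have := sqrtr_ge0 S2; move: hdv hS hAk.
set s := Num.sqrt S2 => hdv hS hAk s0 sS.
(* Completing the square spends a quarter of [S2] on the term linear in [s]; another quarter went
   into the remainders, and half is left for the conclusion. *)
have := sqr_ge0 (s / 2 - 3 * (nn R n * C) * N).
have : (s / 2 - 3 * (nn R n * C) * N) ^+ 2 =
   s ^+ 2 / 4 - N * (nn R n * (3 * (C * s))) + 9 * (nn R n * C) ^+ 2 * N ^+ 2 by field.
move=> ->; rewrite sS; lra.
Qed.

Lemma cpoly_compact t : t < 1 -> compact (cpoly a t).
Proof.
move=> t1; have h : cpoly a t `<=` cball rho by apply: subset_trans arho; exact: cpoly_opoly.
exact: (subclosed_compact (@cpoly_closed R n p a t) (@cball_compact R n rho) h).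
Qed.

Lemma tf_pcut (s t : R) : s < t -> t < 1 -> tf K (pcut a s t).
Proof.
move=> st t1; have [M M1 hM] := pcut_sbd a; split; first by have [] := hM s t st.
exists (cpoly a t); split; [exact: cpoly_compact|exact: cpoly_opoly|].
by move=> x nx; apply: pcut_eq0 => // h; apply: nx; exact: opoly_cpoly h.
Qed.

(** Cauchy-Schwarz against a cutoff, which stands for the finite measure of the support. *)
Lemma l1_le_l2 V r chi : tf V r -> sq chi -> (forall x, V x -> chi x = 1) ->
  \int[mu]_x `|r x| <= L2 chi * L2 r.
Proof.
move=> tr sc c1; have sr := tf_sq tr.
have ii : mu.-integrable setT (EFin \o (fun x => chi x * r x)) by exact: sqintM.
have -> : \int[mu]_x `|r x| = \int[mu]_x `|chi x * r x|.
  apply: eq_Rintegral => x _; have [Vx|nV] := pselect (V x); first by rewrite c1// mul1r.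
  by rewrite (tf_off tr nV) mulr0.
have mr : measurable_fun setT r by case: sr.
have snr : sq (fun x => `|r x|).
  case: sr => _ r2; split; first exact: measurableT_comp.
  by under [X in integrable _ _ X]eq_fun do rewrite /= real_normK ?num_real//.
have snc : sq (fun x => `|chi x|).
  case: sc => mc c2; split; first exact: measurableT_comp.
  by under [X in integrable _ _ X]eq_fun do rewrite /= real_normK ?num_real//.
have nE g : L2 (fun x => `|g x|) = L2 g.
  by congr Num.sqrt; apply: eq_Rintegral => x _; rewrite -!expr2 real_normK ?num_real.
have := l2_CS measurableT snc snr; rewrite !nE; apply: le_trans; apply: le_trans (ler_norm _).
by rewrite le_eqVlt; apply/orP; left; apply/eqP; apply: eq_Rintegral => x _; rewrite normrM.
Qed.

(** At a fixed distance from the boundary the decomposition scale is fixed, and the remainder can be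
    moved at bounded cost by [core_estimate], centred at the origin. The condition [ip q om = 0]
    removes the value that the remainder is compared with. *)
Lemma core_bound (e s : R) om : 0 < e -> e < 1 -> 0 <= s ->
  (forall x z, opoly a (1 - e / 4) x -> `|z| <= s -> K (x + z)) ->
  tf (cball s) om -> (forall x, om (- x) = om x) -> (forall x, 0 <= om x) -> \int[mu]_x om x = 1 ->
  exists2 C : R, (0 : R) <= C & forall q (N : R), sq q -> mu.-integrable setT (EFin \o q) -> 0 <= N ->
    gradle K q N -> ip q om = 0 -> L2 (fun x => q x * \1_(opoly a (1 - e)) x) <= C * N.
Proof.
move=> e0 e1 s0 thick tom ome om0 om1.
have [M0 M01 hcut] := pcut_sbd a.
have [C1 C10 hloc] := @local_decomposition R n M0 (le_trans ler01 M01).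
pose eps := e / 2; have eps0 : 0 < eps by rewrite divr_gt0.
pose V := opoly a (1 - e / 4).
pose chi := pcut a (1 - e / 4) (1 - e / 8).
have tchi : tf K chi by apply: tf_pcut; lra.
have chi1 x : V x -> chi x = 1 by move=> Vx; apply: pcut_eq1; [lra|exact: opoly_cpoly Vx].
have rho0 : 0 <= rho by exact: le_trans rho1.
pose C2 := n%:R * s * (C1 * (1 + n%:R / eps)) + L2 chi * C1 * (n%:R * rho * h1f om).
have C20 : 0 <= C2.
  rewrite addr_ge0// !mulr_ge0 ?ler0n ?h1f_ge0 ?l2n_ge0//.
  by rewrite addr_ge0// divr_ge0 ?ler0n// ltW.
exists (C1 + C2); first by rewrite addr_ge0.
move=> q N sqq iq N0 gq qom.
set f := fun x => _; have sf : sq f by apply: sq_indic => //; exact: opoly_measurable.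
have w1 : 1 - e < 1 - eps by rewrite /eps; lra.
pose X := pcut a (1 - e) (1 - eps).
have sX : sbd M0 eps^-1 X by have := hcut _ _ w1; congr (sbd _ _^-1 _); rewrite /eps; field.
pose As := cpoly a (1 - eps).
have cAs : compact As by apply: cpoly_compact; lra.
have AsV : As `<=` V by apply: cpoly_opoly; rewrite /eps; lra.
have VK : V `<=` K by apply: opoly_mono; lra.
have XAs x : ~ As x -> X x = 0.
  by move=> nA; apply: pcut_eq0 => // h; apply: nA; exact: opoly_cpoly h.
have Xf x : X x * f x = f x.
  rewrite /f indicE; case: (boolP (x \in _)) => [|_]; last by rewrite !mulr0.
  by rewrite inE => h; rewrite /X pcut_eq1 ?mul1r//; exact: opoly_cpoly h.
have eps1 : eps <= 1 by rewrite /eps; lra.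
pose L := L2 f; have L0 : 0 <= L by exact: l2n_ge0.
suff key : L ^+ 2 <= (C1 + C2) * N * L.
  rewrite -/L; have [->|Lne] := eqVneq L 0; first by rewrite mulr_ge0// addr_ge0.
  have {}Lne : 0 < L by rewrite lt_neqAle eq_sym Lne.
  by rewrite -(ler_pM2r Lne) -expr2.
apply: (@small_addr_gt0 _ _ (L2 q)); first exact: l2n_ge0.
move=> d d0.
have [w [r [tw tr _ err [hw hr hpr]]]] := hloc eps X f d As V eps0 eps1 sX cAs AsV XAs sf Xf d0.
have V0 : V 0.
  by move=> i; rewrite (_ : dot (a i) 0 = 0) ?subr_gt0; [lra|apply: big1 => j _; rewrite mxE mulr0].
have starV y t : V y -> 0 <= t <= 1 -> V (0 + t *: (y - 0)).
  move=> Vy /andP[t0 t1] i; rewrite add0r subr0 dotZr; have h := Vy i.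
  have [dn|dp] := leP (dot (a i) y) 0; last by apply: le_lt_trans h; rewrite ler_piMl// ltW.
  by apply: (@le_lt_trans _ _ 0); [exact: mulr_ge0_le0|lra].
have VD x : V x -> `|x - 0| <= rho by rewrite subr0 => /VK /arho.
have core := core_estimate N0 sqq iq gq tr V0 starV thick VD tom ome om0 om1.
have m0 : mavg q om (- 0) = 0.
  by rewrite -[RHS]qom; apply: eq_Rintegral => x _; rewrite oppr0 addr0.
rewrite m0 mulr0 subr0 in core.
have h1r : h1f r <= C1 * (1 + n%:R / eps) * L.
  rewrite /h1f; apply: (@le_trans _ _ (C1 * L + \sum_(j < n) C1 * L / eps)).
    by apply: lerD => //; apply: ler_sum => j _; exact: hpr.
  by rewrite sumr_const card_ord -[_ *+ n]mulr_natl le_eqVlt; apply/orP; left; apply/eqP; field; rewrite gt_eqF.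
have l1r : \int[mu]_x `|r x| <= L2 chi * C1 * L.
  apply: le_trans (l1_le_l2 tr (tf_sq tchi) chi1) _; rewrite -mulrA; apply: ler_wpM2l => //.
  exact: l2n_ge0.
have hqr : `|ip q r| <= N * (C2 * L).
  apply: le_trans core _; apply: ler_wpM2l => //; rewrite /C2 mulrDl; apply: lerD.
    by rewrite -[leRHS]mulrA; apply: ler_wpM2l h1r; rewrite mulr_ge0 ?ler0n.
  rewrite [leRHS]mulrAC; apply: ler_wpM2r => //.
  by rewrite !mulr_ge0 ?ler0n ?h1f_ge0.
have sw := tf_sq (tf_dv tw); have sr := tf_sq tr.
have twK : tfv K w by move=> i; exact: tf_sub VK (tw i).
have hqw : `|ip q (dv w)| <= N * (C1 * L).
  by apply: le_trans (gq _ twK) _; apply: ler_wpM2l.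
have hqe : `|ip q (fun x => f x - (dv w x + r x))| <= L2 q * d.
  apply: le_trans (l2_CS measurableT sqq (sqintB measurableT sf (sqintD measurableT sw sr))) _.
  by apply: ler_wpM2l err; exact: l2n_ge0.
rewrite (l2ipBr measurableT sqq sf (sqintD measurableT sw sr)) (l2ipDr measurableT sqq sw sr) in hqe.
have Lq : L ^+ 2 = ip q f by rewrite /L l2n_sqr /f ip_indic.
rewrite Lq; move: hqe hqw hqr.
move: (ip q f) (ip q (dv w)) (ip q r) (L2 q * d) => x1 x2 x3 x4.
rewrite !ler_norml => /andP[_ h1] /andP[_ h2] /andP[_ h3].
have -> : (C1 + C2) * N * L = N * (C1 * L) + N * (C2 * L) by ring.
clear -h1 h2 h3; lra.
Qed.

Lemma int_dv U v : tfv U v -> \int[mu]_x dv v x = 0.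
Proof.
move=> tv; rewrite /dv Rintegral_sum//; last by move=> i; exact: tf_integrable (tf_pd i (tv i)).
by apply: big1 => i _; exact: int_pd (tv i).
Qed.

(** Subtracting the mean [m] against [om] leaves the gradient bound unchanged, since divergences of
    test fields integrate to zero, and makes [core_bound] applicable. The shells outside the core
    are added with [shell_sum], and the union is exhausted. *)
Lemma necas_centered : exists om (C : R), [/\ tf K om, \int[mu]_x om x = 1, (0 : R) <= C &
  forall q (N : R), sq q -> mu.-integrable setT (EFin \o q) -> 0 <= N -> gradle K q N ->
    L2 (fun x => (q x - ip q om) * \1_K x) <= C * N].
Proof.
have [lam [C [lam4 C0 hsum]]] := shell_sum.
pose e := ek lam 1; have e0 : 0 < e by exact: ek_gt0.
have e1 : e < 1 by have := ek_half lam4 1; rewrite -/e; lra.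
have [s s0 thick] := opoly_thicken (divr_gt0 e0 (ltr0n R 4)).
have [om [tom ome om0 om1]] := @even_bump R n s s0.
have [Cc Cc0 hcore] := core_bound e0 e1 (ltW s0) thick tom ome om0 om1.
have tomK : tf K om.
  apply: tf_sub tom => x xs; rewrite -[x]add0r; apply: thick => // i.
  by rewrite (_ : dot (a i) 0 = 0) ?subr_gt0; [lra|apply: big1 => j _; rewrite mxE mulr0].
(* The core contributes [Cc^2] twice: once for itself and once for the initial shell 0 of the
   recursion, which it contains. *)
exists om, (Num.sqrt (C + 2 * Cc ^+ 2)); split; [exact: tomK|exact: om1|exact: sqrtr_ge0|].
move=> q N sqq iq N0 gq; set m := ip q om.
have mK : measurable K by exact: opoly_measurable.
have muK : (mu K < +oo)%E.
  apply: le_lt_trans (compact_mu_lty (@cball_compact R n rho)); apply: le_measure; rewrite ?inE//.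
  exact: compact_measurable_rV (@cball_compact R n rho).
pose q1 x := (q x - m) * \1_K x.
have sK : sq (\1_K : E -> R).
  split; first exact: measurable_indic.
  have := integrable_indicR 1 mK muK; under eq_fun do rewrite /= mul1r.
  congr (integrable _ _ _); apply/funext => x; rewrite /= indicE.
  by case: (_ \in _); rewrite ?expr1n ?expr0n.
have q1E : q1 = fun x => q x * \1_K x - m * \1_K x by apply/funext => x; rewrite /q1 mulrBl.
have sq1 : sq q1.
  by rewrite q1E; apply: sqintB => //; [exact: sq_indic|exact: sqintZ].
have iK : mu.-integrable setT (EFin \o (fun x : E => m * \1_K x)) by exact: integrable_indicR.
have iq1 : mu.-integrable setT (EFin \o q1).
  rewrite q1E; apply: integrableRB => //.
  apply: (integrable_le measurableT _ (integrable_norm iq)).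
    by apply: measurable_funM; [exact: integrable_mfun iq|exact: measurable_indic].
  move=> x _; rewrite -[(_ \o q) x]/(`|q x|) indicE.
  by case: (_ \in _); rewrite ?mulr1// mulr0 normr0.
have q1ip r : tf K r -> ip q1 r = ip q r - m * \int[mu]_x r x.
  move=> tr; rewrite /l2ip -(RintZ m measurableT (tf_integrable tr)) -RintegralB//.
  - apply: eq_Rintegral => x _; rewrite -mulrBl /q1 indicE.
    case: (boolP (x \in K)) => [_|/negP nK]; first by rewrite mulr1.
    by rewrite (tf_off tr) ?mulr0// => Kx; apply: nK; rewrite inE.
  - by apply: sqintM => //; exact: tf_sq tr.
  - by apply: integrableRZ => //; exact: tf_integrable tr.
have gq1 : gradle K q1 N.
  move=> v tv; have := q1ip _ (tf_dv tv); rewrite (int_dv tv) mulr0 subr0 /l2ip => ->.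
  exact: gq.
have q1om : ip q1 om = 0 by rewrite q1ip// om1 mulr1 subrr.
have hc := hcore q1 N sq1 iq1 N0 gq1 q1om.
pose Km k := opoly a (1 - ek lam k.+1).
pose gm k x := q1 x * \1_(Km k) x.
have mKm k : measurable (Km k) by exact: opoly_measurable.
have a0 : ip (on_shell lam q1 0) (on_shell lam q1 0) <= ip (gm 0%N) (gm 0%N).
  apply: l2ip_le => //.
  - by apply: sq_indic => //; exact: shell_measurable.
  - exact: sq_indic.
  - move=> x _; rewrite /on_shell /gm !normrM ler_wpM2l// !indicE.
    case: (boolP (x \in shell lam 0)); last by rewrite normr0.
    by rewrite inE => -[h _]; rewrite (mem_set h).
have gmS k : ip (gm k.+1) (gm k.+1) = ip (gm k) (gm k) + ip (on_shell lam q1 k.+1) (on_shell lam q1 k.+1).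
  have s1 : sq (gm k) by exact: sq_indic.
  have s2 : sq (on_shell lam q1 k.+1) by apply: sq_indic => //; exact: shell_measurable.
  rewrite /l2ip -RintegralD//; [|exact: sqintM|exact: sqintM].
  apply: eq_Rintegral => x _; rewrite /gm /on_shell !indicE.
  have kk : ek lam k.+2 <= ek lam k.+1 by apply: ek_mono.
  case: (boolP (x \in Km k)) => [|/negP h1].
    rewrite inE => h1; rewrite [x \in Km k.+1]mem_set; last by apply: opoly_mono h1; lra.
    by rewrite memNset ?mulr0 ?addr0// => -[_ h2]; exact: h2.
  case: (boolP (x \in Km k.+1)) => [|/negP h2].
    rewrite inE => h2; rewrite [x \in shell _ _]mem_set; first by rewrite !mulr0 add0r.
    by split => // h3; apply: h1; rewrite inE.
  by rewrite memNset ?mulr0 ?addr0// => -[h3 _]; apply: h2; rewrite inE.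
have gmE k : ip (gm k) (gm k) = ip (gm 0%N) (gm 0%N) + \sum_(l < k) ip (on_shell lam q1 l.+1) (on_shell lam q1 l.+1).
  elim: k => [|k IH]; first by rewrite big_ord0 addr0.
  by rewrite gmS IH big_ord_recr/= addrA.
have gm0 : ip (gm 0%N) (gm 0%N) <= (Cc * N) ^+ 2.
  by rewrite -l2n_sqr ler_pXn2r ?nnegrE ?l2n_ge0 ?mulr_ge0.
have bound k : ip (gm k) (gm k) <= (C + 2 * Cc ^+ 2) * N ^+ 2.
  rewrite gmE; have := hsum q1 N sq1 N0 gq1 k; rewrite exprMn in gm0; lra.
have exh x : K x -> \forall k \near \oo, Km k x.
  move=> Kx; apply: filter_forall => i; have g0 : 0 < 1 - dot (a i) x by rewrite subr_gt0; exact: Kx.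
  have nr := pow4_small g0.
  apply: filterS nr => k hk.
  have := ek_pow4 k lam4.
  by rewrite /=; lra.
have KmK k : Km k `<=` K by apply: opoly_mono; have := ek_gt0 lam4 k.+1; lra.
have fin := l2_exhaust mK mKm KmK exh sq1 bound.
have q1K : (fun x => q1 x * \1_K x) = q1.
  apply/funext => x; rewrite /q1 indicE; case: (_ \in _); first by rewrite !mulr1.
  by rewrite !mulr0.
rewrite q1K in fin; rewrite -/q1; have C3 : 0 <= C + 2 * Cc ^+ 2 by rewrite addr_ge0// mulr_ge0 ?sqr_ge0.
apply: l2n_sqrt; first by rewrite mulr_ge0 ?sqrtr_ge0.
by rewrite exprMn sqr_sqrtr.
Qed.

End polytope.

Section seq_ae.
Context d (T : measurableType d) (R : realType) (mu : {measure set T -> \bar R}).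

Lemma ae_seq (I : eqType) (s : seq I) (Q : I -> T -> Prop) :
  (forall i, i \in s -> {ae mu, forall x, Q i x}) -> {ae mu, forall x, forall i, i \in s -> Q i x}.
Proof.
elim: s => [|i s IH] h; first by apply: aeW.
have h1 := h i (mem_head _ _).
have h2 : {ae mu, forall x, forall i, i \in s -> Q i x}.
  by apply: IH => j js; apply: h; rewrite in_cons js orbT.
by apply: filterS2 h1 h2 => x q1 q2 j; rewrite in_cons => /orP[/eqP ->//|]; exact: q2.
Qed.

End seq_ae.

(** * Necas inequality on a polyhedral domain *)

Section necas_property.
Variables (R : realType) (n : nat).
Local Notation E := 'rV[R]_n.
Local Notation mu := (leb R n).
Local Notation L2 := (l2n mu setT).
Local Notation sq := (sqint mu setT).
Local Notation ip := (l2ip mu setT).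
Implicit Types (f g phi psi q r om : E -> R) (U V : set E) (v w : 'I_n -> E -> R).

Definition gradle_data U q (N : R) :=
  [/\ sq q, mu.-integrable setT (EFin \o q), 0 <= N & gradle U q N].

(** The mean is taken against a test function rather than over [U], so that the means of different
    sets can be compared by moving bumps. *)
Definition necas_on U := exists om (C : R), [/\ tf U om, \int[mu]_x om x = 1, (0 : R) <= C &
  forall q (N : R), gradle_data U q N -> L2 (fun x => (q x - ip q om) * \1_U x) <= C * N].

Lemma l2ip_shift f g (z : E) : sq f -> sq g ->
  ip (fun x => f (x + z)) (fun x => g (x + z)) = ip f g.
Proof.
move=> sf sg; rewrite /l2ip.
exact: (Rintegral_shift z (sqintM measurableT sf sg)).
Qed.

Lemma sqint_shift f (z : E) : sq f -> sq (fun x => f (x + z)).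
Proof.
move=> [mf f2]; split; last exact: (integrable_shift z f2).
have := @measurable_affine R n 1 z; under [X in measurable_fun _ X]eq_fun do rewrite scale1r.
by move=> h; exact: (measurableT_comp mf h).
Qed.

Lemma gradle_shift U q (N : R) (z : E) : sq q -> gradle U q N ->
  gradle [set x | U (x + z)] (fun x => q (x + z)) N.
Proof.
move=> sqq gq v tv; pose v' i x := v i (x - z).
have tv' : tfv U v'.
  move=> i; apply: tf_sub (tf_shiftU (- z) (tv i)) => x /=; by rewrite subrK.
have dvE x : dv v x = dv v' (x + z).
  by apply: eq_bigr => i _; rewrite (pd_shift (- z) i _ (tf_smooth (tv i))) addrK.
have -> : \int[mu]_x (q (x + z) * dv v x) = \int[mu]_x (q x * dv v' x).
  under eq_Rintegral do rewrite dvE.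
  exact: (l2ip_shift z sqq (tf_sq (tf_dv tv'))).
have -> : h1s v = h1s v'; last exact: gq.
apply: eq_bigr => i _; have ti := tf_setT (tv i).
have e0 : L2 (v' i) = L2 (v i) by exact: (l2n_shift (- z) ti).
rewrite e0; apply: (congr1 (fun t => L2 (v i) + t)); apply: eq_bigr => j _.
have -> : pd j (v' i) = fun x => pd j (v i) (x - z).
  by apply/funext => x; rewrite /v' (pd_shift (- z) j x (tf_smooth ti)).
by rewrite (l2n_shift (- z) (tf_pd j ti)).
Qed.

Lemma necas_on_shift U (z : E) : measurable U -> sq (\1_U) -> necas_on [set x | U (x + z)] -> necas_on U.
Proof.
move=> mU sU [om [C [tom om1 C0 h]]].
exists (fun x => om (x - z)), C.
have tom' : tf U (fun x => om (x - z)).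
  by apply: tf_sub (tf_shiftU (- z) tom) => x /=; rewrite subrK.
split=> //; first by rewrite (Rintegral_shift (- z) (tf_integrable tom)).
move=> q N [sqq iq N0 gq]; pose q' x := q (x + z).
have sq' := sqint_shift z sqq.
have iq' : mu.-integrable setT (EFin \o q') by exact: integrable_shift.
have gq' := @gradle_shift U q N z sqq gq.
have mE : ip q' om = ip q (fun x => om (x - z)).
  rewrite -(l2ip_shift z sqq (tf_sq tom')); congr ip.
  by apply/funext => x; rewrite addrK.
have := h q' N (And4 sq' iq' N0 gq'); rewrite mE; apply: le_trans.
set m := ip q _; have sqm : sq (fun x => (q x - m) * \1_U x).
  under [X in sqint _ _ X]eq_fun do rewrite mulrBl.
  by apply: sqintB => //; [exact: sq_indic|exact: sqintZ].
rewrite le_eqVlt; apply/orP; left; apply/eqP; congr Num.sqrt.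
by rewrite -(l2ip_shift z sqm sqm).
Qed.

Lemma sqint_indic1 (A : set E) : measurable A -> (mu A < +oo)%E -> sq (\1_A).
Proof.
move=> mA lA; split; first exact: measurable_indic.
have := integrable_indicR 1 mA lA; under eq_fun do rewrite /= mul1r.
congr (integrable _ _ _); apply/funext => x; rewrite /= indicE.
by case: (_ \in _); rewrite ?expr1n ?expr0n.
Qed.

Section open_polytope.
Variable P : seq (E * R).

(* Degenerate half-spaces, with a zero normal, only contribute a constant
   condition. *)
Definition opolyt : set E := [set x | forall h, h \in P ->
  if h.1 == 0 then 0 <= h.2 else dot h.1 x < h.2].

Let Pnz := [seq h <- P | h.1 != 0].

Lemma dot0l (x : E) : dot 0 x = 0.
Proof. by apply: big1 => i _; rewrite mxE mul0r. Qed.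

Lemma dotDr (b x y : E) : dot b (x + y) = dot b x + dot b y.
Proof. by rewrite /dot -big_split/=; apply: eq_bigr => j _; rewrite mxE mulrDr. Qed.

Lemma opolyt_closed_half x : opolyt x -> forall h, h \in P -> dot h.1 x <= h.2.
Proof.
move=> hx h hP; have := hx h hP; case: eqVneq => [->|_]; last exact: ltW.
by rewrite dot0l.
Qed.

(** With [x0] moved to the origin and the normals rescaled, every proper half-space reads
    [dot a x < 1]. Dilation towards [x0] then shrinks all levels at the same rate. *)
Definition pnormal (x0 : E) (i : 'I_(size Pnz)) : E :=
  let h := tnth (in_tuple Pnz) i in (h.2 - dot h.1 x0)^-1 *: h.1.

Lemma opolyt_opoly x0 : opolyt x0 -> [set x | opolyt (x + x0)] = opoly (pnormal x0) 1.
Proof.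
move=> h0; have pos h : h \in Pnz -> 0 < h.2 - dot h.1 x0.
  by rewrite mem_filter => /andP[h1 hP]; have := h0 h hP; rewrite (negbTE h1) subr_gt0.
have dotZl (c : R) (b y : E) : dot (c *: b) y = c * dot b y.
  by rewrite /dot mulr_sumr; apply: eq_bigr => i _; rewrite mxE mulrA.
apply/seteqP; split => x hx.
  move=> i; have hi : tnth (in_tuple Pnz) i \in Pnz by exact: mem_tnth.
  rewrite /pnormal dotZl mulrC ltr_pdivrMr ?mul1r ?pos// ltrBrDr -dotDr.
  move: hi; rewrite mem_filter => /andP[h1 hP].
  by have := hx _ hP; rewrite (negbTE h1).
move=> h hP; have [h1|h1] := eqVneq h.1 0; first by have := h0 h hP; rewrite h1 eqxx.
have hi : h \in Pnz by rewrite mem_filter h1.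
have [i hE] : exists i, h = tnth (in_tuple Pnz) i by apply/tnthP.
have := hx i; rewrite /pnormal -hE dotZl mulrC ltr_pdivrMr ?pos// mul1r ltrBrDr -dotDr//.
Qed.

Lemma opolyt_open : open opolyt.
Proof.
pose Q (h : E * R) : set E := [set x | if h.1 == 0 then 0 <= h.2 else dot h.1 x < h.2].
have oi h : open (Q h).
  rewrite /Q; have [h1|h1] := eqVneq h.1 0.
    have [h0|h0] := boolP (0 <= h.2).
      rewrite (_ : mkset _ = setT :> set E); first exact: openT.
      by apply/seteqP; split => // y _.
    rewrite (_ : mkset _ = set0 :> set E); first exact: open0.
    by apply/seteqP; split.
  have := @open_comp _ _ (dot h.1) [set y | y < h.2] _ (@open_lt _ _); apply.
  by move=> y _; exact: dot_continuous.
have -> : opolyt = [set x | forall i : 'I_(size P), Q (tnth (in_tuple P) i) x].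
  apply/seteqP; split => x hx; first by move=> i; apply: hx; exact: mem_tnth.
  move=> h hP; have [i ->] : exists i, h = tnth (in_tuple P) i by apply/tnthP.
  exact: hx.
rewrite openE => x hx; apply: (filter_forall (F := nbhs x)) => i.
by have := oi (tnth (in_tuple P) i); rewrite openE => /(_ x); apply; exact: hx.
Qed.

Lemma opolyt_necas x0 : opolyt x0 -> bounded_set opolyt -> open opolyt /\ necas_on opolyt.
Proof.
move=> h0 [M [_ hM]].
have eK := opolyt_opoly h0.
split; first exact: opolyt_open.
have oP := opolyt_open.
pose r := `|M| + 1 + `|x0| + 1.
have r1 : 1 <= r by rewrite lerDr; have := normr_ge0 M; have := normr_ge0 x0; lra.
have hM' x : opolyt x -> `|x| <= `|M| + 1.
  by apply: hM; have := ler_norm M; lra.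
have hr : opoly (pnormal x0) 1 `<=` cball r.
  move=> x; rewrite -eK /= => /hM' h; rewrite /cball/=.
  rewrite -[x](addrK x0); have := ler_normB (x + x0) x0; rewrite /r; lra.
have mP : measurable opolyt by exact: open_measurable_rV.
have lP : (mu opolyt < +oo)%E.
  by apply: leb_bounded_lty => //; exists M; split => //; exact: num_real.
apply: (@necas_on_shift _ x0) => //; first exact: sqint_indic1.
rewrite eK; have [om [C [t1 o1 C0 h]]] := necas_centered r1 hr.
by exists om, C; split => // q N [sqq iq N0 gq]; exact: h.
Qed.

End open_polytope.

(** * Gluing the polytopes of a Lipschitz polyhedral domain *)

Section domain.
Variable Omega : set E.
Hypothesis oO : open Omega.
Hypothesis lip : lipschitz_boundary Omega.
Variable Ps : seq (seq (E * R)).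
Hypothesis clO : closure Omega = [set x | exists2 P, P \in Ps & forall h, h \in P -> dot h.1 x <= h.2].

(* Below a boundary point, in the direction of the Lipschitz graph, lies an
   open set that misses [Omega], hence also its closure. *)
Lemma opolyt_sub P : P \in Ps -> opolyt P `<=` Omega.
Proof.
move=> PPs x hx; apply: contrapT => nOx.
have opcl y : opolyt P y -> closure Omega y.
  by move=> hy; rewrite clO; exists P => //; exact: opolyt_closed_half.
have [r [e [g [r0 ee gl hz]]]] := lip (conj (opcl _ hx) nOx).
have oP := @opolyt_open P.
have [k k0 hk] : exists2 k : R, 0 < k & forall y z, `|g y - g z| <= k * `|y - z|.
  case: gl => M [_ hM]; exists (`|M| + 1); first by rewrite ltr_wpDl.
  have h : M < `|M| + 1 by have := ler_norm M; lra.
  by move=> y z; have := hM _ h (y, z); apply; split.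
have gx : dot x e <= g (x - dot x e *: e).
  by rewrite leNgt; apply/negP => h; apply: nOx; apply/(hz x (ballxx _ r0)).
pose pr (y : E) := y - dot y e *: e.
have dotDl (y z : E) : dot (y + z) e = dot y e + dot z e.
  by rewrite /dot -big_split/=; apply: eq_bigr => i _; rewrite mxE mulrDl.
have dotZl (c : R) (y : E) : dot (c *: y) e = c * dot y e.
  by rewrite /dot mulr_sumr; apply: eq_bigr => i _; rewrite mxE mulrA.
have dotBl (y z : E) : dot (y - z) e = dot y e - dot z e.
  by rewrite -[- z]scaleN1r dotDl dotZl mulN1r.
pose D : R := \sum_(i < n) `|e ord0 i|.
have D0 : 0 <= D by exact: sumr_ge0.
have dotD y : `|dot y e| <= D * `|y|.
  apply: (le_trans (ler_norm_sum _ _ _)); rewrite /D mulr_suml; apply: ler_sum => i _.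
  by rewrite normrM mulrC ler_wpM2l// coord_le.
(* The depth below the graph: near [x], points of [Omega] have [w < 0]. It is [L]-Lipschitz and at
   least [t] at [z = x - t e], so no point of [Omega] lies within [c] of [z], although [z] is in
   [opolyt P] and hence in the closure. *)
pose w y := g (pr y) - dot y e.
pose L := k * (1 + D * `|e|) + D.
have L0 : 0 <= L by rewrite addr_ge0// mulr_ge0 ?(ltW k0)// addr_ge0// mulr_ge0.
have wL y z : w z - L * `|y - z| <= w y.
  have h1 : `|g (pr y) - g (pr z)| <= k * ((1 + D * `|e|) * `|y - z|).
    apply: le_trans (hk _ _) _; rewrite ler_pM2l//.
    have -> : pr y - pr z = (y - z) - dot (y - z) e *: e.
      by apply/rowP => i; rewrite /pr !mxE dotBl; ring.
    apply: le_trans (ler_normB _ _) _; rewrite normrZ mulrDl mul1r lerD2l mulrAC.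
    by apply: ler_wpM2r => //; exact: dotD.
  have h2 := dotD (y - z); rewrite dotBl in h2.
  move: h1 h2; rewrite !ler_norml /w /L => /andP[h1 _] /andP[_ h2]; lra.
have [d /= d0 hd] : exists2 d : R, 0 < d & ball x d `<=` opolyt P.
  by have := oP; rewrite openE => /(_ x hx) /nbhs_ballP[d d0 hd]; exists d.
pose ne := `|e| + 1; have ne0 : 0 < ne by rewrite ltr_wpDl.
pose m := Num.min d r; have m0 : 0 < m by rewrite lt_min d0.
pose t := m / 2 / ne; have t0 : 0 < t by rewrite !divr_gt0.
have te : t * `|e| <= m / 2.
  have -> : m / 2 = t * ne by rewrite /t divfK// gt_eqF.
  by apply: ler_wpM2l; [exact: ltW|rewrite lerDl].
pose z := x - t *: e.
have xz : `|x - z| <= m / 2 by rewrite opprB addrCA subrr addr0 normrZ gtr0_norm.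
have md : m <= d by rewrite ge_min lexx.
have mr : m <= r by rewrite ge_min lexx orbT.
have Pz : opolyt P z by apply: hd; rewrite -ball_normE/=; apply: le_lt_trans xz _; lra.
have wz : t <= w z.
  have dz : dot z e = dot x e - t by rewrite /z -scaleNr dotDl dotZl ee mulr1.
  have prz : pr z = x - dot x e *: e by apply/rowP => i; rewrite /pr dz /z !mxE; ring.
  rewrite /w prz dz; have h := gx; move: h; clear; lra.

pose c := Num.min (m / 2) (t / (L + 1)).
have L1 : 0 < L + 1 by lra.
have c0 : 0 < c by rewrite lt_min !divr_gt0.
have [y [Oy]] := opcl z Pz _ (nbhsx_ballx z _ c0).
rewrite -ball_normE /= => zy.
have cm : c <= m / 2 by rewrite ge_min lexx.
have cL : c * (L + 1) <= t by rewrite -ler_pdivlMr// ge_min lexx orbT.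
have xy : ball x r y.
  rewrite -ball_normE /=; apply: (@le_lt_trans _ _ (`|x - z| + `|z - y|)); last lra.
  by rewrite -{1}[x](subrK z) -addrA ler_normD.
have := (hz y xy).1 Oy; rewrite ltNge => /negP; apply; rewrite -subr_ge0.
have := wL y z; rewrite distrC /w -/(pr y) => h.
have : L * `|z - y| <= L * c by apply: ler_wpM2l => //; exact: ltW.
move: wz; rewrite /w; lra.
Qed.

Definition opolyts (Qs : seq (seq (E * R))) : set E :=
  [set x | exists2 P, P \in Qs & opolyt P x].

(** A point of the closure that satisfies none of the strict systems lies on one of finitely many
    hyperplanes, which are null. *)
Lemma opolyts_ae : {ae mu, forall x, Omega x -> opolyts Ps x}.
Proof.
have h P : P \in Ps -> {ae mu, forall x, forall h, h \in P -> h.1 != 0 -> dot h.1 x <> h.2}.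
  move=> _; apply: (@ae_seq _ _ _ mu _ P (fun h x => h.1 != 0 -> dot h.1 x <> h.2)) => h _; have [h0|h0] := eqVneq h.1 0; first by apply: aeW => x /eqP.
  have z := leb_hyperplane h.2 h0.
  exists [set x | dot h.1 x = h.2]; split => //; last first.
    by move=> x /= nx; apply: contrapT => nh; apply: nx => _.
  have := closed_measurable_rV (@closed_comp _ _ (dot h.1) [set h.2] _ (@closed_eq _ _)); apply.
  by move=> y _; exact: dot_continuous.
have := ae_seq h; apply: filterS => x hx Ox.
have : closure Omega x by exact: subset_closure.
rewrite clO => -[P PPs hP]; exists P => // k kP.
case: ifPn => k0; first by have := hP _ kP; rewrite (eqP k0) dot0l.
by rewrite lt_neqAle hP// andbT; apply/eqP; exact: hx kP k0.
Qed.

(** [eqv_near] moves bumps of radius [s] by up to [s], which takes a ball of radius [2 s]; the rest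
    is slack for changing the centre. *)
Definition deep x (s : R) := 0 < s /\ forall z, `|z - x| <= 3 * s -> Omega z.

Lemma deep_ex x : Omega x -> exists s, deep x s.
Proof.
move=> Ox; have := oO; rewrite openE => /(_ x Ox) /nbhs_ballP[r /= r0 hr].
exists (r / 4); split; first by rewrite divr_gt0.
by move=> z zx; apply: hr; rewrite -ball_normE/= distrC; apply: le_lt_trans zx _; lra.
Qed.

Definition eqv om om' := exists2 C : R, 0 <= C & forall q (N : R), gradle_data Omega q N ->
  `|ip q om - ip q om'| <= C * N.

Lemma eqv_trans om om' om'' : eqv om om' -> eqv om' om'' -> eqv om om''.
Proof.
move=> [C C0 h] [C' C0' h']; exists (C + C'); first exact: addr_ge0.
move=> q N gq; rewrite mulrDl; apply: le_trans (lerD (h _ _ gq) (h' _ _ gq)).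
exact: ler_distD.
Qed.

Let near_ball x (s : R) : set E := [set z | `|z - x| <= s].

(** [core_estimate] for [om - om'], whose integral is zero, so that the mollified value of [q] drops
    out. *)
Lemma eqv_near x s om om' : deep x s -> tf (near_ball x s) om -> tf (near_ball x s) om' ->
  \int[mu]_z om z = 1 -> \int[mu]_z om' z = 1 -> eqv om om'.
Proof.
move=> [s0 ds] t1 t2 o1 o2; have [b [tb be b0 b1]] := even_bump n s0.
pose r := fun z => om z - om' z; have tr : tf (near_ball x s) r by exact: tfB.
have st := tf_setT t1; have st' := tf_setT t2.
have r0 : \int[mu]_z r z = 0.
  by rewrite /r RintegralB//; [rewrite o1 o2 subrr|exact: tf_integrable st|exact: tf_integrable st'].
pose C := n%:R * s * h1f r + (\int[mu]_z `|r z|) * (n%:R * s * h1f b).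
have sn : 0 <= n%:R * s by rewrite mulr_ge0// ltW.
have C0 : 0 <= C.
  rewrite addr_ge0// mulr_ge0 ?h1f_ge0//; last by rewrite mulr_ge0 ?h1f_ge0.
  by apply: Rintegral_ge0.
exists C => // q N [sqq iq N0 gq].
rewrite -l2ipBr//; [|exact: tf_sq st|exact: tf_sq st'].
have Vx : near_ball x s x by rewrite /near_ball/= subrr normr0 ltW.
have star y (t : R) : near_ball x s y -> 0 <= t <= 1 -> near_ball x s (x + t *: (y - x)).
  rewrite /near_ball /= => hy /andP[t0 t1']; rewrite addrAC subrr add0r normrZ ger0_norm//.
  apply: le_trans hy; rewrite -[leRHS]mul1r; exact: ler_wpM2r.
have VU y z : near_ball x s y -> `|z| <= s -> Omega (y + z).
  rewrite /near_ball /= => hy hz; apply: ds; rewrite addrAC.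
  by apply: le_trans (ler_normD _ _) _; have := s0; lra.
have VD y : near_ball x s y -> `|y - x| <= s by [].
have := @core_estimate _ _ _ _ _ _ _ _ _ _ _ N0 sqq iq gq tr Vx star VU VD tb be b0 b1.
by rewrite r0 mul0r subr0 mulrC.
Qed.

Lemma bump_at x (s : R) : 0 < s -> exists2 om, tf (near_ball x s) om & \int[mu]_z om z = 1.
Proof.
move=> s0; have [om [tom _ _ o1]] := even_bump n s0.
exists (fun z => om (z - x)); first exact: (tf_shiftU (- x) tom).
by rewrite (Rintegral_shift (- x) (tf_integrable (tf_setT tom))).
Qed.

Lemma near_ball_sub x y (s t : R) : `|x - y| + t <= s -> near_ball x t `<=` near_ball y s.
Proof.
move=> h z; rewrite /near_ball/= => hz; have := ler_distD x z y; lra.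
Qed.

Hypothesis cO : connected Omega.

Lemma eqv_bump x0 : Omega x0 -> exists om0, [/\ tf Omega om0, \int[mu]_z om0 z = 1 &
  forall x U, Omega x -> open U -> U x -> exists om, [/\ tf U om, \int[mu]_z om z = 1 & eqv om om0]].
Proof.
move=> Ox0; have [s0 ds0] := deep_ex Ox0.
have [om0 t0 o0] := bump_at x0 ds0.1.
exists om0; split => //.
  apply: tf_sub t0 => z; rewrite /near_ball/= => hz; apply: ds0.2; apply: le_trans hz _.
  by have := ds0.1; lra.
(* Points around which every sufficiently concentrated bump is related to [om0]. Openness shrinks
   the radius; closedness links a bump at [x] to one at a nearby point of [B]. *)
pose B := [set x | Omega x /\ exists2 s, deep x s &
  forall om, tf (near_ball x s) om -> \int[mu]_z om z = 1 -> eqv om om0].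
have oB : open B.
  rewrite openE => x [Ox [s ds hs]]; apply/nbhs_ballP; exists (s / 2) => /=; first by rewrite divr_gt0//; case: ds.
  move=> y; rewrite -ball_normE/= => xy; have s1 := ds.1.
  have yx : `|y - x| < s / 2 by rewrite distrC.
  split; first by apply: ds.2; have := s1; lra.
  exists (s / 4).
    split; first by rewrite divr_gt0.
    by move=> z zy; apply: ds.2; have := ler_distD y z x; lra.
  by move=> om tom; apply: hs; apply: tf_sub tom; apply: near_ball_sub; lra.
have BE : B = Omega.
  apply: cO.
  - by exists x0; split => //; exists s0 => // om tom o1; exact: eqv_near ds0 tom t0 o1 o0.
  - by exists B => //; apply/seteqP; split => x; [case|case].
  - exists (closure B); first exact: closed_closure.
    apply/seteqP; split => x; first by move=> Bx; split; [case: Bx|exact: subset_closure].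
    move=> [Ox clx]; split => //; have [s ds] := deep_ex Ox; exists s => // om tom o1.
    have s1 := ds.1; have s2 : 0 < s / 2 by rewrite divr_gt0.
    have [y [[Oy [t dt ht]]]] := clx _ (nbhsx_ballx x _ s2).
    rewrite -ball_normE /= => xy; have t1 := dt.1.
    pose u := Num.min t (s / 2); have u0 : 0 < u by rewrite lt_min t1.
    have ut : u <= t by rewrite ge_min lexx.
    have us : u <= s / 2 by rewrite ge_min lexx orbT.
    have [b tb b1] := bump_at y u0.
    apply: (@eqv_trans _ b); last first.
      by apply: ht => //; apply: tf_sub tb; apply: near_ball_sub; rewrite subrr normr0 add0r.
    apply: eqv_near ds tom _ o1 b1; apply: tf_sub tb; apply: near_ball_sub.
    by rewrite distrC; lra.
move=> x U; rewrite -BE => -[Ox [s ds hs]] oU Ux.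
have := oU; rewrite openE => /(_ x Ux) /nbhs_ballP[r /= r0 hr].
pose u := Num.min s (r / 2); have u0 : 0 < u by rewrite lt_min ds.1 divr_gt0.
have us : u <= s by rewrite ge_min lexx.
have ur : u <= r / 2 by rewrite ge_min lexx orbT.
have [b tb b1] := bump_at x u0; exists b; split => //.
  apply: tf_sub tb => z; rewrite /near_ball /= => zx; apply: hr; rewrite -ball_normE/= distrC; lra.
by apply: hs => //; apply: tf_sub tb; apply: near_ball_sub; rewrite subrr normr0 add0r.
Qed.

Hypothesis bO : bounded_set Omega.

(** The weight [omP] that comes with the polytope is arbitrary. It is linked to [om0] through a bump
    [om] inside [P]: the estimate on [P], tested against [om], compares [om] with [omP], and
    connectedness compares [om] with [om0]. *)
Lemma opolyt_estimate om0 P : P \in Ps -> tf Omega om0 ->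
  (forall x U, Omega x -> open U -> U x -> exists om, [/\ tf U om, \int[mu]_z om z = 1 & eqv om om0]) ->
  exists2 C : R, 0 <= C & forall q (N : R), gradle_data Omega q N ->
    L2 (fun x => (q x - ip q om0) * \1_(opolyt P) x) <= C * N.
Proof.
move=> PPs t0 hb; have PO := opolyt_sub PPs.
have [P0|/set0P[x0 Px0]] := eqVneq (opolyt P) set0.
  exists 0 => // q N _; rewrite P0 mul0r; under [X in L2 X]eq_fun do rewrite indic0 mulr0.
  by rewrite l2n0.
have bP : bounded_set (opolyt P) by move: bO => [M [Mr h]]; exists M; split => // y yM x /PO; exact: h.
have [oP [omP [C [tP oP1 C0 hP]]]] := opolyt_necas Px0 bP.
have [om [tom o1 [C' C0' he]]] := hb x0 _ (PO _ Px0) oP Px0.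
have mP : measurable (opolyt P) by exact: open_measurable_rV.
have s1 : sq (\1_(opolyt P)) by apply: sqint_indic1 => //; exact: leb_bounded_lty.
have sP := tf_sq (tf_setT tP); have so := tf_sq (tf_setT tom).
exists (C + (C * L2 om + C') * L2 (\1_(opolyt P))).
  by rewrite addr_ge0// mulr_ge0 ?l2n_ge0// addr_ge0// mulr_ge0// l2n_ge0.
move=> q N gq; have [sqq iq N0 gg] := gq.
have gq' : gradle_data (opolyt P) q N by split => //; exact: gradle_sub gg.
have h1 := hP q N gq'; have h2 := he q N gq.
set m := ip q omP in h1 *; set m0 := ip q om0 in h2 *.
have sI (c : R) : sq (fun x => c * \1_(opolyt P) x) by exact: sqintZ.
have sm : sq (fun x => (q x - m) * \1_(opolyt P) x).
  under [X in sqint _ _ X]eq_fun do rewrite mulrBl.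
  by apply: sqintB => //; exact: sq_indic.
have h3 : `|ip q om - m| <= C * N * L2 om.
  have -> : ip q om - m = ip (fun x => (q x - m) * \1_(opolyt P) x) om.
    rewrite /l2ip -[X in _ - X]mulr1 -o1 -RintZ//; last exact: tf_integrable (tf_setT tom).
    rewrite -RintegralB//; [|exact: (sqintM measurableT sqq so)|].
      apply: eq_Rintegral => x _; rewrite indicE; case: (boolP (x \in opolyt P)) => [_|/negP nP].
        by rewrite mulr1 mulrBl.
      by rewrite (tf_off tom) ?mulr0 ?subrr// => px; apply: nP; rewrite inE.
    exact: (integrableZl measurableT m (tf_integrable (tf_setT tom))).
  by apply: le_trans (l2_CS measurableT sm so) _; rewrite ler_wpM2r ?l2n_ge0.
have h4 : `|m - m0| <= (C * L2 om + C') * N.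
  by apply: le_trans (ler_distD (ip q om) m m0) _; rewrite distrC mulrDl [C * _ * _]mulrAC; exact: lerD.
have -> : (fun x => (q x - m0) * \1_(opolyt P) x) =
    fun x => (q x - m) * \1_(opolyt P) x + (m - m0) * \1_(opolyt P) x.
  by apply/funext => x; rewrite -mulrDl addrA subrK.
rewrite [leRHS]mulrDl; apply: l2nD_le => //; rewrite l2nZ// mulrAC.
by apply: ler_wpM2r => //; exact: l2n_ge0.
Qed.

Lemma necas : Omega !=set0 -> exists2 C : R, 0 <= C & forall q (N : R), sq q ->
  (forall x, ~ Omega x -> q x = 0) -> \int[mu]_x q x = 0 -> 0 <= N -> gradle Omega q N ->
  L2 q <= C * N.
Proof.
move=> [x0 Ox0]; have [om0 [t0 o0 hb]] := eqv_bump Ox0.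
have mO : measurable Omega by exact: open_measurable_rV.
have s1 : sq (\1_Omega) by apply: sqint_indic1 => //; exact: leb_bounded_lty.
have mU Qs : measurable (opolyts Qs).
  rewrite (_ : opolyts Qs = \big[setU/set0]_(P <- Qs) opolyt P).
    by apply: bigsetU_measurable => P _; exact: open_measurable_rV (@opolyt_open P).
  by apply/seteqP; split => x; rewrite -bigcup_seq => -[P h1 h2]; exists P.
have UO Qs : {subset Qs <= Ps} -> opolyts Qs `<=` Omega.
  by move=> hQ x [P PQ hP]; apply: (opolyt_sub (hQ _ PQ)) hP.
have est Qs : {subset Qs <= Ps} -> exists2 C : R, 0 <= C & forall q (N : R), gradle_data Omega q N ->
    L2 (fun x => (q x - ip q om0) * \1_(opolyts Qs) x) <= C * N.
  elim: Qs => [|P Qs IH] hQ.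
    exists 0 => // q N _; rewrite mul0r (_ : opolyts [::] = set0); last by apply/seteqP; split => x //; case.
    by under [X in L2 X]eq_fun do rewrite indic0 mulr0; rewrite l2n0.
  have PPs : P \in Ps by apply: hQ; exact: mem_head.
  have hQ' : {subset Qs <= Ps} by move=> Q QQ; apply: hQ; rewrite in_cons QQ orbT.
  have [C C0 h] := IH hQ'; have [C' C0' h'] := opolyt_estimate PPs t0 hb.
  exists (C' + C); first exact: addr_ge0.
  move=> q N gq; have [sqq _ _ _] := gq; set m := ip q om0.
  have mP : measurable (opolyt P) by exact: open_measurable_rV (@opolyt_open P).
  have sA A : measurable A -> A `<=` Omega -> sq (fun x => (q x - m) * \1_A x).
    move=> mA AO; under [X in sqint _ _ X]eq_fun do rewrite mulrBl.
    apply: sqintB => //; [exact: sq_indic|apply: sqintZ => //; apply: sqint_indic1 => //].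
    by apply: leb_bounded_lty => //; move: bO => [M [Mr hM]]; exists M; split => // y yM x /AO; exact: hM.
  have sD := sA (opolyts Qs `\` opolyt P) (measurableD (mU Qs) mP) (subset_trans (@subDsetl _ _ _) (UO _ hQ')).
  have sP := sA _ mP (opolyt_sub PPs); have sQ := sA _ (mU Qs) (UO _ hQ').
  have -> : (fun x => (q x - m) * \1_(opolyts (P :: Qs)) x) =
      fun x => (q x - m) * \1_(opolyt P) x + (q x - m) * \1_(opolyts Qs `\` opolyt P) x.
    apply/funext => x; rewrite -mulrDr !indicE; congr (_ * _).
    have [xP|xP] := pselect (opolyt P x).
      rewrite [x \in opolyts (P :: Qs)]mem_set; last by exists P => //; exact: mem_head.
      by rewrite [x \in opolyt P]mem_set// memNset ?addr0// => -[].
    have [xQ|xQ] := pselect (opolyts Qs x).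
      rewrite mem_set; last by case: xQ => Q QQ hx; exists Q => //; rewrite in_cons QQ orbT.
      by rewrite [x \in opolyt P]memNset// mem_set ?add0r.
    rewrite !memNset ?addr0//; first by case.
    by move=> [Q]; rewrite in_cons => /orP[/eqP -> //|QQ hx]; apply: xQ; exists Q.
  rewrite mulrDl; apply: l2nD_le => //; first exact: h'.
  apply: le_trans (h q N gq); apply: l2n_le => // x _.
  rewrite !normrM ler_wpM2l// !indicE; case: (boolP (x \in _ `\` _)) => [|_]; last by rewrite normr0.
  by rewrite inE => -[xQ _]; rewrite mem_set.
have [C C0 h] := est Ps (fun _ => id); exists C => // q N sqq qO q0 N0 gq.
have qE x : q x = q x * \1_Omega x.
  rewrite indicE; have [xO|xO] := pselect (Omega x); first by rewrite mem_set ?mulr1.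
  by rewrite memNset ?mulr0 ?qO.
have iq : mu.-integrable setT (EFin \o q).
  by have := sqintM measurableT sqq s1; congr (integrable _ _ _); apply/funext => x /=; rewrite -qE.
set m := ip q om0 in h *.
have sB : sq (fun x => (q x - m) * \1_Omega x).
  under [X in sqint _ _ X]eq_fun do rewrite mulrBl.
  by apply: sqintB => //; [exact: sq_indic|exact: sqintZ].
have sU : sq (fun x => (q x - ip q om0) * \1_(opolyts Ps) x).
  have := sq_indic (mU Ps) sB; congr (sqint _ _ _); apply/funext => x.
  rewrite -mulrA; congr (_ * _); rewrite !indicE; case: (boolP (x \in opolyts Ps)); rewrite ?mulr0// inE => xU.
  by rewrite mem_set ?mulr1//; exact: (UO Ps).
have le : L2 (fun x => (q x - m) * \1_Omega x) <= C * N.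
  have := h q N (And4 sqq iq N0 gq); apply: le_trans; rewrite le_eqVlt; apply/orP; left; apply/eqP.
  have ee : ae_eq mu setT (fun x => (q x - m) * \1_Omega x) (fun x => (q x - ip q om0) * \1_(opolyts Ps) x).
    have := opolyts_ae; apply: filterS => x hx _; congr (_ * _); rewrite !indicE.
    have [xO|xO] := pselect (Omega x); first by rewrite !mem_set//; exact: hx.
    by rewrite !memNset// => /(UO Ps) h1; apply: xO; exact: h1.
  by rewrite /l2n (l2ip_ae_eq measurableT ee ee sB sU sB sU).
(* As [q] has integral zero, the constant [m] is invisible to the product, and |q|^2 <= |q| |q - m|
   passes from [q - m] to [q] without loss. *)
have e0 : ip q q = ip q (fun x => (q x - m) * \1_Omega x).
  have -> : (fun x => (q x - m) * \1_Omega x) = fun x => q x - m * \1_Omega x.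
    by apply/funext => x; rewrite mulrBl -qE.
  rewrite l2ipBr//; last exact: sqintZ.
  have q1 : ip q \1_Omega = 0 by rewrite -q0; apply: eq_Rintegral => x _; rewrite -qE.
  by rewrite l2ipZr// q1 mulr0 subr0.
have [z|nz] := eqVneq (L2 q) 0; first by rewrite z mulr_ge0.
have p : 0 < L2 q by rewrite lt_neqAle eq_sym nz l2n_ge0.
apply: le_trans le; rewrite -(ler_pM2l p) -expr2 l2n_sqr// e0.
exact: le_trans (ler_norm _) (l2_CS measurableT sqq sB).
Qed.

End domain.

End necas_property.

(** * Ladyzhenskaya inequality *)

Section slices.
Variables (R : realType).
Local Notation leb1 := (@lebesgue_measure R).

Definition ccsupp n (f : 'rV[R]_n -> R) :=
  continuous f /\ exists2 M : R, 0 <= M & forall x, M < `|x| -> f x = 0.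

Lemma tf_ccsupp n U (f : 'rV[R]_n -> R) : tf U f -> ccsupp f.
Proof.
move=> tp; split; first exact: tf_cont tp.
case: tp => _ [A [cA _ pA]]; have [k k0 hk] := compact_bound_rV cA.
by exists k => [|x kx]; [exact: ltW|apply: pA => /hk; rewrite leNgt kx].
Qed.

Lemma ccsuppM n (f g : 'rV[R]_n -> R) : ccsupp f -> ccsupp g -> ccsupp (fun x => f x * g x).
Proof.
move=> [cf [M M0 hM]] [cg _]; split; first by move=> x; exact: (cvgM (cf x) (cg x)).
by exists M => // x /hM ->; rewrite mul0r.
Qed.

Lemma ccsuppZ n (c : R) (f : 'rV[R]_n -> R) : ccsupp f -> ccsupp (fun x => c * f x).
Proof.
move=> [cf [M M0 hM]]; split; first by move=> x; exact: (cvgM (cvg_cst c) (cf x)).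
by exists M => // x /hM ->; rewrite mulr0.
Qed.

Lemma ccsupp_norm n (f : 'rV[R]_n -> R) : ccsupp f -> ccsupp (fun x => `|f x|).
Proof.
move=> [cf [M M0 hM]]; split; first by move=> x; exact: (cvg_norm (cf x)).
by exists M => // x /hM ->; rewrite normr0.
Qed.

Lemma ccsupp_integrable n (f : 'rV[R]_n -> R) : ccsupp f -> (leb R n).-integrable setT (EFin \o f).
Proof.
move=> [cf [M M0 hM]]; have cA := @cball_compact R n M.
have A0 : (cball M : set 'rV[R]_n) !=set0 by exists 0; rewrite /cball/= normr0.
have cn : {within cball M, continuous (fun x : 'rV[R]_n => `|f x|)}.
  by apply: continuous_subspaceT => x; exact: (cvg_norm (cf x)).
have [c _ hc] := EVT_max_rV A0 cA cn.
apply: (integrable_cpt (A := cball M) (M := `|f c|)).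
- exact: cont_measurable.
- exact: compact_measurable_rV.
- exact: compact_mu_lty.
- move=> x; have [Ax|nAx] := pselect (cball M x); first by apply: hc; rewrite inE.
  by rewrite hM ?normr0// ltNge; exact/negP.
- by move=> x nAx; apply: hM; rewrite ltNge; exact/negP.
Qed.

Lemma cons_dist n (s t : R) (x y : 'rV[R]_n) :
  `|rV_cons (s, x) - rV_cons (t, y)| <= `|s - t| + `|x - y|.
Proof.
apply: norm_le_coord; first by rewrite addr_ge0.
move=> i; rewrite mxE [X in _ + X]mxE !rV_consE; case: unliftP => [j _|_] /=.
  by have := coord_le (x - y) j; rewrite !mxE => /le_trans; apply; rewrite lerDr.
by rewrite lerDl.
Qed.

Lemma cons_norml n (t : R) (x : 'rV[R]_n) : `|t| <= `|rV_cons (t, x)|.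
Proof. by have := coord_le (rV_cons (t, x)) ord0; rewrite rV_consE unlift_none. Qed.

Lemma cons_normr n (t : R) (x : 'rV[R]_n) : `|x| <= `|rV_cons (t, x)|.
Proof.
apply: norm_le_coord => // i.
by have := coord_le (rV_cons (t, x)) (lift ord0 i); rewrite rV_consE liftK.
Qed.

Lemma slice_cvg n (t : R) : continuous (fun x : 'rV[R]_n => rV_cons (t, x)).
Proof.
move=> x; apply/(@cvgrPdist_le _ _ _ (nbhs x) (nbhs_filter x)) => e e0.
apply/nbhs_ballP; exists e => //= y.
rewrite -ball_normE/= => xy; apply: le_trans (cons_dist _ _ _ _) _.
by rewrite subrr normr0 add0r ltW.
Qed.

Lemma line_cvg n (x : 'rV[R]_n) : continuous (fun t : R => rV_cons (t, x)).
Proof.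
move=> t; apply/cvgrPdist_le => e e0; apply/nbhs_ballP; exists e => //= s.
rewrite /ball/= => ts; apply: le_trans (cons_dist _ _ _ _) _.
by rewrite subrr normr0 addr0 ltW.
Qed.

Lemma ccsupp_slice n (f : 'rV[R]_n.+1 -> R) (t : R) : ccsupp f -> ccsupp (fun x => f (rV_cons (t, x))).
Proof.
move=> [cf [M M0 hM]]; split.
  by move=> x; exact: (continuous_comp (@slice_cvg n t x) (cf _)).
by exists M => // x Mx; apply: hM; exact: lt_le_trans Mx (cons_normr _ _).
Qed.

Lemma ccsupp_line_integrable n (f : 'rV[R]_n.+1 -> R) (x : 'rV[R]_n) : ccsupp f ->
  leb1.-integrable setT (EFin \o (fun t => f (rV_cons (t, x)))).
Proof.
move=> [cf [M M0 hM]]; set g := fun t => _.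
have cg : continuous g by move=> t; exact: (continuous_comp (@line_cvg n x t) (cf _)).
have : leb1.-integrable `[- M, M] (EFin \o g).
  by apply: continuous_compact_integrable; [exact: segment_compact|exact: continuous_subspaceT].
move/(integrable_mkcond (EFin \o g) (measurable_itv _)); congr (integrable _ _ _).
apply/funext => t; rewrite /patch; case: ifPn => // /negP h.
rewrite /= /g hM// (lt_le_trans _ (cons_norml t x))// ltNge; apply/negP => h'; apply: h.
by rewrite inE/= in_itv/= -ler_norml.
Qed.

Section fubini.
Variables (n : nat) (f : 'rV[R]_n.+1 -> R).
Hypothesis cf : ccsupp f.
Local Notation mu := (leb R n).

Let g (p : measurableTypeR R * 'rV[R]_n) : \bar R := (f (rV_cons p))%:E.

Let mf : measurable_fun setT f.
Proof. by have [c _] := cf; exact: cont_measurable. Qed.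

Let ig : (leb1 \x mu)%E.-integrable setT g.
Proof.
have mg : measurable_fun setT g.
  by apply/measurable_EFinP; exact: (measurableT_comp mf (@measurable_rV_cons R n)).
apply/integrableP; split => //.
have /integrableP[_ h] := ccsupp_integrable cf.
have mf' : measurable_fun setT (fun x => `|(f x)%:E|%E).
  by apply: measurableT_comp => //; exact/measurable_EFinP.
have := @ge0_integral_pushforward _ _ _ _ R _ (@measurable_rV_cons R n)
  (leb1 \x mu)%E setT (fun x => `|(f x)%:E|%E) measurableT mf' (fun _ _ => abse_ge0 _).
by move=> e; move: h; rewrite [X in (X < _)%E](_ : _ = (\int[leb1 \x mu]_p `|g p|)%E)//; exact: e.
Qed.

Let e0 : (\int[leb R n.+1]_x (f x)%:E = \int[leb1 \x mu]_p g p)%E.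
Proof.
apply: (@integral_pushforward _ _ _ _ R _ (@measurable_rV_cons R n) (leb1 \x mu)%E setT) => //.
exact/measurable_EFinP.
Qed.

Let s1 t : (\int[mu]_x (g (t, x)) = (\int[mu]_x f (rV_cons (t, x)))%:E)%E.
Proof.
by rewrite /Rintegral fineK//; apply: integrable_fin_num => //; exact: ccsupp_integrable (ccsupp_slice t cf).
Qed.

Let s2 x : (\int[leb1]_t (g (t, x)) = (\int[leb1]_t f (rV_cons (t, x)))%:E)%E.
Proof.
by rewrite /Rintegral fineK//; apply: integrable_fin_num => //; exact: ccsupp_line_integrable.
Qed.

Lemma slice_integrable : leb1.-integrable setT (EFin \o (fun t => \int[mu]_x f (rV_cons (t, x)))).
Proof.
have := integrable_fubini_F ig; congr (integrable _ _ _); apply/funext => t; exact: s1.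
Qed.

Lemma line_integrable : mu.-integrable setT (EFin \o (fun x => \int[leb1]_t f (rV_cons (t, x)))).
Proof.
have ig' : (mu \x leb1)%E.-integrable setT (fun p => g (p.2, p.1)).
  have mg := measurable_int _ ig; apply/integrable12ltyP.
    apply: (@measurable_comp _ _ _ _ _ _ setT g setT (fun p => (p.2, p.1)) measurableT (@subsetT _ _) mg).
    by apply/measurable_fun_pairP; split => /=; [exact: measurable_snd|exact: measurable_fst].
  exact: ((@integrable21ltyP _ _ _ _ R leb1 mu g mg).1 ig).
have := integrable_fubini_F ig'; congr (integrable _ _ _); apply/funext => t; exact: s2.
Qed.

Lemma slice_fubini : \int[leb R n.+1]_x f x = \int[leb1]_t \int[mu]_x f (rV_cons (t, x)).
Proof.
rewrite [LHS]/Rintegral e0 -integral12_prod_meas1// [RHS]/Rintegral; congr fine.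
by apply: eq_integral => t _; exact: s1.
Qed.

Lemma line_fubini : \int[leb R n.+1]_x f x = \int[mu]_x \int[leb1]_t f (rV_cons (t, x)).
Proof.
rewrite [LHS]/Rintegral e0 -integral21_prod_meas1// [RHS]/Rintegral; congr fine.
by apply: eq_integral => t _; exact: s2.
Qed.

End fubini.

Lemma slice_dir n (t h : R) (i : 'I_n) (x : 'rV[R]_n) :
  rV_cons (t, h *: delta_mx ord0 i + x) = h *: delta_mx ord0 (lift ord0 i) + rV_cons (t, x).
Proof.
apply/rowP => k; rewrite [RHS]mxE [X in _ = X + _]mxE [delta_mx _ _ _ _]mxE eqxx !rV_consE.
case: unliftP => [j ->|->] /=; first by rewrite !mxE eqxx (inj_eq lift_inj).
by rewrite mulr0 add0r.
Qed.

Lemma slice_is_derive n (f : 'rV[R]_n.+1 -> R) (t : R) i x df :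
  is_derive (rV_cons (t, x)) (delta_mx ord0 (lift ord0 i) : 'rV[R]_n.+1) f df ->
  is_derive x (delta_mx ord0 i : 'rV[R]_n) (fun x => f (rV_cons (t, x))) df.
Proof.
move=> [d1 d2]; have e : (fun h : R => h^-1 *: (((fun x => f (rV_cons (t, x))) \o shift x) (h *: delta_mx ord0 i) - f (rV_cons (t, x)))) =
  (fun h => h^-1 *: ((f \o shift (rV_cons (t, x))) (h *: delta_mx ord0 (lift ord0 i)) - f (rV_cons (t, x)))).
  by apply/funext => h /=; rewrite slice_dir.
by split; [rewrite /derivable e|rewrite /derive e].
Qed.

Lemma pd_slice n (f : 'rV[R]_n.+1 -> R) (t : R) i x : smooth f ->
  pd i (fun x => f (rV_cons (t, x))) x = pd (lift ord0 i) f (rV_cons (t, x)).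
Proof.
by move=> sf; apply: derive_val; exact: slice_is_derive (smooth_is_derive _ _ sf).
Qed.

Lemma tf_slice n (f : 'rV[R]_n.+1 -> R) (t : R) : tf setT f -> tf setT (fun x => f (rV_cons (t, x))).
Proof.
move=> tp; have [cc [M M0 hM]] := ccsupp_slice t (tf_ccsupp tp); split.
  have cs (g : 'rV[R]_n.+1 -> R) : smooth g -> continuous (fun x => g (rV_cons (t, x))).
    by move=> /smooth_cont cg x; exact: (continuous_comp (@slice_cvg n t x) (cg _)).
  move=> k; move: (tf_smooth tp); elim: k f {tp cc hM} => [|k IH] f sf; split; try exact: cs.
    by [].
  move=> i; split.
    by move=> x; have [] := slice_is_derive (smooth_is_derive (lift ord0 i) (rV_cons (t, x)) sf).
  apply: (@Ck_ext _ _ _ (fun x => pd (lift ord0 i) f (rV_cons (t, x)))); last first.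
    exact: IH (smooth_pd _ sf).
  by move=> x; rewrite -(pd_slice _ _ _ sf).
exists (cball M); split => //; first exact: cball_compact.
by move=> x h; apply: hM; rewrite ltNge; exact/negP.
Qed.

Lemma line_is_derive n (f : 'rV[R]_n.+1 -> R) (t : R) x : smooth f ->
  is_derive t (1 : R) (fun t => f (rV_cons (t, x))) (pd ord0 f (rV_cons (t, x))).
Proof.
move=> sf; have [d1 d2] := smooth_is_derive ord0 (rV_cons (t, x)) sf.
have e : (fun h : R => h^-1 *: (((fun t => f (rV_cons (t, x))) \o shift t) (h *: 1) - f (rV_cons (t, x)))) =
  (fun h => h^-1 *: ((f \o shift (rV_cons (t, x))) (h *: delta_mx ord0 ord0) - f (rV_cons (t, x)))).
  apply/funext => h /=; congr (_ *: (f _ - _)); apply/rowP => k.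
  rewrite [RHS]mxE [X in _ = X + _]mxE [delta_mx _ _ _ _]mxE eqxx !rV_consE.
  case: unliftP => [j ->|->] /=; last by [].
  by rewrite mulr0 add0r.
by split; [rewrite /derivable e|rewrite -d2 /derive e].
Qed.

Lemma FTC_sup (h dh : R -> R) (M : R) : (forall t, is_derive t (1 : R) h (dh t)) -> continuous dh ->
  (forall t, M < `|t| -> h t = 0) -> leb1.-integrable setT (EFin \o dh) ->
  forall t, `|h t| <= \int[leb1]_s `|dh s|.
Proof.
move=> hd cd hM id t; pose a := - (`|M| + `|t| + 1).
have at_ : a < t by rewrite /a ltrNl; have := ler_norm (- t); have := normr_ge0 M; rewrite normrN; lra.
have ha : h a = 0.
  by apply: hM; rewrite normrN ger0_norm ?addr_ge0//; have := ler_norm M; have := normr_ge0 t; lra.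
have ch : continuous h by move=> s; apply: differentiable_continuous; apply/derivable1_diffP; have [] := hd s.
have F : (\int[leb1]_(x in `[a, t]) (dh x)%:E = (h t)%:E - (h a)%:E)%E.
  apply: continuous_FTC2 => //; first exact: continuous_subspaceT.
    split; first by move=> s _; have [] := hd s.
    - exact: cvg_at_right_filter (ch a).
    - exact: cvg_at_left_filter (ch t).
  by move=> s _; rewrite derive1E; have [_ <-] := hd s.
have ia : leb1.-integrable `[a, t] (EFin \o dh) by exact: integrableS id.
have -> : h t = \int[leb1]_(x in `[a, t]) dh x by rewrite /Rintegral F ha sube0.
apply: (@le_trans _ _ (\int[leb1]_(s in `[a, t]) `|dh s|)); first exact: le_normr_Rintegral.
have n1 := integrable_norm ia; have n2 := integrable_norm id.
apply: fine_le; [exact: integrable_fin_num n1|exact: integrable_fin_num n2|].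
apply: (@ge0_subset_integral _ _ R leb1 _ _ (measurable_itv _) measurableT (fun s => `|dh s|%:E)) => //.
by have /integrableP[] := n2.
Qed.

End slices.

Section ladyzhenskaya.
Variable R : realType.
Local Notation leb1 := (@lebesgue_measure R).

(** This is [|pd i (f^2)|]; its integral over a line in direction [i] bounds [f^2] on that line. *)
Definition flux n (f : 'rV[R]_n -> R) i x : R := `|2 * (f x * pd i f x)|.

Lemma flux_ccsupp n (f : 'rV[R]_n -> R) i : tf setT f -> ccsupp (flux f i).
Proof.
move=> tp; apply: ccsupp_norm; apply: ccsuppZ; apply: ccsuppM; first exact: tf_ccsupp tp.
exact: tf_ccsupp (tf_pd i tp).
Qed.

Lemma flux_le n (f : 'rV[R]_n -> R) i : tf setT f ->
  \int[leb R n]_x flux f i x <= 2 * (l2n (leb R n) setT f * l2n (leb R n) setT (pd i f)).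
Proof.
move=> tp; have t1 := tf_pd i tp; set mu := leb R n.
have sn (g : 'rV[R]_n -> R) : tf setT g -> sqint mu setT (fun x => `|g x|).
  by move=> /tf_sq [mg ig]; split; [exact: measurableT_comp|under eq_fun do rewrite /= real_normK ?num_real//].
have en (g : 'rV[R]_n -> R) : l2n mu setT (fun x => `|g x|) = l2n mu setT g.
  by congr Num.sqrt; apply: eq_Rintegral => x _; rewrite -normrM -expr2 ger0_norm ?sqr_ge0.
have -> : \int[mu]_x flux f i x = 2 * l2ip mu setT (fun x => `|f x|) (fun x => `|pd i f x|).
  rewrite /l2ip -RintZ//; last by apply: sqintM => //; exact: sn.
  by apply: eq_Rintegral => x _; rewrite /flux !normrM [`|2|]ger0_norm.
by rewrite ler_pM2l// -en -[l2n mu setT (pd i f)]en; apply: le_trans (ler_norm _) _; apply: l2_CS => //; exact: sn.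
Qed.

Lemma sup_le n (f : 'rV[R]_n.+1 -> R) (t : R) (x : 'rV[R]_n) : tf setT f ->
  f (rV_cons (t, x)) ^+ 2 <= \int[leb1]_s flux f ord0 (rV_cons (s, x)).
Proof.
move=> tp; have sf := tf_smooth tp; have t1 := tf_pd ord0 tp.
have cp := ccsuppZ 2 (ccsuppM (tf_ccsupp tp) (tf_ccsupp t1)).
have [_ [M M0 hM]] := tf_ccsupp tp.
pose h s := f (rV_cons (s, x)) ^+ 2; pose dh s := 2 * (f (rV_cons (s, x)) * pd ord0 f (rV_cons (s, x))).
have hd s : is_derive s (1 : R) h (dh s).
  have d := line_is_derive s x sf.
  have := is_deriveM d d; rewrite (_ : _ * _ = h); last by apply/funext => r; rewrite /h expr2.
  by move=> dd; apply: (is_derive_eq dd); rewrite /dh /GRing.scale/=; ring.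
have cd : continuous dh.
  by move=> s; exact: (continuous_comp (@line_cvg R n x s) (cp.1 _)).
have := @FTC_sup R h dh M hd cd _ (ccsupp_line_integrable x cp) t.
rewrite ger0_norm ?sqr_ge0//; apply => s Ms.
by rewrite /h hM ?expr0n// (lt_le_trans Ms)// cons_norml.
Qed.

(** [leb R 1] is the product of Lebesgue measure with the unit mass [leb R 0], so this is [sup_le]
    with a trivial second variable. *)
Lemma sup_le1 (f : 'rV[R]_1 -> R) x : tf setT f -> f x ^+ 2 <= \int[leb R 1]_z flux f ord0 z.
Proof.
move=> tp; rewrite (slice_fubini (flux_ccsupp ord0 tp)).
have -> : x = rV_cons (x ord0 ord0, 0 : 'rV[R]_0).
  by apply/rowP => i; rewrite (ord1 i) rV_consE unlift_none.
apply: le_trans (sup_le _ _ tp) _; rewrite le_eqVlt; apply/orP; left; apply/eqP.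
apply: eq_Rintegral => s _; rewrite [RHS]/Rintegral /leb integral_dirac//; first by rewrite diracT mul1e.
by apply/measurable_EFinP; apply: cont_measurable; exact: (ccsupp_slice s (flux_ccsupp ord0 tp)).1.
Qed.

(** [f^4 = f^2 f^2] is at most [a t * b x], one factor per variable, and the two integrate
    separately. With [u], [v], [w] the norms of [f] and of its two derivatives,
    [(2 u v) (2 u w) <= 2 u^2 (v^2 + w^2)]. *)
Lemma lady2 (f : 'rV[R]_2 -> R) : tf setT f ->
  \int[leb R 2]_x f x ^+ 4 <= 2 * l2n (leb R 2) setT f ^+ 2 * \sum_i l2n (leb R 2) setT (pd i f) ^+ 2.
Proof.
move=> tp; have sf := tf_smooth tp.
have c0 := flux_ccsupp ord0 tp; pose i1 : 'I_2 := lift ord0 ord0; have c1 := flux_ccsupp i1 tp.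
pose a t := \int[leb R 1]_x flux f i1 (rV_cons (t, x)).
pose b x := \int[leb1]_s flux f ord0 (rV_cons (s, x)).
have a0 t : 0 <= a t by apply: Rintegral_ge0 => x _; exact: normr_ge0.
have b0 x : 0 <= b x by apply: Rintegral_ge0 => s _; exact: normr_ge0.
have ha t x : f (rV_cons (t, x)) ^+ 2 <= a t.
  apply: le_trans (sup_le1 x (tf_slice t tp)) _; rewrite le_eqVlt; apply/orP; left; apply/eqP.
  by apply: eq_Rintegral => y _; rewrite /flux pd_slice.
have hb t x : f (rV_cons (t, x)) ^+ 2 <= b x by exact: sup_le.
have c4 : ccsupp (fun x => f x ^+ 4).
  have cf := tf_ccsupp tp; have := ccsuppM (ccsuppM cf cf) (ccsuppM cf cf).
  by congr ccsupp; apply/funext => x; ring.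
have ib := line_integrable c0; have ia := slice_integrable c1.
pose B := \int[leb R 1]_x b x; have B0 : 0 <= B by apply: Rintegral_ge0 => x _; exact: b0.
have h : \int[leb R 2]_x f x ^+ 4 <= \int[leb1]_t (B * a t).
  rewrite (slice_fubini c4); apply: le_Rintegral => //; first exact: (slice_integrable c4).
    exact: integrableRZ.
  move=> t _; rewrite mulrC -RintZ//; apply: le_Rintegral => //.
  - exact: ccsupp_integrable (ccsupp_slice t c4).
  - exact: integrableRZ.
  by move=> x _; rewrite (_ : 4 = 2 + 2)%N// exprD; apply: ler_pM => //; rewrite sqr_ge0.
apply: le_trans h _; rewrite RintZ//.
have -> : \int[leb1]_t a t = \int[leb R 2]_x flux f i1 x by rewrite (slice_fubini c1).
have -> : B = \int[leb R 2]_x flux f ord0 x by rewrite (line_fubini c0).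
have h0 := flux_le ord0 tp; have h1 := flux_le i1 tp.
have g0 : 0 <= \int[leb R 2]_x flux f ord0 x by apply: Rintegral_ge0 => x _; exact: normr_ge0.
have g1 : 0 <= \int[leb R 2]_x flux f i1 x by apply: Rintegral_ge0 => x _; exact: normr_ge0.
apply: le_trans (ler_pM g0 g1 h0 h1) _; rewrite big_ord_recl big_ord1 -/i1.
move: (l2n _ _ f) (l2n _ _ (pd ord0 f)) (l2n _ _ (pd i1 f)) => u v w.
rewrite -subr_ge0 [leRHS](_ : _ = 2 * (u * (v - w)) ^+ 2); last by ring.
by rewrite mulr_ge0// sqr_ge0.
Qed.

(** [lady2] on the slices at a fixed first coordinate [t]. The squared norm of [f] on a slice is
    bounded uniformly in [t] by [K], through [sup_le], and the derivatives are then integrated over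
    [t]. *)
Lemma lady3 (f : 'rV[R]_3 -> R) : tf setT f ->
  \int[leb R 3]_x f x ^+ 4 <= 4 * (l2n (leb R 3) setT f * l2n (leb R 3) setT (pd ord0 f))
     * \sum_(i < 2) l2n (leb R 3) setT (pd (lift ord0 i) f) ^+ 2.
Proof.
move=> tp; have sf := tf_smooth tp; have cf := tf_ccsupp tp.
have c0 := flux_ccsupp ord0 tp; have ib := line_integrable c0.
have c4 : ccsupp (fun x => f x ^+ 4).
  have := ccsuppM (ccsuppM cf cf) (ccsuppM cf cf).
  by congr ccsupp; apply/funext => x; ring.
have cd i : ccsupp (fun x => pd (lift ord0 i) f x * pd (lift ord0 i) f x).
  by have c := tf_ccsupp (tf_pd (lift ord0 i) tp); exact: ccsuppM.
pose K := 2 * (l2n (leb R 3) setT f * l2n (leb R 3) setT (pd ord0 f)).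
have hK t : l2n (leb R 2) setT (fun x => f (rV_cons (t, x))) ^+ 2 <= K.
  rewrite l2n_sqr//; apply: le_trans (flux_le ord0 tp); rewrite (line_fubini c0).
  apply: le_Rintegral => //.
    by have := ccsupp_integrable (ccsupp_slice t (ccsuppM cf cf)).
  by move=> x _; rewrite -expr2; exact: sup_le.
pose D i t := \int[leb R 2]_x (pd (lift ord0 i) f (rV_cons (t, x)) * pd (lift ord0 i) f (rV_cons (t, x))).
have iD i : leb1.-integrable setT (EFin \o D i) by exact: slice_integrable (cd i).
have isum : leb1.-integrable setT (EFin \o (fun t => \sum_(i < 2) D i t)) by exact: integrableR_sum.
have h : \int[leb R 3]_x f x ^+ 4 <= \int[leb1]_t (2 * K * \sum_(i < 2) D i t).
  rewrite (slice_fubini c4); apply: le_Rintegral => //; first exact: (slice_integrable c4).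
    exact: integrableRZ.
  move=> t _; apply: le_trans (lady2 (tf_slice t tp)) _.
  have -> : \sum_i l2n (leb R 2) setT (pd i (fun x => f (rV_cons (t, x)))) ^+ 2 = \sum_(i < 2) D i t.
    apply: eq_bigr => i _; apply: etrans (l2n_sqr _ _ _) _; apply: eq_Rintegral => x _.
    by rewrite (pd_slice t i x sf).
  apply: ler_wpM2r; first by apply: sumr_ge0 => i _; apply: Rintegral_ge0 => x _; rewrite -expr2 sqr_ge0.
  by rewrite ler_pM2l.
apply: le_trans h _; rewrite RintZ// Rintegral_sum// le_eqVlt; apply/orP; left; apply/eqP.
rewrite /K mulrA (_ : 2 * 2 = 4) ?mulrA//; last by ring.
congr (_ * _); apply: eq_bigr => i _; apply: esym; apply: etrans (l2n_sqr _ _ _) _.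
exact: (slice_fubini (cd i)).
Qed.

(** Its square root reads |f|_4^2 <= 2 |f|_{H^1}^2. The 2 is cancelled by the factor 1/2 that
    integration by parts puts before the convection term. *)
Lemma l4_bound d (hd : d = 2%N \/ d = 3%N) (f : 'rV[R]_d -> R) : tf setT f ->
  \int[leb R d]_x f x ^+ 4 <=
  4 * (l2n (leb R d) setT f ^+ 2 + \sum_i l2n (leb R d) setT (pd i f) ^+ 2) ^+ 2.
Proof.
move=> tp; have S0 : 0 <= \sum_i l2n (leb R d) setT (pd i f) ^+ 2 by apply: sumr_ge0 => i _; exact: sqr_ge0.
case: hd => dE; subst d.
  apply: le_trans (lady2 tp) _; move: S0; set S := \sum_i _; set u := l2n _ _ f ^+ 2.
  have : 0 <= u by exact: sqr_ge0.
  by move: u S; clear => u S; nra.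
apply: le_trans (lady3 tp) _.
rewrite [X in _ <= 4 * (_ + X) ^+ 2]big_ord_recl.
have : 0 <= \sum_(i < 2) l2n (leb R 3) setT (pd (lift ord0 i) f) ^+ 2 by apply: sumr_ge0 => i _; exact: sqr_ge0.
have := l2n_ge0 (leb R 3) setT f; have := l2n_ge0 (leb R 3) setT (pd ord0 f).
move: (l2n _ _ f) (l2n _ _ (pd ord0 f)) (\sum_(i < 2) _); clear => u v S.
move=> v0 u0 S0; have h1 : u * v <= u ^+ 2 + v ^+ 2 + S by nra.
have h2 : S <= u ^+ 2 + v ^+ 2 + S by nra.
rewrite -mulrA ler_pM2l//.
have -> : u ^+ 2 + (v ^+ 2 + S) = u ^+ 2 + v ^+ 2 + S by ring.
by rewrite expr2; apply: ler_pM => //; exact: mulr_ge0.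
Qed.

End ladyzhenskaya.

(** * Sobolev spaces *)

Section lebesgue_norms.
Context d (T : measurableType d) (R : realType) (mu : {measure set T -> \bar R}).
Variable (D : set T).
Hypothesis mD : measurable D.
Implicit Types f g h : T -> R.

Lemma ae_le_sq f g : measurable_fun D f -> sqint mu D g ->
  {ae mu, forall x, D x -> `|f x| <= `|g x|} -> sqint mu D f /\ l2n mu D f <= l2n mu D g.
Proof.
move=> mf sg fg; have [mg ig] := sg.
have m2 h : measurable_fun D h -> measurable_fun D (fun x => (h x ^+ 2)%:E).
  by move=> mh; apply/measurable_EFinP; exact: measurable_funX.
have le : (\int[mu]_(x in D) (f x ^+ 2)%:E <= \int[mu]_(x in D) (g x ^+ 2)%:E)%E.
  apply: ae_ge0_le_integral => //; try (by move=> x _; rewrite lee_fin sqr_ge0).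
  - exact: m2.
  - exact: m2.
  apply: filterS fg => x fg Dx; rewrite lee_fin -[f x ^+ 2]real_normK ?num_real//.
  by rewrite -[g x ^+ 2]real_normK ?num_real// lerXn2r ?nnegrE ?fg.
have sf : sqint mu D f.
  split => //; apply/integrableP; split; first exact: m2.
  have /integrableP[_] := ig; apply: le_lt_trans.
  by under eq_integral do rewrite /= ger0_norm ?sqr_ge0//;
     under [X in (_ <= X)%E]eq_integral do rewrite /= ger0_norm ?sqr_ge0//.
by split => //; rewrite ler_sqrt ?l2ip_ge0// -lee_fin -!l2ip_int.
Qed.

Lemma ae_eq_sq f g : measurable_fun D f -> sqint mu D g -> ae_eq mu D f g -> sqint mu D f.
Proof. by move=> mf sg fg; apply: (ae_le_sq mf sg _).1; apply: filterS fg => x h Dx; rewrite h. Qed.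

Lemma ae_bounded_sq (w f : T -> R) (M : R) : measurable_fun D w -> {ae mu, forall x, D x -> `|w x| <= M} ->
  sqint mu D f ->
  sqint mu D (fun x => w x * f x) /\ l2n mu D (fun x => w x * f x) <= `|M| * l2n mu D f.
Proof.
move=> mw wM sf; have [mf _] := sf.
rewrite -[X in _ <= X * _]normr_id -l2nZ//; apply: ae_le_sq; [exact: measurable_funM|exact: sqintZ|].
apply: filterS wM => x h Dx; rewrite !normrM normr_id ler_wpM2r//; apply: le_trans (h Dx) _; exact: ler_norm.
Qed.

End lebesgue_norms.

Section sobolev.
Variables (R : realType) (n : nat) (O : set 'rV[R]_n).
Hypothesis oO : open O.
Hypothesis bO : bounded_set O.
Local Notation E := 'rV[R]_n.
Local Notation mu := (leb R n).
Local Notation L2 := (l2n mu O).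
Local Notation ip := (l2ip mu O).
Local Notation sq := (sqint mu O).
Implicit Types (u v g h phi psi w : E -> R).

Lemma omeas : measurable O. Proof. exact: open_measurable_rV. Qed.
Lemma ofin : (mu O < +oo)%E. Proof. exact: leb_bounded_lty omeas bO. Qed.
Let mO := omeas.

Lemma sqr_norm_int u : ('N[mu]_2%:E [(EFin \o u) \_ O] `^ 2 = \int[mu]_(x in O) (u x ^+ 2)%:E)%E.
Proof.
rewrite poweR_Lnorm ?pnatr_eq0// [RHS]integral_mkcond; apply: eq_integral => x _.
rewrite /patch; case: ifPn => _ /=; last by rewrite normr0 powR0// pnatr_eq0.
by rewrite powR_mulrn// real_normK ?num_real.
Qed.

Lemma inL2P u : inL O 2%:E u <-> sq u.
Proof.
split => -[mu' h]; split => //.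
  apply/integrableP; split; first by apply/measurable_EFinP; exact: measurable_funX.
  under eq_integral do rewrite /= ger0_norm ?sqr_ge0//.
  by rewrite -sqr_norm_int; exact: poweR_lty.
apply: (@lty_poweRy _ _ 2); first by rewrite pnatr_eq0.
rewrite sqr_norm_int; have /integrableP[_] := h.
by under eq_integral do rewrite /= ger0_norm ?sqr_ge0//.
Qed.

Lemma normL2E u : sq u -> normL O 2%:E u = L2 u.
Proof.
move=> su; have [_] := (inL2P u).2 su; rewrite /normL.
have := sqr_norm_int u; have := Lnorm_ge0 mu 2%:E ((EFin \o u) \_ O).
case: ('N[mu]_2%:E [_])%E => [r||]//=; rewrite lee_fin => r0 e _.
have : (r ^+ 2)%:E = (L2 u ^+ 2)%:E.
  by rewrite l2n_sqr -l2ip_int// -e powR_mulrn.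
move=> [] /eqP; rewrite eqrXn2 ?l2n_ge0//; exact/eqP.
Qed.

Lemma normLy_ae u : ('N[mu]_+oo [(EFin \o u) \_ O] < +oo)%E ->
  {ae mu, forall x, O x -> `|u x| <= normL O +oo%E u}.
Proof.
rewrite /normL unlock; case: ifPn => [m0|m0] h; last first.
  have m00 : mu setT = 0 by apply/eqP; rewrite eq_le measure_ge0 andbT leNgt.
  by exists setT; split.
have := ess_sup_ge mu (abse \o ((EFin \o u) \_ O)); apply: filterS => x + Ox.
rewrite /= patchE mem_set//=; move: h; case: (ess_sup _ _) => [r||]//= _.
Qed.

Lemma inLy_bound u : inL O +oo%E u -> measurable_fun O u /\
  exists2 M : R, 0 <= M & {ae mu, forall x, O x -> `|u x| <= M}.
Proof.
move=> [mu' h]; split => //; exists `|normL O +oo%E u| => //.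
by apply: filterS (normLy_ae h) => x hx Ox; apply: le_trans (hx Ox) (ler_norm _).
Qed.

Lemma ae_normLy_lty u (M : R) : 0 <= M -> {ae mu, forall x, O x -> `|u x| <= M} ->
  ('N[mu]_+oo [(EFin \o u) \_ O] < +oo)%E.
Proof.
move=> M0 h; rewrite unlock; case: ifPn => // _; apply: (@le_lt_trans _ _ M%:E); last exact: ltry.
apply/ess_supP; apply: filterS h => x hx; rewrite /= /patch; case: ifPn => xO /=.
  by rewrite lee_fin hx// -inE.
by rewrite normr0 lee_fin.
Qed.

Lemma sq_cst (c : R) : sq (fun=> c).
Proof. by split; [exact: measurable_cst|exact: integrable_cstR mO ofin]. Qed.

Lemma sq_int u : sq u -> mu.-integrable O (EFin \o u).
Proof.
move=> su; have := sqintM mO su (sq_cst 1); congr (integrable _ _ _).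
by apply/funext => x /=; rewrite mulr1.
Qed.

Lemma sq_loc u : sq u -> loc_integrable O u.
Proof.
move=> su; split; first by case: su.
move=> K cK KO; apply: integrableS KO (sq_int su) => //; exact: compact_measurable_rV.
Qed.

Lemma int_restr f : (forall x, ~ O x -> f x = 0) -> \int[mu]_(x in O) f x = \int[mu]_x f x.
Proof.
move=> h; rewrite Rintegral_mkcond; congr (Rintegral _ _ _); apply/funext => x.
by rewrite /patch; case: ifPn => // /negP nx; rewrite h// => Ox; apply: nx; rewrite inE.
Qed.

Lemma sq_tf phi : tf O phi -> sq phi.
Proof. exact: tf_sqint. Qed.

Lemma wd_tf i phi : tf O phi -> weak_deriv O i phi (pd i phi).
Proof.
move=> tp; have t1 := tf_pd i tp; split; [exact/sq_loc/sq_tf|exact/sq_loc/sq_tf|].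
move=> psi /tf_test_fun tq; rewrite /integ int_restr; last first.
  by move=> x nx; rewrite (tf_off tp nx) mul0r.
rewrite int_restr; last by move=> x nx; rewrite (tf_off tq nx) mulr0.
exact: int_parts tp (tf_smooth tq).
Qed.

Lemma wd_lin i (a : R) u g v h : sq u -> sq g -> sq v -> sq h -> weak_deriv O i u g -> weak_deriv O i v h ->
  weak_deriv O i (fun x => a * u x + v x) (fun x => a * g x + h x).
Proof.
move=> su sg sv sh [_ _ e1] [_ _ e2]; split.
- by apply: sq_loc; apply: sqintD => //; exact: sqintZ.
- by apply: sq_loc; apply: sqintD => //; exact: sqintZ.
move=> phi tp; have tp' := (tf_test_fun O phi).2 tp.
have sp := sq_tf tp'; have sdp := sq_tf (tf_pd i tp').
have := l2ipDl mO (sqintZ a mO su) sv sdp; rewrite l2ipZl// => E1.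
have := l2ipDl mO (sqintZ a mO sg) sh sp; rewrite l2ipZl// => E2.
rewrite [LHS]E1 [X in - X]E2 [X in a * X + _](e1 _ tp) [X in _ + X](e2 _ tp).
by rewrite /l2ip /integ; ring.
Qed.

Lemma loc_tf_integrable g phi : loc_integrable O g -> tf O phi ->
  mu.-integrable O (EFin \o (fun x => g x * phi x)).
Proof.
move=> [mg lg] tp; have [M M0 hM] := tf_bounded tp; have cp := tf_cont tp.
case: tp => sp [A [cA AU pA]]; have mA := compact_measurable_rV cA.
have gi := lg A cA AU.
have iA : mu.-integrable A (EFin \o (fun x => g x * phi x)).
  apply: (integrable_le (g := fun x => M * `|g x|)) => //.
  - by apply: measurable_funM; [exact: integrable_mfun gi|exact: cont_measurable].
  - by apply: integrableRZ => //; exact: integrable_norm.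
  - by move=> x _; rewrite normrM mulrC ler_wpM2r.
apply: (@integrableS _ _ _ mu setT) => //.
have := (integrable_mkcond _ mA).1 iA; congr (integrable _ _ _).
apply/funext => x; rewrite /patch /=; case: ifPn => // /negP nx.
by rewrite pA ?mulr0// => Ax; apply: nx; rewrite inE.
Qed.

Lemma wd_uniq i u g h : weak_deriv O i u g -> weak_deriv O i u h -> ae_eq mu O g h.
Proof.
move=> [_ lg e1] [_ lh e2]; pose f x := g x - h x.
have lf K : compact K -> K `<=` O -> mu.-integrable K (EFin \o f).
  move=> cK KO; have mK := compact_measurable_rV cK.
  by apply: integrableRB => //; [exact: lg.2|exact: lh.2].
have f0 phi : tf O phi -> \int[mu]_(x in O) (f x * phi x) = 0.
  move=> tp; have ig := loc_tf_integrable lg tp; have ih := loc_tf_integrable lh tp.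
  have tp' := (tf_test_fun O phi).1 tp.
  under eq_Rintegral do rewrite mulrBl.
  rewrite RintegralB//; apply/eqP; rewrite subr_eq0 -eqr_opp; apply/eqP.
  by have := e1 _ tp'; rewrite (e2 _ tp') /integ => <-.
by have := fundamental_ae oO lf f0; apply: filterS => x hx Ox; apply/eqP; rewrite -subr_eq0 -[_ - _]/(f x) hx.
Qed.

(** [xget] returns a weak derivative as soon as one exists; square integrability is then inherited
    from [g] by uniqueness almost everywhere. *)
Lemma wpartialP i u g : sq g -> weak_deriv O i u g ->
  [/\ weak_deriv O i u (wpartial O i u), sq (wpartial O i u) & ae_eq mu O (wpartial O i u) g].
Proof.
move=> sg hg; have hw : weak_deriv O i u (wpartial O i u).
  by apply: (@xgetPex _ (fun=> 0) [set g | weak_deriv O i u g]); exists g.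
have e := wd_uniq hw hg; split => //; apply: ae_eq_sq e => //.
by case: hw => _ [].
Qed.

Lemma wd_close i u g : sq u -> sq g ->
  (forall e : R, 0 < e -> exists v h, [/\ sq v, sq h, weak_deriv O i v h,
     L2 (fun x => u x - v x) <= e & L2 (fun x => g x - h x) <= e]) ->
  weak_deriv O i u g.
Proof.
move=> su sg H; split; [exact: sq_loc|exact: sq_loc|].
move=> phi tp; have tp' := (tf_test_fun O phi).2 tp.
have sp := sq_tf tp'; have sd := sq_tf (tf_pd i tp').
apply/eqP; rewrite -subr_eq0 -normr_le0; apply/ler_addgt0Pl => e e0; rewrite addr0.
pose K := L2 (pd i phi) + L2 phi + 1.
have K0 : 0 < K by rewrite ltr_wpDl// addr_ge0// l2n_ge0.
have [v [h [sv sh [_ _ e1] h1 h2]]] := H (e / K) (divr_gt0 e0 K0).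
have E1 := l2ipDl mO su (sqintN mO sv) sd; have E2 := l2ipDl mO sg (sqintN mO sh) sp.
have N1 : ip (fun x => - v x) (pd i phi) = - ip v (pd i phi).
  by rewrite -[RHS]mulN1r -l2ipZl//; congr (l2ip _ _ _ _); apply/funext => x; rewrite mulN1r.
have N2 : ip (fun x => - h x) phi = - ip h phi.
  by rewrite -[RHS]mulN1r -l2ipZl//; congr (l2ip _ _ _ _); apply/funext => x; rewrite mulN1r.
have e1' : ip v (pd i phi) = - ip h phi by exact: e1.
have -> : integ O (fun x => u x * pd i phi x) - - integ O (fun x => g x * phi x) =
    ip (fun x => u x - v x) (pd i phi) + ip (fun x => g x - h x) phi.
  rewrite E1 E2 N1 N2 e1' -[integ O _]/(ip u (pd i phi)) -[X in - - X]/(ip g phi).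
  by move: (ip u (pd i phi)) (ip g phi) (ip h phi); clear => a b c; ring.
have c1 := l2_CS mO (sqintB mO su sv) sd; have c2 := l2_CS mO (sqintB mO sg sh) sp.
apply: le_trans (ler_normD _ _) _; apply: le_trans (lerD c1 c2) _.
apply: (@le_trans _ _ (e / K * L2 (pd i phi) + e / K * L2 phi)).
  by apply: lerD; apply: ler_wpM2r => //; exact: l2n_ge0.
by rewrite -mulrDr mulrAC ler_pdivrMr// ler_pM2l// /K lerDl.
Qed.

Lemma sqr_sqrt_measurable (f : E -> R) : measurable_fun O f -> measurable_fun O (fun x => Num.sqrt (f x)).
Proof.
by move=> mf; apply: (measurableT_comp _ mf); apply: continuous_measurable_fun; exact: sqrt_continuous.
Qed.

Lemma enorm_sqr k (a : 'rV[R]_k) : enorm a ^+ 2 = \sum_i a ord0 i ^+ 2.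
Proof.
rewrite sqr_sqrtr; last by apply: sumr_ge0 => i _; rewrite -expr2 sqr_ge0.
by apply: eq_bigr => i _; rewrite expr2.
Qed.

Lemma sq_enorm k (w : E -> 'rV[R]_k) : (forall i, sq (fun x => w x ord0 i)) -> sq (fun x => enorm (w x)).
Proof.
move=> sw; split.
  apply: sqr_sqrt_measurable; apply: measurable_sum => i; have [m _] := sw i; exact: measurable_funM.
have : mu.-integrable O (EFin \o (fun x => \sum_(i <- index_enum 'I_k) w x ord0 i ^+ 2)).
  by apply: (integrableR_sum _ mO) => i; have [] := sw i.
by congr (integrable _ _ _); apply/funext => x /=; rewrite enorm_sqr.
Qed.

Lemma vnormL2_sqr k (w : E -> 'rV[R]_k) : (forall i, sq (fun x => w x ord0 i)) ->
  vnormL O 2%:E w ^+ 2 = \sum_i ip (fun x => w x ord0 i) (fun x => w x ord0 i).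
Proof.
move=> sw; rewrite /vnormL normL2E; last exact: sq_enorm.
rewrite l2n_sqr /l2ip -Rintegral_sum//; last by move=> i; exact: sqintM.
by apply: eq_Rintegral => x _; rewrite -expr2 enorm_sqr; apply: eq_bigr => i _; rewrite expr2.
Qed.

End sobolev.

(** * Products, closures and density in semi-Hilbert spaces *)

Section hilbert_constructions.
Variable R : realType.

Definition prod_shilb (H1 H2 : lmodType R) (X : shilb H1) (Y : shilb H2) : shilb (H1 * H2)%type.
Proof.
refine (@Shilb R (H1 * H2)%type (fun u => hdom X u.1 /\ hdom Y u.2)
  (fun u v => hip X u.1 v.1 + hip Y u.2 v.2) _ _ _ _ _ _).
- by split; exact: hdom0.
- by move=> a u v [? ?] [? ?]; split; exact: hdomL.
- by move=> u v [? ?] [? ?]; congr (_ + _); exact: hipC.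
- move=> a u v w [? ?] [? ?] [? ?].
  have e1 : hip X (a *: u + v).1 w.1 = a * hip X u.1 w.1 + hip X v.1 w.1 by exact: hipL.
  have e2 : hip Y (a *: u + v).2 w.2 = a * hip Y u.2 w.2 + hip Y v.2 w.2 by exact: hipL.
  by rewrite e1 e2 mulrDr addrACA.
- by move=> u [? ?]; rewrite addr_ge0// hip_ge0.
- move=> u c Su hu.
  have S1 k : hdom X (u k).1 := (Su k).1; have S2 k : hdom Y (u k).2 := (Su k).2.
  have D1 k : 0 <= hip X ((u k.+1).1 - (u k).1) ((u k.+1).1 - (u k).1) by apply: hip_ge0; exact: hdomB.
  have D2 k : 0 <= hip Y ((u k.+1).2 - (u k).2) ((u k.+1).2 - (u k).2) by apply: hip_ge0; exact: hdomB.
  have [|x Sx [K hx]] := @hcomplete _ _ X (fun k => (u k).1) c S1.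
    by move=> k; apply: le_trans (hu k); rewrite lerDl; exact: D2.
  have [|y Sy [L hy]] := @hcomplete _ _ Y (fun k => (u k).2) c S2.
    by move=> k; apply: le_trans (hu k); rewrite lerDr; exact: D1.
  exists (x, y) => //; exists (K + L) => k; rewrite mulrDl; exact: lerD (hx k) (hy k).
Defined.

Definition fin_shilb (I : finType) (H : lmodType R) (X : shilb H) : shilb (I -> H).
Proof.
refine (@Shilb R (I -> H) (fun u => forall i, hdom X (u i))
  (fun u v => \sum_i hip X (u i) (v i)) _ _ _ _ _ _).
- by move=> i; exact: hdom0.
- by move=> a u v Su Sv i; exact: hdomL.
- by move=> u v Su Sv; apply: eq_bigr => i _; exact: hipC.
- by move=> a u v w Su Sv Sw; rewrite mulr_sumr -big_split; apply: eq_bigr => i _; exact: hipL.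
- by move=> u Su; apply: sumr_ge0 => i _; exact: hip_ge0.
- move=> u c Su hu.
  have /choice[l hl] : forall i, exists l, hdom X l /\
      exists K, forall k, hip X (u k i - l) (u k i - l) <= K * 4^-1 ^+ k.
    move=> i; have [|l Sl hl] := @hcomplete _ _ X (u ^~ i) c (fun k => Su k i); last by exists l.
    move=> k; apply: le_trans (hu k); rewrite (bigD1 i)//= lerDl sumr_ge0// => j _.
    by apply: hip_ge0; exact: hdomB.
  have /choice[K hK] : forall i, exists K, forall k, hip X (u k i - l i) (u k i - l i) <= K * 4^-1 ^+ k.
    by move=> i; case: (hl i).
  exists l; first by move=> i; case: (hl i).
  by exists (\sum_i K i) => k; rewrite mulr_suml; apply: ler_sum => i _; exact: hK.
Defined.

Lemma shilb_normN (H : lmodType R) (X : shilb H) u : hdom X u -> hnorm X (- u) = hnorm X u.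
Proof. by move=> Su; rewrite -scaleN1r hnormZ// normrN1 mul1r. Qed.

Section closure.
Variables (H : lmodType R) (X : shilb H) (S : set H).
Hypothesis SX : S `<=` hdom X.
Hypothesis S0 : S 0.
Hypothesis SL : forall a u v, S u -> S v -> S (a *: u + v).

Definition closure_dom u := hdom X u /\ forall e : R, 0 < e -> exists2 s, S s & hnorm X (u - s) < e.

Definition closure_shilb : shilb H.
Proof.
refine (@Shilb R H closure_dom (hip X) _ _ _ _ _ _).
- split=> [|e e0]; [exact: hdom0|exists 0 => //].
  rewrite subr0 (_ : hnorm X 0 = 0)//; have := @hnormZ _ _ X 0 0 (hdom0 X).
  by rewrite scale0r normr0 mul0r.
- move=> a u v [Su hu] [Sv hv]; split=> [|e e0]; first exact: hdomL.
  have a0 : 0 < 2 * (`|a| + 1) by rewrite mulr_gt0// ltr_wpDl.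
  have [s Ss hs] := hu (e / (2 * (`|a| + 1))) (divr_gt0 e0 a0).
  have [t St ht] := hv (e / 2) (divr_gt0 e0 (ltr0n _ 2)).
  exists (a *: s + t); first exact: SL.
  have Xs := SX Ss; have Xt := SX St.
  have -> : a *: u + v - (a *: s + t) = a *: (u - s) + (v - t) by rewrite scalerBr opprD addrACA.
  apply: (@le_lt_trans _ _ (hnorm X (a *: (u - s)) + hnorm X (v - t))).
    by apply: hnormD; [apply: hdomZ; exact: hdomB|exact: hdomB].
  rewrite hnormZ ?[X in _ < X](splitr e); last exact: hdomB.
  apply: ler_ltD => //; apply: (@le_trans _ _ (`|a| * (e / (2 * (`|a| + 1))))); first by rewrite ler_wpM2l// ltW.
  have -> : `|a| * (e / (2 * (`|a| + 1))) = e / 2 * (`|a| / (`|a| + 1)) by rewrite invfM; ring.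
  rewrite ler_piMr//; first by rewrite divr_ge0// ltW.
  by rewrite ler_pdivrMr ?mul1r ?lerDl// ltr_wpDl.
- by move=> u v [? _] [? _]; exact: hipC.
- by move=> a u v w [? _] [? _] [? _]; exact: hipL.
- by move=> u [? _]; exact: hip_ge0.
- move=> u c clu hu; have [l Sl [K hl]] := @hcomplete _ _ X u c (fun k => (clu k).1) hu.
  exists l; last by exists K.
  split => // e e0.
  have [k hk] : exists k, hnorm X (l - u k) <= e / 2.
    apply/not_existsP => h; suff : (e / 2) ^+ 2 <= 0.
      by rewrite leNgt exprn_gt0// divr_gt0.
    apply: (@quarter_small _ _ K) => k; apply: le_trans (hl k).
    have /negP := h k; rewrite -ltNge => /ltW.
    rewrite -[l - _]opprB shilb_normN; last by apply: hdomB => //; case: (clu k).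
    rewrite -hnorm_sqr; last by apply: hdomB => //; case: (clu k).
    by move=> h1; rewrite lerXn2r ?nnegrE ?hnorm_ge0// divr_ge0// ltW.
  have [Sk hk'] := clu k; have [s Ss hs] := hk' (e / 2) (divr_gt0 e0 (ltr0n _ 2)).
  exists s => //; rewrite -[l](subrK (u k)) -addrA [X in _ < X](splitr e).
  apply: le_lt_trans (ler_ltD hk hs); apply: hnormD; apply: hdomB => //; exact: SX.
Defined.

End closure.

Section density.
Variables (H1 H2 : lmodType R) (X : shilb H1) (Y : shilb H2) (b : H1 -> H2 -> R).
Hypothesis bb : bbilin X Y b.

Lemma bbilin_dense0 (S : set H1) (T : set H2) : S `<=` hdom X -> T `<=` hdom Y ->
  (forall u, hdom X u -> forall e : R, 0 < e -> exists2 s, S s & hnorm X (u - s) < e) ->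
  (forall u, hdom Y u -> forall e : R, 0 < e -> exists2 s, T s & hnorm Y (u - s) < e) ->
  (forall s t, S s -> T t -> b s t = 0) -> forall u v, hdom X u -> hdom Y v -> b u v = 0.
Proof.
move=> SX TY hS hT st0; case: bb => bL bR [C C0 bB].
have sv s v : S s -> hdom Y v -> b s v = 0.
  move=> Ss Sv; apply/eqP; rewrite -normr_le0; apply/ler_addgt0Pl => e e0; rewrite addr0.
  have K0 : 0 < C * hnorm X s + 1 by rewrite ltr_wpDl// mulr_ge0 ?hnorm_ge0.
  have [t Tt ht] := hT v Sv _ (divr_gt0 e0 K0).
  have -> : b s v = b s (v - t).
    by rewrite addrC -scaleN1r (bR _ _ _ _ (TY _ Tt) Sv (SX _ Ss)) (st0 _ _ Ss Tt) mulr0 add0r.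
  apply: le_trans (bB _ _ _ _) _; [exact: SX|apply: hdomB => //; exact: TY|].
  apply: (@le_trans _ _ ((C * hnorm X s + 1) * (e / (C * hnorm X s + 1)))); last first.
    by rewrite mulrC divfK// gt_eqF.
  by apply: ler_pM; rewrite ?mulr_ge0 ?hnorm_ge0 ?lerDl// ltW.
move=> u v Su Sv; apply/eqP; rewrite -normr_le0; apply/ler_addgt0Pl => e e0; rewrite addr0.
have K0 : 0 < C * hnorm Y v + 1 by rewrite ltr_wpDl// mulr_ge0 ?hnorm_ge0.
have [s Ss hs] := hS u Su _ (divr_gt0 e0 K0).
have -> : b u v = b (u - s) v.
  by rewrite addrC -scaleN1r (bL _ _ _ _ (SX _ Ss) Su Sv) (sv _ _ Ss Sv) mulr0 add0r.
apply: le_trans (bB _ _ _ Sv) _; first by apply: hdomB => //; exact: SX.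
rewrite mulrAC; apply: (@le_trans _ _ ((C * hnorm Y v + 1) * (e / (C * hnorm Y v + 1)))); last first.
  by rewrite mulrC divfK// gt_eqF.
by apply: ler_pM; rewrite ?mulr_ge0 ?hnorm_ge0 ?lerDl// ltW.
Qed.

End density.

Section bilinear_algebra.
Variables (H1 H2 : lmodType R) (X : shilb H1) (Y : shilb H2).
Implicit Types b : H1 -> H2 -> R.

Lemma bbilin_ext b b' : (forall u v, hdom X u -> hdom Y v -> b u v = b' u v) -> bbilin X Y b -> bbilin X Y b'.
Proof.
move=> e [bL bR [C C0 bB]]; split.
- by move=> a u v w Su Sv Sw; rewrite -!e ?bL//; exact: hdomL.
- by move=> a u v w Su Sv Sw; rewrite -!e ?bR//; exact: hdomL.
- by exists C => // u v Su Sv; rewrite -e ?bB.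
Qed.

Lemma bbilin0 : bbilin X Y (fun _ _ => 0).
Proof.
split => [*|*|]; rewrite ?mulr0 ?addr0//.
by exists 0 => // u v _ _; rewrite normr0 !mul0r.
Qed.

Lemma bbilinD b b' : bbilin X Y b -> bbilin X Y b' -> bbilin X Y (fun u v => b u v + b' u v).
Proof.
move=> [bL bR [C C0 bB]] [bL' bR' [C' C0' bB']]; split.
- by move=> a u v w *; rewrite bL// bL'// mulrDr addrACA.
- by move=> a u v w *; rewrite bR// bR'// mulrDr addrACA.
- exists (C + C'); first exact: addr_ge0.
  by move=> u v Su Sv; rewrite !mulrDl; apply: le_trans (ler_normD _ _) (lerD (bB _ _ Su Sv) (bB' _ _ Su Sv)).
Qed.

Lemma bbilinZ (c : R) b : bbilin X Y b -> bbilin X Y (fun u v => c * b u v).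
Proof.
move=> [bL bR [C C0 bB]]; split.
- by move=> a u v w *; rewrite bL// mulrDr mulrCA.
- by move=> a u v w *; rewrite bR// mulrDr mulrCA.
- exists (`|c| * C); first exact: mulr_ge0.
  by move=> u v Su Sv; rewrite normrM -!mulrA ler_wpM2l// mulrA bB.
Qed.

Lemma bbilin_sum (I : Type) (s : seq I) (b : I -> H1 -> H2 -> R) : (forall i, bbilin X Y (b i)) ->
  bbilin X Y (fun u v => \sum_(i <- s) b i u v).
Proof.
move=> hb; elim: s => [|i s IH].
  by apply: bbilin_ext bbilin0 => u v _ _; rewrite big_nil.
by apply: bbilin_ext (bbilinD (hb i) IH) => u v _ _; rewrite big_cons.
Qed.

End bilinear_algebra.

End hilbert_constructions.

(** * The spaces H^1 and H^1_0 *)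

Section h10.
Variables (R : realType) (n : nat) (O : set 'rV[R]_n).
Hypothesis oO : open O.
Hypothesis bO : bounded_set O.
Local Notation E := 'rV[R]_n.
Local Notation mu := (leb R n).
Local Notation L2 := (l2n mu O).
Local Notation ip := (l2ip mu O).
Local Notation sq := (sqint mu O).
Local Notation wp := (wpartial O).
Implicit Types (u v g h phi psi w : E -> R).
Let mO : measurable O := omeas oO.

Definition w12 u := sq u /\ forall j, weak_deriv O j u (wp j u) /\ sq (wp j u).

Definition w12_ip u v := ip u v + \sum_j ip (wp j u) (wp j v).

Lemma w12_intro u (g : 'I_n -> E -> R) : sq u -> (forall j, sq (g j)) -> (forall j, weak_deriv O j u (g j)) ->
  w12 u /\ forall j, ae_eq mu O (wp j u) (g j).
Proof.
move=> su sg hg; split; last by move=> j; have [] := wpartialP oO (sg j) (hg j).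
by split => // j; have [] := wpartialP oO (sg j) (hg j).
Qed.

Lemma W1_w12 u : W1 O 2%:E u <-> w12 u.
Proof.
split=> [[/inL2P su h]|[su h]].
  split => // j; have [g hg /inL2P sg] := h j.
  by have [] := wpartialP oO sg hg.
split=> [|j]; first exact/inL2P.
by have [h1 h2] := h j; exists (wp j u) => //; exact/inL2P.
Qed.

Lemma w12_lin (a : R) u v : w12 u -> w12 v -> w12 (a *: u + v) /\
  forall j, ae_eq mu O (wp j (a *: u + v)) (fun x => a * wp j u x + wp j v x).
Proof.
move=> [su hu] [sv hv]; apply: w12_intro.
- by apply: sqintD => //; exact: sqintZ.
- by move=> j; apply: sqintD => //; [apply: sqintZ => //; case: (hu j)|case: (hv j)].
- by move=> j; have [h1 h2] := hu j; have [h3 h4] := hv j; exact: (wd_lin oO bO).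
Qed.

Lemma w12_tf phi : tf O phi -> w12 phi /\ forall j, ae_eq mu O (wp j phi) (pd j phi).
Proof.
move=> tp; apply: w12_intro; first exact: (sq_tf oO).
- by move=> j; apply: (sq_tf oO); exact: tf_pd.
- by move=> j; exact: (wd_tf oO bO).
Qed.

Lemma w12_sub u v : w12 u -> w12 v -> w12 (u - v) /\
  forall j, ae_eq mu O (wp j (u - v)) (fun x => wp j u x - wp j v x).
Proof.
move=> hu hv; have [h1 h2] := w12_lin (-1) hv hu.
have -> : u - v = -1 *: v + u by rewrite scaleN1r addrC.
split => // j; apply: filterS (h2 j) => x h Ox; rewrite h//.
by rewrite mulN1r addrC.
Qed.

Lemma w120 : w12 0. Proof. exact: (w12_tf (tf0 O)).1. Qed.

Definition w12_shilb : shilb (E -> R).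
Proof.
refine (@Shilb R (E -> R) w12 w12_ip w120 _ _ _ _ _).
- by move=> a u v hu hv; exact: (w12_lin a hu hv).1.
- move=> u v _ _; rewrite /w12_ip (l2ipC _ _ u v); apply: (congr1 (fun t => ip v u + t)).
  by apply: eq_bigr => j _; exact: l2ipC.
- move=> a u v w hu hv hw; have [_ e] := w12_lin a hu hv.
  have [su du] := hu; have [sv dv] := hv; have [sw dw] := hw.
  have e1 : ip (a *: u + v) w = a * ip u w + ip v w.
    by rewrite -l2ipZl// -l2ipDl//; exact: sqintZ.
  rewrite /w12_ip e1 mulrDr addrACA; apply: (congr1 (fun t => a * ip u w + ip v w + t)).
  rewrite mulr_sumr -big_split; apply: eq_bigr => j _ /=.
  have s1 : sq (wp j u) by case: (du j). have s2 : sq (wp j v) by case: (dv j).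
  have s3 : sq (wp j w) by case: (dw j).
  rewrite -l2ipZl// -l2ipDl//; last exact: sqintZ.
  have s4 : sq (wp j (a *: u + v)) by have [_ d] := (w12_lin a hu hv).1; case: (d j).
  have s5 : sq (fun x => a * wp j u x + wp j v x) by apply: sqintD => //; exact: sqintZ.
  exact: (l2ip_ae_eq mO (e j) (ae_eq_refl _ _ _) s4 s5 s3 s3).
- by move=> u _; rewrite addr_ge0 ?l2ip_ge0// sumr_ge0// => j _; exact: l2ip_ge0.
- move=> u c wu hu.
  have su k : sq (u k) by case: (wu k).
  have sd j k : sq (wp j (u k)) by have [_ d] := wu k; case: (d j).
  have dE j v w : w12 v -> w12 w ->
      ip (wp j (v - w)) (wp j (v - w)) = ip (fun x => wp j v x - wp j w x) (fun x => wp j v x - wp j w x).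
    move=> hv hw; have [[_ d] e] := w12_sub hv hw.
    have s : sq (fun x => wp j v x - wp j w x).
      by apply: sqintB => //; [case: hv|case: hw] => _ q; case: (q j).
    by apply: l2ip_ae_eq => //; case: (d j).
  have [|l sl hl] := @l2_complete _ _ _ mu O u c mO su.
    move=> k; apply: le_trans (hu k); rewrite lerDl sumr_ge0// => j _; exact: l2ip_ge0.
  have /choice[g hg] : forall j, exists g, sq g /\ forall k,
      ip (fun x => wp j (u k) x - g x) (fun x => wp j (u k) x - g x) <= 4 * c * 4^-1 ^+ k.
    move=> j; have [|g sg hg] := @l2_complete _ _ _ mu O (fun k => wp j (u k)) c mO (sd j); last by exists g.
    move=> k; rewrite -dE//; apply: le_trans (hu k).
    rewrite /w12_ip (bigD1 j)//= addrCA lerDl addr_ge0 ?l2ip_ge0// sumr_ge0// => i _; exact: l2ip_ge0.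
  have sg j : sq (g j) by case: (hg j).
  have small (f : nat -> E -> R) (e : R) : 0 < e -> (forall k, ip (f k) (f k) <= 4 * c * 4^-1 ^+ k) ->
      exists N, forall k, (N <= k)%N -> L2 (f k) <= e.
    move=> e0 hf; pose M := 4 * `|c|.
    have M0 : 0 <= M by rewrite mulr_ge0.
    have [N hN] : exists N : nat, M * 4^-1 ^+ N <= e ^+ 2.
      apply/not_existsP => h; suff : e ^+ 2 <= 0 by rewrite leNgt exprn_gt0.
      apply: (@quarter_small _ _ M) => k; apply: ltW; rewrite ltNge; apply/negP; exact: h.
    exists N => k Nk; rewrite -(@ler_pXn2r _ 2)// ?nnegrE ?l2n_ge0 ?(ltW e0)//.
    rewrite l2n_sqr; apply: le_trans (hf k) _; apply: le_trans hN.
    apply: (@le_trans _ _ (M * 4^-1 ^+ k)).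
      by rewrite ler_wpM2r ?exprn_ge0 ?invr_ge0// /M ler_pM2l// ler_norm.
    by rewrite ler_wpM2l// ler_wiXn2l// ?invr_ge0// invf_le1// ler1n.
  have hw : w12 l /\ forall j, ae_eq mu O (wp j l) (g j).
    apply: w12_intro => // j; apply: (wd_close oO bO) => // e e0.
    have [N1 h1] := small (fun k x => u k x - l x) e e0 hl.
    have [N2 h2] := small (fun k x => wp j (u k) x - g j x) e e0 (hg j).2.
    pose k := maxn N1 N2; exists (u k), (wp j (u k)).
    have sw (p q : E -> R) : L2 (fun x => q x - p x) = L2 (fun x => p x - q x).
      rewrite -(l2nN _ _ (fun x => p x - q x)); congr (l2n _ _ _).
      by apply/funext => x; rewrite opprB.
    split => //; first by have [_ d] := wu k; case: (d j).
    - by rewrite sw; apply: h1; exact: leq_maxl.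
    - by rewrite sw; apply: h2; exact: leq_maxr.
  exists l; first by case: hw.
  exists (4 * c + \sum_(j < n) 4 * c) => k; rewrite mulrDl; apply: lerD; first exact: hl.
  rewrite mulr_suml; apply: ler_sum => j _; rewrite (dE j _ _ (wu k) hw.1).
  apply: le_trans ((hg j).2 k); rewrite le_eqVlt; apply/orP; left; apply/eqP.
  have s1 : sq (fun x => wp j (u k) x - wp j l x) by apply: sqintB => //; have [[_ d] _] := hw; case: (d j).
  have s2 : sq (fun x => wp j (u k) x - g j x) by exact: sqintB.
  have e : ae_eq mu O (fun x => wp j (u k) x - wp j l x) (fun x => wp j (u k) x - g j x).
    by have [_ q] := hw; apply: filterS (q j) => x h Ox; rewrite h.
  exact: l2ip_ae_eq.
Defined.

Definition h10_shilb : shilb (E -> R) :=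
  @closure_shilb R _ w12_shilb (tf O) (fun phi tp => (w12_tf tp).1) (tf0 O)
    (fun a u v tu tv => tfD (tfZ a tu) tv).

Lemma normH1E u : w12 u -> normH1 O u = hnorm w12_shilb u.
Proof.
move=> [su du]; rewrite /normH1 normL2E// l2n_sqr vnormL2_sqr//; last first.
  by move=> j; under eq_fun do rewrite mxE; case: (du j).
apply: (congr1 (fun t => Num.sqrt (ip u u + t))); apply: eq_bigr => j _.
by have -> : (fun x => grad O u x ord0 j) = wp j u by apply/funext => x; rewrite mxE.
Qed.

Lemma H10_dom u : H10 O u <-> hdom h10_shilb u.
Proof.
split=> -[hu h]; split; try exact/W1_w12; move=> e e0; have [phi tp hp] := h e e0; exists phi.
- exact/tf_test_fun.
- move: hp; rewrite normH1E//; apply: (w12_sub _ _).1; first exact/W1_w12.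
  by have /tf_test_fun/w12_tf[] := tp.
- exact/tf_test_fun.
- rewrite normH1E//; apply: (w12_sub _ _).1 => //.
  by have [] := w12_tf tp.
Qed.

End h10.

(** * Boundedness of the forms *)

Section bounded_l2_maps.
Variables (R : realType) (n : nat) (O : set 'rV[R]_n).
Hypothesis mO : measurable O.
Local Notation E := 'rV[R]_n.
Local Notation mu := (leb R n).
Local Notation L2 := (l2n mu O).
Local Notation ip := (l2ip mu O).
Local Notation sq := (sqint mu O).

(** Bounded maps into L^2 that are linear only almost everywhere, as [wpartial] is: its values on a
    sum and on the summands are separate choices. Pairing two such maps gives a genuine bounded
    bilinear form. *)
Definition bl2 (H : lmodType R) (X : shilb H) (T : H -> E -> R) := [/\
  forall u, hdom X u -> sq (T u),
  forall a u v, hdom X u -> hdom X v -> ae_eq mu O (T (a *: u + v)) (fun x => a * T u x + T v x) &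
  exists2 C : R, 0 <= C & forall u, hdom X u -> L2 (T u) <= C * hnorm X u].

Section algebra.
Variables (H : lmodType R) (X : shilb H).
Implicit Types T : H -> E -> R.

Lemma bl2_ext T T' : (forall u x, T u x = T' u x) -> bl2 X T -> bl2 X T'.
Proof. by move=> e; have -> : T = T' by apply/funext => u; apply/funext. Qed.

Lemma bl2_0 : bl2 X (fun _ _ => 0).
Proof.
split=> [u _|a u v _ _|]; first exact: sqint0.
  by apply: aeW => x _; rewrite mulr0 addr0.
by exists 0 => // u _; rewrite mul0r /l2n /l2ip; under eq_Rintegral do rewrite mul0r;
  rewrite Rintegral_cst// mul0r sqrtr0.
Qed.

Lemma bl2D T T' : bl2 X T -> bl2 X T' -> bl2 X (fun u x => T u x + T' u x).
Proof.
move=> [s l [C C0 b]] [s' l' [C' C0' b']]; split.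
- by move=> u Su; apply: sqintD => //; [exact: s|exact: s'].
- move=> a u v Su Sv; apply: filterS2 (l a u v Su Sv) (l' a u v Su Sv) => x h h' Ox.
  by rewrite h// h'// mulrDr addrACA.
- exists (C + C'); first exact: addr_ge0.
  move=> u Su; apply: le_trans (l2nD mO (s _ Su) (s' _ Su)) _.
  by rewrite mulrDl; apply: lerD; [exact: b|exact: b'].
Qed.

Lemma bl2_mul (w : E -> R) (M : R) T : measurable_fun O w -> {ae mu, forall x, O x -> `|w x| <= M} ->
  bl2 X T -> bl2 X (fun u x => w x * T u x).
Proof.
move=> mw wM [s l [C C0 b]]; split.
- by move=> u Su; have [] := ae_bounded_sq mO mw wM (s _ Su).
- by move=> a u v Su Sv; apply: filterS (l a u v Su Sv) => x h Ox; rewrite h// mulrDr mulrCA.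
- exists (`|M| * C); first exact: mulr_ge0.
  move=> u Su; have [_ h] := ae_bounded_sq mO mw wM (s _ Su).
  by apply: le_trans h _; rewrite -mulrA ler_wpM2l// b.
Qed.

Lemma bl2Z (c : R) T : bl2 X T -> bl2 X (fun u x => c * T u x).
Proof. by apply: (@bl2_mul _ `|c|); [exact: measurable_cst|apply: aeW]. Qed.

Lemma bl2B T T' : bl2 X T -> bl2 X T' -> bl2 X (fun u x => T u x - T' u x).
Proof.
move=> h h'; apply: bl2_ext (bl2D h (bl2Z (-1) h')) => u x; by rewrite mulN1r.
Qed.

Lemma bl2_sum (I : Type) (r : seq I) (T : I -> H -> E -> R) : (forall i, bl2 X (T i)) ->
  bl2 X (fun u x => \sum_(i <- r) T i u x).
Proof.
move=> h; elim: r => [|i r IH]; first by apply: bl2_ext bl2_0 => u x; rewrite big_nil.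
by apply: bl2_ext (bl2D (h i) IH) => u x; rewrite big_cons.
Qed.

Lemma bl2_entry d (M : H -> E -> 'M[R]_d) p q : (forall i j, bl2 X (fun u x => M u x i j)) ->
  bl2 X (fun u x => mx_entry (M u x) p q).
Proof.
move=> h; rewrite /mx_entry; case: insubP => [i _ _|_]; last exact: bl2_0.
by case: insubP => [j _ _|_]; [exact: h|exact: bl2_0].
Qed.

Lemma bl2_axial d (M : H -> E -> 'M[R]_d) k : (forall i j, bl2 X (fun u x => M u x i j)) ->
  bl2 X (fun u x => axial (M u x) ord0 k).
Proof.
move=> h; pose p := if d == 2%N then 0%N else ((k + 1) %% 3)%N.
pose q := if d == 2%N then 1%N else ((k + 2) %% 3)%N.
by apply: bl2_ext (bl2B (bl2_entry p q h) (bl2_entry q p h)) => u x; rewrite mxE.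
Qed.

End algebra.

Section forms.
Variables (H1 H2 : lmodType R) (X : shilb H1) (Y : shilb H2).

Lemma bl2_bbilin (T : H1 -> E -> R) (T' : H2 -> E -> R) : bl2 X T -> bl2 Y T' ->
  bbilin X Y (fun u v => ip (T u) (T' v)).
Proof.
move=> [s l [C C0 b]] [s' l' [C' C0' b']]; split.
- move=> a u v w Su Sv Sw; have s1 := s _ Su; have s2 := s _ Sv; have s3 := s' _ Sw.
  have s4 : sq (fun x => a * T u x + T v x) by apply: sqintD => //; exact: sqintZ.
  have s5 : sq (T (a *: u + v)) by apply: s; exact: hdomL.
  rewrite (l2ip_ae_eq mO (l a u v Su Sv) (ae_eq_refl _ _ _) s5 s4 s3 s3).
  by rewrite l2ipDl ?l2ipZl//; exact: sqintZ.
- move=> a u v w Su Sv Sw; have s1 := s' _ Su; have s2 := s' _ Sv; have s3 := s _ Sw.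
  have s4 : sq (fun x => a * T' u x + T' v x) by apply: sqintD => //; exact: sqintZ.
  have s5 : sq (T' (a *: u + v)) by apply: s'; exact: hdomL.
  rewrite (l2ip_ae_eq mO (ae_eq_refl _ _ _) (l' a u v Su Sv) s3 s3 s5 s4).
  by rewrite ![ip (T w) _]l2ipC l2ipDl ?l2ipZl//; exact: sqintZ.
- exists (C * C'); first exact: mulr_ge0.
  move=> u v Su Sv; apply: le_trans (l2_CS mO (s _ Su) (s' _ Sv)) _.
  rewrite [leRHS](_ : _ = (C * hnorm X u) * (C' * hnorm Y v)); last by rewrite -!mulrA [hnorm X u * _]mulrCA.
  by apply: ler_pM; rewrite ?l2n_ge0// ?b ?b'.
Qed.

Lemma integ_dot k (w w' : E -> 'rV[R]_k) : (forall i, sq (fun x => w x ord0 i)) ->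
  (forall i, sq (fun x => w' x ord0 i)) ->
  integ O (fun x => dot (w x) (w' x)) = \sum_i ip (fun x => w x ord0 i) (fun x => w' x ord0 i).
Proof. by move=> s s'; rewrite /l2ip -Rintegral_sum// => i; exact: sqintM. Qed.

Lemma dot_bbilin k (T : H1 -> E -> 'rV[R]_k) (T' : H2 -> E -> 'rV[R]_k) :
  (forall i, bl2 X (fun u x => T u x ord0 i)) -> (forall i, bl2 Y (fun u x => T' u x ord0 i)) ->
  bbilin X Y (fun u v => integ O (fun x => dot (T u x) (T' v x))).
Proof.
move=> h h'; apply: bbilin_ext (bbilin_sum (index_enum 'I_k) (fun i => bl2_bbilin (h i) (h' i))) => u v Su Sv.
by rewrite integ_dot// => i; [have [s _ _] := h i|have [s _ _] := h' i]; exact: s.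
Qed.

Lemma wdot_bbilin k (w : E -> R) (M : R) (T : H1 -> E -> 'rV[R]_k) (T' : H2 -> E -> 'rV[R]_k) :
  measurable_fun O w -> {ae mu, forall x, O x -> `|w x| <= M} ->
  (forall i, bl2 X (fun u x => T u x ord0 i)) -> (forall i, bl2 Y (fun u x => T' u x ord0 i)) ->
  bbilin X Y (fun u v => integ O (fun x => w x * dot (T u x) (T' v x))).
Proof.
move=> mw wM h h'; apply: (@bbilin_ext _ _ _ _ _ (fun u v => integ O (fun x => dot (w x *: T u x) (T' v x)))).
  move=> u v _ _; congr (Rintegral _ _ _); apply/funext => x.
  by rewrite /dot mulr_sumr; apply: eq_bigr => i _; rewrite mxE mulrA.
apply: dot_bbilin => // i; apply: bl2_ext (bl2_mul mw wM (h i)) => u x; by rewrite mxE.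
Qed.

End forms.

End bounded_l2_maps.

(** The Hilbert spaces are built componentwise, on families of scalar functions; [vec] and [vecK]
    translate to the row-valued fields of the statement. *)
Definition vec (R : realType) (n k : nat) (f : 'I_k -> 'rV[R]_n -> R) (x : 'rV[R]_n) : 'rV[R]_k :=
  \row_i f i x.

Lemma vecE (R : realType) n k (f : 'I_k -> 'rV[R]_n -> R) x i : vec f x ord0 i = f i x.
Proof. exact: mxE. Qed.

Lemma vecK (R : realType) n k (y : 'rV[R]_n -> 'rV[R]_k) : y = vec (fun i x => y x ord0 i).
Proof. by apply/funext => x; apply/rowP => i; rewrite mxE. Qed.

Lemma lin_fst (R : realType) (H1 H2 : lmodType R) (a : R) (u v : H1 * H2) : (a *: u + v).1 = a *: u.1 + v.1.
Proof. by []. Qed.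

Lemma lin_snd (R : realType) (H1 H2 : lmodType R) (a : R) (u v : H1 * H2) : (a *: u + v).2 = a *: u.2 + v.2.
Proof. by []. Qed.

Lemma lin_app (R : realType) (I : Type) (H : lmodType R) (a : R) (f g : I -> H) i : (a *: f + g) i = a *: f i + g i.
Proof. by []. Qed.

Lemma lin_fun (R : realType) (I : Type) (a : R) (f g : I -> R) i : (a *: f + g) i = a * f i + g i.
Proof. by []. Qed.

Section oseen_spaces.
Variables (R : realType) (d : nat) (O : set 'rV[R]_d).
Hypothesis oO : open O.
Hypothesis bO : bounded_set O.
Local Notation E := 'rV[R]_d.
Local Notation mu := (leb R d).
Local Notation L2 := (l2n mu O).
Local Notation ip := (l2ip mu O).
Local Notation sq := (sqint mu O).
Local Notation wp := (wpartial O).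
Let mO : measurable O := omeas oO.

Local Notation H1 := (('I_d -> E -> R) * ('I_(cdim d) -> E -> R))%type.

(** The velocity carries the full H^1 norm, for which completeness is known. [normVW_flow] shows
    that on H^1_0 this is exactly the norm [normVW], made of the curl and the divergence. *)
Definition flow_shilb : shilb H1 :=
  prod_shilb (fin_shilb 'I_d (h10_shilb oO bO)) (fin_shilb 'I_(cdim d) (l2_hilb mu mO)).

Local Notation X := flow_shilb.

Lemma flow_normE u : hip X u u = \sum_i (ip (u.1 i) (u.1 i) + \sum_j ip (wp j (u.1 i)) (wp j (u.1 i)))
  + \sum_k ip (u.2 k) (u.2 k).
Proof. by []. Qed.

Lemma flow_dom u : hdom X u <-> inV O (vec u.1) /\ inW O (vec u.2).
Proof.
have e1 i : (fun x => vec u.1 x ord0 i) = u.1 i by apply/funext => x; rewrite mxE.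
have e2 i : (fun x => vec u.2 x ord0 i) = u.2 i by apply/funext => x; rewrite mxE.
split=> -[h1 h2]; split => i.
- by rewrite e1; apply/(H10_dom oO bO); exact: h1.
- by rewrite e2; apply/inL2P; exact: h2.
- by apply/(H10_dom oO bO); rewrite -e1; exact: h1.
- by apply/inL2P; rewrite -e2; exact: h2.
Qed.

Lemma flow_w12 u i : hdom X u -> w12 O (u.1 i).
Proof. by move=> [/(_ i)[]]. Qed.

Lemma flow_sq u : hdom X u -> [/\ forall i, sq (u.1 i), forall i j, sq (wp j (u.1 i)) & forall k, sq (u.2 k)].
Proof.
move=> Su; split=> [i|i j|k]; [by have [] := flow_w12 i Su|by have [_ /(_ j)[]] := flow_w12 i Su|].
by case: Su => _; exact.
Qed.

Lemma flow_part_le u : hdom X u -> [/\ forall i, L2 (u.1 i) <= hnorm X u,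
  forall i j, L2 (wp j (u.1 i)) <= hnorm X u & forall k, L2 (u.2 k) <= hnorm X u].
Proof.
have p i : 0 <= ip (u.1 i) (u.1 i) + \sum_j ip (wp j (u.1 i)) (wp j (u.1 i)).
  by rewrite addr_ge0 ?l2ip_ge0// sumr_ge0// => j _; exact: l2ip_ge0.
have s1 : 0 <= \sum_i (ip (u.1 i) (u.1 i) + \sum_j ip (wp j (u.1 i)) (wp j (u.1 i))) by exact: sumr_ge0.
have s2 : 0 <= \sum_k ip (u.2 k) (u.2 k) by apply: sumr_ge0 => k _; exact: l2ip_ge0.
move=> Su; split=> [i|i j|k]; rewrite ler_sqrt ?addr_ge0// flow_normE.
- apply: (@le_trans _ _ (ip (u.1 i) (u.1 i) + \sum_j ip (wp j (u.1 i)) (wp j (u.1 i)))).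
    by rewrite lerDl sumr_ge0// => j _; exact: l2ip_ge0.
  apply: (@le_trans _ _ (\sum_i (ip (u.1 i) (u.1 i) + \sum_j ip (wp j (u.1 i)) (wp j (u.1 i))))); last by rewrite lerDl.
  exact: (ler_sum_term (F := fun i => ip (u.1 i) (u.1 i) + \sum_j ip (wp j (u.1 i)) (wp j (u.1 i)))).
- apply: (@le_trans _ _ (ip (u.1 i) (u.1 i) + \sum_j ip (wp j (u.1 i)) (wp j (u.1 i)))).
    apply: (@le_trans _ _ (\sum_j ip (wp j (u.1 i)) (wp j (u.1 i)))); last by rewrite lerDr l2ip_ge0.
    by apply: (ler_sum_term (F := fun j => ip (wp j (u.1 i)) (wp j (u.1 i)))) => l; exact: l2ip_ge0.
  apply: (@le_trans _ _ (\sum_i (ip (u.1 i) (u.1 i) + \sum_j ip (wp j (u.1 i)) (wp j (u.1 i))))); last by rewrite lerDl.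
  exact: (ler_sum_term (F := fun i => ip (u.1 i) (u.1 i) + \sum_j ip (wp j (u.1 i)) (wp j (u.1 i)))).
- apply: (@le_trans _ _ (\sum_k ip (u.2 k) (u.2 k))); last by rewrite lerDr.
  by apply: (ler_sum_term (F := fun k => ip (u.2 k) (u.2 k))) => l; exact: l2ip_ge0.
Qed.

Lemma bl2_vel i : bl2 O X (fun u x => vec u.1 x ord0 i).
Proof.
have e (u : H1) : (fun x => vec u.1 x ord0 i) = u.1 i by apply/funext => x; rewrite mxE.
split=> [u /flow_sq[h _ _]|a u v _ _|]; first by rewrite e.
  by apply: aeW => x _; rewrite !vecE lin_fst lin_app lin_fun.
by exists 1 => // u Su; rewrite e mul1r; have [h _ _] := flow_part_le Su.
Qed.

Lemma bl2_vor k : bl2 O X (fun u x => vec u.2 x ord0 k).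
Proof.
have e (u : H1) : (fun x => vec u.2 x ord0 k) = u.2 k by apply/funext => x; rewrite mxE.
split=> [u /flow_sq[_ _ h]|a u v _ _|]; first by rewrite e.
  by apply: aeW => x _; rewrite !vecE lin_snd lin_app lin_fun.
by exists 1 => // u Su; rewrite e mul1r; have [_ _ h] := flow_part_le Su.
Qed.

Lemma jac_vec (y : 'I_d -> E -> R) i j x : jac O (vec y) x i j = wp j (y i) x.
Proof. by rewrite mxE; congr wpartial; apply/funext => z; rewrite mxE. Qed.

Lemma bl2_jac i j : bl2 O X (fun u x => jac O (vec u.1) x i j).
Proof.
apply: (@bl2_ext _ _ _ _ _ (fun u => wp j (u.1 i))) => [u x|]; first by rewrite jac_vec.
split=> [u /flow_sq[_ h _]//|a u v Su Sv|].
  rewrite lin_fst lin_app.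
  exact: ((w12_lin oO bO a (flow_w12 i Su) (flow_w12 i Sv)).2 j).
by exists 1 => // u Su; rewrite mul1r; have [_ h _] := flow_part_le Su.
Qed.

Lemma bl2_div : bl2 O X (fun u => divg O (vec u.1)).
Proof. exact: (bl2_sum mO (index_enum 'I_d) (fun i => bl2_jac i i)). Qed.

Lemma bl2_curl k : bl2 O X (fun u x => curl O (vec u.1) x ord0 k).
Proof.
apply: (bl2_axial mO) => i j; apply: bl2_ext (bl2_jac j i) => u x; by rewrite [RHS]mxE.
Qed.

Section coefficients.
Variables (rho1 rho2 M : R) (nu sigma : E -> R) (beta : E -> 'rV[R]_d).
Let bounded (w : E -> R) := measurable_fun O w /\ {ae mu, forall x, O x -> `|w x| <= M}.
Hypothesis bnu : bounded nu.
Hypothesis bsig : bounded sigma.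
Hypothesis bbeta : forall i, bounded (fun x => beta x ord0 i).
Hypothesis bgnu : forall i, bounded (fun x => grad O nu x ord0 i).

Definition oseen_form (u v : H1) : R :=
  formA O rho1 rho2 nu sigma beta (vec u.1) (vec u.2) (vec v.1) (vec v.2).

Lemma bl2_strain i : bl2 O X (fun u x => (grad O nu x *m (2 *: strain O (vec u.1) x)^T) ord0 i).
Proof.
have h j : bl2 O X (fun u x => grad O nu x ord0 j * (2 * (2^-1 * (jac O (vec u.1) x i j + jac O (vec u.1) x j i)))).
  have [mg gM] := bgnu j; apply: (bl2_mul mO mg gM); do 2 apply: (bl2Z mO).
  by apply: (bl2D mO); exact: bl2_jac.
apply: bl2_ext (bl2_sum mO (index_enum 'I_d) h) => u x; rewrite mxE; apply: eq_bigr => j _.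
by rewrite !mxE.
Qed.

Lemma bl2_cross k : bl2 O X (fun u x => cross (grad O nu x) (vec u.1 x) ord0 k).
Proof.
apply: (bl2_axial mO) => i j; have [mg gM] := bgnu i.
apply: bl2_ext (bl2_mul mO mg gM (bl2_vel j)) => u x.
by rewrite [RHS]mxE big_ord1 [X in _ = X * _]mxE.
Qed.

Lemma bl2_conv i : bl2 O X (fun u x => Defs.conv O beta (vec u.1) x ord0 i).
Proof.
have h j : bl2 O X (fun u x => beta x ord0 j * jac O (vec u.1) x i j).
  by have [mb bM] := bbeta j; apply: (bl2_mul mO mb bM); exact: bl2_jac.
apply: bl2_ext (bl2_sum mO (index_enum 'I_d) h) => u x; rewrite [RHS]mxE; apply: eq_bigr => j _.
by rewrite [X in _ = _ * X]mxE.
Qed.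

Lemma oseen_form_bbilin : bbilin X X oseen_form.
Proof.
have [mn nM] := bnu; have [ms sM] := bsig.
have opp (b : H1 -> H1 -> R) : bbilin X X b -> bbilin X X (fun u v => - b u v).
  by move=> h; apply: bbilin_ext (bbilinZ (-1) h) => u v _ _; rewrite mulN1r.
have b1 : bbilin X X (fun u v => - integ O (fun x => dot (grad O nu x *m (2 *: strain O (vec u.1) x)^T) (vec v.1 x))).
  by apply: opp; apply: (dot_bbilin mO); [exact: bl2_strain|exact: bl2_vel].
have b2 : bbilin X X (fun u v => integ O (fun x => nu x * dot (vec u.2 x) (curl O (vec v.1) x))).
  by apply: (wdot_bbilin mO mn nM); [exact: bl2_vor|exact: bl2_curl].
have b3 : bbilin X X (fun u v => integ O (fun x => dot (vec u.2 x) (cross (grad O nu x) (vec v.1 x)))).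
  by apply: (dot_bbilin mO); [exact: bl2_vor|exact: bl2_cross].
have b4 : bbilin X X (fun u v => integ O (fun x => nu x * dot (vec u.2 x) (vec v.2 x))).
  by apply: (wdot_bbilin mO mn nM); exact: bl2_vor.
have b5 : bbilin X X (fun u v => - integ O (fun x => nu x * dot (vec v.2 x) (curl O (vec u.1) x))).
  apply: opp; apply: (@bbilin_ext _ _ _ _ _ (fun u v =>
    integ O (fun x => nu x * dot (curl O (vec u.1) x) (vec v.2 x)))).
    move=> u v _ _; congr (Rintegral _ _ _); apply/funext => x; congr (_ * _).
    by apply: eq_bigr => i _; rewrite mulrC.
  by apply: (wdot_bbilin mO mn nM); [exact: bl2_curl|exact: bl2_vor].
have b6 : bbilin X X (fun u v => integ O (fun x => dot (sigma x *: vec u.1 x + Defs.conv O beta (vec u.1) x) (vec v.1 x))).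
  apply: (dot_bbilin mO); last exact: bl2_vel.
  move=> i; apply: bl2_ext (bl2D mO (bl2_mul mO ms sM (bl2_vel i)) (bl2_conv i)) => u x.
  by rewrite [RHS]mxE; congr (_ + _); rewrite [RHS]mxE.
have b7 : bbilin X X (fun u v => rho1 * integ O (fun x => dot (curl O (vec u.1) x - vec u.2 x) (curl O (vec v.1) x))).
  apply: bbilinZ; apply: (dot_bbilin mO); last exact: bl2_curl.
  move=> k; apply: bl2_ext (bl2B mO (bl2_curl k) (bl2_vor k)) => u x.
  by rewrite [RHS]mxE; congr (_ + _); rewrite [RHS]mxE.
have b8 : bbilin X X (fun u v => rho2 * integ O (fun x => divg O (vec u.1) x * divg O (vec v.1) x)).
  by apply: bbilinZ; apply: (bl2_bbilin mO); exact: bl2_div.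
exact: (bbilinD (bbilinD (bbilinD (bbilinD (bbilinD (bbilinD (bbilinD b1 b2) b3) b4) b5) b6) b7) b8).
Qed.

End coefficients.

End oseen_spaces.

(** * Coercivity *)

Section pointwise.
Variable R : realType.

Lemma dot_CS n (a b : 'rV[R]_n) : dot a b ^+ 2 <= dot a a * dot b b.
Proof.
apply: quad_discr => t; have : 0 <= \sum_i (a ord0 i + t * b ord0 i) ^+ 2 by apply: sumr_ge0 => i _; exact: sqr_ge0.
congr (_ <= _); rewrite /dot !mulr_sumr -!big_split; apply: eq_bigr => i _ /=; ring.
Qed.

Lemma dot_ge0 n (a : 'rV[R]_n) : 0 <= dot a a.
Proof. by apply: sumr_ge0 => i _; rewrite -expr2 sqr_ge0. Qed.

Lemma mx_entryE d (M : 'M[R]_d) (i j : 'I_d) : mx_entry M i j = M i j.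
Proof. by rewrite /mx_entry !valK. Qed.

(** Both sides are the sum of [(M i j - M j i)^2] over unordered pairs of indices. Applied to a
    Jacobian this gives |curl|^2 = |J|^2 - J : J^T. *)
Lemma dot_axial d (hd : d = 2%N \/ d = 3%N) (M : 'M[R]_d) :
  dot (axial M) (axial M) = \sum_i \sum_j M i j ^+ 2 - \sum_i \sum_j M i j * M j i.
Proof.
pose G (k : nat) := let p := if d == 2%N then 0%N else ((k + 1) %% 3)%N in
     let q := if d == 2%N then 1%N else ((k + 2) %% 3)%N in
     (mx_entry M p q - mx_entry M q p) ^+ 2.
have -> : dot (axial M) (axial M) = \sum_(0 <= k < cdim d) G k.
  by rewrite big_mkord; apply: eq_bigr => k _; rewrite mxE -expr2.
rewrite {}/G; case: hd => dE; subst d.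
  have e i j : mx_entry M (nat_of_ord i) (nat_of_ord j) = M i j := mx_entryE M i j.
  pose o0 : 'I_2 := ord0; pose o1 : 'I_2 := lift ord0 ord0.
  rewrite (_ : cdim 2 = 1%N)// /index_iota /= !big_cons big_nil !big_ord_recl !big_ord0 /=.
  rewrite [mx_entry M 0 1](e o0 o1) [mx_entry M 1 0](e o1 o0) -/o0 -/o1.
  move: (M o0 o0) (M o0 o1) (M o1 o0) (M o1 o1); clear => *; ring.
have e i j : mx_entry M (nat_of_ord i) (nat_of_ord j) = M i j := mx_entryE M i j.
pose o0 : 'I_3 := ord0; pose o1 : 'I_3 := lift ord0 ord0; pose o2 : 'I_3 := lift ord0 (lift ord0 ord0).
rewrite (_ : cdim 3 = 3%N)// /index_iota /= !big_cons big_nil !big_ord_recl !big_ord0 /=.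
rewrite (_ : ((0 + 1) %% 3)%N = 1%N)// (_ : ((0 + 2) %% 3)%N = 2%N)// (_ : ((1 + 2) %% 3)%N = 0%N)//.
rewrite (_ : ((2 + 2) %% 3)%N = 1%N)//.
rewrite [mx_entry M 0 1](e o0 o1) [mx_entry M 1 0](e o1 o0) [mx_entry M 0 2](e o0 o2) [mx_entry M 2 0](e o2 o0).
rewrite [mx_entry M 1 2](e o1 o2) [mx_entry M 2 1](e o2 o1) -/o0 -/o1 -/o2.
move: (M o0 o0) (M o0 o1) (M o0 o2) (M o1 o0) (M o1 o1) (M o1 o2) (M o2 o0) (M o2 o1) (M o2 o2); clear => *; ring.
Qed.

(** Lagrange's identity: for [M = a^T b], [dot_axial] reads |a x b|^2 = |a|^2 |b|^2 - (a . b)^2. *)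
Lemma dot_cross_le d (hd : d = 2%N \/ d = 3%N) (a b : 'rV[R]_d) :
  dot (cross a b) (cross a b) <= dot a a * dot b b.
Proof.
rewrite /cross dot_axial//.
have e i j : (a^T *m b) i j = a ord0 i * b ord0 j by rewrite mxE big_ord1 mxE.
have -> : \sum_i \sum_j (a^T *m b) i j ^+ 2 = dot a a * dot b b.
  rewrite /dot mulr_suml; apply: eq_bigr => i _; rewrite mulr_sumr; apply: eq_bigr => j _.
  by rewrite e; ring.
have -> : \sum_i \sum_j (a^T *m b) i j * (a^T *m b) j i = dot a b ^+ 2.
  rewrite expr2 /dot mulr_suml; apply: eq_bigr => i _; rewrite mulr_sumr; apply: eq_bigr => j _.
  by rewrite !e; ring.
by rewrite lerBlDr lerDl sqr_ge0.
Qed.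

Lemma sum_strain d (J : 'M[R]_d) :
  \sum_i \sum_j (2^-1 * (J i j + J j i)) ^+ 2 =
  2^-1 * (\sum_i \sum_j J i j ^+ 2 + \sum_i \sum_j J i j * J j i).
Proof.
have e : \sum_i \sum_j J i j ^+ 2 = \sum_i \sum_j (2^-1 * J i j ^+ 2 + 2^-1 * J j i ^+ 2).
  under [RHS]eq_bigr do rewrite big_split -!mulr_sumr /=.
  rewrite big_split -!mulr_sumr /= [X in _ = _ + _ * X]exchange_big /=.
  by move: (\sum_i _); clear => x; field.
rewrite [X in _ = _ * (X + _)]e -big_split mulr_sumr; apply: eq_bigr => i _.
by rewrite -big_split mulr_sumr; apply: eq_bigr => j _ /=; field.
Qed.

Lemma dot_strain_le d (a : 'rV[R]_d) (J : 'M[R]_d) (w : 'rV[R]_d) :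
  (forall i, w ord0 i = \sum_j a ord0 j * (2 * J i j)) ->
  dot w w <= 4 * dot a a * \sum_i \sum_j J i j ^+ 2.
Proof.
move=> h; rewrite /dot -/(dot a a) mulr_sumr; apply: ler_sum => i _.
pose b : 'rV[R]_d := \row_j (2 * J i j).
have -> : w ord0 i = dot a b by rewrite h; apply: eq_bigr => j _; rewrite mxE.
rewrite -expr2; apply: le_trans (dot_CS a b) _.
rewrite [4 * _]mulrC -mulrA ler_wpM2l ?dot_ge0// /dot mulr_sumr; apply: ler_sum => j _.
by rewrite !mxE le_eqVlt; apply/orP; left; apply/eqP; ring.
Qed.

Lemma am_gm (x p q : R) : 0 <= p -> 0 <= q -> x ^+ 2 <= 4 * p * q -> `|x| <= p + q.
Proof.
move=> p0 q0 h; rewrite -(@ler_pXn2r _ 2)// ?nnegrE ?addr_ge0//.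
rewrite real_normK ?num_real//; apply: le_trans h _; rewrite -subr_ge0.
have -> : (p + q) ^+ 2 - 4 * p * q = (p - q) ^+ 2 by ring.
exact: sqr_ge0.
Qed.

End pointwise.

Section l2_families.
Context d (T : measurableType d) (R : realType) (mu : {measure set T -> \bar R}).
Variable (D : set T).
Hypothesis mD : measurable D.
Local Notation ip := (l2ip mu D).
Local Notation sq := (sqint mu D).

Lemma family_norm (I : finType) (w : I -> T -> R) : (forall i, sq (w i)) ->
  sq (fun x => Num.sqrt (\sum_i w i x ^+ 2)) /\
  l2n mu D (fun x => Num.sqrt (\sum_i w i x ^+ 2)) ^+ 2 = \sum_i ip (w i) (w i).
Proof.
move=> sw; have p x : 0 <= \sum_i w i x ^+ 2 by apply: sumr_ge0 => i _; exact: sqr_ge0.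
split; first split.
- apply: measurableT_comp; first by apply: continuous_measurable_fun; exact: sqrt_continuous.
  by apply: measurable_sum => i; have [m _] := sw i; exact: measurable_funX.
- have : mu.-integrable D (EFin \o (fun x => \sum_(i <- index_enum I) w i x ^+ 2)).
    by apply: (integrableR_sum _ mD) => i; have [] := sw i.
  by congr (integrable _ _ _); apply/funext => x /=; rewrite sqr_sqrtr.
- rewrite l2n_sqr /l2ip -Rintegral_sum//; last by move=> i; exact: sqintM.
  apply: eq_Rintegral => x _; rewrite -expr2 sqr_sqrtr//; apply: eq_bigr => i _; exact: expr2.
Qed.

Lemma family_ae_le (I J : finType) (w : I -> T -> R) (z : J -> T -> R) (c : R) : 0 <= c ->
  (forall i, sq (w i)) -> (forall j, sq (z j)) ->
  {ae mu, forall x, D x -> \sum_i w i x ^+ 2 <= c * \sum_j z j x ^+ 2} ->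
  \sum_i ip (w i) (w i) <= c * \sum_j ip (z j) (z j).
Proof.
move=> c0 sw sz h; have [s1 e1] := family_norm sw; have [s2 e2] := family_norm sz.
have s3 := sqintZ (Num.sqrt c) mD s2; have [m1 _] := s1.
have hle : {ae mu, forall x, D x -> `|Num.sqrt (\sum_i w i x ^+ 2)| <=
    `|Num.sqrt c * Num.sqrt (\sum_j z j x ^+ 2)|}.
  apply: filterS h => x h Dx; rewrite !ger0_norm ?mulr_ge0 ?sqrtr_ge0// -sqrtrM//.
  by apply: ler_wsqrtr; exact: h.
have [_ le] := ae_le_sq mD m1 s3 hle.
rewrite -e1 -e2; apply: (@le_trans _ _ (l2n mu D (fun x => Num.sqrt c * Num.sqrt (\sum_j z j x ^+ 2)) ^+ 2)).
  by rewrite lerXn2r ?nnegrE ?l2n_ge0.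
by rewrite l2nZ// exprMn real_normK ?num_real// sqr_sqrtr.
Qed.

Lemma Rint_ae_ge0 (f : T -> R) : measurable_fun D f -> {ae mu, forall x, D x -> 0 <= f x} ->
  0 <= \int[mu]_(x in D) f x.
Proof.
move=> mf h; rewrite (_ : \int[mu]_(x in D) f x = \int[mu]_(x in D) `|f x|).
  by apply: Rintegral_ge0 => x _; exact: normr_ge0.
rewrite /Rintegral; congr fine; apply: ae_eq_integral => //.
- exact/measurable_EFinP.
- by apply/measurable_EFinP; exact: measurableT_comp.
- by apply: filterS h => x h Dx; rewrite ger0_norm ?h.
Qed.

Lemma weighted_lower (w f : T -> R) (c M : R) : measurable_fun D w ->
  {ae mu, forall x, D x -> `|w x| <= M} -> {ae mu, forall x, D x -> c <= w x} -> sq f ->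
  c * ip f f <= ip (fun x => w x * f x) f.
Proof.
move=> mw wM cw sf; have [s1 _] := ae_bounded_sq mD mw wM sf; have s2 := sqintZ c mD sf.
rewrite -subr_ge0 -l2ipZl// /l2ip -RintegralB//; [|exact: sqintM|exact: sqintM].
have [mf _] := sf; apply: Rint_ae_ge0.
  apply: measurable_funB; apply: measurable_funM => //; exact: measurable_funM.
apply: filterS cw => x h Dx; rewrite -mulrBl -mulrBl -mulrA mulr_ge0 ?subr_ge0 ?h//.
by rewrite -expr2 sqr_ge0.
Qed.

Lemma family_CS (I : finType) (w z : I -> T -> R) : (forall i, sq (w i)) -> (forall i, sq (z i)) ->
  (\sum_i ip (w i) (z i)) ^+ 2 <= (\sum_i ip (w i) (w i)) * \sum_i ip (z i) (z i).
Proof.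
move=> sw sz; have := @hip_CS _ _ (fin_shilb I (l2_hilb mu mD)) w z sw sz.
rewrite -ler_sqr ?nnegrE ?mulr_ge0 ?hnorm_ge0// real_normK ?num_real// exprMn.
by rewrite !hnorm_sqr.
Qed.

End l2_families.

Section dense_bound.
Variables (R : realType) (H : lmodType R) (X : shilb H) (b : H -> H -> R) (S : set H) (K : R).
Hypothesis bb : bbilin X X b.
Hypothesis SX : S `<=` hdom X.
Hypothesis dS : forall u, hdom X u -> forall e : R, 0 < e -> exists2 s, S s & hnorm X (u - s) < e.
Hypothesis K0 : 0 <= K.
Hypothesis bS : forall s, S s -> `|b s s| <= K * hip X s s.

Lemma bbilin_dense_le u : hdom X u -> `|b u u| <= K * hip X u u.
Proof.
move=> Su; case: bb => bL bR [C C0 bB]; have k0 := K0.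
pose N := hnorm X u; have N0 : 0 <= N by exact: hnorm_ge0.
(* [t L] bounds the total change of both sides when [u] is replaced by a point of [S] at distance
   less than [t <= 1]. *)
pose L := K * (2 * N + 1) + C * (N + 1) + C * N + 1.
have L0 : 0 < L by rewrite ltr_wpDl// !addr_ge0// mulr_ge0// ?addr_ge0// mulr_ge0.
rewrite -hnorm_sqr// -/N; apply/ler_addgt0Pr => e e0.
pose t := Num.min 1 (e / L); have t0 : 0 < t by rewrite lt_min ltr01 divr_gt0.
have t1 : t <= 1 by rewrite ge_min lexx.
have te : t * L <= e by rewrite -ler_pdivlMr// ge_min lexx orbT.
have [s Ss hs] := dS Su t0; have Xs := SX Ss; have Sd : hdom X (u - s) by exact: hdomB.
have ns : hnorm X s <= N + t.
  have -> : s = u + - (u - s) by rewrite opprB addrC subrK.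
  by apply: le_trans (hnormD Su (hdomN Sd)) _; rewrite shilb_normN// lerD2l ltW.
have e1 : b u u = b s s + b (u - s) s + b u (u - s).
  have h1 : b u s = b s s + b (u - s) s.
    by rewrite -{1}[u](subrK s) -[u - s]scale1r bL// mul1r scale1r addrC.
  by rewrite -h1 -{2}[u](subrK s) -[u - s]scale1r bR// mul1r scale1r addrC.
have b1 := bS Ss; rewrite -hnorm_sqr// in b1.
have b2 := bB _ _ Sd Xs; have b3 := bB _ _ Su Sd.
have n0 := hnorm_ge0 X s; have m0 := hnorm_ge0 X (u - s); have hs' := ltW hs.
rewrite e1; apply: le_trans (ler_normD _ _) _.
apply: le_trans (lerD (ler_normD _ _) (lexx _)) _.
have f1 : K * hnorm X s ^+ 2 <= K * (N ^+ 2 + t * (2 * N + 1)).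
  apply: ler_wpM2l => //; apply: (@le_trans _ _ ((N + t) ^+ 2)); first by rewrite lerXn2r ?nnegrE ?addr_ge0 ?(ltW t0).
  by move: t0 t1 N0; clear; move: (N) t => n t; nra.
have f2 : C * hnorm X (u - s) * hnorm X s <= C * (t * (N + 1)).
  rewrite -mulrA ler_wpM2l//; apply: ler_pM => //; apply: le_trans ns _; by rewrite lerD2l.
have f3 : C * N * hnorm X (u - s) <= C * (N * t) by rewrite -mulrA ler_wpM2l// ler_wpM2l.
have f4 : K * (N ^+ 2 + t * (2 * N + 1)) + C * (t * (N + 1)) + C * (N * t) <= K * N ^+ 2 + t * L.
  rewrite -subr_ge0 [leRHS](_ : _ = t) ?(ltW t0)// /L; ring.
rewrite -/N in b3; apply: le_trans (le_trans f4 _); last by rewrite lerD2l.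
apply: lerD; first apply: lerD.
- exact: le_trans b1 f1.
- exact: le_trans b2 f2.
- exact: le_trans b3 f3.
Qed.

End dense_bound.

Lemma half_bound (R : realFieldType) (p q r s : R) : q <= 2 * r * s -> 2 * p = - q -> - (r * s) <= p.
Proof. by move=> *; lra. Qed.

(** * Integration by parts in H^1_0 and the convection term *)

Section identities.
Variables (R : realType) (d : nat) (O : set 'rV[R]_d).
Hypothesis oO : open O.
Hypothesis bO : bounded_set O.
Local Notation E := 'rV[R]_d.
Local Notation mu := (leb R d).
Local Notation L2 := (l2n mu O).
Local Notation ip := (l2ip mu O).
Local Notation sq := (sqint mu O).
Local Notation wp := (wpartial O).
Local Notation X := (h10_shilb oO bO).
Let mO : measurable O := omeas oO.

Lemma h10_w12 u : hdom X u -> w12 O u. Proof. by case. Qed.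

Lemma h10_tf phi : tf O phi -> hdom X phi.
Proof.
move=> tp; split; first by case: (w12_tf oO bO tp).
move=> e e0; exists phi => //; rewrite subrr.
have := @hnormZ _ _ (w12_shilb oO bO) 0 0 (hdom0 _).
by rewrite scale0r normr0 mul0r => ->.
Qed.

Lemma h10_dense u : hdom X u -> forall e : R, 0 < e -> exists2 s, tf O s & hnorm X (u - s) < e.
Proof. by case. Qed.

Lemma h10_part_le u : w12 O u -> L2 u <= hnorm X u /\ forall j, L2 (wp j u) <= hnorm X u.
Proof.
move=> hu; have p j : 0 <= ip (wp j u) (wp j u) by exact: l2ip_ge0.
split=> [|j]; rewrite ler_sqrt ?addr_ge0 ?l2ip_ge0 ?sumr_ge0//.
  by rewrite lerDl sumr_ge0.
apply: (@le_trans _ _ (\sum_j ip (wp j u) (wp j u))); last by rewrite lerDr l2ip_ge0.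
exact: (ler_sum_term (F := fun j => ip (wp j u) (wp j u))).
Qed.

Lemma bl2_h10 : bl2 O X (fun u => u).
Proof.
split=> [u /h10_w12[]//|a u v _ _|]; first by apply: aeW.
by exists 1 => // u /h10_w12 hu; rewrite mul1r; case: (h10_part_le hu).
Qed.

Lemma bl2_wp j : bl2 O X (wp j).
Proof.
split=> [u /h10_w12[_ /(_ j)[]]//|a u v /h10_w12 hu /h10_w12 hv|].
  exact: ((w12_lin oO bO a hu hv).2 j).
by exists 1 => // u /h10_w12 hu; rewrite mul1r; case: (h10_part_le hu).
Qed.

Lemma tf_ip_wp i j phi psi : tf O phi -> tf O psi ->
  ip (wp i phi) (wp j psi) = \int[mu]_x (pd i phi x * pd j psi x).
Proof.
move=> tp tq; have [[_ d1] e1] := w12_tf oO bO tp; have [[_ d2] e2] := w12_tf oO bO tq.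
have s1 := sq_tf oO (tf_pd i tp); have s2 := sq_tf oO (tf_pd j tq).
rewrite (l2ip_ae_eq mO (e1 i) (e2 j) (d1 i).2 s1 (d2 j).2 s2) /l2ip int_restr// => x nx.
by rewrite (tf_off (tf_pd i tp) nx) mul0r.
Qed.

(** What the symmetry of second derivatives becomes when only first ones exist. It is an effect of
    the zero boundary values, and extends by density from [int_pd_swap]. *)
Lemma wp_swap i j u v : hdom X u -> hdom X v -> ip (wp i u) (wp j v) = ip (wp j u) (wp i v).
Proof.
have b1 := bl2_bbilin mO (bl2_wp i) (bl2_wp j); have b2 := bl2_bbilin mO (bl2_wp j) (bl2_wp i).
have bb := bbilinD b1 (bbilinZ (-1) b2).
suff h : forall u v, hdom X u -> hdom X v -> ip (wp i u) (wp j v) + -1 * ip (wp j u) (wp i v) = 0.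
  by move=> Su Sv; apply/eqP; rewrite -subr_eq0; apply/eqP; have := h u v Su Sv; rewrite mulN1r.
apply: (bbilin_dense0 bb (S := tf O) (T := tf O)).
- exact: h10_tf.
- exact: h10_tf.
- exact: h10_dense.
- exact: h10_dense.
move=> s t ts tt; have e1 := tf_ip_wp i j ts tt; have e2 := tf_ip_wp j i ts tt.
have e3 := etrans e1 (etrans (int_pd_swap i j (tf_setT ts) (tf_setT tt)) (esym e2)).
by rewrite mulN1r; apply/eqP; rewrite subr_eq0; apply/eqP; exact: e3.
Qed.

Section convection.
Variable b : E -> 'rV[R]_d.
Variable M : R.
Hypothesis wb : forall j, weak_deriv O j (fun x => b x ord0 j) (wp j (fun x => b x ord0 j)).
Hypothesis mb : forall j, measurable_fun O (fun x => b x ord0 j).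
Hypothesis bM : forall j, {ae mu, forall x, O x -> `|b x ord0 j| <= M}.
Hypothesis mw : forall j, measurable_fun O (wp j (fun x => b x ord0 j)).
Hypothesis wM : forall j, {ae mu, forall x, O x -> `|wp j (fun x => b x ord0 j) x| <= M}.

Lemma divgE x : divg O b x = \sum_j wp j (fun x => b x ord0 j) x.
Proof. by apply: eq_bigr => j _; rewrite mxE. Qed.

Lemma divg_sq : sq (divg O b).
Proof.
rewrite (_ : divg O b = fun x => \sum_(j <- index_enum 'I_d) wp j (fun x => b x ord0 j) x).
  apply: (sqint_sum _ mO) => j; have [s _] := ae_bounded_sq mO (mw j) (wM j) (sq_cst oO bO 1).
  by move: s; congr (sqint _ _ _); apply/funext => x; rewrite mulr1.
by apply/funext => x; rewrite divgE.
Qed.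

Let bl2_div_mul : bl2 O X (fun u x => \sum_j wp j (fun x => b x ord0 j) x * u x).
Proof. by apply: (bl2_sum mO) => j; exact: (bl2_mul mO (mw j) (wM j) bl2_h10). Qed.

Let bl2_adv : bl2 O X (fun u x => \sum_j b x ord0 j * wp j u x).
Proof. by apply: (bl2_sum mO) => j; exact: (bl2_mul mO (mb j) (bM j) (bl2_wp j)). Qed.

Lemma tf_advection j phi : tf O phi ->
  \int[mu]_(x in O) (b x ord0 j * pd j phi x) = - \int[mu]_(x in O) (wp j (fun x => b x ord0 j) x * phi x).
Proof. by move=> tp; have [_ _] := wb j; apply; apply/tf_test_fun. Qed.

(** The quadratic identity is first polarised, because density is available for bilinear forms. For
    test functions [s] and [t] it is the weak derivative of the coefficients tested with the product
    [s t]. *)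
Lemma advection u : hdom X u ->
  2 * ip (fun x => \sum_j b x ord0 j * wp j u x) u = - ip (fun x => \sum_j wp j (fun x => b x ord0 j) x * u x) u.
Proof.
move=> Su; have b1 := bl2_bbilin mO bl2_adv bl2_h10; have b2 := bl2_bbilin mO bl2_h10 bl2_adv.
have b3 := bl2_bbilin mO bl2_div_mul bl2_h10.
have bb := bbilinD (bbilinD b1 b2) b3.
suff : forall u v, hdom X u -> hdom X v -> ip (fun x => \sum_j b x ord0 j * wp j u x) v
    + ip u (fun x => \sum_j b x ord0 j * wp j v x) + ip (fun x => \sum_j wp j (fun x => b x ord0 j) x * u x) v = 0.
  move=> /(_ u u Su Su); rewrite [ip u _]l2ipC => h; apply/eqP; rewrite -subr_eq0 opprK mulr2n mulrDl mul1r.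
  exact/eqP.
apply: (bbilin_dense0 bb (S := tf O) (T := tf O)).
- exact: h10_tf.
- exact: h10_tf.
- exact: h10_dense.
- exact: h10_dense.
move=> s t ts tt.
have [[ss d1] e1] := w12_tf oO bO ts; have [[st d2] e2] := w12_tf oO bO tt.
have bw j f (sf : sq f) := ae_bounded_sq mO (mb j) (bM j) sf.
have ww j f (sf : sq f) := ae_bounded_sq mO (mw j) (wM j) sf.
have S1 j : sq (fun x => b x ord0 j * wp j s x) := (bw j _ (d1 j).2).1.
have S2 j : sq (fun x => b x ord0 j * wp j t x) := (bw j _ (d2 j).2).1.
have S3 j : sq (fun x => wp j (fun x => b x ord0 j) x * s x) := (ww j _ ss).1.
rewrite [ip (fun x => \sum_j b x ord0 j * _) t]l2ipC [ip (fun x => \sum_j wp j _ x * _) t]l2ipC.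
rewrite !(l2ip_sumr mO (index_enum 'I_d))// -!big_split; apply: big1 => j _ /=.
have tst : tf O (fun x => s x * t x) := tfMl (tf_smooth ts) tt.
have P1 := sq_tf oO (tf_pd j ts); have P2 := sq_tf oO (tf_pd j tt).
have Q1 := (bw j _ P1).1; have Q2 := (bw j _ P2).1.
have E1 : ip t (fun x => b x ord0 j * wp j s x) = ip t (fun x => b x ord0 j * pd j s x).
  apply: (l2ip_ae_eq mO (ae_eq_refl _ _ _) _ st st (S1 j) Q1).
  by apply: filterS (e1 j) => x h Ox; rewrite h.
have E2 : ip s (fun x => b x ord0 j * wp j t x) = ip s (fun x => b x ord0 j * pd j t x).
  apply: (l2ip_ae_eq mO (ae_eq_refl _ _ _) _ ss ss (S2 j) Q2).
  by apply: filterS (e2 j) => x h Ox; rewrite h.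
rewrite E1 E2 /l2ip -RintegralD//; [|exact: sqintM|exact: sqintM].
have -> : \int[mu]_(x in O) (t x * (b x ord0 j * pd j s x) + s x * (b x ord0 j * pd j t x)) =
    \int[mu]_(x in O) (b x ord0 j * pd j (fun x => s x * t x) x).
  apply: eq_Rintegral => x _; have D1 : derivable s x (delta_mx ord0 j : E) := smooth_derivable (tf_smooth ts).
  have D2 : derivable t x (delta_mx ord0 j : E) := smooth_derivable (tf_smooth tt); rewrite (pdM D1 D2).
  by move: (pd j s x) (pd j t x) (s x) (t x) (b x ord0 j) => *; ring.
rewrite (tf_advection j tst); apply/eqP; rewrite addrC subr_eq0; apply/eqP.
by apply: eq_Rintegral => x _; rewrite mulrC mulrA.
Qed.

Hypothesis hd : d = 2%N \/ d = 3%N.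

(** Cauchy-Schwarz with the square of [u] and [l4_bound]. Elements of H^1_0 are reached through
    [bbilin_dense_le], so the square is only ever formed for test functions. *)
Lemma div_mul_bound u : hdom X u ->
  `|ip (fun x => \sum_j wp j (fun x => b x ord0 j) x * u x) u| <= 2 * L2 (divg O b) * hip X u u.
Proof.
have b3 := bl2_bbilin mO bl2_div_mul bl2_h10; have sd := divg_sq.
apply: (bbilin_dense_le b3 (S := tf O)).
- exact: h10_tf.
- exact: h10_dense.
- by rewrite mulr_ge0 ?l2n_ge0.
move=> s ts; have t2 : tf O (fun x => s x * s x) := tfMl (tf_smooth ts) ts.
have s2 := sq_tf oO t2.
have -> : ip (fun x => \sum_j wp j (fun x => b x ord0 j) x * s x) s = ip (divg O b) (fun x => s x * s x).
  by apply: eq_Rintegral => x _; rewrite divgE -mulr_suml mulrA.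
apply: le_trans (l2_CS mO sd s2) _; rewrite [2 * _]mulrC -mulrA; apply: ler_wpM2l; first exact: l2n_ge0.
rewrite -(@ler_pXn2r _ 2)// ?nnegrE ?l2n_ge0//; last by rewrite mulr_ge0// hip_ge0//; exact: h10_tf.
rewrite l2n_sqr exprMn.
have -> : ip (fun x => s x * s x) (fun x => s x * s x) = \int[mu]_x s x ^+ 4.
  rewrite /l2ip int_restr; last by move=> x nx; rewrite (tf_off ts nx) !mul0r.
  by apply: eq_Rintegral => x _; ring.
have -> : hip X s s = l2n mu setT s ^+ 2 + \sum_i l2n mu setT (pd i s) ^+ 2.
  have -> : hip X s s = ip s s + \sum_j ip (wp j s) (wp j s) by [].
  have -> : ip s s = l2n mu setT s ^+ 2.
    by rewrite l2n_sqr /l2ip int_restr// => x nx; rewrite (tf_off ts nx) mul0r.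
  apply: (congr1 (fun t => l2n mu setT s ^+ 2 + t)); apply: eq_bigr => j _.
  by rewrite (tf_ip_wp j j ts ts) l2n_sqr.
have := l4_bound hd (tf_setT ts); rewrite (_ : 2 ^+ 2 = 4)// -natrX //.
Qed.

Lemma advection_lower u : hdom X u ->
  - (L2 (divg O b) * hip X u u) <= ip (fun x => \sum_j b x ord0 j * wp j u x) u.
Proof.
move=> Su; have := advection Su; have := div_mul_bound Su; rewrite ler_norml => /andP[_ h1] h2.
exact: half_bound h1 h2.
Qed.

End convection.

End identities.

(** The budget behind the constants. The terms in [grad nu] use [4 + 5 = 9] times [g2 / nu0] of the
    mass term. In units of [nu0], the curl keeps [2/3 - 1/3 - 1/8 = 5/24] and the vorticity
    [1 - 1/3 - 1/20 = 37/60], where 1/3 is the share of the mixed product [m]; the divergence loses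
    [1/4] of its [rho2]. Convection takes [B] from the velocity, the curl and the divergence. *)
Lemma combine_bounds (R : realFieldType) (nu0 smin g2 B rho2 a0 c2 k2 D t1 t3 t4 t6s t6b t7 m : R) :
  0 < nu0 -> 0 <= c2 -> 0 <= k2 ->
  `|t1| <= nu0 / 4 * (2^-1 * (c2 + D + D)) + 4 * g2 / nu0 * a0 ->
  `|t3| <= nu0 / 20 * k2 + 5 * g2 / nu0 * a0 ->
  nu0 * k2 <= t4 -> smin * a0 <= t6s -> - (B * (a0 + (c2 + D))) <= t6b ->
  `|m| <= k2 / 2 + c2 / 2 -> t7 = c2 - m ->
  (smin - 9 * g2 / nu0 - B) * a0 + (nu0 * (5 / 24) - B) * c2 + nu0 * (37 / 60) * k2
    + (rho2 - nu0 / 4 - B) * D <=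
  - t1 + t3 + t4 + (t6s + t6b) + 2 / 3 * nu0 * t7 + rho2 * D.
Proof.
move=> n0 c0 k0; rewrite !ler_norml => /andP[_ h1] /andP[h3 _] h4 h6 h6b /andP[_ hm] ->.
have e4 : 4 * g2 / nu0 * a0 = 4 * (g2 / nu0 * a0) by ring.
have e5 : 5 * g2 / nu0 * a0 = 5 * (g2 / nu0 * a0) by ring.
have -> : (smin - 9 * g2 / nu0 - B) * a0 = smin * a0 - 9 * (g2 / nu0 * a0) - B * a0 by ring.
rewrite e4 in h1; rewrite e5 in h3.
have h7 : nu0 * m <= nu0 * (k2 / 2 + c2 / 2) by rewrite ler_pM2l.
move: (g2 / nu0 * a0) h1 h3 => G h1 h3; clear e4 e5 hm.
lra.
Qed.

(** * Curl, divergence and strain from the Jacobian *)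

Section jacobian_integrals.
Context dd (T : measurableType dd) (R : realType) (mu : {measure set T -> \bar R}) (D : set T) (n : nat).
Hypothesis mD : measurable D.
Variable J : 'I_n -> 'I_n -> T -> R.
Local Notation ip := (l2ip mu D).
Local Notation sq := (sqint mu D).
Hypothesis sJ : forall i j, sq (J i j).
Hypothesis swapJ : forall i j, ip (J i i) (J j j) = ip (J i j) (J j i).

Lemma int_double (F : 'I_n -> 'I_n -> T -> R) : (forall i j, mu.-integrable D (EFin \o F i j)) ->
  mu.-integrable D (EFin \o (fun x => \sum_i \sum_j F i j x)) /\
  \int[mu]_(x in D) (\sum_i \sum_j F i j x) = \sum_i \sum_j \int[mu]_(x in D) F i j x.
Proof.
move=> iF; have i1 i : mu.-integrable D (EFin \o (fun x => \sum_j F i j x)) by exact: (integrableR_sum _ mD).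
split; first exact: (integrableR_sum _ mD).
by rewrite Rintegral_sum//; apply: eq_bigr => i _; rewrite Rintegral_sum.
Qed.

Lemma jac_div : ip (fun x => \sum_i J i i x) (fun x => \sum_i J i i x) = \sum_i \sum_j ip (J i j) (J j i).
Proof.
have sS : sq (fun x => \sum_(i <- index_enum 'I_n) J i i x) by apply: (sqint_sum _ mD).
have Es f (sf : sq f) := l2ip_sumr mD (index_enum 'I_n) sf (fun i => sJ i i).
rewrite (Es _ sS); apply: eq_bigr => i _; rewrite l2ipC (Es _ (sJ i i)); apply: eq_bigr => j _.
exact: swapJ.
Qed.

Let iS := int_double (fun i j => sqintM mD (sJ i j) (sJ i j)).
Let iC := int_double (fun i j => sqintM mD (sJ i j) (sJ j i)).

Lemma jac_curl (hn : n = 2%N \/ n = 3%N) (c : 'I_(cdim n) -> T -> R) : (forall k, sq (c k)) ->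
  (forall k x, c k x = axial (\matrix_(i, j) J i j x)^T ord0 k) ->
  \sum_k ip (c k) (c k) = \sum_i \sum_j ip (J i j) (J i j) - \sum_i \sum_j ip (J i j) (J j i).
Proof.
move=> sc hc; rewrite -iS.2 -iC.2 -RintegralB//; [|exact: iS.1|exact: iC.1].
rewrite /l2ip -Rintegral_sum//; last by move=> k; exact: sqintM.
apply: eq_Rintegral => x _; under eq_bigr do rewrite !hc.
rewrite -[LHS]/(dot (axial _) (axial _)) dot_axial//.
congr (_ - _); rewrite exchange_big; apply: eq_bigr => i _; apply: eq_bigr => j _.
  by rewrite !mxE expr2.
by rewrite !mxE mulrC.
Qed.

Lemma jac_strain : \sum_(p : 'I_n * 'I_n) ip (fun x => 2^-1 * (J p.1 p.2 x + J p.2 p.1 x))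
    (fun x => 2^-1 * (J p.1 p.2 x + J p.2 p.1 x)) =
  2^-1 * (\sum_i \sum_j ip (J i j) (J i j) + \sum_i \sum_j ip (J i j) (J j i)).
Proof.
have sE (p : 'I_n * 'I_n) : sq (fun x => 2^-1 * (J p.1 p.2 x + J p.2 p.1 x)) by apply: sqintZ => //; exact: sqintD.
rewrite -iS.2 -iC.2 -RintegralD//; [|exact: iS.1|exact: iC.1].
rewrite -RintZ//; last by apply: integrableRD => //; [exact: iS.1|exact: iC.1].
rewrite /l2ip -Rintegral_sum//; last by move=> p; exact: sqintM.
apply: eq_Rintegral => x _.
have := sum_strain (\matrix_(i, j) J i j x); rewrite pair_bigA /= => h.
have -> : \sum_i \sum_j J i j x * J i j x = \sum_i \sum_j (\matrix_(i, j) J i j x) i j ^+ 2.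
  by apply: eq_bigr => i _; apply: eq_bigr => j _; rewrite mxE expr2.
have -> : \sum_i \sum_j J i j x * J j i x =
    \sum_i \sum_j (\matrix_(i, j) J i j x) i j * (\matrix_(i, j) J i j x) j i.
  by apply: eq_bigr => i _; apply: eq_bigr => j _; rewrite !mxE.
by rewrite -h; apply: eq_bigr => p _; rewrite !mxE expr2.
Qed.

End jacobian_integrals.

Section coercivity.
Variables (R : realType) (d : nat) (O : set 'rV[R]_d).
Hypothesis oO : open O.
Hypothesis bO : bounded_set O.
Hypothesis hd : d = 2%N \/ d = 3%N.
Local Notation E := 'rV[R]_d.
Local Notation mu := (leb R d).
Local Notation ip := (l2ip mu O).
Local Notation sq := (sqint mu O).
Local Notation wp := (wpartial O).
Local Notation X := (flow_shilb oO bO).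
Local Notation H1 := (('I_d -> E -> R) * ('I_(cdim d) -> E -> R))%type.
Let mO : measurable O := omeas oO.

Section flow.
Variable u : H1.
Hypothesis Su : hdom X u.
Let J i j := wp j (u.1 i).

Let sJ i j : sq (J i j). Proof. by have [_ h _] := flow_sq Su; exact: h. Qed.
Let su i : sq (u.1 i). Proof. by have [h _ _] := flow_sq Su; exact: h. Qed.

Definition vel2 := \sum_i ip (u.1 i) (u.1 i).
Definition vor2 := \sum_k ip (u.2 k) (u.2 k).
Definition div2 := ip (divg O (vec u.1)) (divg O (vec u.1)).
Definition curl2 := \sum_k ip (fun x => curl O (vec u.1) x ord0 k) (fun x => curl O (vec u.1) x ord0 k).

Lemma divg_vec x : divg O (vec u.1) x = \sum_i J i i x.
Proof. by apply: eq_bigr => i _; rewrite jac_vec. Qed.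

Let swapJ i j : ip (J i i) (J j j) = ip (J i j) (J j i).
Proof. exact: (wp_swap i j (Su.1 i) (Su.1 j)). Qed.

Lemma div2E : div2 = \sum_i \sum_j ip (J i j) (J j i).
Proof.
rewrite -(jac_div mO sJ swapJ) /div2.
by have -> : divg O (vec u.1) = fun x => \sum_i J i i x by apply/funext => x; rewrite divg_vec.
Qed.

Lemma curl_sqk k : sq (fun x => curl O (vec u.1) x ord0 k).
Proof. by have [h _ _] := bl2_curl oO bO k; exact: h. Qed.

Lemma curl2_div2 : curl2 + div2 = \sum_i \sum_j ip (J i j) (J i j).
Proof.
have hc k x : curl O (vec u.1) x ord0 k = axial (\matrix_(i, j) J i j x)^T ord0 k.
  have e : jac O (vec u.1) x = \matrix_(i, j) J i j x.
    by apply/matrixP => i j; rewrite [RHS]mxE; exact: jac_vec.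
  by rewrite /curl e.
have h := jac_curl mO sJ hd curl_sqk hc.
by rewrite div2E; apply: (etrans (congr1 (fun t => t + _) h)); exact: subrK.
Qed.

Lemma flow_normC : hip X u u = vel2 + (curl2 + div2) + vor2.
Proof. by rewrite curl2_div2 flow_normE big_split. Qed.

Let eps (p : 'I_d * 'I_d) x := 2^-1 * (J p.1 p.2 x + J p.2 p.1 x).

Let seps p : sq (eps p).
Proof. by apply: sqintZ => //; exact: sqintD. Qed.

Lemma strain2 : \sum_p ip (eps p) (eps p) = 2^-1 * (curl2 + div2 + div2).
Proof. by rewrite curl2_div2 div2E; exact: jac_strain. Qed.

Lemma vel2_ge0 : 0 <= vel2. Proof. by apply: sumr_ge0 => i _; exact: l2ip_ge0. Qed.
Lemma vor2_ge0 : 0 <= vor2. Proof. by apply: sumr_ge0 => i _; exact: l2ip_ge0. Qed.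
Lemma curl2_ge0 : 0 <= curl2. Proof. by apply: sumr_ge0 => i _; exact: l2ip_ge0. Qed.
Lemma div2_ge0 : 0 <= div2. Proof. exact: l2ip_ge0. Qed.

Section terms.
Variables (nu0 g2 M : R) (nu : E -> R).
Hypothesis n0 : 0 < nu0.
Hypothesis g20 : 0 <= g2.
Hypothesis gM : {ae mu, forall x, O x -> dot (grad O nu x) (grad O nu x) <= g2}.
Hypothesis mg : forall i, measurable_fun O (fun x => grad O nu x ord0 i).
Hypothesis bg : forall i, {ae mu, forall x, O x -> `|grad O nu x ord0 i| <= M}.

(** Pointwise |2 eps grad nu|^2 <= 4 |grad nu|^2 |eps|^2, then Cauchy-Schwarz and [am_gm]. By
    [strain2] the share [nu0 / 4] of |eps|^2 amounts to [nu0 / 8] of the curl and [nu0 / 4] of the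
    divergence. *)
Lemma strain_term : `|integ O (fun x => dot (grad O nu x *m (2 *: strain O (vec u.1) x)^T) (vec u.1 x))| <=
  nu0 / 4 * (2^-1 * (curl2 + div2 + div2)) + 4 * g2 / nu0 * vel2.
Proof.
have bst i := bl2_strain oO bO (fun j => conj (mg j) (bg j)) i.
have sT i : sq (fun x => (grad O nu x *m (2 *: strain O (vec u.1) x)^T) ord0 i).
  by have [h _ _] := bst i; exact: h.
have sv i : sq (fun x => vec u.1 x ord0 i) by have [h _ _] := bl2_vel oO bO i; exact: h.
rewrite (integ_dot mO)//; rewrite -strain2.
have vE : \sum_i ip (fun x => vec u.1 x ord0 i) (fun x => vec u.1 x ord0 i) = vel2.
  by apply: eq_bigr => i _; have -> : (fun x => vec u.1 x ord0 i) = u.1 i by apply/funext => x; rewrite vecE.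
apply: am_gm.
- by rewrite mulr_ge0 ?divr_ge0 ?(ltW n0)// sumr_ge0// => p _; exact: l2ip_ge0.
- by rewrite mulr_ge0 ?vel2_ge0// divr_ge0 ?(ltW n0)// mulr_ge0.
apply: le_trans (family_CS mO sT sv) _; rewrite vE.
have h : \sum_i ip (fun x => (grad O nu x *m (2 *: strain O (vec u.1) x)^T) ord0 i)
    (fun x => (grad O nu x *m (2 *: strain O (vec u.1) x)^T) ord0 i) <= 4 * g2 * \sum_p ip (eps p) (eps p).
  apply: (family_ae_le mO) => //; first by rewrite mulr_ge0.
  apply: filterS gM => x gx Ox; rewrite -(pair_bigA _ (fun i j => eps (i, j) x ^+ 2)) /=.
  pose S : 'M[R]_d := \matrix_(i, j) eps (i, j) x; pose w := grad O nu x *m (2 *: strain O (vec u.1) x)^T.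
  have hw i : w ord0 i = \sum_j grad O nu x ord0 j * (2 * S i j).
    rewrite mxE; apply: eq_bigr => j _; congr (_ * _); rewrite !mxE; congr (2 * (_ * _)).
    by congr (_ + _); rewrite -?/(J _ _ x) /J /=; congr wpartial; apply/funext => z; rewrite mxE.
  have dd : \sum_i w ord0 i ^+ 2 = dot w w by apply: eq_bigr => i _; rewrite expr2.
  apply: (@le_trans _ _ (dot w w)); first by rewrite -dd.
  apply: le_trans (dot_strain_le hw) _.
  have -> : \sum_i \sum_j S i j ^+ 2 = \sum_i \sum_j eps (i, j) x ^+ 2.
    by apply: eq_bigr => i _; apply: eq_bigr => j _; rewrite mxE.
  rewrite -!mulrA ler_pM2l// ler_wpM2r ?gx//.
  by apply: sumr_ge0 => i _; apply: sumr_ge0 => j _; exact: sqr_ge0.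
apply: (@le_trans _ _ ((4 * g2 * \sum_p ip (eps p) (eps p)) * vel2)).
  by apply: ler_wpM2r => //; exact: vel2_ge0.
move: (\sum_p _) vel2 => e a; rewrite le_eqVlt; apply/orP; left; apply/eqP; field.
by rewrite gt_eqF.
Qed.

Lemma cross_term : `|integ O (fun x => dot (vec u.2 x) (cross (grad O nu x) (vec u.1 x)))| <=
  nu0 / 20 * vor2 + 5 * g2 / nu0 * vel2.
Proof.
have bcr k := bl2_cross oO bO (fun j => conj (mg j) (bg j)) k.
have sT k : sq (fun x => cross (grad O nu x) (vec u.1 x) ord0 k) by have [h _ _] := bcr k; exact: h.
have sv k : sq (fun x => vec u.2 x ord0 k) by have [h _ _] := bl2_vor oO bO k; exact: h.
rewrite (integ_dot mO)//.
have vE : \sum_i ip (fun x => vec u.2 x ord0 i) (fun x => vec u.2 x ord0 i) = vor2.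
  by apply: eq_bigr => i _; have -> : (fun x => vec u.2 x ord0 i) = u.2 i by apply/funext => x; rewrite vecE.
apply: am_gm.
- by rewrite mulr_ge0 ?divr_ge0 ?(ltW n0)// vor2_ge0.
- by rewrite mulr_ge0 ?vel2_ge0// divr_ge0 ?(ltW n0)// mulr_ge0.
apply: le_trans (family_CS mO sv sT) _; rewrite vE.
have h : \sum_k ip (fun x => cross (grad O nu x) (vec u.1 x) ord0 k)
    (fun x => cross (grad O nu x) (vec u.1 x) ord0 k) <= g2 * \sum_i ip (u.1 i) (u.1 i).
  apply: (family_ae_le mO) => //.
  apply: filterS gM => x gx Ox; have := dot_cross_le hd (grad O nu x) (vec u.1 x).
  rewrite {1}/dot; under eq_bigr do rewrite -expr2; move=> /le_trans; apply.
  rewrite [dot (vec _ _) _]/dot; under [X in _ * X <= _]eq_bigr do rewrite vecE -expr2.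
  by rewrite ler_wpM2r ?gx// sumr_ge0// => i _; exact: sqr_ge0.
apply: (@le_trans _ _ (vor2 * (g2 * vel2))); first by apply: ler_wpM2l => //; exact: vor2_ge0.
move: vor2 vel2 => e a; rewrite le_eqVlt; apply/orP; left; apply/eqP; field.
by rewrite gt_eqF.
Qed.

End terms.

End flow.

End coercivity.

(** On the diagonal, the two terms that couple the vorticity with the curl through [nu] are
    opposite; [i2] is their common value. *)
Lemma form_cancel (R : comRingType) (a1 i2 a3 a4 a6 r a7 b a8 : R) :
  - a1 + a3 + a4 + a6 + r * a7 + b * a8 = - a1 + i2 + a3 + a4 - i2 + a6 + r * a7 + b * a8.
Proof. ring. Qed.

(** * Well-posedness *)

Section well_posedness.
Variables (R : realType) (d : nat) (O : set 'rV[R]_d).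
Hypothesis oO : open O.
Hypothesis bO : bounded_set O.
Hypothesis hd : d = 2%N \/ d = 3%N.
Local Notation E := 'rV[R]_d.
Local Notation mu := (leb R d).
Local Notation L2 := (l2n mu O).
Local Notation ip := (l2ip mu O).
Local Notation sq := (sqint mu O).
Local Notation wp := (wpartial O).
Local Notation X := (flow_shilb oO bO).
Local Notation H1 := (('I_d -> E -> R) * ('I_(cdim d) -> E -> R))%type.
Let mO : measurable O := omeas oO.

Section coefficients.
Variables (rho1 rho2 nu0 smin g2 M : R) (nu sigma : E -> R) (beta : E -> 'rV[R]_d).
Let bounded (w : E -> R) := measurable_fun O w /\ {ae mu, forall x, O x -> `|w x| <= M}.
Hypothesis bnu : bounded nu.
Hypothesis bsig : bounded sigma.
Hypothesis bbeta : forall i, bounded (fun x => beta x ord0 i).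
Hypothesis bgnu : forall i, bounded (fun x => grad O nu x ord0 i).
Hypothesis wb : forall j, weak_deriv O j (fun x => beta x ord0 j) (wp j (fun x => beta x ord0 j)).
Hypothesis bwb : forall j, bounded (wp j (fun x => beta x ord0 j)).
Hypothesis n0 : 0 < nu0.
Hypothesis nu_lower : {ae mu, forall x, O x -> nu0 <= nu x}.
Hypothesis sig_lower : {ae mu, forall x, O x -> smin <= sigma x}.
Hypothesis g20 : 0 <= g2.
Hypothesis gM : {ae mu, forall x, O x -> dot (grad O nu x) (grad O nu x) <= g2}.
Hypothesis rhoE : rho1 = 2 / 3 * nu0.

Let A := oseen_form O rho1 rho2 nu sigma beta.

Lemma oseen_lower u : hdom X u ->
  (smin - 9 * g2 / nu0 - L2 (divg O beta)) * vel2 O u + (nu0 * (5 / 24) - L2 (divg O beta)) * curl2 O u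
    + nu0 * (37 / 60) * vor2 O u + (rho2 - nu0 / 4 - L2 (divg O beta)) * div2 O u <= A u u.
Proof.
move=> Su; have [mn nM] := bnu; have [ms sM] := bsig; have [sy sJ sk] := flow_sq Su.
have mg i : measurable_fun O (fun x => grad O nu x ord0 i) := (bgnu i).1.
have bg i := (bgnu i).2.
have h1 := strain_term hd Su n0 g20 gM mg bg; have h3 := cross_term hd Su n0 g20 gM mg bg.
have sc := curl_sqk Su.
have eK k : (fun x => vec u.2 x ord0 k) = u.2 k by apply/funext => x; rewrite vecE.
have eY i : (fun x => vec u.1 x ord0 i) = u.1 i by apply/funext => x; rewrite vecE.
have bw (w : E -> R) (mw : measurable_fun O w) (wM : {ae mu, forall x, O x -> `|w x| <= M}) (f : E -> R) (sf : sq f) :=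
  (ae_bounded_sq mO mw wM sf).1.
pose t4 := integ O (fun x => nu x * dot (vec u.2 x) (vec u.2 x)).
have h4 : nu0 * vor2 O u <= t4.
  have -> : t4 = \sum_k ip (fun x => nu x * u.2 k x) (u.2 k).
    have -> : t4 = integ O (fun x => dot (nu x *: vec u.2 x) (vec u.2 x)).
      congr (Rintegral _ _ _); apply/funext => x; rewrite /dot mulr_sumr; apply: eq_bigr => k _.
      by rewrite [in RHS]mxE mulrA.
    have e k : (fun x => (nu x *: vec u.2 x) ord0 k) = fun x => nu x * u.2 k x.
      by apply/funext => x; rewrite mxE vecE.
    rewrite (integ_dot mO); last by move=> k; rewrite eK.
      by apply: eq_bigr => k _; rewrite e eK.
    by move=> k; rewrite e; exact: bw.
  rewrite /vor2 mulr_sumr; apply: ler_sum => k _; exact: (weighted_lower mO mn nM nu_lower).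
pose Cv i x := \sum_j beta x ord0 j * wp j (u.1 i) x.
have sCv i : sq (Cv i).
  apply: (sqint_sum (index_enum 'I_d) mO) => j; have [mb bM] := bbeta j; exact: bw.
pose t6s := \sum_i ip (fun x => sigma x * u.1 i x) (u.1 i); pose t6b := \sum_i ip (Cv i) (u.1 i).
have h6 : smin * vel2 O u <= t6s.
  rewrite /vel2 mulr_sumr; apply: ler_sum => i _; exact: (weighted_lower mO ms sM sig_lower).
have h6b : - (L2 (divg O beta) * (vel2 O u + (curl2 O u + div2 O u))) <= t6b.
  rewrite (curl2_div2 hd Su) /vel2 -big_split mulr_sumr -sumrN; apply: ler_sum => i _ /=.
  have h := advection_lower wb (fun j => (bbeta j).1) (fun j => (bbeta j).2)
    (fun j => (bwb j).1) (fun j => (bwb j).2) hd (Su.1 i).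
  exact: h.
have e6 : integ O (fun x => dot (sigma x *: vec u.1 x + Defs.conv O beta (vec u.1) x) (vec u.1 x)) = t6s + t6b.
  have e i : (fun x => (sigma x *: vec u.1 x + Defs.conv O beta (vec u.1) x) ord0 i) =
      fun x => sigma x * u.1 i x + Cv i x.
    apply/funext => x; rewrite mxE; congr (_ + _); first by rewrite mxE vecE.
    by rewrite mxE; apply: eq_bigr => j _; rewrite [X in _ * X]mxE jac_vec.
  have ss i : sq (fun x => sigma x * u.1 i x) := bw _ ms sM _ (sy i).
  rewrite (integ_dot mO); last by move=> i; rewrite eY.
    rewrite -big_split; apply: eq_bigr => i _; rewrite e eY; exact: l2ipDl.
  by move=> i; rewrite e; exact: sqintD.
pose m := \sum_k ip (u.2 k) (fun x => curl O (vec u.1) x ord0 k).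
pose t7 := integ O (fun x => dot (curl O (vec u.1) x - vec u.2 x) (curl O (vec u.1) x)).
have e7 : t7 = curl2 O u - m.
  have e k : (fun x => (curl O (vec u.1) x - vec u.2 x) ord0 k) =
      fun x => curl O (vec u.1) x ord0 k - u.2 k x.
    by apply/funext => x; rewrite mxE [X in _ + X]mxE vecE.
  rewrite /t7 (integ_dot mO)//; last by move=> k; rewrite e; exact: sqintB.
  rewrite /curl2 /m -sumrB; apply: eq_bigr => k _; rewrite e l2ipC.
  by rewrite (l2ipBr mO (sc k) (sc k) (sk k)) [ip _ (u.2 k)]l2ipC.
have hm : `|m| <= vor2 O u / 2 + curl2 O u / 2.
  apply: am_gm; rewrite ?divr_ge0 ?vor2_ge0 ?curl2_ge0//.
  apply: le_trans (family_CS mO sk sc) _; rewrite -/(vor2 O u) -/(curl2 O u).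
  by rewrite le_eqVlt; apply/orP; left; apply/eqP; move: (vor2 O u) (curl2 O u) => *; field.
have := combine_bounds rho2 n0 (curl2_ge0 O u) (vor2_ge0 O u) h1 h3 h4 h6 h6b hm e7.
move=> /le_trans; apply; rewrite /A /oseen_form /formA e6 rhoE -/t4 -/t7 -[integ O (fun x => _ * divg _ _ x)]/(div2 O u).
rewrite le_eqVlt; apply/orP; left; apply/eqP.
exact: form_cancel.
Qed.

End coefficients.

Definition pressure_shilb : shilb (E -> R).
Proof.
refine (@Shilb R (E -> R) (fun q => sq q /\ integ O q = 0) ip _ _ _ _ _ _).
- split; first exact: sqint0.
  by rewrite /integ (@Rintegral_cst _ _ _ mu O mO 0) mul0r.
- move=> a u v [su u0] [sv v0]; split; first by apply: sqintD => //; exact: sqintZ.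
  have iu := sq_int oO bO su; have iv := sq_int oO bO sv.
  have iz := integrableRZ a mO iu.
  have -> : integ O (a *: u + v) = integ O (fun x => a * u x) + integ O v by exact: RintegralD.
  have -> : integ O (fun x => a * u x) = a * integ O u by exact: RintZ.
  by rewrite u0 v0 mulr0 addr0.
- by move=> u v _ _; exact: l2ipC.
- move=> a u v w [su _] [sv _] [sw _]; rewrite -l2ipZl// -l2ipDl//; exact: sqintZ.
- by move=> u _; exact: l2ip_ge0.
- move=> u c Su hu; have su k : sq (u k) := (Su k).1.
  have [l sl hl] := l2_complete mO su hu; exists l; last by exists (4 * c).
  split => //; have s1 := sq_cst oO bO 1; pose K := 4 * c * L2 (fun=> 1) ^+ 2.
  have e (f : E -> R) : ip f (fun=> 1) = integ O f by apply: eq_Rintegral => x _; rewrite mulr1.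
  (* The mean is a bounded functional, so it inherits the geometric rate of the sequence and
     vanishes in the limit. *)
  have : integ O l ^+ 2 <= 0.
    apply: (@quarter_small _ _ K) => k.
    have sb := sqintB mO (su k) sl.
    have -> : integ O l ^+ 2 = ip (fun x => u k x - l x) (fun=> 1) ^+ 2.
      rewrite l2ipC (l2ipBr mO s1 (su k) sl) [ip _ (u k)]l2ipC [ip _ l]l2ipC !e (Su k).2.
      by rewrite sub0r sqrrN.
    rewrite -real_normK ?num_real//; apply: (@le_trans _ _ ((L2 (fun x => u k x - l x) * L2 (fun=> 1)) ^+ 2)).
      by rewrite lerXn2r ?nnegrE ?mulr_ge0 ?l2n_ge0// l2_CS.
    rewrite exprMn l2n_sqr /K mulrAC ler_wpM2r ?sqr_ge0//; exact: hl.
  by rewrite le_eqVlt ltNge sqr_ge0 orbF sqrf_eq0 => /eqP.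
Defined.

Definition pressure_form (u : H1) (q : E -> R) : R := Defs.formB O (vec u.1) (vec u.2) q.

Lemma pressure_formE u q : pressure_form u q = - ip (divg O (vec u.1)) q.
Proof.
by congr (- _); apply: eq_Rintegral => x _; rewrite mulrC.
Qed.

Lemma pressure_form_bbilin : bbilin X pressure_shilb pressure_form.
Proof.
have bq : bl2 O pressure_shilb (fun q => q).
  split=> [u []//|a u v _ _|]; first by apply: aeW.
  by exists 1 => // u _; rewrite mul1r.
have h := bbilinZ (-1) (bl2_bbilin mO (bl2_div oO bO) bq).
by apply: bbilin_ext h => u q _ _; rewrite pressure_formE mulN1r.
Qed.

Lemma sum_sqr_le (I : finType) (a : I -> R) : (forall i, 0 <= a i) -> \sum_i a i ^+ 2 <= (\sum_i a i) ^+ 2.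
Proof.
move=> a0; rewrite [leRHS]expr2 mulr_suml; apply: ler_sum => i _; rewrite expr2 ler_wpM2l//.
by rewrite (bigD1 i)//= lerDl sumr_ge0.
Qed.

Lemma tf_flow (v : 'I_d -> E -> R) : tfv O v -> hdom X (v, 0) /\ hnorm X (v, 0) <= h1s v.
Proof.
move=> tv; have Sv : hdom X (v, 0).
  by split=> [i|k]; [exact: (h10_tf oO bO (tv i))|exact: sqint0].
split => //; rewrite -(@ler_pXn2r _ 2)// ?nnegrE ?hnorm_ge0 ?h1s_ge0// hnorm_sqr//.
have eO (f : E -> R) : tf O f -> ip f f = l2n mu setT f ^+ 2.
  by move=> tf_; rewrite l2n_sqr /l2ip int_restr// => x nx; rewrite (tf_off tf_ nx) mul0r.
have -> : hip X (v, 0) (v, 0) = \sum_i (l2n mu setT (v i) ^+ 2 + \sum_j l2n mu setT (pd j (v i)) ^+ 2).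
  rewrite flow_normE [X in _ + X]big1 ?addr0; last first.
    by move=> k _; rewrite /l2ip; under eq_Rintegral do rewrite mul0r; rewrite Rintegral_cst// mul0r.
  apply: eq_bigr => i _; rewrite (eO _ (tv i)); congr (_ + _); apply: eq_bigr => j _.
  by rewrite (tf_ip_wp oO bO j j (tv i) (tv i)) l2n_sqr.
have p i : 0 <= l2n mu setT (v i) + \sum_j l2n mu setT (pd j (v i)).
  by rewrite addr_ge0 ?l2n_ge0// sumr_ge0// => j _; exact: l2n_ge0.
apply: le_trans (sum_sqr_le p); apply: ler_sum => i _.
have s0 : 0 <= \sum_j l2n mu setT (pd j (v i)) by apply: sumr_ge0 => j _; exact: l2n_ge0.
apply: (@le_trans _ _ (l2n mu setT (v i) ^+ 2 + (\sum_j l2n mu setT (pd j (v i))) ^+ 2)).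
  by rewrite lerD2l; apply: sum_sqr_le => j; exact: l2n_ge0.
by rewrite sqrrD -addrA [X in _ <= _ + X]addrC addrA lerDl mulrn_wge0// mulr_ge0// l2n_ge0.
Qed.

(** Only velocities made of test functions, with zero vorticity, are tried: as [hnorm] is at most
    [h1s] there, the hypothesis is [gradle] for the extension of [q] by zero, to which [necas]
    applies. *)
Lemma infsup : connected O -> O !=set0 -> lipschitz_boundary O -> polyhedral O ->
  exists2 K : R, 0 <= K & forall q (N : R), 0 <= N -> hdom pressure_shilb q ->
    (forall u, hdom X u -> `|pressure_form u q| <= N * hnorm X u) -> hnorm pressure_shilb q <= K * N.
Proof.
move=> cO neO lip [Ps clO]; have [K K0 hK] := necas oO lip clO cO bO neO.
exists K => // q N N0 [sqq q0] hN; pose q' x := q x * \1_O x.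
have qE x : O x -> q' x = q x by move=> Ox; rewrite /q' indicE mem_set// mulr1.
have qN x : ~ O x -> q' x = 0 by move=> nx; rewrite /q' indicE memNset// mulr0.
have q'E : q' = q \_ O.
  by apply/funext => x; rewrite /patch; case: ifPn => [/set_mem/qE//|/negP nx]; apply: qN => Ox; apply: nx; rewrite inE.
have sq' : sqint mu setT q'.
  have [mq iq] := sqq; split; first by rewrite q'E; exact: (measurable_restrictT _ mO).1.
  have := (integrable_mkcond _ mO).1 iq; congr (integrable _ _ _); apply/funext => x; rewrite q'E /patch /=.
  by case: ifPn => // _; rewrite expr0n.
have e2 (f : E -> R) : \int[mu]_x (q' x * f x) = \int[mu]_(x in O) (q x * f x).
  rewrite -(int_restr (O := O)); last by move=> x nx; rewrite qN// mul0r.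
  by apply: eq_Rintegral => x; rewrite inE => Ox; rewrite qE.
have -> : hnorm pressure_shilb q = l2n mu setT q'.
  congr Num.sqrt; rewrite [RHS]e2; apply: eq_Rintegral => x; rewrite inE => Ox; by rewrite qE.
apply: (hK q' N sq' qN) => //.
  rewrite -(int_restr (O := O)) //; rewrite -q0; apply: eq_Rintegral => x; rewrite inE => Ox; exact: qE.
move=> v tv; have [Sv nv] := tf_flow tv; have := hN _ Sv; rewrite pressure_formE normrN /=.
have -> : ip (divg O (vec v)) q = \int[mu]_x (q' x * dv v x).
  rewrite e2 l2ipC; have ed : ae_eq mu O (divg O (vec v)) (dv v).
    have : {ae mu, forall x, forall i, i \in index_enum 'I_d -> O x -> wp i (v i) x = pd i (v i) x}.
      by apply: ae_seq => i _; have [_ h] := w12_tf oO bO (tv i); exact: h.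
    apply: filterS => x h Ox; apply: eq_bigr => i _; rewrite jac_vec h//; exact: mem_index_enum.
  have [s1 _ _] := bl2_div oO bO; have s2 := s1 _ Sv.
  exact: (l2ip_ae_eq mO (ae_eq_refl _ _ _) ed sqq sqq s2 (sq_tf oO (tf_dv tv))).
by move=> /le_trans; apply; rewrite ler_wpM2l.
Qed.

End well_posedness.

(** [nu0 / 12] is the margin [nu0 / 3 - nu0 / 4] left for the divergence by [rho2 > nu0 / 3]; the
    margin [5/24] of the curl is larger. *)
Lemma positive_margins (R : realFieldType) (nu0 G s B rho2 : R) : B < s - G -> B < nu0 / 12 -> 0 <= B ->
  0 < nu0 -> nu0 / 3 < rho2 ->
  [/\ 0 < s - G - B, 0 < nu0 * (5 / 24) - B, 0 < nu0 * (37 / 60) & 0 < rho2 - nu0 / 4 - B].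
Proof. by move=> h1 h2 h3 h4 h5; split; lra. Qed.

Lemma weighted_sum_le (R : realFieldType) (al c1 c2 c3 c4 x1 x2 x3 x4 : R) : al <= c1 -> al <= c2 -> al <= c3 ->
  al <= c4 -> 0 <= x1 -> 0 <= x2 -> 0 <= x3 -> 0 <= x4 ->
  al * (x1 + (x2 + x4) + x3) <= c1 * x1 + c2 * x2 + c3 * x3 + c4 * x4.
Proof.
move=> a1 a2 a3 a4 p1 p2 p3 p4; have -> : al * (x1 + (x2 + x4) + x3) = al * x1 + al * x2 + al * x3 + al * x4 by ring.
by rewrite !lerD// ler_wpM2r.
Qed.

(** * Translation to the forms and norms of the statement *)

Section assembly.
Variables (R : realType) (d : nat) (O : set 'rV[R]_d).
Hypothesis oO : open O.
Hypothesis bO : bounded_set O.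
Hypothesis hd : d = 2%N \/ d = 3%N.
Local Notation E := 'rV[R]_d.
Local Notation mu := (leb R d).
Local Notation L2 := (l2n mu O).
Local Notation ip := (l2ip mu O).
Local Notation sq := (sqint mu O).
Local Notation wp := (wpartial O).
Local Notation X := (flow_shilb oO bO).
Local Notation Y := (pressure_shilb oO bO).
Local Notation H1 := (('I_d -> E -> R) * ('I_(cdim d) -> E -> R))%type.
Let mO : measurable O := omeas oO.

Definition ae_bounded (w : E -> R) := exists2 M : R, 0 <= M & {ae mu, forall x, O x -> `|w x| <= M}.

Lemma common_bound (I : finType) (w : I -> E -> R) : (forall i, ae_bounded (w i)) ->
  exists2 M : R, 0 <= M & forall i, {ae mu, forall x, O x -> `|w i x| <= M}.
Proof.
move=> h; have /choice[M hM] : forall i, exists M : R, 0 <= M /\ {ae mu, forall x, O x -> `|w i x| <= M}.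
  by move=> i; have [M M0 ?] := h i; exists M.
exists (\sum_i M i); first by apply: sumr_ge0 => i _; case: (hM i).
move=> i; have [_ hi] := hM i; apply: filterS hi => x h1 Ox; apply: le_trans (h1 Ox) _.
by rewrite (bigD1 i)//= lerDl sumr_ge0// => j _; case: (hM j).
Qed.

Lemma W1y_facts w : W1 O +oo%E w -> [/\ measurable_fun O w, ae_bounded w,
  forall i, weak_deriv O i w (wp i w), forall i, measurable_fun O (wp i w) & forall i, ae_bounded (wp i w)].
Proof.
move=> [/inLy_bound[mw [M M0 wM]] h].
have hw i : weak_deriv O i w (wp i w).
  by have [g hg _] := h i; apply: (@xgetPex _ (fun=> 0) [set g | weak_deriv O i w g]); exists g.
split => //; first by exists M.
  by move=> i; have [_ [m _] _] := hw i.
move=> i; have [g hg /inLy_bound[_ [N N0 gN]]] := h i; exists N => //.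
by have := wd_uniq oO (hw i) hg; apply: filterS2 gN => x h1 h2 Ox; rewrite h2// h1.
Qed.

Lemma vnormL2E k (w : E -> 'rV[R]_k) : (forall i, sq (fun x => w x ord0 i)) ->
  vnormL O 2%:E w = Num.sqrt (\sum_i ip (fun x => w x ord0 i) (fun x => w x ord0 i)).
Proof.
move=> sw; rewrite -(vnormL2_sqr oO sw) sqrtr_sqr ger0_norm// /vnormL normL2E ?l2n_ge0//.
exact: sq_enorm.
Qed.

Lemma normVW_flow u : hdom X u -> normVW O (vec u.1) (vec u.2) = hnorm X u.
Proof.
move=> Su; have [sy _ sk] := flow_sq Su; have sc := curl_sqk Su.
have sD : sq (divg O (vec u.1)) by have [h _ _] := bl2_div oO bO; exact: h.
have eK k : (fun x => vec u.2 x ord0 k) = u.2 k by apply/funext => x; rewrite vecE.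
have eY i : (fun x => vec u.1 x ord0 i) = u.1 i by apply/funext => x; rewrite vecE.
rewrite /hnorm (flow_normC hd Su) /normVW /norm1 sqr_sqrtr; last by rewrite !addr_ge0// sqr_ge0.
rewrite !(vnormL2_sqr oO)//; try by move=> i; rewrite ?eK ?eY.
rewrite normL2E// l2n_sqr -/(curl2 O u) -/(div2 O u).
have -> : \sum_i ip (fun x => vec u.1 x ord0 i) (fun x => vec u.1 x ord0 i) = vel2 O u.
  by apply: eq_bigr => i _; rewrite eY.
have -> : \sum_k ip (fun x => vec u.2 x ord0 k) (fun x => vec u.2 x ord0 k) = vor2 O u.
  by apply: eq_bigr => i _; rewrite eK.
exact: (congr1 (fun t => Num.sqrt (t + vor2 O u)) (esym (addrA _ _ _))).
Qed.

Definition load (f w : E -> 'rV[R]_d) (v : H1) : R := integ O (fun x => dot (f x + w x) (vec v.1 x)).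

Lemma load_blin f w : vinL O 2%:E f -> vinL O 2%:E w ->
  blin X (load f w) (vnormL O 2%:E f + vnormL O 2%:E w).
Proof.
move=> Lf Lw; have sf i : sq (fun x => f x ord0 i) by exact/inL2P.
have sw i : sq (fun x => w x ord0 i) by exact/inL2P.
pose g i x := f x ord0 i + w x ord0 i; have sg i : sq (g i) by exact: sqintD.
have eL v : hdom X v -> load f w v = \sum_i ip (g i) (v.1 i).
  move=> Sv; have [sv _ _] := flow_sq Sv; rewrite /load (integ_dot mO).
  - apply: eq_bigr => i _; have -> : (fun x => vec v.1 x ord0 i) = v.1 i by apply/funext => x; rewrite vecE.
    by have -> : (fun x => (f x + w x) ord0 i) = g i by apply/funext => x; rewrite mxE.
  - by move=> i; have -> : (fun x => (f x + w x) ord0 i) = g i by apply/funext => x; rewrite mxE.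
  - by move=> i; have -> : (fun x => vec v.1 x ord0 i) = v.1 i by apply/funext => x; rewrite vecE.
have n0 k (z : E -> 'rV[R]_k) : (forall i, sq (fun x => z x ord0 i)) -> 0 <= vnormL O 2%:E z.
  by move=> /vnormL2E ->; exact: sqrtr_ge0.
split; first by rewrite addr_ge0 ?n0.
- move=> a u v Su Sv; have [su _ _] := flow_sq Su; have [sv _ _] := flow_sq Sv.
  rewrite !eL//; last exact: hdomL.
  rewrite mulr_sumr -big_split; apply: eq_bigr => i _; rewrite lin_fst lin_app.
  have e := l2ipDr mO (sg i) (sqintZ a mO (su i)) (sv i).
  by apply: (etrans e); rewrite l2ipZr.
move=> v Sv; have [sv _ _] := flow_sq Sv; rewrite eL//.
have F := fin_shilb 'I_d (l2_hilb mu mO).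
have ng : Num.sqrt (\sum_i ip (g i) (g i)) <= vnormL O 2%:E f + vnormL O 2%:E w.
  rewrite !vnormL2E//.
  exact: (@hnormD _ _ (fin_shilb 'I_d (l2_hilb mu mO)) (fun i x => f x ord0 i) (fun i x => w x ord0 i) sf sw).
rewrite -(@ler_pXn2r _ 2)// ?nnegrE ?mulr_ge0 ?hnorm_ge0 ?addr_ge0 ?n0//.
rewrite real_normK ?num_real// exprMn hnorm_sqr//; apply: le_trans (family_CS mO sg sv) _.
apply: ler_pM.
- by apply: sumr_ge0 => i _; exact: l2ip_ge0.
- by apply: sumr_ge0 => i _; exact: l2ip_ge0.
- rewrite -[leLHS]sqr_sqrtr; last by apply: sumr_ge0 => i _; exact: l2ip_ge0.
  by rewrite lerXn2r ?nnegrE ?sqrtr_ge0// addr_ge0 ?n0.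
- rewrite (flow_normC hd Sv) -addrA lerDl !addr_ge0 ?curl2_ge0 ?div2_ge0 ?vor2_ge0//.
Qed.

Lemma solution_abstract rho1 rho2 nu sigma beta f w (x : H1) p :
  oseen_solution O rho1 rho2 nu sigma beta f w (vec x.1) (vec x.2) p <->
  [/\ hdom X x, hdom Y p,
    (forall v, hdom X v -> oseen_form O rho1 rho2 nu sigma beta x v + pressure_form O v p = load f w v) &
    forall q, hdom Y q -> pressure_form O x q = 0].
Proof.
split=> [[yV kW [/inL2P sp p0] e1 e2]|[Sx [sp p0] e1 e2]].
  split=> [|||q [sq_ q0]].
  - exact/flow_dom.
  - by split.
  - by move=> v /flow_dom[vV vW]; exact: e1.
  - by apply: e2; split => //; exact/inL2P.
have [yV kW] := (flow_dom oO bO x).1 Sx; split => //.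
- by split => //; exact/inL2P.
- move=> v th vV tW; have Sv : hdom X (fun i x => v x ord0 i, fun k x => th x ord0 k).
    by apply/flow_dom; split; rewrite /= -vecK.
  by have := e1 _ Sv; rewrite /oseen_form /pressure_form /load /= -!vecK.
- by move=> q [/inL2P sq_ q0]; exact: e2.
Qed.

Lemma hnorm_flow0 u : hdom X u -> hnorm X u <= 0 ->
  (forall i, ae_eq mu O (u.1 i) (fun=> 0)) /\ (forall k, ae_eq mu O (u.2 k) (fun=> 0)).
Proof.
move=> Su h; have [h1 _ h2] := flow_part_le Su; have [s1 _ s2] := flow_sq Su.
have z (g : E -> R) : sq g -> L2 g <= hnorm X u -> ae_eq mu O g (fun=> 0).
  move=> sg hg; have := l2ip_eq0_ae mO sg; apply.
  by rewrite -l2n_sqr (_ : L2 g = 0) ?expr0n//; apply/le_anti; rewrite l2n_ge0 (le_trans hg h).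
by split=> [i|k]; apply: z.
Qed.

End assembly.

Theorem theorem2p4 (R : realType) (d : nat) (hd : d = 2%N \/ d = 3%N)
    (Omega : set 'rV[R]_d) (hOmega : polyhedral_lipschitz_domain Omega) :
  exists2 Ct : R, 0 < Ct &
  forall (nu0 nu1 sigma_min sigma_max rho1 rho2 : R)
      (nu sigma : 'rV[R]_d -> R) (beta : 'rV[R]_d -> 'rV[R]_d),
    0 < nu0 -> 0 < nu1 -> 0 < sigma_min -> 0 < sigma_max ->
    0 < rho1 -> 0 < rho2 ->
    W1 Omega +oo%E nu -> inL Omega +oo%E sigma -> vW1 Omega +oo%E beta ->
    {ae leb R d, forall x, Omega x -> nu0 < nu x < nu1} ->
    {ae leb R d, forall x, Omega x -> sigma_min < sigma x < sigma_max} ->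
    let gnu := vnormL Omega +oo%E (grad Omega nu) in
    9 * gnu ^+ 2 / nu0 <= sigma_min ->
    Ct * normL Omega 2%:E (divg Omega beta)
      < Num.min (sigma_min - 9 * gnu ^+ 2 / nu0) (nu0 / 12) ->
    rho1 = 2 / 3 * nu0 ->
    nu0 / 3 < rho2 ->
    (forall f u : 'rV[R]_d -> 'rV[R]_d,
       vinL Omega 2%:E f -> vinL Omega 2%:E u ->
       exists y kappa p,
         oseen_solution Omega rho1 rho2 nu sigma beta f u y kappa p /\
         forall y' kappa' p',
           oseen_solution Omega rho1 rho2 nu sigma beta f u y' kappa' p' ->
           [/\ vae_eq Omega y y', vae_eq Omega kappa kappa' &
               ae_eq (leb R d) Omega p p']) /\
    (exists2 C : R, 0 < C &
       forall f u : 'rV[R]_d -> 'rV[R]_d,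
         vinL Omega 2%:E f -> vinL Omega 2%:E u ->
         forall y kappa p,
           oseen_solution Omega rho1 rho2 nu sigma beta f u y kappa p ->
           normVW Omega y kappa + normL Omega 2%:E p
             <= C * (vnormL Omega 2%:E f + vnormL Omega 2%:E u)).
Proof.
case: hOmega => -[oO neO cO] [bO lip pol]; exists 1 => //.
move=> nu0 nu1 smin smax rho1 rho2 nu sigma beta n0 _ _ _ _ _ Wnu Lsig Wbeta hnu hsig gnu _ hB rhoE hr2.
have mO := omeas oO.
have [mnu [M1 M10 nuM] _ mwnu bwnu] := W1y_facts oO Wnu.
have [msig [M2 M20 sigM]] := inLy_bound Lsig.
have fb j := W1y_facts oO (Wbeta j).
have wb j : weak_deriv Omega j (fun x => beta x ord0 j) (wpartial Omega j (fun x => beta x ord0 j)).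
  by have [_ _ h _ _] := fb j; exact: h.
have mb j : measurable_fun Omega (fun x => beta x ord0 j) by have [] := fb j.
have mwb j : measurable_fun Omega (wpartial Omega j (fun x => beta x ord0 j)) by have [_ _ _ h _] := fb j; exact: h.
have [M3 M30 bM] : exists2 M : R, 0 <= M & forall j, {ae leb R d, forall x, Omega x -> `|beta x ord0 j| <= M}.
  by apply: common_bound => j; have [_ h _ _ _] := fb j.
have [M4 M40 wbM] : exists2 M : R, 0 <= M & forall j, {ae leb R d, forall x, Omega x ->
    `|wpartial Omega j (fun x => beta x ord0 j) x| <= M}.
  by apply: common_bound => j; have [_ _ _ _ h] := fb j; exact: h.
have [M5 M50 gM] := common_bound bwnu.
(* The boundedness and coercivity lemmas share a single bound for all coefficients and their
   derivatives. *)
pose M := M1 + M2 + M3 + M4 + M5.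
have weak (w : 'rV[R]_d -> R) (N : R) : N <= M -> {ae leb R d, forall x, Omega x -> `|w x| <= N} ->
    {ae leb R d, forall x, Omega x -> `|w x| <= M}.
  by move=> NM; apply: filterS => x h Ox; exact: le_trans (h Ox) NM.
have le1 : M1 <= M by move: M10 M20 M30 M40 M50; rewrite /M; clear; lra.
have le2 : M2 <= M by move: M10 M20 M30 M40 M50; rewrite /M; clear; lra.
have le3 : M3 <= M by move: M10 M20 M30 M40 M50; rewrite /M; clear; lra.
have le4 : M4 <= M by move: M10 M20 M30 M40 M50; rewrite /M; clear; lra.
have le5 : M5 <= M by move: M10 M20 M30 M40 M50; rewrite /M; clear; lra.
have bnu := conj mnu (weak _ _ le1 nuM); have bsig := conj msig (weak _ _ le2 sigM).
have bbeta j := conj (mb j) (weak _ _ le3 (bM j)); have bwb j := conj (mwb j) (weak _ _ le4 (wbM j)).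
have eg i : (fun x => grad Omega nu x ord0 i) = wpartial Omega i nu by apply/funext => x; rewrite mxE.
have bgnu i : measurable_fun Omega (fun x => grad Omega nu x ord0 i) /\
    {ae leb R d, forall x, Omega x -> `|grad Omega nu x ord0 i| <= M}.
  rewrite eg; split; first exact: mwnu.
  by apply: filterS (weak _ _ le5 (gM i)) => x h Ox; rewrite mxE; exact: h.
have g2M : {ae leb R d, forall x, Omega x -> dot (grad Omega nu x) (grad Omega nu x) <= gnu ^+ 2}.
  (* [gnu] is the [fine] part of an extended real, which would be 0 at infinity; finiteness has to
     be known before [gnu] bounds the gradient. *)
  have lty : ('N[leb R d]_+oo [(EFin \o (fun x => enorm (grad Omega nu x))) \_ Omega] < +oo)%E.
    apply: (@ae_normLy_lty _ _ _ _ (Num.sqrt (\sum_(i < d) M5 ^+ 2))); first exact: sqrtr_ge0.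
    have := ae_seq (s := index_enum 'I_d) (fun i _ => gM i); apply: filterS => x h Ox.
    rewrite ger0_norm ?sqrtr_ge0//; apply: ler_wsqrtr; apply: ler_sum => i _.
    rewrite mxE -expr2 -real_normK ?num_real// lerXn2r ?nnegrE// h//; exact: mem_index_enum.
  have := normLy_ae lty; apply: filterS => x h Ox.
  have -> : dot (grad Omega nu x) (grad Omega nu x) = enorm (grad Omega nu x) ^+ 2.
    by rewrite sqr_sqrtr// dot_ge0.
  rewrite -real_normK ?num_real// -[gnu ^+ 2]real_normK ?num_real// lerXn2r ?nnegrE//.
  by apply: le_trans (h Ox) _; exact: ler_norm.
have nul : {ae leb R d, forall x, Omega x -> nu0 <= nu x}.
  by apply: filterS hnu => x h Ox; have /andP[/ltW] := h Ox.
have sigl : {ae leb R d, forall x, Omega x -> smin <= sigma x}.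
  by apply: filterS hsig => x h Ox; have /andP[/ltW] := h Ox.
have sD := divg_sq oO bO mwb wbM.
pose B := l2n (leb R d) Omega (divg Omega beta).
have [hB1 hB2] : B < smin - 9 * gnu ^+ 2 / nu0 /\ B < nu0 / 12.
  by move: hB; rewrite mul1r normL2E// lt_min => /andP[].
have B0 : 0 <= B by exact: l2n_ge0.
pose al := Num.min (Num.min (smin - 9 * gnu ^+ 2 / nu0 - B) (nu0 * (5 / 24) - B))
  (Num.min (nu0 * (37 / 60)) (rho2 - nu0 / 4 - B)).
have al0 : 0 < al.
  by rewrite !lt_min; have [-> -> -> ->] := positive_margins hB1 hB2 B0 n0 hr2.
pose X := flow_shilb oO bO; pose Y := pressure_shilb oO bO.
pose a := oseen_form Omega rho1 rho2 nu sigma beta; pose b := @pressure_form R d Omega.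
have acoer v : hdom X v -> al * hip X v v <= a v v.
  move=> Sv; have h := oseen_lower hd rho2 bnu bsig bbeta bgnu wb bwb n0 nul sigl (sqr_ge0 gnu) g2M rhoE Sv.
  apply: le_trans h.
  have e : hip X v v = vel2 Omega v + (curl2 Omega v + div2 Omega v) + vor2 Omega v.
    exact: (flow_normC hd Sv).
  rewrite e -/B; apply: weighted_sum_le; rewrite ?vel2_ge0 ?curl2_ge0 ?vor2_ge0 ?div2_ge0 //.
  - by rewrite /al !ge_min lexx.
  - by rewrite /al !ge_min lexx orbT.
  - by rewrite /al !ge_min lexx !orbT.
  - by rewrite /al !ge_min lexx !orbT.
have ab : bbilin X X a := oseen_form_bbilin oO bO rho1 rho2 bnu bsig bbeta bgnu.
have bb : bbilin X Y b := pressure_form_bbilin oO bO.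
have [K K0 isup] := infsup oO bO cO neO lip pol.
have [D D0 est] := brezzi_estimate ab al0 acoer K0 isup.
split.
  move=> f w Lf Lw; have lb := load_blin oO bO hd Lf Lw.
  have [x [p [Sx Sp e1 e2]]] := brezzi_existence ab bb al0 acoer K0 isup lb.
  exists (vec x.1), (vec x.2), p; split; first exact/(solution_abstract oO bO).
  move=> y' k' p'; rewrite (vecK y') (vecK k').
  pose x' : ('I_d -> 'rV[R]_d -> R) * ('I_(cdim d) -> 'rV[R]_d -> R) :=
    (fun i z => y' z ord0 i, fun k z => k' z ord0 k).
  move=> /(@solution_abstract _ _ _ oO bO _ _ _ _ _ _ _ x')[Sx' Sp' e1' e2'].
  have [aL aR _] := ab; have [bL bR _] := bb.
  have Sd : hdom X (-1 *: x' + x) by exact: hdomL.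
  have Sq : hdom Y (-1 *: p' + p) by exact: hdomL.
  (* Uniqueness is the a priori estimate for zero data, applied to the difference of two solutions.
     A null semi-norm then means equality almost everywhere. *)
  have l0 : blin X (fun=> 0) 0.
    by split => // [*|*]; rewrite ?mulr0 ?addr0// normr0 mul0r.
  have hz : hnorm X (-1 *: x' + x) + hnorm Y (-1 *: p' + p) <= D * 0.
    apply: est l0 Sd Sq _ _ => [v Sv|r Sr].
      rewrite -/b aL// bR//; have := e1 _ Sv; have := e1' _ Sv; rewrite -/a -/b => h' h.
      by move: h h'; move: (a x v) (b v p) (a x' v) (b v p') (load _ _ _); clear => *; lra.
    have h1 : b x r = 0 := e2 r Sr; have h2 : b x' r = 0 := e2' r Sr.
    by rewrite -/b bL// h1 h2 mulr0 addr0.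
  rewrite mulr0 in hz.
  have hx0 := hnorm_ge0 X (-1 *: x' + x); have hp0 := hnorm_ge0 Y (-1 *: p' + p).
  have zx : hnorm X (-1 *: x' + x) <= 0 by apply: le_trans hz; rewrite lerDl.
  have zp : hnorm Y (-1 *: p' + p) <= 0 by apply: le_trans hz; rewrite lerDr.
  have [z1 z2] := hnorm_flow0 Sd zx.
  have eqv0 k (u v : 'I_k -> 'rV[R]_d -> R) :
      (forall i, ae_eq (leb R d) Omega (-1 *: u i + v i) (fun=> 0)) -> vae_eq Omega (vec v) (vec u).
    move=> h; have := ae_seq (s := index_enum 'I_k) (fun i _ => h i); apply: filterS => z hz' Oz.
    apply/rowP => i; rewrite !vecE; have := hz' i (mem_index_enum _) Oz; rewrite lin_fun mulN1r => e.
    by apply/eqP; rewrite -subr_eq0 addrC; apply/eqP.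
  split.
  - by apply: eqv0 => i; have := z1 i; rewrite lin_fst lin_app.
  - by apply: eqv0 => i; have := z2 i; rewrite lin_snd lin_app.
  have : ae_eq (leb R d) Omega (-1 *: p' + p) (fun=> 0).
    apply: (l2ip_eq0_ae mO Sq.1); rewrite -l2n_sqr.
    by rewrite (_ : l2n _ _ _ = 0) ?expr0n//; apply/le_anti; rewrite l2n_ge0 andbT.
  apply: filterS => z h Oz; have := h Oz; rewrite lin_fun mulN1r => e.
  by apply/eqP; rewrite -subr_eq0 addrC; apply/eqP.
exists (D + 1); first by rewrite ltr_wpDl.
move=> f w Lf Lw y k p; rewrite (vecK y) (vecK k).
pose x : ('I_d -> 'rV[R]_d -> R) * ('I_(cdim d) -> 'rV[R]_d -> R) :=
  (fun i z => y z ord0 i, fun j z => k z ord0 j).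
move=> /(@solution_abstract _ _ _ oO bO _ _ _ _ _ _ _ x)[Sx Sp e1 e2].
have lb := load_blin oO bO hd Lf Lw.
have h := est _ _ _ _ lb Sx Sp e1 e2.
rewrite (normVW_flow hd Sx) normL2E; last by case: Sp.
apply: le_trans h _; apply: ler_wpM2r; last by rewrite lerDl.
by case: lb.
Qed.
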